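(* Let $p\in\,]2,3[$, let $(X_i)_{i\in\mathbb Z}$, $X_i=X_0\circ T^i$, be a stationary sequence of centered random variables in $L^p$ (not necessarily adapted to $(\mathcal F_i)$), and let $\sigma_n^2=n^{-1}\mathbb E(S_n^2)$. Assume that $$\sum_{n>0}\mathbb E(X_n|\mathcal F_0)\quad\text{and}\quad\sum_{n>0}\big(X_{-n}-\mathbb E(X_{-n}|\mathcal F_0)\big)\quad\text{converge in } L^p,$$ and $$\sum_{n\ge 1}n^{-2+p/2}\big\Vert n^{-1}\mathbb E(S_n^2|\mathcal F_0)-\sigma_n^2\big\Vert_{p/2}<\infty .$$ Then the series $\sum_{k\in\mathbb Z}\mathrm{Cov}(X_0,X_k)$ converges to some nonnegative $\sigma^2$, and, as $n\to\infty$, 1. $\zeta_r(P_{n^{-1/2}S_n},G_{\sigma^2})=O(n^{1-p/2})$ for $r\in[p-2,2]$; 2. $\zeta_r(P_{n^{-1/2}S_n},G_{\sigma_n^2})=O(n^{1-p/2})$ for $r\in\,]2,p]$.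
   Context: Setting: $(\Omega,\mathcal A,\mathbb P)$ is a probability space, $T:\Omega\to\Omega$ is a bijective bimeasurable transformation preserving $\mathbb P$, $\mathcal F_0\subseteq\mathcal A$ is a $\sigma$-algebra with $\mathcal F_0\subseteq T^{-1}(\mathcal F_0)$, and $\mathcal F_i=T^{-i}(\mathcal F_0)$. $X_i=X_0\circ T^i$ and $S_n=X_1+\cdots+X_n$. $\|\cdot\|_q$ is the $L^q(\mathbb P)$ norm. $P_Z$ is the law of a random variable $Z$; $G_v$ is the normal law $N(0,v)$. Zolotarev distance: for real $r>0$ let $l\ge 0$ be the integer with $l<r\le l+1$. $\Lambda_r$ is the class of real functions $f$ on $\mathbb R$ that are $l$-times continuously differentiable with $|f^{(l)}(x)-f^{(l)}(y)|\le|x-y|^{r-l}$ for all $x,y\in\mathbb R$. For probability measures $\mu,\nu$ on $\mathbb R$, $\zeta_r(\mu,\nu)=\sup\{\int f\,d\mu-\int f\,d\nu: f\in\Lambda_r\}$. *)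

(* Defs.v *)
From HB Require Import structures.
From mathcomp Require Import all_boot all_order all_algebra.
From mathcomp Require Import all_classical all_reals all_analysis measurable_realfun.

Set Implicit Arguments.
Unset Strict Implicit.
Unset Printing Implicit Defensive.

Import Order.TTheory GRing.Theory Num.Theory.
Import numFieldNormedType.Exports.

Local Open Scope classical_set_scope.
Local Open Scope ring_scope.

Section iteration.
Context d (Omega : measurableType d).

(* T^i for i : int, where Tinv stands for the inverse of T;
   Negz n is the integer - n.+1. *)
Definition iterz (T Tinv : Omega -> Omega) (i : int) : Omega -> Omega :=
  match i with
  | Posz n => iter n T
  | Negz n => iter n.+1 Tinv
  end.

Lemma measurable_iter (T : {mfun Omega >-> Omega}) n :
  measurable_fun setT (iter n T).
Proof.
elim: n => [|n IHn]; first exact: measurable_id.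
exact: (measurableT_comp (@measurable_funPT _ _ _ _ T) IHn).
Qed.

Lemma measurable_iterz (T Tinv : {mfun Omega >-> Omega}) i :
  measurable_fun setT (iterz T Tinv i).
Proof. by case: i => n; exact: measurable_iter. Qed.

Definition measure_preserving (R : realType) (P : probability Omega R)
    (T : Omega -> Omega) : Prop :=
  forall A, measurable A -> P (T @^-1` A) = P A.

End iteration.

Section stationary_sequence.
Context d (Omega : measurableType d) (R : realType).
Variables (T Tinv : {mfun Omega >-> Omega}) (X0 : {mfun Omega >-> R}).

Definition Xseq (i : int) : Omega -> R := X0 \o iterz T Tinv i.

Definition Ssum (n : nat) : Omega -> R :=
  fun w => \sum_(1 <= k < n.+1) Xseq k%:Z w.

Definition normSsum (n : nat) : Omega -> R :=
  fun w => n%:R `^ (- 2^-1) * Ssum n w.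

Lemma measurable_Xseq i : measurable_fun setT (Xseq i).
Proof.
exact: (measurableT_comp (@measurable_funPT _ _ _ _ X0)
                         (measurable_iterz T Tinv i)).
Qed.

Lemma measurable_Ssum n : measurable_fun setT (Ssum n).
Proof. by apply: measurable_sum => k; exact: measurable_Xseq. Qed.

Lemma measurable_normSsum n : measurable_fun setT (normSsum n).
Proof. by apply: measurable_funM => //; exact: measurable_Ssum. Qed.

HB.instance Definition _ i :=
  @isMeasurableFun.Build _ _ _ _ (Xseq i) (measurable_Xseq i).
HB.instance Definition _ n :=
  @isMeasurableFun.Build _ _ _ _ (Ssum n) (measurable_Ssum n).
HB.instance Definition _ n :=
  @isMeasurableFun.Build _ _ _ _ (normSsum n) (measurable_normSsum n).

End stationary_sequence.

Section conditional_expectation.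
Context d (Omega : measurableType d) (R : realType).
Variable P : probability Omega R.

Definition sigma_subalgebra (F : set (set Omega)) : Prop :=
  sigma_algebra setT F /\ F `<=` measurable.

Definition is_cond_exp (F : set (set Omega)) (X Y : Omega -> R) : Prop :=
  [/\ forall B : set R, measurable B -> F (Y @^-1` B),
      P.-integrable setT (EFin \o Y) &
      forall A, F A -> (\int[P]_(w in A) (Y w)%:E = \int[P]_(w in A) (X w)%:E)%E].

(* A version of E(X | F); the default value is only used when X is not
   integrable, see cond_expP. *)
Definition cond_exp (F : set (set Omega)) (X : Omega -> R) : Omega -> R :=
  xget (cst 0) [set Y | is_cond_exp F X Y].

Lemma is_cond_exp_exists (F : set (set Omega)) (X : Omega -> R) :
  sigma_subalgebra F -> P.-integrable setT (EFin \o X) ->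
  exists Y, is_cond_exp F X Y.
Proof.
move=> [sF FA] iX.
pose OF := g_sigma_algebraType F.
have mOF (A : set OF) : measurable A = F A.
  by rewrite /measurable /= (sigma_algebra_id sF).
pose idF : Omega -> OF := id.
have midF : measurable_fun setT idF.
  by move=> _ A; rewrite mOF setTI; exact: FA.
pose idF' : {mfun Omega >-> OF} := mfun_Sub (mem_set midF).
pose nu := induced_charge iX.
have nuP A : measurable A -> P A = 0%E -> nu A = 0%E.
  move=> mA PA0; apply: null_set_integral => //.
  by apply: measurable_funTS; exact: measurable_int iX.
have mFA (A : set OF) : measurable A -> measurable (A : set Omega).
  by rewrite mOF; exact: FA.
pose nuF0 : set OF -> \bar R := nu.
have nuF00 : nuF0 set0 = 0%E by exact: charge0.
have nuF0fin A : measurable A -> nuF0 A \is a fin_num.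
  by move=> /mFA; exact: fin_num_measure.
have nuF0add : semi_sigma_additive nuF0.
  move=> B mB tB mUB; apply: (@charge_semi_sigma_additive _ _ _ nu) => //.
  - by move=> n; exact/mFA.
  - exact/mFA.
pose nuF : {charge set OF -> \bar R} :=
  HB.pack nuF0 (isCharge.Build _ _ _ nuF0 nuF00 nuF0fin nuF0add).
pose PF : probability OF R := distribution P idF'.
have dom : nuF `<< PF.
  apply/null_content_dominatesP => A mA PFA0.
  exact: nuP (mFA _ mA) PFA0.
pose h := Radon_Nikodym nuF PF.
have ih := Radon_Nikodym_integrable dom.
have mh : measurable_fun setT h := measurable_int _ ih.
have hfin w : h w \is a fin_num := Radon_Nikodym_fin_num w dom.
have mhO : measurable_fun setT (h \o idF) by exact: measurableT_comp.
have ihP : P.-integrable setT (h \o idF).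
  apply/integrableP; split => //.
  move/integrableP : ih => [_].
  rewrite ge0_integral_pushforward//.
  exact: measurableT_comp.
exists (fun w => fine (h w)); split.
- move=> B mB; rewrite -mOF -[X in measurable X]setTI.
  exact: (measurableT_comp (@fine_measurable _ setT measurableT) mh).
- by apply: eq_integrable ihP => // w _ /=; rewrite fineK.
- move=> A FA'.
  have mA : measurable (A : set OF) by rewrite mOF.
  transitivity (\int[P]_(w in A) (h \o idF) w)%E.
    by apply: eq_integral => w _ /=; rewrite fineK.
  transitivity (nuF A); last by [].
  rewrite (Radon_Nikodym_integral dom mA).
  rewrite -/h [RHS]integral_pushforward//.
  exact: (integrableS measurableT (FA _ FA') (@subsetT _ _) ihP).
Qed.

Lemma cond_expP (F : set (set Omega)) (X : Omega -> R) :
  sigma_subalgebra F -> P.-integrable setT (EFin \o X) ->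
  is_cond_exp F X (cond_exp F X).
Proof.
move=> sF iX; have [Y XY] := is_cond_exp_exists sF iX.
by rewrite /cond_exp; case: xgetP => [_ -> //|/(_ Y)].
Qed.

End conditional_expectation.

Section Lp.
Context d (Omega : measurableType d) (R : realType).
Variable P : probability Omega R.

Definition cvg_in_Lp (p : R) (u : nat -> Omega -> R) : Prop :=
  exists2 Y : Omega -> R, Y \in Lfun P p%:E &
    ('N[P]_(p%:E)[(fun w => (u n w - Y w)%:E)] @[n --> \oo] --> 0)%E.

Definition series_cvg_in_Lp (p : R) (u : nat -> Omega -> R) : Prop :=
  cvg_in_Lp p (fun n w => \sum_(1 <= k < n.+1) u k w).

End Lp.

Section zolotarev.
Context (R : realType).

(* 0 `^ a = 0 for a > 0, so the Hoelder bound also makes sense at x = y. *)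
Definition Lambda (r : R) : set (R -> R) :=
  [set f | exists l : nat,
    [/\ l%:R < r, r <= l.+1%:R,
        forall k, (k < l)%N -> forall x, derivable (derive1n k f) x 1,
        continuous (derive1n l f) &
        forall x y, `|derive1n l f x - derive1n l f y| <= `|x - y| `^ (r - l%:R)]].

(* The integrals are finite as soon as mu and nu have a moment of order r;
   otherwise the conventions of the library for undefined integrals apply. *)
Definition zolotarev (r : R) (mu nu : probability R R) : \bar R :=
  ereal_sup [set (\int[mu]_x (f x)%:E - \int[nu]_x (f x)%:E)%E
            | f in Lambda r].

Let idTR : measurableTypeR R -> R := idfun.

#[local] HB.instance Definition _ :=
  @isMeasurableFun.Build _ _ _ _ idTR (@measurable_id _ _ setT).

(* N(0, v). The parameter of normal_prob is the standard deviation, and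
   normal_prob 0 0 is not the Dirac mass at 0. The pushforward by the identity
   only changes the measurable structure from measurableTypeR R to the canonical
   one on R, which has the same measurable sets. *)
Definition normal_law (v : R) : probability R R :=
  if v == 0 then (\d_(0 : R) : probability R R)
  else distribution (normal_prob 0 (Num.sqrt v)) idTR.

(* Convergence of a series indexed by the integers: both ends of the range of
   summation tend to infinity independently. *)
Definition bilateral_series_cvg (u : int -> \bar R) (l : \bar R) : Prop :=
  (\sum_(1 <= k < mn.1.+1) u (- k%:Z)%R + \sum_(0 <= k < mn.2.+1) u k%:Z)%E
    @[mn --> (\oo, \oo)] --> l.

Definition ebigO (u : nat -> \bar R) (v : nat -> R) : Prop :=
  exists C : R, \forall n \near \oo, (`|u n| <= (C * `|v n|)%:E)%E.

End zolotarev.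

(* Main.v *)
(** By Gordin's decomposition, with A the sum of the series E(X_k|F_0), B the sum
    of the series X_-k - E(X_-k|F_0), and V = A - B - X_0 + E(X_0|F_0), the
    variable D = X_0 + V - V o T^-1 is a martingale difference in L^p and
    S_n = M_n - V o T^n + V with M_n = D o T + ... + D o T^n. Hence sigma^2 = E(D^2),
    and the hypothesis on E(S_n^2|F_0) bounds E(h (M_m^2 - m sigma^2)) for h
    measurable for F_0 and |h| <= |U|^(p-2), U in L^p.

    For f in Lambda_r, Lindeberg's method replaces the martingale differences one
    by one by N(0, sigma^2) variables; at step k the test function is f convolved
    with N(0, (n - k + 1) sigma^2), and the errors of order larger than 2 are
    controlled by moments of order p. The second-order terms are grouped in blocks
    of length 2^j: passing from j to j + 1 costs the increments of the second
    derivative tested against M_m^2 - m sigma^2, m = 2^j, which the previous bound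
    controls. The coboundary and the first smoothing only see f minus its Taylor
    polynomial at 0, since this polynomial has the same mean under both laws (for
    r > 2 this is the reason for the variance sigma_n^2). *)

Require Import Defs.
From HB Require Import structures.
From mathcomp Require Import all_boot all_order all_algebra.
From mathcomp Require Import all_classical all_reals all_analysis.
From mathcomp Require Import measurable_realfun ring lra zify.

Set Implicit Arguments.
Unset Strict Implicit.
Unset Printing Implicit Defensive.

Import Order.TTheory GRing.Theory Num.Theory.
Import numFieldNormedType.Exports.
Import HBNNSimple.

Local Open Scope classical_set_scope.
Local Open Scope ring_scope.

(** A third derivative of a function smoothed at scale t has size t^(r-3), but the variables only
    have moments of order p < 3; the estimates therefore go through [omega t], a modulus of
    continuity for the smoothed second derivative. One inequality carries the proof: the sum of
    [omega] over the scales sigma (l m)^(1/2), with l m <= n, is at most a constant times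
    n^((r-p+2)/2) m^(-1) u^(p-2). With m = 1 and u the size of an increment it pays for all Taylor
    remainders at once; with u the size of M_m it pays for the increments of the second derivative
    at a dyadic level. Functions bounded by |U|^(p-2), U in L^p, are the dual side of L^(p/2), where
    the hypothesis on E(S_n^2|F_0) lives.

    The condition r >= p - 2 makes r - p + 2 nonnegative, so that the largest scale governs the sum.
    The condition p < 3 serves to sum the tail where [omega] is linear in u, and to sum along powers
    of 2 the errors of order n^(1/2) that the coboundary causes in second moments. The norms in the
    hypothesis need not be monotone in n, whence the averaging that reaches dyadic lengths. *)

Section integrable_random_variables.
Context d (T : measurableType d) (R : realType) (P : probability T R).
Implicit Types f g : T -> R.

Definition L1 f : Prop := P.-integrable setT (EFin \o f).

Definition Ex f : R := (\int[P]_x f x)%R.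

Lemma L1_measurable f : L1 f -> measurable_fun setT f.
Proof. by move=> /measurable_int/measurable_EFinP. Qed.

Lemma L1_le f g : measurable_fun setT f -> (forall x, `|f x| <= g x) ->
  L1 g -> L1 f.
Proof.
move=> mf fg; apply: le_integrable => //; first exact/measurable_EFinP.
move=> x _ /=; rewrite lee_fin (le_trans (fg x))// ler_norm//.
Qed.

Lemma eq_L1 f g : f =1 g -> L1 f -> L1 g.
Proof. by move=> /funext->. Qed.

Lemma L1D f g : L1 f -> L1 g -> L1 (fun x => f x + g x).
Proof. by move=> lf lg; apply: eq_integrable (integrableD _ lf lg). Qed.

Lemma L1Z k f : L1 f -> L1 (fun x => k * f x).
Proof. by move=> lf; apply: eq_integrable (integrableZl _ k lf). Qed.

Lemma L1N f : L1 f -> L1 (fun x => - f x).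
Proof. by move=> /(L1Z (-1)); apply: eq_L1 => x; rewrite mulN1r. Qed.

Lemma L1B f g : L1 f -> L1 g -> L1 (fun x => f x - g x).
Proof. by move=> lf /L1N; exact: L1D. Qed.

Lemma L1_norm f : L1 f -> L1 (fun x => `|f x|).
Proof. by move=> lf; apply: eq_integrable (integrable_abse lf). Qed.

Lemma L1_cst k : L1 (fun=> k).
Proof. exact: finite_measure_integrable_cst. Qed.

Lemma L1_sum (I : Type) (s : seq I) (F : I -> T -> R) :
  (forall i, L1 (F i)) -> L1 (fun x => \sum_(i <- s) F i x).
Proof.
move=> lF; elim: s => [|i s IH].
  by apply: eq_L1 (L1_cst 0) => x; rewrite big_nil.
by apply: eq_L1 (L1D (lF i) IH) => x; rewrite big_cons.
Qed.

Lemma EFin_Ex f : L1 f -> (Ex f)%:E = (\int[P]_x (f x)%:E)%E.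
Proof. by move=> lf; rewrite /Ex /Rintegral fineK// integrable_fin_num. Qed.

Lemma eq_Ex f g : f =1 g -> Ex f = Ex g.
Proof. by move=> /funext->. Qed.

Lemma ExD f g : L1 f -> L1 g -> Ex (fun x => f x + g x) = Ex f + Ex g.
Proof. exact: RintegralD. Qed.

Lemma ExB f g : L1 f -> L1 g -> Ex (fun x => f x - g x) = Ex f - Ex g.
Proof. exact: RintegralB. Qed.

Lemma ExZ k f : L1 f -> Ex (fun x => k * f x) = k * Ex f.
Proof. exact: RintegralZl. Qed.

Lemma Ex_cst k : Ex (fun=> k) = k.
Proof.
transitivity (k * fine (P setT)); first exact: Rintegral_cst.
by rewrite probability_setT mulr1.
Qed.

Lemma Ex_sum (I : Type) (s : seq I) (F : I -> T -> R) :
  (forall i, L1 (F i)) ->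
  Ex (fun x => \sum_(i <- s) F i x) = \sum_(i <- s) Ex (F i).
Proof.
move=> lF; elim: s => [|i s IH].
  by rewrite big_nil -[RHS](Ex_cst 0); apply: eq_Ex => x; rewrite big_nil.
rewrite big_cons -IH -ExD//; last exact: L1_sum.
by apply: eq_Ex => x; rewrite big_cons.
Qed.

Lemma Ex_le f g : L1 f -> L1 g -> (forall x, f x <= g x) -> Ex f <= Ex g.
Proof. by move=> lf lg fg; apply: le_Rintegral => // x _; exact: fg. Qed.

Lemma Ex_ge0 f : (forall x, 0 <= f x) -> 0 <= Ex f.
Proof. by move=> f0; apply: Rintegral_ge0 => x _; exact: f0. Qed.

Lemma Ex_norm_le f g : measurable_fun setT f -> L1 g ->
  (forall x, `|f x| <= g x) -> `|Ex f| <= Ex g.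
Proof.
move=> mf lg fg; have lf := L1_le mf fg lg.
apply: (le_trans (le_normr_Rintegral _ lf)) => //.
by apply: Ex_le => //; exact: L1_norm.
Qed.

Lemma Ex_ae f g : measurable_fun setT f -> measurable_fun setT g ->
  (f = g %[ae P]) -> Ex f = Ex g.
Proof.
move=> mf mg fg; congr fine; apply: ae_eq_integral => //.
- exact/measurable_EFinP.
- exact/measurable_EFinP.
- by apply: filterS fg => x /= ->.
Qed.

Lemma L1_ge0 f : measurable_fun setT f -> (forall x, 0 <= f x) ->
  (\int[P]_x (f x)%:E < +oo)%E -> L1 f.
Proof.
move=> mf f0 foo; apply/integrableP; split; first exact/measurable_EFinP.
apply: le_lt_trans foo; apply: ge0_le_integral => //.
- by apply: measurableT_comp => //; exact/measurable_EFinP.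
- exact/measurable_EFinP.
- by move=> x _ /=; rewrite lee_fin ger0_norm.
Qed.

Lemma Ex_ge0_eq0 f : L1 f -> (forall x, 0 <= f x) -> Ex f = 0 ->
  f = cst 0 %[ae P].
Proof.
move=> lf f0 Ef0.
have /ae_eq_integral_abs : measurable_fun setT (EFin \o f).
  exact: measurable_int lf.
move=> /(_ P measurableT)[+ _].
have -> : (\int[P]_x `|(EFin \o f) x| = 0)%E.
  by rewrite -[RHS]/(0%:E) -Ef0 EFin_Ex//; apply: eq_integral => x _ /=;
    rewrite ger0_norm.
by move=> /(_ erefl); apply: filterS => x /= /(_ I) [].
Qed.

Section preserving.
Variable tau : T -> T.
Hypothesis mtau : measurable_fun setT tau.
Hypothesis tauP : measure_preserving P tau.

Lemma integral_preserving (f : T -> \bar R) : measurable_fun setT f ->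
  (forall x, 0 <= f x)%E -> (\int[P]_x f (tau x) = \int[P]_x f x)%E.
Proof.
move=> mf f0.
have : (\int[pushforward P tau]_x f x = \int[P]_x f (tau x))%E.
  by rewrite ge0_integral_pushforward.
by move=> <-; apply: eq_measure_integral => A mA _; exact: tauP.
Qed.

Lemma L1_preserving f : L1 f -> L1 (fun x => f (tau x)).
Proof.
move=> lf; have mf := L1_measurable lf.
case/integrableP: lf => _ foo; apply/integrableP; split.
  by apply/measurable_EFinP; exact: measurableT_comp.
rewrite (integral_preserving (f := fun x => `|(f x)%:E|%E))//.
by apply: measurableT_comp => //; exact/measurable_EFinP.
Qed.

Lemma Ex_preserving f : measurable_fun setT f ->
  Ex (fun x => f (tau x)) = Ex f.
Proof.
move=> mf; congr fine; rewrite integralE [in RHS]integralE; congr (_ - _)%E.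
  transitivity (\int[P]_x ((EFin \o f)^\+ (tau x)))%E.
  by apply: eq_integral => x _; rewrite ?funeposE ?funenegE.
  apply: integral_preserving => //.
  exact/measurable_funepos/measurable_EFinP.
transitivity (\int[P]_x ((EFin \o f)^\- (tau x)))%E.
  by apply: eq_integral => x _; rewrite ?funeposE ?funenegE.
apply: integral_preserving => //.
exact/measurable_funeneg/measurable_EFinP.
Qed.

End preserving.

End integrable_random_variables.

(** * Inequalities for real powers *)

Section powR_inequalities.
Context (R : realType).
Implicit Types x y a b p q : R.

Lemma le_powR a x y : 0 <= a -> 0 <= x -> x <= y -> x `^ a <= y `^ a.
Proof.
by move=> a0 x0 xy; apply: ge0_ler_powR; rewrite // nnegrE// (le_trans x0).
Qed.

Lemma powR_le1D a b x : 0 <= a -> a <= b -> 0 <= x -> x `^ a <= 1 + x `^ b.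
Proof.
move=> a0 ab x0; have [x1|x1] := leP x 1.
  apply: (@le_trans _ _ 1); last by rewrite lerDl powR_ge0.
  by have := le_powR a0 x0 x1; rewrite powR1.
apply: (@le_trans _ _ (x `^ b)); last by rewrite lerDr.
by apply: ler_powR => //; exact: ltW.
Qed.

(* Both factors are dominated by the larger of x and y. *)
Lemma powR_mul_leD a b x y : 0 <= a -> 0 <= b -> 0 < a + b -> 0 <= x -> 0 <= y ->
  x `^ a * y `^ b <= x `^ (a + b) + y `^ (a + b).
Proof.
move=> a0 b0 ab x0 y0; have [xy|/ltW xy] := leP x y.
  apply: (@le_trans _ _ (y `^ (a + b))); last by rewrite lerDr powR_ge0.
  rewrite powRD; last by rewrite gt_eqF.
  by rewrite ler_wpM2r ?powR_ge0// le_powR.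
apply: (@le_trans _ _ (x `^ (a + b))); last by rewrite lerDl powR_ge0.
rewrite powRD; last by rewrite gt_eqF.
by rewrite ler_wpM2l ?powR_ge0// le_powR.
Qed.

Lemma powRD_le a x y : 0 <= a -> 0 <= x -> 0 <= y ->
  (x + y) `^ a <= 2 `^ a * (x `^ a + y `^ a).
Proof.
move=> a0 x0 y0; rewrite mulrDr -!powRM//; have [xy|/ltW xy] := leP x y.
  apply: (@le_trans _ _ ((2 * y) `^ a)); last by rewrite lerDr powR_ge0.
  by apply: le_powR; lra.
apply: (@le_trans _ _ ((2 * x) `^ a)); last by rewrite lerDl powR_ge0.
by apply: le_powR; lra.
Qed.

(** Young's inequality for (1 + v)^q and 1 with the conjugate exponents 1/q and 1/(1-q). *)
Lemma powR_bernoulli q v : 0 <= q -> q <= 1 -> -1 <= v ->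
  (1 + v) `^ q <= 1 + q * v.
Proof.
move=> q0 q1 v1; have [->|qn0] := eqVneq q 0; first by rewrite powRr0; lra.
have [->|qn1] := eqVneq q 1; first by rewrite powRr1; lra.
have qp : 0 < q by rewrite lt_neqAle eq_sym qn0.
have qp1 : 0 < 1 - q by rewrite subr_gt0 lt_neqAle qn1.
have v0 : 0 <= 1 + v by lra.
have := @conjugate_powR R ((1 + v) `^ q) 1 q^-1 (1 - q)^-1 (powR_ge0 _ _) ler01.
rewrite !invr_gt0 !invrK => /(_ qp qp1).
rewrite -powRrM divff// powRr1// powR1 mulr1.
move=> /(_ _)/le_trans; apply; lra.
Qed.

Lemma powR_scale_le c x a : 0 <= a -> a <= 1 -> 0 <= c -> 0 <= x ->
  (c * x) `^ a <= (1 + c) * x `^ a.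
Proof.
move=> a0 a1 c0 x0; rewrite powRM// ler_wpM2r ?powR_ge0//.
have := powR_le1D a0 a1 c0; by rewrite powRr1.
Qed.

End powR_inequalities.

(** * Integration against a measure given by a density *)

Section density.
Context d (T : measurableType d) (R : realType).
Variables (mu nu : {measure set T -> \bar R}) (g : T -> R).
Hypothesis g0 : forall x, 0 <= g x.
Hypothesis mg : measurable_fun setT g.
Hypothesis nuE : forall A, measurable A -> nu A = (\int[mu]_(x in A) (g x)%:E)%E.

(** Simple functions first, then monotone convergence on both sides. It turns integrals against
    normal laws into Lebesgue integrals. *)
Lemma ge0_integral_density (f : T -> \bar R) : measurable_fun setT f ->
  (forall x, 0 <= f x)%E ->
  (\int[nu]_x f x = \int[mu]_x (f x * (g x)%:E))%E.
Proof.
move=> mf f0; pose h := nnsfun_approx measurableT mf.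
have hf (x : T) : (h n x)%:E @[n --> \oo] --> f x.
  exact: cvg_nnsfun_approx.
have hnd (x : T) : {homo (fun n => (h n x)%:E) : a b / (a <= b)%N >-> (a <= b)%E}.
  by move=> a b ab; rewrite lee_fin; exact/lefP/nd_nnsfun_approx.
have mh n : measurable_fun setT (fun x => (h n x)%:E) by exact/measurable_EFinP.
have mgE : measurable_fun setT (EFin \o g) by exact/measurable_EFinP.
transitivity (lim (\int[nu]_x (h n x)%:E @[n --> \oo]))%E.
  rewrite -monotone_convergence//; last by move=> n x _; rewrite lee_fin.
  by apply: eq_integral => x _; apply/esym/cvg_lim => //; exact: hf.
transitivity (lim (\int[mu]_x ((h n x)%:E * (g x)%:E) @[n --> \oo]))%E; last first.
  rewrite -monotone_convergence//.
  - by apply: eq_integral => x _; apply/cvg_lim => //; apply: cvgeZr => //; exact: hf.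
  - by move=> n; exact: emeasurable_funM.
  - by move=> n x _; rewrite mule_ge0 ?lee_fin.
  - by move=> x _ a b ab; rewrite lee_wpmul2r ?lee_fin//; exact: hnd.
apply: congr_lim; apply/funext => n.
rewrite [RHS](eq_integral (fun x => \sum_(y \in range (h n))
    (y%:E * (\1_(h n @^-1` [set y]) x * g x)%:E))%E); last first.
  move=> x _; rewrite {1}fimfunE -fsumEFin// ge0_mule_fsuml; last first.
    by move=> y; exact: nnfun_muleindic_ge0.
  by apply: eq_fsbigr => y _; rewrite -!EFinM mulrA.
have ind r : (\int[mu]_x (\1_(h n @^-1` [set r]) x * g x)%:E)%E
    = nu (h n @^-1` [set r]).
  rewrite nuE// [RHS]integral_mkcond; apply: eq_integral => x _.
  by rewrite patchE indicE; case: (_ \in _); rewrite ?mul1r ?mul0r.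
have mind r : measurable_fun setT (fun x => (\1_(h n @^-1` [set r]) x * g x)%:E).
  by apply/measurable_EFinP; exact: measurable_funM.
rewrite [RHS]ge0_integral_fsum//; first last.
- move=> y x _; have [y0|y0] := leP 0 y.
    by rewrite mule_ge0// lee_fin mulr_ge0// indicE.
  by rewrite preimage_nnfun0 ?indic0 ?mul0r ?mule0.
- by move=> y; apply: emeasurable_funM => //; exact: mind.
rewrite (eq_integral (fun x => \sum_(y \in range (h n))
    (y * \1_(h n @^-1` [set y]) x)%:E)%E); last first.
  by move=> x _; rewrite {1}fimfunE -fsumEFin.
rewrite ge0_integral_fsum//; first last.
- by move=> y x _; exact: nnfun_muleindic_ge0.
- by move=> y; apply/measurable_EFinP; exact: measurable_funM.
apply: eq_fsbigr => r /[!inE] -[t _ <-].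
rewrite [RHS]ge0_integralZl ?ind ?lee_fin//; last first.
  by move=> x _; rewrite lee_fin mulr_ge0// indicE.
under eq_integral do rewrite EFinM.
by rewrite integralZl_indic_nnsfun// integral_indic// setIT.
Qed.

End density.

(** * The standard Gaussian law: scaling, translation, reflection, convolution *)

Section gauss.
Context (R : realType).
Notation mu := (@lebesgue_measure R).
Implicit Types f : R -> R.

Lemma ge0_integral_affine (G : R -> R) (a b : R) : 0 < a -> continuous G ->
  (forall x, 0 <= G x) ->
  (\int[mu]_x (G x)%:E = \int[mu]_x (G (a * x + b) * a)%:E)%E.
Proof.
move=> a0 cG G0; pose F x : R := x * a + b.
have dF (x : R) : is_derive x 1 F a.
  by apply: is_derive_eq; rewrite ?scaler0 ?add0r ?addr0 /GRing.scale/= mulr1.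
have F' : F^`()%classic = cst a by apply/funext => x; rewrite derive1E derive_val.
rewrite (increasing_ge0_integration_by_substitutionT (F := F))//.
- by apply: eq_integral => x _; rewrite F' !fctE/= /F mulrC (mulrC a x) mulrC.
- by move=> x y xy; rewrite /F ltrD2r ltr_pM2r.
- by rewrite F' => ?; exact: cvg_cst.
- by rewrite F'; exact: is_cvg_cst.
- by rewrite F'; exact: is_cvg_cst.
- rewrite /F; apply: (cvg_comp (fun x => x * a) (fun x => x + b)).
    by apply: gt0_cvgMlNy => //; exact: cvg_id.
  exact: cvg_addrr_Ny.
- rewrite /F; apply: (cvg_comp (fun x => x * a) (fun x => x + b)).
    by apply: gt0_cvgMly => //; exact: cvg_id.
  exact: cvg_addrr.
Qed.

(** Locked so that the normal law is never unfolded by unification. *)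
Definition gauss : probability R R := locked (normal_law 1).

Lemma gaussE : gauss = normal_law 1. Proof. by rewrite /gauss -lock. Qed.

Definition phi (x : R) : R := normal_pdf 0 1 x.

(** The normalizing constant stays hidden in [phi 0]: in the translation, reflection and convolution
    identities it occurs equally often on both sides. *)
Lemma phiE x : phi x = phi 0 * expR (- x ^+ 2 / 2).
Proof.
rewrite /phi normal_pdfE ?oner_neq0// /normal_fun !subr0 expr0n/= oppr0 mul0r.
by rewrite expR0 mulr1 expr1n.
Qed.

Lemma phi_ge0 x : 0 <= phi x. Proof. exact: normal_pdf_ge0. Qed.

Lemma continuous_phi : continuous phi.
Proof. by apply: continuous_normal_pdf; rewrite oner_neq0. Qed.

Lemma measurable_phi : measurable_fun setT phi.
Proof. exact: measurable_normal_pdf. Qed.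

Lemma ge0_integral_normal_law (v : R) (f : R -> \bar R) : 0 < v ->
  measurable_fun setT f -> (forall x, 0 <= f x)%E ->
  (\int[normal_law v]_x f x
   = \int[mu]_x (f x * (normal_pdf 0 (Num.sqrt v) x)%:E))%E.
Proof.
move=> v0 mf f0; rewrite /normal_law gt_eqF// ge0_integral_distribution//.
rewrite (ge0_integral_density (mu := mu) (g := normal_pdf 0 (Num.sqrt v)))//.
- by move=> x; exact: normal_pdf_ge0.
- exact: measurable_normal_pdf.
Qed.

Lemma ge0_integral_gauss (f : R -> \bar R) :
  measurable_fun setT f -> (forall x, 0 <= f x)%E ->
  (\int[gauss]_x f x = \int[mu]_x (f x * (phi x)%:E))%E.
Proof.
by move=> mf f0; rewrite gaussE (ge0_integral_normal_law ltr01 mf f0) sqrtr1.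
Qed.

(** Reduces every N(0, v) to the standard law. For v = 0 the law is a Dirac mass and the integrand
    on the right is constant. *)
Lemma ge0_integral_normal_law_scale (v : R) f : 0 <= v -> continuous f ->
  (forall x, 0 <= f x) ->
  (\int[normal_law v]_x (f x)%:E = \int[gauss]_x (f (Num.sqrt v * x))%:E)%E.
Proof.
move=> v0 cf f0.
have mf : measurable_fun setT f by exact: continuous_measurable_fun.
have [->|vn0] := eqVneq v 0.
  rewrite sqrtr0; under [RHS]eq_integral do rewrite mul0r.
  have -> : (\int[gauss]__ (f 0)%:E = (f 0)%:E)%E.
    rewrite -[RHS]mule1 -[X in (_ * X)%E](@probability_setT _ _ _ gauss).
    exact: integral_cst.
  rewrite /normal_law eqxx.
  rewrite integral_dirac; [|exact: measurableT|exact/measurable_EFinP].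
  by rewrite diracT mul1e.
have vp : 0 < v by rewrite lt_neqAle eq_sym vn0.
have sp : 0 < Num.sqrt v by rewrite sqrtr_gt0.
rewrite ge0_integral_normal_law; last 3 first.
- exact: vp.
- exact/measurable_EFinP.
- by move=> x; rewrite lee_fin.
rewrite ge0_integral_gauss; last 2 first.
- by apply/measurable_EFinP; apply: measurableT_comp => //; exact: mulrl_measurable.
- by move=> x; rewrite lee_fin.
under eq_integral do rewrite -EFinM.
rewrite (ge0_integral_affine 0 sp); last 2 first.
- move=> x; apply: cvgM; first exact: cf.
  by apply: continuous_normal_pdf; rewrite gt_eqF.
- by move=> x; rewrite mulr_ge0// normal_pdf_ge0.
apply: eq_integral => x _; rewrite addr0 -EFinM -mulrA; congr ((_ * _)%:E).
rewrite /phi !normal_pdfE ?gt_eqF ?oner_neq0// /normal_fun !subr0.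
rewrite [LHS]mulrAC; congr (_ * expR _).
  rewrite /normal_peak expr1n mul1r -mulrnAr sqrtrM ?sqr_ge0// sqrtr_sqr.
  by rewrite gtr0_norm// invfM mulrAC mulVf ?gt_eqF// mul1r.
have := lt0r_neq0 sp; move: (Num.sqrt v) => s s0.
by field.
Qed.

(** Cameron-Martin formula: a translation of f becomes an exponential weight, so that derivatives in
    the translation fall on the weight and f need not be smooth. *)
Lemma ge0_integral_gauss_shift f (a : R) : continuous f -> (forall x, 0 <= f x) ->
  (\int[gauss]_z (f (z + a))%:E
   = \int[gauss]_z (f z * expR (a * z - a ^+ 2 / 2))%:E)%E.
Proof.
move=> cf f0.
have mf : measurable_fun setT f by exact: continuous_measurable_fun.
rewrite ge0_integral_gauss; last 2 first.
- by apply/measurable_EFinP; apply: measurableT_comp => //; exact: measurable_funD.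
- by move=> x; rewrite lee_fin.
rewrite ge0_integral_gauss; last 2 first.
- apply/measurable_EFinP; apply: measurable_funM => //.
  by apply: measurableT_comp => //; apply: measurable_funB.
- by move=> x; rewrite lee_fin mulr_ge0// expR_ge0.
under eq_integral do rewrite -EFinM.
under [RHS]eq_integral do rewrite -EFinM.
rewrite [RHS](ge0_integral_affine a ltr01); last 2 first.
- move=> x; apply: cvgM; last exact: continuous_phi.
  apply: cvgM; first exact: cf.
  apply: continuous_comp; last exact: continuous_expR.
  by apply: cvgB; [apply: cvgM; [exact: cvg_cst|exact: cvg_id]|exact: cvg_cst].
- by move=> x; rewrite mulr_ge0 ?phi_ge0// mulr_ge0// expR_ge0.
apply: eq_integral => x _; rewrite mul1r mulr1 -mulrA; congr ((_ * _)%:E).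
rewrite (phiE x) (phiE (x + a)) mulrCA -expRD; congr (_ * expR _).
by field.
Qed.

Lemma ge0_integral_gaussN f : continuous f -> (forall x, 0 <= f x) ->
  (\int[gauss]_z (f (- z))%:E = \int[gauss]_z (f z)%:E)%E.
Proof.
move=> cf f0.
have mf : measurable_fun setT f by exact: continuous_measurable_fun.
rewrite ge0_integral_gauss; last 2 first.
- by apply/measurable_EFinP; apply: measurableT_comp.
- by move=> x; rewrite lee_fin.
rewrite ge0_integral_gauss; last 2 first.
- exact/measurable_EFinP.
- by move=> x; rewrite lee_fin.
transitivity (\int[pushforward mu (-%R : measurableTypeR R -> measurableTypeR R)]_x
    ((f x)%:E * (phi x)%:E))%E; last first.
  by apply: eq_measure_integral => A mA _; exact: lebesgue_measureN.
rewrite [RHS]ge0_integral_pushforward; last 3 first.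
- exact: measurableT.
- by apply: emeasurable_funM; apply/measurable_EFinP => //; exact: measurable_phi.
- by move=> x _; rewrite mule_ge0 ?lee_fin ?phi_ge0.
  by apply: eq_integral => x _ /=; rewrite (phiE x) (phiE (- x)) sqrrN.
exact: oppr_measurable.
Qed.

(* Completing the square in the joint density. *)
Lemma ge0_integral_gauss_conv f (a b : R) : 0 <= a -> 0 < b -> continuous f ->
  (forall x, 0 <= f x) ->
  (\int[gauss]_y \int[gauss]_z (f (a * y + b * z))%:E
   = \int[gauss]_z (f (Num.sqrt (a ^+ 2 + b ^+ 2) * z))%:E)%E.
Proof.
move=> a0 b0 cf f0.
set c := Num.sqrt (a ^+ 2 + b ^+ 2).
have cE : c ^+ 2 = a ^+ 2 + b ^+ 2 by rewrite sqr_sqrtr// addr_ge0// sqr_ge0.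
have c0 : 0 < c by rewrite sqrtr_gt0 ltr_wpDl ?sqr_ge0// exprn_gt0.
have bn0 : b != 0 by rewrite gt_eqF.
have cn0 : c != 0 by rewrite gt_eqF.
have mf : measurable_fun setT f by exact: continuous_measurable_fun.
(* Joint density of (w, y) when c w = a y + b z, with Jacobian c / b. By [kE] it is also the density
   of w times the conditional density of y given w, which integrates to 1. *)
pose k (w y : R) : R := phi y * phi ((c * w - a * y) / b) * (c / b).
have k0 w y : 0 <= k w y.
  by rewrite /k !mulr_ge0 ?phi_ge0// ?invr_ge0 ltW.
have mk2 : measurable_fun setT (fun wy : R * R => k wy.1 wy.2).
  apply: measurable_funM => //; apply: measurable_funM.
    by apply: measurableT_comp => //; exact: measurable_phi.
  apply: measurableT_comp; first exact: measurable_phi.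
  apply: measurable_funM => //.
  by apply: measurable_funB; apply: measurable_funM.
have kE w y : k w y = phi w * (phi (c / b * y + (- (a * w / b))) * (c / b)).
  rewrite /k mulrA; congr (_ * _).
  rewrite (phiE y) (phiE ((c * w - a * y) / b)) (phiE w).
  rewrite (phiE (c / b * y - a * w / b)) mulrACA -expRD [RHS]mulrACA -expRD; congr (_ * expR _).
  rewrite -mulrDl -mulrDl; congr (_ / _).
  apply: (mulfI (_ : b ^+ 2 != 0)); first by rewrite expf_neq0.
  have -> : b ^+ 2 * (- y ^+ 2 - ((c * w - a * y) / b) ^+ 2) =
     - b ^+ 2 * y ^+ 2 - (c * w - a * y) ^+ 2 by field.
  have -> : b ^+ 2 * (- w ^+ 2 - (c / b * y - a * w / b) ^+ 2) =
     - b ^+ 2 * w ^+ 2 - (c * y - a * w) ^+ 2 by field.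
  have -> : b ^+ 2 = c ^+ 2 - a ^+ 2 by rewrite cE; ring.
  ring.
have phi1 : (\int[mu]_x (phi x)%:E = 1)%E by exact: integral_normal_pdf.
have kint w : (\int[mu]_y (k w y)%:E = (phi w)%:E)%E.
  under eq_integral do rewrite kE EFinM.
  rewrite ge0_integralZl; last 4 first.
  - exact: measurableT.
  - apply/measurable_EFinP; apply: measurable_funM => //.
    apply: measurableT_comp; first exact: measurable_phi.
    by apply: measurable_funD => //; exact: mulrl_measurable.
  - by move=> x _; rewrite lee_fin mulr_ge0 ?phi_ge0// divr_ge0// ltW.
  - by rewrite lee_fin phi_ge0.
  rewrite -(ge0_integral_affine (- (a * w / b)) (divr_gt0 c0 b0)) ?phi1 ?mule1//.
  - exact: continuous_phi.
  - exact: phi_ge0.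
transitivity (\int[mu]_y \int[mu]_w (f (c * w) * k w y)%:E)%E.
  rewrite ge0_integral_gauss; last 2 first.
  - apply: (measurable_fun_fubini_tonelli_F
      (fun yz : R * R => (f (a * yz.1 + b * yz.2))%:E)).
    + apply/measurable_EFinP; apply: measurableT_comp => //.
      by apply: measurable_funD; apply: measurable_funM.
    + by move=> x; rewrite lee_fin.
  - by move=> y; apply: integral_ge0 => z _; rewrite lee_fin.
  apply: eq_integral => y _.
  rewrite ge0_integral_gauss; last 2 first.
  - apply/measurable_EFinP; apply: measurableT_comp => //.
    by apply: measurable_funD => //; exact: mulrl_measurable.
  - by move=> x; rewrite lee_fin.
  under eq_integral do rewrite -EFinM.
  rewrite (ge0_integral_affine (- (a * y / b)) (divr_gt0 c0 b0)); last 2 first.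
  - move=> x; apply: cvgM; last exact: continuous_phi.
    apply: continuous_comp; last exact: cf.
    by apply: cvgD; [exact: cvg_cst|apply: cvgM; [exact: cvg_cst|exact: cvg_id]].
  - by move=> x; rewrite mulr_ge0// phi_ge0.
  rewrite muleC -ge0_integralZl; last 4 first.
  - exact: measurableT.
  - apply/measurable_EFinP; apply: measurable_funM => //.
    have maff : measurable_fun setT (fun x : R => c / b * x - a * y / b).
      by apply: measurable_funB => //; exact: mulrl_measurable.
    apply: measurable_funM; last first.
      by apply: measurableT_comp => //; exact: measurable_phi.
    apply: measurableT_comp => //; apply: measurable_funD => //.
    exact: measurable_funM.
  - by move=> x _; rewrite lee_fin !mulr_ge0 ?phi_ge0// ?invr_ge0 ltW.
  - by rewrite lee_fin phi_ge0.
  apply: eq_integral => w _; rewrite -EFinM /k; congr (_%:E).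
  have -> : a * y + b * (c / b * w - a * y / b) = c * w by field.
  have -> : c / b * w - a * y / b = (c * w - a * y) / b by field.
  ring.
transitivity (\int[mu]_w \int[mu]_y (f (c * w) * k w y)%:E)%E.
  have fub := @fubini_tonelli _ _ _ _ R mu mu
    (fun yw : R * R => (f (c * yw.2) * k yw.2 yw.1)%:E).
  apply: fub.
    apply/measurable_EFinP; apply: measurable_funM.
      by apply: measurableT_comp => //; exact: measurable_funM.
    apply: (measurableT_comp (f := fun wy : R * R => k wy.1 wy.2)
       (g := fun yw : R * R => (yw.2, yw.1))) => //.
    exact: measurable_fun_pair.
  by move=> x; rewrite lee_fin mulr_ge0.
rewrite ge0_integral_gauss; last 2 first.
- by apply/measurable_EFinP; apply: measurableT_comp.
- by move=> x; rewrite lee_fin.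
apply: eq_integral => w _ /=; under eq_integral do rewrite EFinM.
rewrite ge0_integralZl ?kint//.
- apply/measurable_EFinP.
  exact: (measurableT_comp mk2 (pair1_measurable w)).
- by move=> x _; rewrite lee_fin.
- by rewrite lee_fin.
Qed.

End gauss.

(** * The mean value inequality, and continuity of powers of the absolute value *)

Section mean_value.
Context (R : realType).
Implicit Types g : R -> R.

Lemma mean_value_bound g (g1 : R -> R) (M h : R) :
  (forall s : R, is_derive s 1 g (g1 s)) ->
  (forall s, `|s| <= `|h| -> `|g1 s| <= M) -> `|g h - g 0| <= M * `|h|.
Proof.
move=> dg g1M.
have cg a b : {within `[a, b], continuous g}.
  by apply: derivable_within_continuous => x _; case: (dg x).
have [h0|h0|->] := ltgtP h 0; last by rewrite subrr !normr0 mulr0.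
- have [c /[!in_itv]/= /andP[hc c0] E] := @MVT R g g1 h 0 h0 (fun x _ => dg x) (cg h 0).
  rewrite distrC E normrM sub0r normrN ler_wpM2r// g1M//.
  by rewrite !ltr0_norm// lerN2 ltW.
- have [c /[!in_itv]/= /andP[hc c0] E] := @MVT R g g1 0 h h0 (fun x _ => dg x) (cg 0 h).
  rewrite E normrM subr0 ler_wpM2r// g1M//.
  by rewrite !gtr0_norm// ltW.
Qed.

Lemma continuous_norm_powR (r : R) : 0 < r -> continuous (fun z : R => `|z| `^ r).
Proof.
move=> r0 z; have [->|z0] := eqVneq z 0.
  rewrite /continuous_at normr0 powR0 ?gt_eqF//; apply/cvgr0Pnorm_lt => e e0.
  apply: filterS (@nbhs0_lt R R _ (powR_gt0 r^-1 e0)) => x xe.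
  rewrite ger0_norm ?powR_ge0//.
  rewrite -[ltRHS]powRr1 ?(ltW e0)// -(mulVf (lt0r_neq0 r0)) powRrM.
  by apply: gt0_ltr_powR; rewrite ?nnegrE ?powR_ge0.
apply: (@continuous_comp _ _ _ (fun x : R => `|x|) (fun x => x `^ r)).
  exact: norm_continuous.
apply: differentiable_continuous; apply/derivable1_diffP.
by apply: derivable_powR; rewrite in_itv/= andbT normr_gt0.
Qed.

End mean_value.

(** * Continuous functions of exponential growth under the Gaussian law *)

Section tame_functions.
Context (R : realType).
Implicit Types f g : R -> R.

(** Exponential growth is stable under products with polynomials and with the weights of the
    translation formula, and it ensures Gaussian integrability. *)
Definition tame f : Prop := continuous f /\
  exists C c : R, [/\ 0 <= C, 0 <= c & forall z, `|f z| <= C * expR (c * `|z|)].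

Lemma tame_continuous f : tame f -> continuous f. Proof. by case. Qed.

Lemma tame_le f g : continuous f -> tame g -> (forall z, `|f z| <= `|g z|) -> tame f.
Proof.
move=> cf [_ [C [c [C0 c0 gC]]]] fg; split => //.
by exists C, c; split => // z; rewrite (le_trans (fg z)).
Qed.

Lemma eq_tame f g : f =1 g -> tame f -> tame g.
Proof. by move=> /funext ->. Qed.

Lemma tame_cst k : tame (fun=> k).
Proof.
split; first by move=> x; exact: cvg_cst.
by exists `|k|, 0; split => // z; rewrite mul0r expR0 mulr1.
Qed.

Lemma tame_id : tame id.
Proof.
split; first by move=> x; exact: cvg_id.
exists 1, 1; split => // z; rewrite !mul1r.
by apply: le_trans (expR_ge1Dx `|z|); rewrite lerDr.
Qed.

Lemma tameD f g : tame f -> tame g -> tame (fun z => f z + g z).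
Proof.
move=> [cf [C [c [C0 c0 fC]]]] [cg [D [d [D0 d0 gD]]]]; split.
  by move=> x; apply: cvgD; [exact: cf|exact: cg].
exists (C + D), (c + d); split; rewrite ?addr_ge0// => z.
rewrite (le_trans (ler_normD _ _))// mulrDl lerD//.
- by rewrite (le_trans (fC z))// ler_wpM2l// ler_expR ler_wpM2r// lerDl.
- by rewrite (le_trans (gD z))// ler_wpM2l// ler_expR ler_wpM2r// lerDr.
Qed.

Lemma tameM f g : tame f -> tame g -> tame (fun z => f z * g z).
Proof.
move=> [cf [C [c [C0 c0 fC]]]] [cg [D [d [D0 d0 gD]]]]; split.
  by move=> x; apply: cvgM; [exact: cf|exact: cg].
exists (C * D), (c + d); split; rewrite ?addr_ge0 ?mulr_ge0// => z.
by rewrite mulrDl expRD mulrACA normrM ler_pM.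
Qed.

Lemma tameZ k f : tame f -> tame (fun z => k * f z).
Proof. exact: (tameM (tame_cst k)). Qed.

Lemma tameN f : tame f -> tame (fun z => - f z).
Proof. by move=> /(tameZ (-1)); apply: eq_tame => z; rewrite mulN1r. Qed.

Lemma tameB f g : tame f -> tame g -> tame (fun z => f z - g z).
Proof. by move=> tf /tameN; exact: tameD. Qed.

Lemma tameX f n : tame f -> tame (fun z => f z ^+ n).
Proof.
move=> tf; elim: n => [|n IH]; first exact: tame_cst.
by apply: eq_tame (tameM tf IH) => z; rewrite exprS.
Qed.

Lemma tame_norm f : tame f -> tame (fun z => `|f z|).
Proof.
move=> [cf [C [c [C0 c0 fC]]]]; split.
  by move=> x; apply: cvg_norm; exact: cf.
by exists C, c; split => // z; rewrite normr_id.
Qed.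

Lemma tame_expR (a : R) : tame (fun z => expR (a * z)).
Proof.
split.
  move=> x; apply: continuous_comp; last exact: continuous_expR.
  by apply: cvgM; [exact: cvg_cst|exact: cvg_id].
exists 1, `|a|; split => // z; rewrite mul1r ger0_norm ?expR_ge0// ler_expR.
by rewrite -normrM ler_norm.
Qed.

Lemma tame_expR_norm (a : R) : tame (fun z => expR (a * `|z|)).
Proof.
split.
  move=> x; apply: continuous_comp; last exact: continuous_expR.
  by apply: cvgM; [exact: cvg_cst|apply: cvg_norm; exact: cvg_id].
exists 1, `|a|; split => // z; rewrite mul1r ger0_norm ?expR_ge0// ler_expR.
by rewrite ler_wpM2r// ler_norm.
Qed.

Lemma tame_affine f (a b : R) : tame f -> tame (fun z => f (a * z + b)).
Proof.
move=> [cf [C [c [C0 c0 fC]]]]; split.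
  move=> x; apply: continuous_comp; last exact: cf.
  by apply: cvgD; [apply: cvgM; [exact: cvg_cst|exact: cvg_id]|exact: cvg_cst].
exists (C * expR (c * `|b|)), (c * `|a|); split; rewrite ?mulr_ge0 ?expR_ge0// => z.
rewrite (le_trans (fC _))// -mulrA -expRD ler_wpM2l// ler_expR -mulrA -mulrDr.
by rewrite ler_wpM2l// (le_trans (ler_normD _ _))// normrM addrC.
Qed.

Lemma tame_powR (r : R) : 0 < r -> tame (fun z => `|z| `^ r).
Proof.
move=> r0; split; first exact: continuous_norm_powR.
exists 1, r; split; rewrite ?ltW// => z; rewrite mul1r ger0_norm ?powR_ge0//.
apply: (@le_trans _ _ (expR `|z| `^ r)).
  apply: le_powR; rewrite ?(ltW r0)//.
  by apply: le_trans (expR_ge1Dx `|z|); rewrite lerDr.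
by rewrite -expRM mulrC.
Qed.

(** Applied to the constant 1, the translation formula for nonnegative functions shows that exp (a
    z) has a finite Gaussian integral; exp (c |z|) is at most the sum of two such exponentials. *)
Lemma tame_L1 f : tame f -> L1 (gauss R) f.
Proof.
move=> [cf [C [c [C0 c0 fC]]]].
have E (a : R) : L1 (gauss R) (fun z => expR (a * z)).
  have ca : continuous (fun z : R => expR (a * z)) by exact: (tame_expR a).1.
  apply: L1_ge0.
  - exact: continuous_measurable_fun.
  - by move=> z; exact: expR_ge0.
  have := @ge0_integral_gauss_shift R (fun=> 1) a (@cst_continuous _ _ _) (fun=> ler01).
  have -> : (\int[gauss R]__ 1%:E = 1)%E.
    rewrite -[RHS]mule1 -[X in (_ * X)%E](@probability_setT _ _ _ (gauss R)).
    exact: integral_cst.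
  have <- : (\int[gauss R]_z ((expR (- (a ^+ 2 / 2)))%:E * (expR (a * z))%:E) =
      \int[gauss R]_z (1 * expR (a * z - a ^+ 2 / 2))%:E)%E.
    by apply: eq_integral => z _; rewrite mul1r addrC expRD.
  rewrite ge0_integralZl_EFin; last 4 first.
  - exact: measurableT.
  - by move=> z _; rewrite lee_fin expR_ge0.
  - by apply/measurable_EFinP; exact: continuous_measurable_fun.
  - exact: expR_ge0.
  case: (eqVneq (\int[gauss R]_x (expR (a * x))%:E)%E +oo%E) => [->|ny _].
    by rewrite gt0_muley// lte_fin expR_gt0.
  by rewrite ltNge leye_eq.
apply: (@L1_le _ _ _ _ _ (fun z => C * (expR (c * z) + expR (- c * z)))).
- exact: continuous_measurable_fun.
- move=> z; rewrite (le_trans (fC z))// ler_wpM2l//.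
  case: (ger0P z) => z0; first by rewrite lerDl expR_ge0.
  by rewrite mulrN mulNr lerDr expR_ge0.
- by apply: L1Z; apply: L1D.
Qed.

Lemma tame_measurable f : tame f -> measurable_fun setT f.
Proof. by case=> cf _; exact: continuous_measurable_fun. Qed.

Notation G := (Ex (gauss R)).

(* Transfer to signed functions: add a tame majorant to make f nonnegative. *)
Lemma tame_dominated f : tame f -> exists g,
  [/\ tame g, forall z, 0 <= g z & forall z, 0 <= f z + g z].
Proof.
move=> [cf [C [c [C0 c0 fC]]]]; exists (fun z => C * expR (c * `|z|)); split.
- by apply: tameZ; exact: tame_expR_norm.
- by move=> z; rewrite mulr_ge0// expR_ge0.
- by move=> z; rewrite -lerBlDr sub0r; have := fC z; rewrite ler_norml => /andP[].
Qed.

Lemma Ex_gauss_shift f (a : R) : tame f ->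
  G (fun z => f (z + a)) = G (fun z => f z * expR (a * z - a ^+ 2 / 2)).
Proof.
move=> tf; have [g [tg g0 fg0]] := tame_dominated tf.
have sh h : tame h -> tame (fun z => h (z + a)).
  by move=> th; apply: eq_tame (tame_affine 1 a th) => z; rewrite mul1r.
have te h : tame h -> tame (fun z => h z * expR (a * z - a ^+ 2 / 2)).
  move=> th; apply: tameM => //; apply: eq_tame (tameZ (expR (- (a ^+ 2 / 2))) (tame_expR a)).
  by move=> z; rewrite -expRD addrC.
have Sg h : tame h -> (forall z, 0 <= h z) ->
    G (fun z => h (z + a)) = G (fun z => h z * expR (a * z - a ^+ 2 / 2)).
  by move=> [ch _] h0; congr fine; exact: ge0_integral_gauss_shift.
have tfg := tameD tf tg.
have := Sg _ tfg fg0; rewrite ExD; last 2 first.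
- exact/tame_L1/sh.
- exact/tame_L1/sh.
rewrite (Sg _ tg g0) => H; apply: (addIr (G (fun z => g z * expR (a * z - a ^+ 2 / 2)))).
rewrite H -ExD; last 2 first.
- exact/tame_L1/te.
- exact/tame_L1/te.
by apply: eq_Ex => z; rewrite mulrDl.
Qed.

Lemma Ex_gaussN f : tame f -> G (fun z => f (- z)) = G f.
Proof.
move=> tf; have [g [tg g0 fg0]] := tame_dominated tf.
have sh h : tame h -> tame (fun z => h (- z)).
  by move=> th; apply: eq_tame (tame_affine (-1) 0 th) => z; rewrite mulN1r addr0.
have Sg h : tame h -> (forall z, 0 <= h z) -> G (fun z => h (- z)) = G h.
  by move=> [ch _] h0; congr fine; exact: ge0_integral_gaussN.
have := Sg _ (tameD tf tg) fg0; rewrite ExD; last 2 first.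
- exact/tame_L1/sh.
- exact/tame_L1/sh.
rewrite (Sg _ tg g0) ExD; [|exact: tame_L1|exact: tame_L1].
exact: addIr.
Qed.

Lemma Ex_gauss_conv f (a b : R) : 0 <= a -> 0 < b -> tame f ->
  G (fun y => G (fun z => f (a * y + b * z))) =
  G (fun z => f (Num.sqrt (a ^+ 2 + b ^+ 2) * z)).
Proof.
move=> a0 b0 tf; have [g [tg g0 fg0]] := tame_dominated tf.
have tb h x : tame h -> tame (fun z => h (a * x + b * z)).
  by move=> th; apply: eq_tame (tame_affine b (a * x) th) => z; rewrite addrC.
set c := Num.sqrt _.
have tc h : tame h -> tame (fun z => h (c * z)).
  by move=> th; apply: eq_tame (tame_affine c 0 th) => z; rewrite addr0.
have Sg h : tame h -> (forall z, 0 <= h z) ->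
    (\int[gauss R]_y (G (fun z => h (a * y + b * z)))%:E = (G (fun z => h (c * z)))%:E)%E.
  move=> th h0; rewrite EFin_Ex; last exact/tame_L1/tc.
  rewrite -ge0_integral_gauss_conv//; last exact: th.1.
  by apply: eq_integral => y _; rewrite EFin_Ex//; exact/tame_L1/tb.
have mS h : tame h -> (forall z, 0 <= h z) ->
    measurable_fun setT (fun y => G (fun z => h (a * y + b * z))).
  move=> th h0; apply/measurable_EFinP.
  have : measurable_fun setT (fun y => \int[gauss R]_z (h (a * y + b * z))%:E)%E.
    apply: (measurable_fun_fubini_tonelli_F
      (fun yz : R * R => (h (a * yz.1 + b * yz.2))%:E)).
      apply/measurable_EFinP; apply: (measurableT_comp (tame_measurable th)).
      by apply: measurable_funD; apply: measurable_funM.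
    by move=> x; rewrite lee_fin.
  apply: eq_measurable_fun => y _ /=; rewrite EFin_Ex//.
  exact/tame_L1/tb.
have LS h : tame h -> (forall z, 0 <= h z) ->
    L1 (gauss R) (fun y => G (fun z => h (a * y + b * z))).
  move=> th h0; apply: L1_ge0; first exact: mS.
    by move=> y; apply: Ex_ge0 => z.
  by rewrite Sg// ltry.
have tfg := tameD tf tg.
have E y : G (fun z => f (a * y + b * z)) =
    G (fun z => f (a * y + b * z) + g (a * y + b * z)) -
    G (fun z => g (a * y + b * z)).
  rewrite ExD ?addrK//; [exact: (tame_L1 (tb _ y tf))|exact: (tame_L1 (tb _ y tg))].
rewrite (eq_Ex _ E) ExB; [|exact: (LS _ tfg fg0)|exact: (LS _ tg g0)].
have H h : tame h -> (forall z, 0 <= h z) ->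
    G (fun y => G (fun z => h (a * y + b * z))) = G (fun z => h (c * z)).
  by move=> th h0; rewrite /(G (fun y => _)) /Rintegral Sg.
rewrite (H _ tfg fg0) (H _ tg g0) ExD ?addrK//.
- exact: (tame_L1 (tc _ tf)).
- exact: (tame_L1 (tc _ tg)).
Qed.

End tame_functions.

(** * Second-order Hermite expansion of Gaussian translations, and Gaussian moments *)

Section gauss_moments.
Context (R : realType).
Notation G := (Ex (gauss R)).
Implicit Types f g : R -> R.

Lemma le_expR_sub1 (b : R) : `|expR b - 1| <= `|b| * expR `|b|.
Proof.
have d (s : R) : is_derive s 1 (@expR R) (expR s) by exact: is_derive_expR.
have := @mean_value_bound R (@expR R) (@expR R) (expR `|b|) b d.
rewrite expR0 mulrC; apply => s sb.
by rewrite ger0_norm ?expR_ge0// ler_expR (le_trans (ler_norm s)).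
Qed.

Lemma le_expR_taylor1 (b : R) : `|expR b - 1 - b| <= `|b| ^+ 2 * expR `|b|.
Proof.
have d (s : R) : is_derive s 1 (fun x : R => expR x - 1 - x) (expR s - 1).
  by apply: is_derive_eq; rewrite ?subr0// /GRing.scale/= mulr1.
have := mean_value_bound (M := `|b| * expR `|b|) (h := b) d.
rewrite expR0 subrr !subr0 mulrAC -expr2; apply => s sb.
by rewrite (le_trans (le_expR_sub1 s))// ler_pM// ler_expR.
Qed.

Lemma le_expR_taylor2 (b : R) :
  `|expR b - 1 - b - b ^+ 2 / 2| <= `|b| ^+ 3 * expR `|b|.
Proof.
have d (s : R) : is_derive s 1 (fun x : R => expR x - 1 - x - x ^+ 2 / 2) (expR s - 1 - s).
  apply: is_derive_eq; rewrite /GRing.scale/=.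
  by field.
have := mean_value_bound (M := `|b| ^+ 2 * expR `|b|) (h := b) d.
rewrite expR0 subrr expr0n/= mul0r !subr0.
rewrite (_ : `|b| ^+ 2 * expR `|b| * `|b| = `|b| ^+ 3 * expR `|b|); last by ring.
apply => s sb.
by rewrite (le_trans (le_expR_taylor1 s))// ler_pM ?exprn_ge0// ?lerXn2r ?nnegrE// ler_expR.
Qed.

(** The weight of the translation formula is the generating function of the Hermite polynomials;
    this is what is left after degree 2, of order a^3. *)
Definition gauss_rem (a z : R) : R :=
  expR (a * z - a ^+ 2 / 2) - 1 - a * z - a ^+ 2 / 2 * (z ^+ 2 - 1).

Lemma gauss_rem_le a z : `|a| <= 1 ->
  `|gauss_rem a z| <= `|a| ^+ 3 * (2 * expR 1 * expR (4 * `|z|)).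
Proof.
move=> a1; set b := a * z - a ^+ 2 / 2.
have b1 : `|b| <= `|a| * (1 + `|z|).
  rewrite (le_trans (ler_normB _ _))// normrM mulrDr mulr1 addrC lerD2r.
  rewrite normrM normrX normfV (gtr0_norm (@ltr0Sn R 1)) expr2.
  have := ler_piMr (normr_ge0 a) a1.
  have := mulr_ge0 (normr_ge0 a) (normr_ge0 a); lra.
have b2 : `|b| <= 1 + `|z|.
  by rewrite (le_trans b1)// ler_piMl// addr_ge0.
(* In b + b^2 / 2 the terms of degree at most 2 in a are the Hermite terms, so only a^3 (a / 8 - z /
   2) is added to the Taylor remainder in b. *)
have -> : gauss_rem a z = (expR b - 1 - b - b ^+ 2 / 2) +
    (a ^+ 3 * (a / 8 - z / 2)) by rewrite /gauss_rem /b; field.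
have e1 : 1 + `|z| <= expR `|z| := expR_ge1Dx _.
have E : (1 + `|z|) ^+ 3 * expR (1 + `|z|) <= expR 1 * expR (4 * `|z|).
  have -> : 4 * `|z| = `|z| *+ 3 + `|z| by rewrite -mulr_natl; ring.
  have -> : expR (`|z| *+ 3 + `|z|) = expR `|z| ^+ 3 * expR `|z|.
    by rewrite expRD !mulrS mulr0n addr0 !expRD; ring.
  rewrite expRD mulrCA ler_wpM2l ?expR_ge0//.
  by rewrite ler_wpM2r ?expR_ge0// lerXn2r ?nnegrE ?expR_ge0// addr_ge0.
have E2 : `|a / 8 - z / 2| <= expR 1 * expR (4 * `|z|).
  apply: (@le_trans _ _ (1 + `|z|)).
    rewrite (le_trans (ler_normB _ _))// !normrM !normfV.
    rewrite (gtr0_norm (@ltr0Sn R 1)) (gtr0_norm (@ltr0Sn R 7)).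
    have := normr_ge0 z; lra.
  rewrite (le_trans e1)// -[leLHS]mul1r ler_pM ?expR_ge0//.
    by rewrite -[leLHS]expR0 ler_expR.
  by rewrite ler_expR; have := normr_ge0 z; lra.
rewrite (le_trans (ler_normD _ _))// -mulrA (mulrDl 1 1) !mul1r [leRHS]mulrDr.
rewrite lerD//; last by rewrite normrM normrX ler_wpM2l ?exprn_ge0.
rewrite (le_trans (le_expR_taylor2 b))//.
apply: (@le_trans _ _ (`|a| ^+ 3 * ((1 + `|z|) ^+ 3 * expR (1 + `|z|)))).
  rewrite mulrA -exprMn ler_pM ?exprn_ge0 ?expR_ge0 ?ler_expR//.
  by rewrite lerXn2r ?nnegrE// mulr_ge0// addr_ge0.
by rewrite ler_wpM2l ?exprn_ge0.
Qed.

Lemma tame_rem_bound : tame (fun z : R => 2 * expR 1 * expR (4 * `|z|)).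
Proof. by apply: tameZ; exact: tame_expR_norm. Qed.

Lemma tame_gauss_rem a : tame (gauss_rem a).
Proof.
have te : tame (fun z => expR (a * z - a ^+ 2 / 2)).
  apply: eq_tame (tameZ (expR (- (a ^+ 2 / 2))) (tame_expR a)).
  by move=> z; rewrite -expRD addrC.
apply: tameB; last by apply/tameZ/tameB; [apply: tameX; exact: tame_id|exact: tame_cst].
apply: tameB; last by apply: tameZ; exact: tame_id.
by apply: tameB => //; exact: tame_cst.
Qed.

Lemma Ex_gauss_shift_taylor f a : tame f ->
  G (fun z => f (z + a)) = G f + a * G (fun z => z * f z)
    + a ^+ 2 / 2 * G (fun z => (z ^+ 2 - 1) * f z) + G (fun z => gauss_rem a z * f z).
Proof.
move=> tf.
have t1 : tame (fun z => z * f z) by exact: tameM (@tame_id R) tf.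
have t2 : tame (fun z => (z ^+ 2 - 1) * f z).
  by apply: tameM => //; apply: tameB; [apply: tameX; exact: tame_id|exact: tame_cst].
have t3 : tame (fun z => gauss_rem a z * f z) by apply: tameM => //; exact: tame_gauss_rem.
rewrite Ex_gauss_shift// -ExZ; last exact: tame_L1.
rewrite -ExD; [|exact: tame_L1|exact/tame_L1/tameZ].
rewrite -ExZ; last exact: tame_L1.
rewrite -ExD; [|apply: tame_L1; apply: tameD => //; exact: tameZ|exact/tame_L1/tameZ].
rewrite -ExD; [|apply: tame_L1; apply: tameD; [apply: tameD => //; exact: tameZ|exact: tameZ]|exact/tame_L1].
by apply: eq_Ex => z; rewrite /gauss_rem; ring.
Qed.

Lemma Ex_gauss_rem_le f a : tame f -> `|a| <= 1 ->
  `|G (fun z => gauss_rem a z * f z)| <=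
  `|a| ^+ 3 * G (fun z => 2 * expR 1 * expR (4 * `|z|) * `|f z|).
Proof.
move=> tf a1.
have tb : tame (fun z => 2 * expR 1 * expR (4 * `|z|) * `|f z|).
  by apply: tameM; [exact: tame_rem_bound|exact: tame_norm].
rewrite -ExZ; last exact: tame_L1.
apply: Ex_norm_le.
- exact: (tame_measurable (tameM (tame_gauss_rem a) tf)).
- exact/tame_L1/tameZ.
- by move=> z; rewrite normrM mulrA ler_wpM2r// gauss_rem_le.
Qed.

Lemma Ex_gauss_id : G id = 0.
Proof.
have := Ex_gaussN (@tame_id R).
have -> : G (fun z => - id z) = - G id.
  rewrite -mulN1r -ExZ; last exact/tame_L1/tame_id.
  by apply: eq_Ex => z; rewrite mulN1r.
lra.
Qed.

Lemma eq0_of_le_small (x C : R) : (forall a, 0 < a -> a <= 1 -> `|x| <= C * a) -> x = 0.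
Proof.
move=> H; apply/eqP; rewrite -normr_le0; apply/ler_addgt0Pr => e e0; rewrite add0r.
have C0 : 0 <= `|C| := normr_ge0 C.
have ep : 0 < e + `|C| + 1 by lra.
have := H (e / (e + `|C| + 1)) (divr_gt0 e0 ep).
rewrite ler_pdivrMr// mul1r => /(_ _)/le_trans; apply; first by lra.
apply: (@le_trans _ _ (`|C| * (e / (e + `|C| + 1)))).
  by apply: ler_wpM2r; [rewrite divr_ge0// ltW|exact: ler_norm].
by rewrite mulrCA -[leRHS]mulr1 ler_pM2l// ler_pdivrMr// mul1r; lra.
Qed.

(** For f = 1 the left side of the translation formula does not depend on a, so the coefficient of
    a^2 vanishes, the remainder being of order a^3. *)
Lemma Ex_gauss_sqr : G (fun z => z ^+ 2) = 1.
Proof.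
apply/eqP; rewrite -subr_eq0; apply/eqP.
pose C := 2 * G (fun z => 2 * expR 1 * expR (4 * `|z|) * `|1|).
apply: (@eq0_of_le_small _ C) => a a0 a1.
have t1 := @tame_cst R 1.
have aa : `|a| <= 1 by rewrite gtr0_norm.
have := Ex_gauss_shift_taylor a t1; rewrite Ex_cst.
have -> : G (fun z => z * 1) = 0 by rewrite -Ex_gauss_id; apply: eq_Ex => z; rewrite mulr1.
have -> : G (fun z => (z ^+ 2 - 1) * 1) = G (fun z => z ^+ 2) - 1.
  rewrite -[in RHS](Ex_cst (gauss R) 1) -ExB; last exact: L1_cst.
    by apply: eq_Ex => z; rewrite mulr1.
  exact/tame_L1/tameX/tame_id.
have := Ex_gauss_rem_le t1 aa.
set x := G (fun z => z ^+ 2) - 1; set y := G (fun z => gauss_rem a z * 1).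
move=> yl; rewrite mulr0 addr0 => H1.
have xy : a ^+ 2 / 2 * x = - y by move: H1; lra.
have {xy}x_E : x = - (2 / a ^+ 2 * y).
  have an0 : a != 0 by rewrite gt_eqF.
  apply: (mulfI (_ : a ^+ 2 / 2 != 0)); first by rewrite mulf_neq0 ?expf_neq0 ?invr_eq0 ?pnatr_eq0.
  by rewrite xy; field.
rewrite x_E normrN normrM.
rewrite ger0_norm; last by rewrite divr_ge0// exprn_ge0// ltW.
apply: (@le_trans _ _ (2 / a ^+ 2 * (`|a| ^+ 3 * (C / 2)))).
  rewrite ler_wpM2l ?divr_ge0 ?exprn_ge0 ?(ltW a0)// (le_trans yl)//.
  by rewrite le_eqVlt; apply/orP; left; apply/eqP; rewrite /C; field.
rewrite gtr0_norm// le_eqVlt; apply/orP; left; apply/eqP.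
by field; rewrite gt_eqF.
Qed.

Lemma Ex_gauss_cub : G (fun z => z ^+ 3) = 0.
Proof.
have t3 := tameX 3 (@tame_id R).
have := Ex_gaussN t3.
have -> : G (fun z => (id (- z)) ^+ 3) = - G (fun z => z ^+ 3).
  rewrite -mulN1r -ExZ; last exact/tame_L1.
  by apply: eq_Ex => z /=; ring.
rewrite /=; lra.
Qed.

(** The sum of two independent standard variables has the law of sqrt 2 times one of them; with m
    the fourth moment, expanding the fourth power gives 2 m + 6 = 4 m. *)
Lemma Ex_gauss_quart : G (fun z => z ^+ 4) = 3.
Proof.
have t2 := tameX 2 (@tame_id R).
have c2 := @Ex_gauss_conv R (fun z => z ^+ 4) 1 1 ler01 ltr01 (tameX 4 (@tame_id R)).
have : G (fun y => G (fun z => (1 * y + 1 * z) ^+ 4)) = 2 * G (fun z => z ^+ 4) + 6.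
  have E y : G (fun z => (1 * y + 1 * z) ^+ 4) = y ^+ 4 + 6 * y ^+ 2 + G (fun z => z ^+ 4).
    have -> : G (fun z => (1 * y + 1 * z) ^+ 4) = G (fun z => y ^+ 4 + 4 * y ^+ 3 * z +
       6 * y ^+ 2 * z ^+ 2 + 4 * y * z ^+ 3 + z ^+ 4) by apply: eq_Ex => z; ring.
    have L n := tame_L1 (tameX n (@tame_id R)).
    have L1' := tame_L1 (@tame_id R).
    rewrite ExD; [|do ?[apply: L1D]; [exact: L1_cst|exact: L1Z L1'|exact: L1Z (L 2%N)|exact: L1Z (L 3%N)]|exact: (L 4%N)].
    rewrite ExD; [|do ?[apply: L1D]; [exact: L1_cst|exact: L1Z L1'|exact: L1Z (L 2%N)]|exact: L1Z (L 3%N)].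
    rewrite ExD; [|do ?[apply: L1D]; [exact: L1_cst|exact: L1Z L1']|exact: L1Z (L 2%N)].
    rewrite ExD; [|exact: L1_cst|exact: L1Z L1'].
    rewrite Ex_cst (ExZ _ L1') (ExZ _ (L 2%N)) (ExZ _ (L 3%N)).
    by rewrite Ex_gauss_cub Ex_gauss_sqr Ex_gauss_id; ring.
  have L n := tame_L1 (tameX n (@tame_id R)).
  rewrite (eq_Ex _ E) ExD; [|apply: L1D; [exact: (L 4%N)|exact: L1Z (L 2%N)]|exact: L1_cst].
  rewrite ExD; [|exact: (L 4%N)|exact: L1Z (L 2%N)].
  rewrite Ex_cst (ExZ _ (L 2%N)) Ex_gauss_sqr; ring.
rewrite c2 expr1n.
have -> : G (fun z => (Num.sqrt (1 + 1) * z) ^+ 4) = 4 * G (fun z => z ^+ 4).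
  rewrite -ExZ; last exact/tame_L1/tameX/tame_id.
  apply: eq_Ex => z; rewrite exprMn (exprM _ 2 2) sqr_sqrtr; last by lra.
  by congr (_ * _); ring.
lra.
Qed.

End gauss_moments.

(** * Consequences of a uniform second-order expansion with modulus w *)

Section second_order_expansion.
Context (R : realType) (q : R) (F F1 F2 w : R -> R) (A : R).
Hypothesis q0 : 0 < q.
Hypothesis q1 : q <= 1.
Hypothesis w_ge0 : forall u, 0 <= u -> 0 <= w u.
Hypothesis w_scale : forall c u, 0 <= c -> 0 <= u -> w (c * u) <= (1 + c) * w u.
Hypothesis w_powR : forall u, 0 <= u -> w u <= A * u `^ q.
Hypothesis F_expand : forall x d,
  `|F (x + d) - F x - F1 x * d - F2 x * d ^+ 2 / 2| <= d ^+ 2 * w `|d|.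

Let w_double (u : R) : w `|2 * u| <= 3 * w `|u|.
Proof.
rewrite normrM gtr0_norm//; apply: le_trans (w_scale _ _) _ => //.
Qed.

(* Compare the second difference of F at y, of step y - x, with the expansion at x. *)
Lemma expansion_modulus2 x y : `|F2 y - F2 x| <= 16 * w `|y - x|.
Proof.
have [->|xy] := eqVneq y x; first by rewrite !subrr normr0 mulr_ge0// w_ge0.
set u := y - x; have un0 : u != 0 by rewrite subr_eq0.
have yE : y = x + u by rewrite /u; ring.
have e1 := F_expand y u; have e2 := F_expand y (- u).
have e3 := F_expand x (2 * u); have e4 := F_expand x u.
rewrite (_ : y + u = x + 2 * u) in e1; last by rewrite yE; ring.
rewrite (_ : y - u = x) in e2; last by rewrite yE; ring.
rewrite -yE in e4; rewrite normrN sqrrN in e2.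
have W2 : (2 * u) ^+ 2 * w `|2 * u| <= 12 * (u ^+ 2 * w `|u|).
  rewrite exprMn -mulrA (_ : 12 * (u ^+ 2 * w `|u|) = 2 ^+ 2 * (u ^+ 2 * (3 * w `|u|))); last by ring.
  by rewrite ler_wpM2l ?sqr_ge0// ler_wpM2l ?sqr_ge0.
rewrite -(ler_pM2r (_ : 0 < u ^+ 2)); last by rewrite exprn_even_gt0.
rewrite -{1}(ger0_norm (sqr_ge0 u)) -normrM.
move: e1 e2 e3 e4 W2; rewrite !ler_norml !exprMn => /andP[? ?] /andP[? ?] /andP[? ?] /andP[? ?] ?.
by apply/andP; split; lra.
Qed.

(** With y = x + u, the expansions at y of steps u and -u express F (y + u) - F (y - u) by F1 y, and
    the one at x of step 2 u expresses it by F1 x and F2 x. The errors 1 + 1 + 12, divided by 2,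
    give the constant 7. *)
Lemma expansion_modulus1 x u : `|F1 (x + u) - F1 x - F2 x * u| <= 7 * (`|u| * w `|u|).
Proof.
have [->|un0] := eqVneq u 0.
  by rewrite mulr0 addr0 subrr subr0 !normr0 mul0r mulr0.
set y := x + u.
have e1 := F_expand y u; have e2 := F_expand y (- u).
have e3 := F_expand x (2 * u).
rewrite (_ : y + u = x + 2 * u) in e1; last by rewrite /y; ring.
rewrite (_ : y - u = x) in e2; last by rewrite /y; ring.
rewrite normrN sqrrN in e2.
have W2 : (2 * u) ^+ 2 * w `|2 * u| <= 12 * (u ^+ 2 * w `|u|).
  rewrite exprMn -mulrA (_ : 12 * (u ^+ 2 * w `|u|) = 2 ^+ 2 * (u ^+ 2 * (3 * w `|u|))); last by ring.
  by rewrite ler_wpM2l ?sqr_ge0// ler_wpM2l ?sqr_ge0.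
rewrite -(ler_pM2r (_ : 0 < `|u|)); last by rewrite normr_gt0.
rewrite -normrM (_ : 7 * (`|u| * w `|u|) * `|u| = 7 * (u ^+ 2 * w `|u|)); last first.
  by rewrite -real_normK ?num_real//; ring.
move: e1 e2 e3 W2; rewrite !ler_norml !exprMn => /andP[? ?] /andP[? ?] /andP[? ?] ?.
by apply/andP; split; lra.
Qed.

Let A0 : 0 <= A.
Proof. by have := le_trans (w_ge0 ler01) (w_powR ler01); rewrite powR1 mulr1. Qed.

Let continuous_of_modulus (g : R -> R) :
  (forall x, exists C, 0 <= C /\ forall d, `|d| <= 1 -> `|g (x + d) - g x| <= C * `|d| `^ q) ->
  continuous g.
Proof.
move=> H x; have [C [C0 gC]] := H x; apply/cvgrPdist_lt => e e0.
have C1 : 0 < C + 1 by lra.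
have ep : 0 < (e / (C + 1)) `^ q^-1 by rewrite powR_gt0// divr_gt0.
have n1 : \forall y \near x, `|x - y| < Num.min 1 ((e / (C + 1)) `^ q^-1).
  by apply: nbhsx_ballx; rewrite lt_min ltr01.
apply: filterS n1 => y; rewrite lt_min => /andP[xy1 xye].
rewrite distrC (_ : y = x + (y - x)); last by ring.
rewrite (le_lt_trans (gC _ _))//; first by rewrite distrC ltW.
have h : `|y - x| `^ q < e / (C + 1).
  have -> : e / (C + 1) = ((e / (C + 1)) `^ q^-1) `^ q.
    by rewrite -powRrM mulVf ?gt_eqF// powRr1// divr_ge0 ?ltW.
  rewrite distrC; by apply: gt0_ltr_powR; rewrite // ?nnegrE ?powR_ge0.
apply: (@le_lt_trans _ _ ((C + 1) * `|y - x| `^ q)).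
  by rewrite ler_wpM2r ?powR_ge0//; lra.
by rewrite mulrC -ltr_pdivlMr.
Qed.

Let le_powRq (u : R) : 0 <= u -> u <= 1 -> u <= u `^ q.
Proof.
move=> u0 u1; have [->|un0] := eqVneq u 0; first by rewrite powR_ge0.
by apply: ger1_powR; rewrite // u1 lt_neqAle eq_sym un0 u0.
Qed.

Let wq (d : R) : w `|d| <= A * `|d| `^ q. Proof. exact: w_powR. Qed.

Lemma expansion_continuous2 : continuous F2.
Proof.
apply: continuous_of_modulus => x; exists (16 * A); split; first by rewrite mulr_ge0.
move=> d d1; have := expansion_modulus2 x (x + d); rewrite (addrC x) addrK.
by move=> /le_trans; apply; rewrite -mulrA ler_wpM2l.
Qed.

Lemma expansion_continuous1 : continuous F1.
Proof.
apply: continuous_of_modulus => x; exists (`|F2 x| + 7 * A); split.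
  by rewrite addr_ge0// mulr_ge0.
move=> d d1; rewrite (_ : F1 (x + d) - F1 x = (F1 (x + d) - F1 x - F2 x * d) + F2 x * d); last by ring.
rewrite (le_trans (ler_normD _ _))// addrC mulrDl lerD//.
  by rewrite normrM ler_wpM2l// le_powRq.
rewrite (le_trans (expansion_modulus1 _ _))// -mulrA ler_wpM2l//.
by rewrite (le_trans _ (wq d))// ler_piMl// w_ge0.
Qed.

Lemma expansion_continuous : continuous F.
Proof.
apply: continuous_of_modulus => x; exists (`|F1 x| + `|F2 x| + A); split.
  by rewrite !addr_ge0.
move=> d d1.
rewrite (_ : F (x + d) - F x = (F1 x * d + F2 x * (d ^+ 2 / 2))
  + (F (x + d) - F x - F1 x * d - F2 x * d ^+ 2 / 2)); last by ring.
have dd : d ^+ 2 <= `|d|.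
  by rewrite -real_normK ?num_real// expr2 ler_piMl.
rewrite (le_trans (ler_normD _ _))// mulrDl lerD//.
  rewrite (le_trans (ler_normD _ _))// mulrDl lerD//.
    by rewrite normrM ler_wpM2l// le_powRq.
  rewrite normrM ler_wpM2l// (le_trans _ (le_powRq _ d1))//.
  by rewrite ger0_norm ?divr_ge0 ?sqr_ge0//; have := normr_ge0 d; lra.
rewrite (le_trans (F_expand _ _))// (le_trans _ (wq d))// ler_piMl ?w_ge0//.
exact: le_trans d1.
Qed.

Let tame_q : tame (fun x : R => `|x| `^ q). Proof. exact: tame_powR. Qed.
Let tid := @tame_id R.

Lemma expansion_tame2 : tame F2.
Proof.
apply: (tame_le (g := fun x => `|F2 0| + 16 * A * `|x| `^ q)).
- exact: expansion_continuous2.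
- by apply: tameD; [exact: tame_cst|exact: tameZ].
- move=> z; rewrite [leRHS]ger0_norm; last by rewrite addr_ge0// !mulr_ge0// powR_ge0.
  rewrite -[leLHS](_ : `|(F2 z - F2 0) + F2 0| = _); last by rewrite subrK.
  rewrite (le_trans (ler_normD _ _))// addrC lerD2l.
  rewrite (le_trans (expansion_modulus2 _ _))// subr0 -mulrA ler_wpM2l//.
Qed.

Lemma expansion_tame1 : tame F1.
Proof.
apply: (tame_le (g := fun x => `|F1 0| + `|F2 0| * `|x| + 7 * A * (`|x| * `|x| `^ q))).
- exact: expansion_continuous1.
- apply: tameD; last by apply/tameZ/tameM => //; exact: tame_norm.
  by apply: tameD; [exact: tame_cst|apply: tameZ; exact: tame_norm].
- move=> z; rewrite [leRHS]ger0_norm; last first.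
    by rewrite !addr_ge0// !mulr_ge0// powR_ge0.
  rewrite (_ : F1 z = (F1 0 + F2 0 * z) + (F1 (0 + z) - F1 0 - F2 0 * z)); last first.
    by rewrite add0r; ring.
  rewrite (le_trans (ler_normD _ _))// lerD//.
    by rewrite (le_trans (ler_normD _ _))// normrM.
  rewrite (le_trans (expansion_modulus1 _ _))// -mulrA ler_wpM2l//.
  by rewrite mulrCA ler_wpM2l.
Qed.

Lemma expansion_tame : tame F.
Proof.
apply: (tame_le (g := fun x => `|F 0| + `|F1 0| * `|x| + `|F2 0| * x ^+ 2 +
   x ^+ 2 * (A * `|x| `^ q))).
- exact: expansion_continuous.
- apply: tameD; last first.
    by apply: tameM; [exact: tameX|exact: tameZ].
  apply: tameD; last by apply: tameZ; exact: tameX.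
  by apply: tameD; [exact: tame_cst|apply: tameZ; exact: tame_norm].
- move=> z; rewrite [leRHS]ger0_norm; last first.
    have zq : 0 <= A * `|z| `^ q by rewrite mulr_ge0// powR_ge0.
    by rewrite !addr_ge0// mulr_ge0// sqr_ge0.
  rewrite (_ : F z = (F 0 + F1 0 * z + F2 0 * (z ^+ 2 / 2))
     + (F (0 + z) - F 0 - F1 0 * z - F2 0 * z ^+ 2 / 2)); last first.
    by rewrite add0r; ring.
  rewrite (le_trans (ler_normD _ _))// lerD//.
    rewrite (le_trans (ler_normD _ _))// lerD//.
      by rewrite (le_trans (ler_normD _ _))// normrM.
    rewrite normrM ler_wpM2l// ger0_norm ?divr_ge0 ?sqr_ge0//.
    by have := sqr_ge0 z; lra.
  by rewrite (le_trans (F_expand _ _))// ler_wpM2l// sqr_ge0.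
Qed.

End second_order_expansion.

(* The second differences, of step s, of F * N(0, s^2) are Gaussian averages of
   those of F. *)
Lemma expansion_gauss_average (R : realType) (q : R) (F F1 F2 H H1 H2 w w' : R -> R)
    (A s : R) :
  0 < q -> q <= 1 -> 0 < s ->
  (forall u, 0 <= u -> 0 <= w u) ->
  (forall c u, 0 <= c -> 0 <= u -> w (c * u) <= (1 + c) * w u) ->
  (forall u, 0 <= u -> w u <= A * u `^ q) ->
  (forall x d, `|F (x + d) - F x - F1 x * d - F2 x * d ^+ 2 / 2| <= d ^+ 2 * w `|d|) ->
  (forall u, 0 <= u -> w' u <= w u) ->
  (forall x d, `|H (x + d) - H x - H1 x * d - H2 x * d ^+ 2 / 2| <= d ^+ 2 * w' `|d|) ->
  (forall x, H x = Ex (gauss R) (fun y => F (x + s * y))) ->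
  forall x, `|H2 x - F2 x| <= 52 * w s.
Proof.
move=> q0 q1 s0 w0 wl wA Fe w'w He HF x.
have tF := expansion_tame q0 q1 w0 wA Fe.
have tF2 := expansion_tame2 q0 w0 wl wA Fe.
have ta g y : tame g -> tame (fun z => g (y + s * z)).
  by move=> tg; apply: eq_tame (tame_affine s y tg) => z; rewrite addrC.
have ws := w0 _ (ltW s0).
have tt y := tame_L1 (ta _ y tF).
have t2 := tame_L1 (ta _ x tF2).
have c2 : `|H (x + s) + H (x - s) - 2 * H x - H2 x * s ^+ 2| <= 2 * (s ^+ 2 * w s).
  have := He x s; have := He x (- s); rewrite normrN sqrrN (gtr0_norm s0).
  have ww : s ^+ 2 * w' s <= s ^+ 2 * w s by rewrite ler_wpM2l ?sqr_ge0 ?w'w// ltW.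
  move: ww; rewrite !ler_norml => ? /andP[? ?] /andP[? ?]; apply/andP; split; lra.
have f2 y : `|F (y + s) + F (y - s) - 2 * F y - F2 y * s ^+ 2| <= 2 * (s ^+ 2 * w s).
  have := Fe y s; have := Fe y (- s); rewrite normrN sqrrN (gtr0_norm s0).
  rewrite !ler_norml => /andP[? ?] /andP[? ?]; apply/andP; split; lra.
have E : H (x + s) + H (x - s) - 2 * H x = Ex (gauss R) (fun y =>
    F (x + s + s * y) + F (x - s + s * y) - 2 * F (x + s * y)).
  rewrite ExB; [|apply: L1D; exact: tt|apply: L1Z; exact: tt].
  by rewrite ExD ?ExZ -?HF//; exact: tt.
have Le : L1 (gauss R) (fun y =>
    F (x + s + s * y) + F (x - s + s * y) - 2 * F (x + s * y)).
  by apply: L1B; [apply: L1D; exact: tt|apply: L1Z; exact: tt].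
have E2 : `|Ex (gauss R) (fun y =>
    F (x + s + s * y) + F (x - s + s * y) - 2 * F (x + s * y)) -
    Ex (gauss R) (fun y => F2 (x + s * y)) * s ^+ 2| <= 2 * (s ^+ 2 * w s).
  rewrite mulrC -ExZ; last exact: t2.
  rewrite -ExB//; last exact: L1Z t2.
  rewrite -[leRHS](Ex_cst (gauss R)); apply: Ex_norm_le.
  - exact: (L1_measurable (L1B Le (L1Z _ t2))).
  - exact: L1_cst.
  - move=> y; rewrite (_ : x + s + s * y = x + s * y + s); last by ring.
    rewrite (_ : x - s + s * y = x + s * y - s); last by ring.
    by rewrite (mulrC (s ^+ 2)).
(* The modulus of F2 at distance s |y| is at most 16 (1 + |y|) w s, and 1 + |y| <= 2 + y^2 has mean
   at most 3, whence 48. The two second differences add 2 each to reach 52. *)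
have E3 : `|Ex (gauss R) (fun y => F2 (x + s * y)) - F2 x| <= 48 * w s.
  rewrite -(Ex_cst (gauss R) (F2 x)) -ExB//; last exact: L1_cst.
  have tz : tame (fun y : R => 16 * ((2 + y ^+ 2) * w s)).
    apply: tameZ; apply: tameM; last exact: tame_cst.
    by apply: tameD; [exact: tame_cst|apply: tameX; exact: tame_id].
  apply: (@le_trans _ _ (Ex (gauss R) (fun y => 16 * ((2 + y ^+ 2) * w s)))).
    apply: Ex_norm_le.
    - exact: (L1_measurable (L1B t2 (L1_cst _ _))).
    - exact: tame_L1.
    - move=> y; rewrite (le_trans (expansion_modulus2 w0 wl Fe _ _))// ler_wpM2l//.
      rewrite addrAC subrr add0r normrM (gtr0_norm s0) mulrC.
      rewrite (le_trans (wl _ _ _ (ltW s0)))// ler_wpM2r//.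
      have := sqr_ge0 (`|y| - 1); rewrite -(real_normK (num_real y)).
      have := sqr_ge0 `|y|; nra.
  have L2 := tame_L1 (tameX 2 (@tame_id R)).
  rewrite ExZ; last first.
    by apply: tame_L1; apply: tameM; [apply: tameD; [exact: tame_cst|apply: tameX; exact: tame_id]|exact: tame_cst].
  rewrite (@eq_Ex _ _ _ _ _ (fun y : R => w s * (2 + y ^+ 2))); last by move=> y; rewrite mulrC.
  rewrite ExZ; last by apply: L1D => //; exact: L1_cst.
  rewrite ExD//; last exact: L1_cst.
  by rewrite Ex_cst Ex_gauss_sqr; lra.
rewrite E in c2.
rewrite -(ler_pM2r (_ : 0 < s ^+ 2)); last by rewrite exprn_gt0.
rewrite -{1}(ger0_norm (sqr_ge0 s)) -normrM.
have {}E3 : `|(Ex (gauss R) (fun y => F2 (x + s * y)) - F2 x) * s ^+ 2| <= 48 * (w s * s ^+ 2).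
  by rewrite normrM mulrA (ger0_norm (sqr_ge0 s)) ler_wpM2r// sqr_ge0.
move: c2 E2 E3; rewrite !ler_norml => /andP[? ?] /andP[? ?] /andP[? ?].
by apply/andP; split; lra.
Qed.

(** * Gaussian smoothing of the test functions *)

Section smoothing.
Context (R : realType).
Notation G := (Ex (gauss R)).
Implicit Types (f : R -> R) (r p t : R).

(* Satisfied by K f for f in Lambda_r, with c1 = f' and c2 = f'' / 2, each
   present only if r > 1, resp. r > 2. *)
Definition taylor2 r K f (c1 c2 : R -> R) : Prop :=
  [/\ 0 <= K, continuous f,
      forall x h, `|f (x + h) - f x - c1 x * h - c2 x * h ^+ 2| <= K * `|h| `^ r,
      r <= 1 -> forall x, c1 x = 0 & r <= 2 -> forall x, c2 x = 0].

(* f * N(0, t^2) and its first two derivatives; Gaussian integration by parts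
   moves the derivatives to the density, so that f need not be smooth. *)
Definition smooth f t x := G (fun z => f (x + t * z)).
Definition smooth1 f t x := t^-1 * G (fun z => z * f (x + t * z)).
Definition smooth2 f t x := t^-1 ^+ 2 * G (fun z => (z ^+ 2 - 1) * f (x + t * z)).

Lemma taylor2_tame r K f c1 c2 : 0 < r -> taylor2 r K f c1 c2 -> tame f.
Proof.
move=> r0 [K0 cf fe _ _].
apply: (tame_le (g := fun x => `|f 0| + `|c1 0| * `|x| + `|c2 0| * x ^+ 2 + K * `|x| `^ r)) => //.
- apply: tameD; last by apply: tameZ; exact: tame_powR.
  apply: tameD; last by apply/tameZ/tameX; exact: tame_id.
  by apply: tameD; [exact: tame_cst|apply/tameZ/tame_norm; exact: tame_id].
- move=> z; rewrite [leRHS]ger0_norm; last first.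
    by rewrite !addr_ge0// mulr_ge0 ?sqr_ge0 ?powR_ge0.
  rewrite (_ : f z = (f 0 + c1 0 * z + c2 0 * z ^+ 2)
     + (f (0 + z) - f 0 - c1 0 * z - c2 0 * z ^+ 2)); last by rewrite add0r; ring.
  rewrite (le_trans (ler_normD _ _))// lerD//.
  rewrite (le_trans (ler_normD _ _))// lerD//.
    by rewrite (le_trans (ler_normD _ _))// normrM.
  by rewrite normrM (ger0_norm (sqr_ge0 z)).
Qed.

Lemma tame_add_scale f (x t : R) : tame f -> tame (fun z => f (x + t * z)).
Proof. by move=> tf; apply: eq_tame (tame_affine t x tf) => z; rewrite addrC. Qed.

(** Size of the Gaussian remainder for an integrand of growth |z|^r: cubic for small translations;
    for large ones, the quadratic polynomial plus the translated integrand itself. *)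
Definition rem_modulus r (a : R) : R := if a <= 1 then a ^+ 3 else a ^+ 2 + a `^ r.

Let tid := @tame_id R.
Let thn : tame (fun z : R => z ^+ 2 - 1).
Proof. by apply: tameB; [exact: tameX|exact: tame_cst]. Qed.

(** For |a| <= 1 the pointwise bound on [gauss_rem] is integrated; for |a| > 1 there is no
    cancellation to exploit and the four terms of the expansion are bounded one by one. *)
Lemma gauss_rem_powR r : 0 < r -> exists2 C, 0 <= C &
  forall K a (g : R -> R), 0 <= K -> 0 <= a `^ r -> tame g ->
    (forall z, `|g z| <= K * `|z| `^ r) ->
  `|G (fun z => gauss_rem a z * g z)| <= C * K * rem_modulus r `|a|.
Proof.
move=> r0.
have tr : tame (fun z : R => `|z| `^ r) by exact: tame_powR.
pose B1 := G (fun z => 2 * expR 1 * expR (4 * `|z|) * `|z| `^ r).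
pose B2 := G (fun z => `|z| `^ r).
pose B3 := G (fun z => `|z| * `|z| `^ r).
pose B4 := G (fun z => `|z ^+ 2 - 1| * `|z| `^ r).
have B1_ge0 : 0 <= B1.
  by apply: Ex_ge0 => z; rewrite !mulr_ge0 ?powR_ge0 ?expR_ge0.
have B2_ge0 : 0 <= B2 by apply: Ex_ge0 => z; rewrite powR_ge0.
have B3_ge0 : 0 <= B3 by apply: Ex_ge0 => z; rewrite mulr_ge0 ?powR_ge0.
have B4_ge0 : 0 <= B4 by apply: Ex_ge0 => z; rewrite mulr_ge0 ?powR_ge0.
have c2 : 0 <= 2 `^ r :> R by rewrite powR_ge0.
exists (B1 + (2 `^ r * (B2 + 1) + B2 + B3 + B4)).
  by rewrite !addr_ge0// mulr_ge0// addr_ge0.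
move=> K a g K0 _ tg gK.
have tag : tame (fun z => `|g z|) by exact: tame_norm.
rewrite /rem_modulus; case: ifPn => a1.
  apply: (le_trans (Ex_gauss_rem_le tg a1)).
  rewrite mulrC ler_wpM2r ?exprn_ge0//.
  apply: (@le_trans _ _ (B1 * K)); last first.
    rewrite ler_wpM2r// lerDl; by rewrite !addr_ge0// mulr_ge0// addr_ge0.
  rewrite [leRHS]mulrC -ExZ; last by apply: tame_L1; apply: tameM => //; exact: tame_rem_bound.
  apply: Ex_le.
  - by apply: tame_L1; apply: tameM => //; exact: tame_rem_bound.
  - by apply/tame_L1/tameZ; apply: tameM => //; exact: tame_rem_bound.
  - move=> z; rewrite mulrCA ler_wpM2l ?mulr_ge0 ?expR_ge0//.
move/negP: a1 => /negP; rewrite -ltNge => a1.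
have ar1 : 1 <= `|a| `^ r.
  by have := le_powR (ltW r0) ler01 (ltW a1); rewrite powR1.
have aa : `|a| <= `|a| ^+ 2 by rewrite expr2 ler_peMl// ltW.
have tsh : tame (fun z => g (z + a)).
  by apply: eq_tame (tame_affine 1 a tg) => z; rewrite mul1r.
have := Ex_gauss_shift_taylor a tg.
set S := G (fun z => g (z + a)); set E0 := G g.
set E1 := G (fun z => z * g z); set E2 := G (fun z => (z ^+ 2 - 1) * g z).
move=> SE.
have -> : G (fun z => gauss_rem a z * g z) = S - E0 - a * E1 - a ^+ 2 / 2 * E2.
  by rewrite SE; ring.
have S_le : `|S| <= K * (2 `^ r * (B2 + `|a| `^ r)).
  have tz : tame (fun z : R => K * (2 `^ r * (`|z| `^ r + `|a| `^ r))).
    by do 2 apply: tameZ; apply: tameD => //; exact: tame_cst.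
  apply: (@le_trans _ _ (G (fun z => K * (2 `^ r * (`|z| `^ r + `|a| `^ r))))).
    apply: Ex_norm_le; [exact: tame_measurable|exact: tame_L1|].
    move=> z; rewrite (le_trans (gK _))// ler_wpM2l//.
    rewrite (le_trans _ (powRD_le (ltW r0) (normr_ge0 z) (normr_ge0 a)))//.
    by apply: le_powR; rewrite ?(ltW r0) ?ler_normD.
  have tz1 : tame (fun z : R => `|z| `^ r + `|a| `^ r).
    by apply: tameD => //; exact: tame_cst.
  rewrite ExZ; last by apply/tame_L1/tameZ.
  rewrite ExZ; last exact: tame_L1.
  by rewrite ExD ?Ex_cst//; [exact: tame_L1|exact: L1_cst].
have gen (h : R -> R) : tame h -> `|G (fun z => h z * g z)| <= K * G (fun z => `|h z| * `|z| `^ r).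
  move=> th; have tn := tame_norm th.
  rewrite -ExZ; last exact: (tame_L1 (tameM tn tr)).
  apply: Ex_norm_le; [exact: (tame_measurable (tameM th tg))|exact: (tame_L1 (tameZ K (tameM tn tr)))|].
  by move=> z; rewrite normrM mulrCA ler_wpM2l.
have E0_le : `|E0| <= K * B2.
  have := gen _ (tame_cst 1); have -> : G (fun z => 1 * g z) = E0 by apply: eq_Ex => z; rewrite mul1r.
  by move=> /le_trans; apply; rewrite le_eqVlt; apply/orP; left; apply/eqP;
    congr (_ * _); apply: eq_Ex => z; rewrite normr1 mul1r.
have E1_le : `|E1| <= K * B3 by exact: (gen _ tid).
have E2_le : `|E2| <= K * B4 by exact: (gen _ thn).
apply: (@le_trans _ _ (`|S| + `|E0| + `|a| * `|E1| + `|a| ^+ 2 * `|E2|)).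
  rewrite (le_trans (ler_normB _ _))// lerD//.
    rewrite (le_trans (ler_normB _ _))// lerD// ?normrM//.
    exact: ler_normB.
  rewrite normrM ler_wpM2r// ger0_norm ?divr_ge0 ?sqr_ge0//.
  rewrite real_normK ?num_real//; have := sqr_ge0 a; lra.
have KB : 0 <= K * B1 by rewrite mulr_ge0.
have c2B := mulr_ge0 c2 B2_ge0.
have a2 : 0 <= `|a| ^+ 2 by rewrite sqr_ge0.
have a21 : 1 <= `|a| ^+ 2 by rewrite (le_trans (ltW a1)).
set v := `|a| ^+ 2 in aa a2 a21 *; set y := `|a| `^ r in ar1 S_le *.
have KE1 : `|a| * `|E1| <= v * (K * B3) by rewrite ler_pM.
have KE2 : v * `|E2| <= v * (K * B4) by rewrite ler_wpM2l.
have y0 : 0 <= y by lra.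
have T1 : K * (2 `^ r * (B2 + y)) <= K * (2 `^ r * (B2 + 1)) * (v + y).
  rewrite -!mulrA ler_wpM2l// ler_wpM2l//; nra.
have T2 : K * B2 <= K * B2 * (v + y).
  by rewrite ler_peMr ?mulr_ge0//; lra.
have T3 : v * (K * B3) <= K * B3 * (v + y).
  by rewrite mulrC ler_wpM2l ?mulr_ge0//; lra.
have T4 : v * (K * B4) <= K * B4 * (v + y).
  by rewrite mulrC ler_wpM2l ?mulr_ge0//; lra.
have T5 : 0 <= K * B1 * (v + y) by rewrite mulr_ge0//; lra.
lra.
Qed.

(** Removing from f its Taylor polynomial at x leaves an integrand of size K t^r |z|^r. The
    polynomial itself has no remainder: its translate is exactly quadratic in a, as the Gaussian
    moments up to order 4 confirm. *)
Lemma smooth_expand_raw r : 0 < r -> exists2 C, 0 <= C &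
  forall K f c1 c2 t x d, taylor2 r K f c1 c2 -> 0 < t ->
  `|smooth f t (x + d) - smooth f t x - smooth1 f t x * d - smooth2 f t x * d ^+ 2 / 2|
  <= C * (K * t `^ r) * rem_modulus r (`|d| / t).
Proof.
move=> r0; have [C C0 HC] := gauss_rem_powR r0; exists C => // K f c1 c2 t x d tf t0.
have tmf := taylor2_tame r0 tf.
case: tf => K0 cf fe _ _.
pose g z := f (x + t * z) - f x - c1 x * (t * z) - c2 x * (t * z) ^+ 2.
have tfz := tame_add_scale x t tmf.
have tg : tame g.
  apply: tameB; last first.
    apply: tameZ; apply: tameX; apply: tameZ; exact: tid.
  apply: tameB; last by do 2 apply: tameZ; exact: tid.
  by apply: tameB => //; exact: tame_cst.
pose a := d / t; have tn0 : t != 0 by rewrite gt_eqF.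
have aE : `|a| = `|d| / t by rewrite normrM normfV (gtr0_norm t0).
have gK z : `|g z| <= K * t `^ r * `|z| `^ r.
  rewrite (le_trans (fe _ _))// normrM (gtr0_norm t0) powRM ?(ltW t0)//.
  by rewrite mulrA.
have Kt : 0 <= K * t `^ r by rewrite mulr_ge0 ?powR_ge0.
have := HC _ a g Kt (powR_ge0 _ _) tg gK; rewrite aE; apply: le_trans.
rewrite le_eqVlt; apply/orP; left; apply/eqP; congr `| _ |.
have lin (h k : R -> R) (u v : R) : tame h -> tame k ->
    G (fun z => u * h z + v * k z) = u * G h + v * G k.
  by move=> th tk; rewrite ExD ?ExZ//; [exact/tame_L1|exact/tame_L1|exact/tame_L1/tameZ|exact/tame_L1/tameZ].
pose P z := f x + c1 x * (t * z) + c2 x * (t * z) ^+ 2.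
have t2 := tameX 2 tid; have tP : tame P.
  apply: tameD; last by apply/tameZ/tameX/tameZ.
  by apply: tameD; [exact: tame_cst|do 2 apply: tameZ].
have S1 := Ex_gauss_shift_taylor a tfz.
have -> : smooth f t (x + d) = G (fun z => f (x + t * (z + a))).
  apply: eq_Ex => z; congr f; rewrite /a; field; exact: tn0.
rewrite S1 /smooth /smooth1 /smooth2.
have -> : G (fun z => gauss_rem a z * g z) = G (fun z => gauss_rem a z * f (x + t * z))
   - G (fun z => gauss_rem a z * P z).
  rewrite -ExB; [|exact: (tame_L1 (tameM (tame_gauss_rem a) tfz))|exact: (tame_L1 (tameM (tame_gauss_rem a) tP))].
  by apply: eq_Ex => z; rewrite /g /P; ring.
have -> : G (fun z => gauss_rem a z * P z) = 0.
  have := Ex_gauss_shift_taylor a tP.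
  set Y := G (fun z => gauss_rem a z * P z).
  have L n := tame_L1 (tameX n tid).
  have quad u1 u2 u3 : G (fun z => u1 + u2 * z + u3 * z ^+ 2) = u1 + u3.
    rewrite ExD; last exact: L1Z (L 2%N).
      rewrite ExD; [|exact: L1_cst|exact: L1Z (tame_L1 tid)].
      by rewrite Ex_cst !ExZ; [rewrite Ex_gauss_id Ex_gauss_sqr; ring|exact: (L 2%N)|exact: (tame_L1 tid)].
    by apply: L1D; [exact: L1_cst|exact: L1Z (tame_L1 tid)].
  have -> : G P = f x + c2 x * t ^+ 2.
    rewrite -(quad (f x) (c1 x * t) (c2 x * t ^+ 2)); apply: eq_Ex => z; rewrite /P; ring.
  have -> : G (fun z => P (z + a)) = f x + c1 x * t * a + c2 x * t ^+ 2 * a ^+ 2 + c2 x * t ^+ 2.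
    rewrite -(quad _ (c1 x * t + 2 * a * c2 x * t ^+ 2) (c2 x * t ^+ 2)); apply: eq_Ex => z; rewrite /P; ring.
  have -> : G (fun z => z * P z) = c1 x * t.
    rewrite (@eq_Ex _ _ _ _ _ (fun z => (0 + f x * z + c1 x * t * z ^+ 2) + c2 x * t ^+ 2 * z ^+ 3)); last first.
      by move=> z; rewrite /P; ring.
    rewrite ExD; last exact: L1Z (L 3%N).
      by rewrite quad ExZ ?Ex_gauss_cub; [ring|exact: (L 3%N)].
    by apply: L1D; [apply: L1D; [exact: L1_cst|exact: L1Z (tame_L1 tid)]|exact: L1Z (L 2%N)].
  have -> : G (fun z => (z ^+ 2 - 1) * P z) = 2 * c2 x * t ^+ 2.
    rewrite (@eq_Ex _ _ _ _ _ (fun z => (- f x + - (c1 x * t) * z + (f x - c2 x * t ^+ 2) * z ^+ 2)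
        + (c1 x * t * z ^+ 3 + c2 x * t ^+ 2 * z ^+ 4))); last first.
      by move=> z; rewrite /P; ring.
    rewrite ExD; last by apply: L1D; [exact: L1Z (L 3%N)|exact: L1Z (L 4%N)].
      rewrite quad ExD; [|exact: L1Z (L 3%N)|exact: L1Z (L 4%N)].
      by rewrite !ExZ; [rewrite Ex_gauss_cub Ex_gauss_quart; ring|exact: (L 4%N)|exact: (L 3%N)].
    by apply: L1D; [apply: L1D; [exact: L1_cst|exact: L1Z (tame_L1 tid)]|exact: L1Z (L 2%N)].
  move=> /eqP; rewrite -subr_eq0 => /eqP H; apply/eqP; rewrite -oppr_eq0; apply/eqP.
  by rewrite -[RHS]H; field.
rewrite subr0 /a; field; exact: tn0.
Qed.

Lemma smooth_semigroup r K f c1 c2 s t x : 0 < r -> taylor2 r K f c1 c2 ->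
  0 <= s -> 0 < t ->
  smooth f (Num.sqrt (s ^+ 2 + t ^+ 2)) x = G (fun y => smooth f t (x + s * y)).
Proof.
move=> r0 /(taylor2_tame r0) tf s0 t0.
have th : tame (fun w => f (x + 1 * w)) by exact: tame_add_scale.
have := Ex_gauss_conv s0 t0 th; rewrite /smooth => H.
transitivity (G (fun z => f (x + 1 * (Num.sqrt (s ^+ 2 + t ^+ 2) * z)))).
  by apply: eq_Ex => z; rewrite mul1r.
by rewrite -H; apply: eq_Ex => y; apply: eq_Ex => z; rewrite mul1r addrA.
Qed.

End smoothing.

(** * Modulus of continuity of the smoothed second derivative *)

Section modulus.
Context (R : realType) (p r : R).
Hypotheses (p2 : 2 < p) (p3 : p < 3) (r0 : 0 < r) (rp : r <= p).

(** At scale 1 the smoothed second derivative is bounded and Lipschitz when r <= 2. When r > 2 its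
    increments are of order v for small v and v^(r-2) for large v; both are below v^(p-2), since r -
    2 <= p - 2 <= 1. *)
Definition base_modulus (v : R) : R :=
  if r <= 2 then Num.min 1 v else v `^ (p - 2).

(* Up to a constant, the modulus of continuity of (f * N(0, t^2))''. *)
Definition omega (t u : R) : R := t `^ (r - 2) * base_modulus (u / t).

Lemma base_modulus_ge0 v : 0 <= v -> 0 <= base_modulus v.
Proof.
by move=> v0; rewrite /base_modulus; case: ifP => _; rewrite ?powR_ge0// le_min ler01.
Qed.

Let q0 : 0 < p - 2. Proof. by rewrite subr_gt0. Qed.
Let q1 : p - 2 <= 1. Proof. by move: p3; lra. Qed.
Let q2 : r - p <= 0. Proof. by rewrite subr_le0. Qed.

Lemma base_modulus_powR v : 0 <= v -> base_modulus v <= v `^ (p - 2).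
Proof.
move=> v0; rewrite /base_modulus; case: ifP => _ //.
have [v1|v1] := leP v 1.
  have [->|vn0] := eqVneq v 0; first by rewrite powR_ge0.
  by apply: ger1_powR => //; rewrite andbC v1 lt_neqAle eq_sym vn0.
by have := le_powR (ltW q0) ler01 (ltW v1); rewrite powR1.
Qed.

Lemma base_modulus_scale c v : 0 <= c -> 0 <= v ->
  base_modulus (c * v) <= (1 + c) * base_modulus v.
Proof.
move=> c0 v0; rewrite /base_modulus; case: ifP => _; last first.
  by apply: powR_scale_le; rewrite ?(ltW q0).
have [v1|v1] := leP v 1.
  rewrite ge_min; apply/orP; right; nra.
by rewrite mulr1 ge_min; apply/orP; left; lra.
Qed.

Lemma omega_ge0 t u : 0 < t -> 0 <= u -> 0 <= omega t u.
Proof. by move=> t0 u0; rewrite mulr_ge0 ?powR_ge0// base_modulus_ge0// divr_ge0// ltW. Qed.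

Lemma omega_scale t c u : 0 < t -> 0 <= c -> 0 <= u ->
  omega t (c * u) <= (1 + c) * omega t u.
Proof.
move=> t0 c0 u0; rewrite /omega -mulrA (mulrCA (1 + c)) ler_wpM2l ?powR_ge0//.
by apply: base_modulus_scale => //; rewrite divr_ge0 ?(ltW t0).
Qed.

Let pow_split t u : 0 < t -> 0 <= u ->
  t `^ (r - 2) * (u / t) `^ (p - 2) = t `^ (r - p) * u `^ (p - 2).
Proof.
move=> t0 u0; rewrite powRM ?invr_ge0 ?(ltW t0)// -powR_inv1 ?(ltW t0)//.
rewrite -powRrM mulrCA [RHS]mulrC -powRD; last by rewrite (gt_eqF t0) implybT.
by congr (_ * _ `^ _); ring.
Qed.

Lemma omega_powR t u : 0 < t -> 0 <= u -> omega t u <= t `^ (r - p) * u `^ (p - 2).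
Proof.
move=> t0 u0; rewrite -pow_split// ler_wpM2l ?powR_ge0//.
by apply: base_modulus_powR; rewrite divr_ge0// ltW.
Qed.

Let powR_nonincr (e s t : R) : e <= 0 -> 0 < s -> s <= t -> t `^ e <= s `^ e.
Proof.
move=> e0 s0 st; rewrite -[e]opprK !(powRN _ (- e)).
rewrite lef_pV2 ?posrE ?powR_gt0//; last exact: lt_le_trans st.
by apply: le_powR; rewrite ?(ltW s0) ?oppr_ge0.
Qed.

Lemma omega_nonincr s t u : 0 < s -> s <= t -> 0 <= u -> omega t u <= omega s u.
Proof.
move=> s0 st u0; have t0 := lt_le_trans s0 st.
rewrite /omega /base_modulus; case: ifPn => r2.
  apply: ler_pM; rewrite ?powR_ge0 ?le_min ?ler01 ?divr_ge0 ?(ltW t0)//.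
    by apply: powR_nonincr => //; lra.
  rewrite ge_min lexx/= ge_min; apply/orP; right.
  by rewrite ler_wpM2l// lef_pV2.
rewrite !pow_split// ler_wpM2r ?powR_ge0//; exact: powR_nonincr.
Qed.

Lemma rem_modulus_le a : 0 <= a -> rem_modulus r a <= 2 * (a ^+ 2 * base_modulus a).
Proof.
move=> a0; rewrite /rem_modulus /base_modulus.
have a2 : 0 <= a ^+ 2 := sqr_ge0 a.
have [a1|a1] := leP a 1; case: ifPn => r2.
- by rewrite exprSr; have := mulr_ge0 a2 a0; lra.
- have h : a <= a `^ (p - 2).
    have [->|an0] := eqVneq a 0; first by rewrite powR_ge0.
    by apply: ger1_powR => //; rewrite andbC a1 lt_neqAle eq_sym an0.
  have := ler_wpM2l a2 h; rewrite exprSr.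
  have := mulr_ge0 a2 (powR_ge0 a (p - 2)); lra.
- have : a `^ r <= a ^+ 2.
    by rewrite -powR_mulrn//; apply: ler_powR => //; exact: ltW.
  lra.
- have ap : a `^ r <= a ^+ 2 * a `^ (p - 2).
    rewrite -powR_mulrn// -powRD; last by rewrite (gt_eqF (lt_trans ltr01 a1)) implybT.
    by apply: ler_powR; [exact: ltW|rewrite addrC subrK].
  have a3 : a ^+ 2 <= a ^+ 2 * a `^ (p - 2).
    rewrite ler_peMr//; have := le_powR (ltW q0) ler01 (ltW a1); rewrite powR1//.
  lra.
Qed.

Lemma smooth_expand : exists2 C, 0 <= C &
  forall K f c1 c2 t x d, taylor2 r K f c1 c2 -> 0 < t ->
  `|smooth f t (x + d) - smooth f t x - smooth1 f t x * d - smooth2 f t x * d ^+ 2 / 2|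
  <= d ^+ 2 * (C * K * omega t `|d|).
Proof.
have [C C0 HC] := smooth_expand_raw r0; exists (2 * C); first by rewrite mulr_ge0.
move=> K f c1 c2 t x d tf t0; apply: (le_trans (HC _ _ _ _ _ _ _ tf t0)).
have K0 : 0 <= K by case: tf.
have dt0 : 0 <= `|d| / t by rewrite divr_ge0// ltW.
apply: (@le_trans _ _ (C * (K * t `^ r) * (2 * ((`|d| / t) ^+ 2 * base_modulus (`|d| / t))))).
  by rewrite ler_wpM2l ?rem_modulus_le// !mulr_ge0// powR_ge0.
rewrite /omega le_eqVlt; apply/orP; left; apply/eqP.
have -> : t `^ r = t `^ (r - 2) * t ^+ 2.
  rewrite -powR_mulrn ?(ltW t0)// -powRD; last by rewrite (gt_eqF t0) implybT.
  by rewrite subrK.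
rewrite -(real_normK (num_real d)); field; by rewrite gt_eqF.
Qed.

End modulus.

(** * Sums of powers of integers *)

Section power_sums.
Context (R : realType).
Implicit Types (a s v V : R) (j J : nat).

(** Bernoulli's inequality at 1 - 1/(j+1) replaces the derivative of x^(1-a) and makes sums of
    j^(-a) telescope. *)
Lemma powR_step_le a j : 0 <= a -> a < 1 ->
  (1 - a) * j.+1%:R `^ (- a) <= j.+1%:R `^ (1 - a) - j%:R `^ (1 - a) :> R.
Proof.
move=> a0 a1; set x : R := j.+1%:R; have x0 : 0 < x by rewrite ltr0n.
have xn0 : x != 0 by rewrite gt_eqF.
have jE : j%:R = x * (1 + - x^-1) :> R.
  by rewrite /x -natr1; field; rewrite natr1.
have x1 : x^-1 <= 1 by rewrite invf_le1// ler1n.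
have xi : 0 < x^-1 by rewrite invr_gt0.
rewrite jE powRM ?(ltW x0)//; last by rewrite subr_ge0.
have -> : x `^ (1 - a) = x * x `^ (- a).
  by rewrite powRD ?powRr1 ?(ltW x0)// xn0 implybT.
clearbody x.
have := @powR_bernoulli R (1 - a) (- x^-1).
move=> /(_ _ _ _) B; have {}B : (1 + - x^-1) `^ (1 - a) <= 1 + (1 - a) * - x^-1 by apply: B; lra.
have xa : 0 <= x * x `^ (- a) by rewrite mulr_ge0 ?powR_ge0// ltW.
have := ler_wpM2l xa B.
have -> : x * x `^ (- a) * (1 + (1 - a) * - x^-1) = x * x `^ (- a) - (1 - a) * x `^ (- a).
  by field.
lra.
Qed.

(** Bernoulli's inequality at 1 - 1/(x+1) with x = j + 1; the factor 2 pays for 1/x <= 2/(x+1). *)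
Lemma powR_tail_step_le s j : 0 < s -> s <= 1 ->
  j.+1%:R `^ (- (1 + s)) <= 2 / s * (j.+1%:R `^ (- s) - j.+2%:R `^ (- s)) :> R.
Proof.
move=> s0 s1; set x : R := j.+1%:R; have x0 : 0 < x by rewrite ltr0n.
have xn0 : x != 0 by rewrite gt_eqF.
have x1 : 1 <= x by rewrite ler1n.
pose y := (x + 1)^-1.
have y0 : 0 < y by rewrite invr_gt0; lra.
have y1 : y <= 1 by rewrite invf_le1; lra.
have x1n : x + 1 != 0 by rewrite gt_eqF//; lra.
have yx : 1 - y = x / (x + 1).
  by apply: (mulIf x1n); rewrite divfK// mulrBl mul1r mulVf// addrK.
have jE : j.+2%:R = x * (1 + - y)^-1 :> R.
  by rewrite -natr1 -/x yx invf_div mulrCA divff// mulr1.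
have yp : 0 < 1 - y by rewrite yx divr_gt0//; lra.
rewrite jE powRM ?(ltW x0)//; last by rewrite invr_ge0 ltW.
have -> : (1 + - y)^-1 `^ (- s) = (1 + - y) `^ s.
  by rewrite -powR_inv1 ?(ltW yp)// -powRrM mulN1r opprK.
have -> : x `^ (- (1 + s)) = x^-1 * x `^ (- s).
  by rewrite opprD powRD ?xn0 ?implybT// powR_inv1// ltW.
have := @powR_bernoulli R s (- y) (ltW s0) s1.
move=> /(_ _) B; have {}B : (1 + - y) `^ s <= 1 + s * - y by apply: B; lra.
have xs := powR_ge0 x (- s).
have := ler_wpM2l xs B.
have sy : x^-1 <= 2 * y.
  rewrite /y ler_pdivlMr; last by lra.
  by rewrite mulrDr mulVf// mulr1 (_ : 2 = 1 + 1 :> R)// lerD2l invf_le1.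
move=> B2.
have B3 : s * (x `^ (- s) * y) <= x `^ (- s) - x `^ (- s) * (1 + - y) `^ s.
  by move: B2; rewrite mulrDr mulr1; lra.
apply: (@le_trans _ _ (2 / s * (s * (x `^ (- s) * y)))).
  have -> : 2 / s * (s * (x `^ (- s) * y)) = x `^ (- s) * (2 * y) by field; rewrite gt_eqF.
  by rewrite mulrC ler_wpM2l.
by rewrite ler_wpM2l// divr_ge0// ltW.
Qed.

Lemma sum_powR_le a J : 0 <= a -> a < 1 ->
  \sum_(1 <= j < J.+1) j%:R `^ (- a) <= (1 - a)^-1 * J%:R `^ (1 - a) :> R.
Proof.
move=> a0 a1; have a1' : 0 < 1 - a by lra.
elim: J => [|J IH]; first by rewrite big_geq// mulr_ge0 ?powR_ge0// invr_ge0 ltW.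
rewrite big_nat_recr//=; have := powR_step_le J a0 a1.
rewrite -(ler_pM2l (_ : 0 < (1 - a)^-1)) ?invr_gt0// mulKf ?gt_eqF// mulrBr; lra.
Qed.

Lemma sum_powR_head_le a V J : 0 <= a -> a < 1 -> 0 <= V ->
  \sum_(1 <= j < J.+1) (if j%:R <= V then j%:R `^ (- a) else 0)
  <= (1 - a)^-1 * Num.min J%:R V `^ (1 - a) :> R.
Proof.
move=> a0 a1 V0; have a1' : 0 < 1 - a by lra.
elim: J => [|J IH]; first by rewrite big_geq// mulr_ge0 ?powR_ge0// invr_ge0 ltW.
rewrite big_nat_recr//=; case: ifPn => [JV|JV].
  have JV' : J%:R <= V by apply: le_trans JV; rewrite ler_nat.
  rewrite (min_idPl JV); rewrite (min_idPl JV') in IH.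
  have := powR_step_le J a0 a1.
  rewrite -(ler_pM2l (_ : 0 < (1 - a)^-1)) ?invr_gt0// mulKf ?gt_eqF// mulrBr; lra.
rewrite addr0 (le_trans IH)// ler_wpM2l ?invr_ge0 ?(ltW a1')//.
apply: le_powR; rewrite ?(ltW a1') ?le_min ?ler0n//.
by rewrite ge_min ler_nat leqnSn/= ge_min lexx orbT.
Qed.

Lemma sum_powR_tail_le s V J : 0 < s -> s <= 1 -> 0 < V ->
  \sum_(1 <= j < J.+1) (if j%:R <= V then 0 else j%:R `^ (- (1 + s)))
  <= 2 / s * V `^ (- s) :> R.
Proof.
move=> s0 s1 V0.
have c0 : 0 <= 2 / s by rewrite divr_ge0// ltW.
have decr (x y : R) : 0 < x -> x <= y -> y `^ (- s) <= x `^ (- s).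
  move=> x0 xy; rewrite !(powRN _ s) lef_pV2 ?posrE ?powR_gt0//.
    by apply: le_powR; rewrite // ltW.
  exact: lt_le_trans xy.
(* Strengthened to a telescoping bound; the maximum with V accounts for the terms set to 0. *)
suff: \sum_(1 <= j < J.+1) (if j%:R <= V then 0 else j%:R `^ (- (1 + s)))
  <= 2 / s * (V `^ (- s) - Num.max V J.+1%:R `^ (- s)).
  move=> /le_trans; apply; rewrite ler_wpM2l// gerDl oppr_le0 powR_ge0//.
elim: J => [|J IH].
  by rewrite big_geq// mulr_ge0// subr_ge0 decr// le_max lexx.
rewrite big_nat_recr//=; case: ifPn => [JV|].
  rewrite addr0 (le_trans IH)// ler_wpM2l// lerD2l lerN2 decr//.
    by rewrite lt_max V0.
  by rewrite ge_max !le_max lexx/= ler_nat leqnSn orbT.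
rewrite -ltNge => VJ.
have VJ2 : V <= J.+2%:R by apply: le_trans (ltW VJ) _; rewrite ler_nat.
rewrite (max_idPr VJ2); rewrite (max_idPr (ltW VJ)) in IH.
have := powR_tail_step_le J s0 s1; rewrite !mulrBr in IH *; lra.
Qed.

(** The minimum changes regime at j = v^2. Below, the exponent (4-p)/2 < 1 lets the end of the range
    dominate; above, the exponent 1 + (3-p)/2 > 1 lets the beginning dominate. Both contributions
    are of order v^(p-2). *)
Lemma sum_powR_min_le p v J : 2 < p -> p < 3 -> 0 <= v ->
  \sum_(1 <= j < J.+1) j%:R `^ ((p - 4) / 2) * Num.min 1 (v * j%:R `^ (- 2^-1))
  <= (2 / (p - 2) + 4 / (3 - p)) * v `^ (p - 2) :> R.
Proof.
move=> p2 p3; rewrite le_eqVlt => /predU1P[<-|v0].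
  rewrite big1_seq ?mulr_ge0 ?powR_ge0// => [|j _]; last first.
    by rewrite mul0r (min_idPr ler01) mulr0.
  by rewrite addr_ge0// divr_ge0//; lra.
pose a := (4 - p) / 2; pose s := (3 - p) / 2; pose V := v ^+ 2.
have V0 : 0 < V by rewrite exprn_gt0.
apply: (@le_trans _ _ (\sum_(1 <= j < J.+1) ((if j%:R <= V then j%:R `^ (- a) else 0)
   + v * (if j%:R <= V then 0 else j%:R `^ (- (1 + s)))))).
  rewrite !big_seq; apply: ler_sum => j; rewrite mem_index_iota => /andP[j1 _].
  have j0 : 0 < j%:R :> R by rewrite ltr0n.
  have -> : (p - 4) / 2 = - a by rewrite /a; field.
  case: ifPn => jV.
    by rewrite mulr0 addr0 ler_piMr ?powR_ge0// ge_min lexx.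
  rewrite add0r (_ : - (1 + s) = - a - 2^-1); last by rewrite /s /a; field.
  rewrite powRD ?(gt_eqF j0) ?implybT// mulrCA ler_wpM2l ?powR_ge0//.
  by rewrite ge_min lexx orbT.
rewrite big_split/= -mulr_sumr mulrDl lerD//.
  have a0 : 0 <= a by rewrite /a; lra.
  have a1 : a < 1 by rewrite /a; lra.
  rewrite (le_trans (sum_powR_head_le J a0 a1 (ltW V0)))//.
  have -> : (1 - a)^-1 = 2 / (p - 2) by rewrite /a; field; rewrite gt_eqF//; lra.
  rewrite ler_wpM2l ?divr_ge0//; first by lra.
  have -> : v `^ (p - 2) = V `^ (1 - a).
    by rewrite /V -powR_mulrn ?(ltW v0)// -powRrM; congr (_ `^ _); rewrite /a; field.
  apply: le_powR; rewrite ?le_min ?ler0n ?(ltW V0) ?ge_min ?lexx ?orbT//; lra.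
have s0 : 0 < s by rewrite /s; lra.
have s1 : s <= 1 by rewrite /s; lra.
apply: (@le_trans _ _ (v * (2 / s * V `^ (- s)))).
  by rewrite ler_wpM2l ?(ltW v0) ?sum_powR_tail_le.
rewrite mulrCA le_eqVlt; apply/orP; left; apply/eqP; congr (_ * _).
  by rewrite /s; field; rewrite gt_eqF//; lra.
rewrite /V -powR_mulrn ?(ltW v0)// -powRrM -{1}(powRr1 (ltW v0)) -powRD ?(gt_eqF v0) ?implybT//.
by congr (_ `^ _); rewrite /s; field.
Qed.

End power_sums.

(** * Sums of the modulus over the smoothing scales *)

Section modulus_sums.
Context (R : realType) (p r : R).
Hypotheses (p2 : 2 < p) (p3 : p < 3) (r0 : p - 2 <= r) (rp : r <= p).

Let powR_split (t x y : R) : 0 < t -> t `^ x * t `^ y = t `^ (x + y).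
Proof. by move=> t0; rewrite powRD// (gt_eqF t0) implybT. Qed.

(** Serves for a single block, where no sum over scales helps: u is compared with the largest scale
    T instead of t. *)
Lemma omega_le_scale t T u : 0 < t -> t <= T -> 0 <= u ->
  omega p r t u <= T `^ (r - p + 2) * t `^ (p - 4) * (1 + (u / T) `^ (p - 2)).
Proof.
move=> t0 tT u0; have T0 := lt_le_trans t0 tT.
have := p2; have := p3; have := r0; have := rp => rp' r0' p3' p2'.
rewrite /omega /base_modulus; case: ifPn => r2.
  apply: (@le_trans _ _ (t `^ (r - 2))).
    by rewrite ler_piMr ?powR_ge0// ge_min lexx.
  apply: (@le_trans _ _ (T `^ (r - p + 2) * t `^ (p - 4))); last first.
    by rewrite ler_peMr ?mulr_ge0 ?powR_ge0// lerDl powR_ge0.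
  have -> : r - 2 = (r - p + 2) + (p - 4) by ring.
  rewrite -powR_split// ler_wpM2r ?powR_ge0//; apply: le_powR; rewrite ?(ltW t0)//; lra.
have -> : t `^ (r - 2) * (u / t) `^ (p - 2) = t `^ (p - 4) * (t `^ (r - 2 * p + 4) * u `^ (p - 2)).
  rewrite powRM ?invr_ge0 ?(ltW t0)// -powR_inv1 ?(ltW t0)// -powRrM.
  rewrite [LHS]mulrCA powR_split// [RHS]mulrA powR_split// mulrC.
  by congr (_ `^ _ * _); ring.
apply: (@le_trans _ _ (t `^ (p - 4) * (T `^ (r - 2 * p + 4) * u `^ (p - 2)))).
  rewrite ler_wpM2l ?powR_ge0// ler_wpM2r ?powR_ge0//.
  by move: r2; rewrite -ltNge => r2; apply: le_powR; rewrite ?(ltW t0)//; lra.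
have E : T `^ (r - 2 * p + 4) = T `^ (r - p + 2) * T `^ (- 1 * (p - 2)).
  by rewrite powR_split//; congr (_ `^ _); ring.
rewrite E [leRHS]mulrDr mulr1 (powRM _ u0) ?invr_ge0 ?(ltW T0)//.
rewrite -(powR_inv1 (ltW T0)) -powRrM.
have -> : t `^ (p - 4) * (T `^ (r - p + 2) * T `^ (-1 * (p - 2)) * u `^ (p - 2)) =
  T `^ (r - p + 2) * t `^ (p - 4) * (u `^ (p - 2) * T `^ (-1 * (p - 2))) by ring.
by rewrite lerDr mulr_ge0 ?powR_ge0.
Qed.

(** For r <= 2, t^(r-2) = t^(r-p+2) t^(p-4), and the first factor is at most its value at T because
    r >= p - 2. For r > 2 the terms are powers of j with exponent above -1, so the sum is governed
    by j = J, where b J^(1/2) <= T. *)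
Lemma sum_omega_le : exists2 C, 0 <= C & forall b T u J, 0 < b -> 0 <= u ->
  b * J%:R `^ 2^-1 <= T ->
  \sum_(1 <= j < J.+1) omega p r (b * j%:R `^ 2^-1) u
  <= C * T `^ (r - p + 2) * b `^ (- 2) * u `^ (p - 2).
Proof.
have := p2; have := p3; have := r0; have := rp => rp' r0' p3' p2'.
exists (2 / (p - 2) + 4 / (3 - p) + (1 - (p - r) / 2)^-1).
  rewrite !addr_ge0// ?divr_ge0// ?invr_ge0; lra.
move=> b T u J b0 u0 bJ.
have [->|J0] := posnP J.
  by rewrite big_geq// !mulr_ge0 ?powR_ge0// !addr_ge0 ?divr_ge0 ?invr_ge0//; lra.
have sJ : 0 < J%:R `^ 2^-1 :> R by rewrite powR_gt0// ltr0n.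
have T0 : 0 < T by apply: lt_le_trans bJ; rewrite mulr_gt0.
have TT := powR_ge0 T (r - p + 2).
have bj j : (0 < j)%N -> 0 < b * j%:R `^ 2^-1 by move=> j0; rewrite mulr_gt0// powR_gt0// ltr0n.
have bV x : (b^-1) `^ x = b `^ (- x).
  by rewrite -powR_inv1 ?(ltW b0)// -powRrM mulN1r.
have [r2|r2] := leP r 2.
  apply: (@le_trans _ _ (T `^ (r - p + 2) * b `^ (p - 4) *
     \sum_(1 <= j < J.+1) j%:R `^ ((p - 4) / 2) * Num.min 1 (u / b * j%:R `^ (- 2^-1)))).
    rewrite mulr_sumr !big_seq; apply: ler_sum => j; rewrite mem_index_iota => /andP[j1 jJ].
    have j0 : 0 < j%:R :> R by rewrite ltr0n.
    have bj0 := bj _ j1.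
    rewrite /omega /base_modulus r2.
    have -> : u / (b * j%:R `^ 2^-1) = u / b * j%:R `^ (- 2^-1).
      by rewrite invfM powRN mulrA.
    have -> : r - 2 = (r - p + 2) + (p - 4) by ring.
    rewrite -powR_split// [X in X `^ (p - 4)]mulrC.
    rewrite (powRM _ (powR_ge0 _ _) (ltW b0)) -powRrM.
    rewrite (_ : 2^-1 * (p - 4) = (p - 4) / 2); last by ring.
    rewrite (mulrC (_ `^ ((p - 4) / 2))) !mulrA.
    rewrite ler_wpM2r//; first by rewrite le_min ler01/= mulr_ge0 ?powR_ge0// divr_ge0// ltW.
    rewrite ler_wpM2r ?powR_ge0// ler_wpM2r ?powR_ge0//.
    apply: le_powR; rewrite ?(ltW bj0)//; first by lra.
    apply: le_trans bJ; rewrite ler_wpM2l ?(ltW b0)//; apply: le_powR; rewrite ?ler0n ?ler_nat//.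
  have ub : 0 <= u / b by rewrite divr_ge0// ltW.
  have S := sum_powR_min_le J p2' p3' ub.
  apply: (@le_trans _ _ (T `^ (r - p + 2) * b `^ (p - 4) *
     ((2 / (p - 2) + 4 / (3 - p)) * (u / b) `^ (p - 2)))).
    by rewrite ler_wpM2l ?mulr_ge0 ?powR_ge0.
  rewrite powRM ?invr_ge0 ?(ltW b0)// bV.
  have -> : b `^ (- 2) = b `^ (p - 4) * b `^ (- (p - 2)).
    by rewrite powR_split//; congr (_ `^ _); ring.
  set c := (1 - _)^-1; have c0 : 0 <= c by rewrite invr_ge0; lra.
  have : 0 <= c * (T `^ (r - p + 2) * (b `^ (p - 4) * b `^ (- (p - 2))) * u `^ (p - 2)).
    by rewrite !mulr_ge0 ?powR_ge0.
  lra.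
apply: (@le_trans _ _ (b `^ (r - p) * u `^ (p - 2) * \sum_(1 <= j < J.+1) j%:R `^ (- ((p - r) / 2)))).
  rewrite mulr_sumr !big_seq; apply: ler_sum => j; rewrite mem_index_iota => /andP[j1 jJ].
  have H := omega_powR r p2' p3' (bj _ j1) u0.
  apply: (le_trans H).
  rewrite powRM ?powR_ge0 ?(ltW b0)// -powRrM mulrAC (_ : 2^-1 * (r - p) = - ((p - r) / 2))//.
  by field.
have a0 : 0 <= (p - r) / 2 by lra.
have a1 : (p - r) / 2 < 1 by lra.
apply: (@le_trans _ _ (b `^ (r - p) * u `^ (p - 2) * ((1 - (p - r) / 2)^-1 * J%:R `^ (1 - (p - r) / 2)))).
  by rewrite ler_wpM2l ?mulr_ge0 ?powR_ge0 ?sum_powR_le.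
set c := (1 - _)^-1; have c0 : 0 <= c by rewrite invr_ge0; lra.
have h : b `^ (r - p) * J%:R `^ (1 - (p - r) / 2) <= T `^ (r - p + 2) * b `^ (- 2).
  have -> : J%:R `^ (1 - (p - r) / 2) = (J%:R `^ 2^-1) `^ (r - p + 2) :> R.
    by rewrite -powRrM; congr (_ `^ _); field.
  have -> : b `^ (r - p) = b `^ (r - p + 2) * b `^ (- 2).
    by rewrite powR_split//; congr (_ `^ _); ring.
  rewrite mulrAC -powRM ?powR_ge0 ?(ltW b0)// ler_wpM2r ?powR_ge0//.
  apply: le_powR => //; last by rewrite mulr_ge0 ?powR_ge0// ltW.
  by lra.
have := ler_wpM2l (mulr_ge0 c0 (powR_ge0 u (p - 2))) h.
have d1 : 0 <= 2 / (p - 2) by rewrite divr_ge0//; lra.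
have d2 : 0 <= 4 / (3 - p) by rewrite divr_ge0//; lra.
have := mulr_ge0 (addr_ge0 d1 d2) (mulr_ge0 (mulr_ge0 TT (powR_ge0 b (- 2))) (powR_ge0 u (p - 2))).
lra.
Qed.

End modulus_sums.

(** * Measurability for F0, orthogonality and conditional expectation *)

Section sub_sigma_algebra.
Context d (Omega : measurableType d) (R : realType) (P : probability Omega R).
Variable F0 : set (set Omega).
Hypothesis sF : sigma_subalgebra F0.
Implicit Types h Y : Omega -> R.

(** The measurable sets of [g_sigma_algebraType F0] are those of F0, so the closure properties of
    measurable functions apply verbatim. *)
Definition measF h := measurable_fun setT (h : g_sigma_algebraType F0 -> R).

Lemma measurable_sub (A : set (g_sigma_algebraType F0)) : measurable A = F0 A.
Proof. by rewrite /measurable /= (sigma_algebra_id sF.1). Qed.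

Lemma measFP h : measF h <-> (forall B, measurable B -> F0 (h @^-1` B)).
Proof.
split => [mh B mB|H _ B mB].
  by have := mh measurableT B mB; rewrite setTI measurable_sub.
by rewrite setTI measurable_sub; exact: H.
Qed.

Lemma measF_measurable h : measF h -> measurable_fun setT h.
Proof. by move=> /measFP mh _ B mB; rewrite setTI; exact/sF.2/mh. Qed.

Lemma measF_comp (g : R -> R) h : measurable_fun setT g -> measF h -> measF (g \o h).
Proof. by move=> mg mh; exact: measurableT_comp. Qed.

Lemma Ex_indic_mul A Y : F0 A -> L1 P Y ->
  Ex P (fun w => \1_A w * Y w) = fine (\int[P]_(w in A) (Y w)%:E).
Proof.
move=> FA lY; congr fine; rewrite [RHS]integral_mkcond; apply: eq_integral => w _.
by rewrite patchE indicE; case: (_ \in _); rewrite ?mul1r ?mul0r.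
Qed.

Lemma L1_indic_mul A Y : F0 A -> L1 P Y -> L1 P (fun w => \1_A w * Y w).
Proof.
move=> FA lY; apply: L1_le (L1_norm lY).
  apply: measurable_funM; last exact: L1_measurable lY.
  by apply: measurable_indic; exact: sF.2.
by move=> w; rewrite normrM indicE; case: (_ \in _); rewrite ?normr1 ?mul1r ?normr0 ?mul0r.
Qed.

(** After splitting h into positive and negative parts, simple F0-measurable functions increase to
    each part; products with Y are dominated by the integrable |h Y|, so h itself may be
    unbounded. *)
Lemma Ex_orthogonal Y h : L1 P Y ->
  (forall A, F0 A -> (\int[P]_(w in A) (Y w)%:E = 0)%E) ->
  measF h -> L1 P (fun w => h w * Y w) -> Ex P (fun w => h w * Y w) = 0.
Proof.
move=> lY Y0.
have mY := L1_measurable lY.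
suff pos h' : measF h' -> (forall w, 0 <= h' w) -> L1 P (fun w => h' w * Y w) ->
    Ex P (fun w => h' w * Y w) = 0.
  move=> mh lhY; have mh' := measF_measurable mh.
  have mp : measF (fun w => Num.max (h w) 0).
    by apply: (@measF_comp (fun x => Num.max x 0)) => //; exact: measurable_funrpos.
  have mn : measF (fun w => Num.max (- h w) 0).
    apply: (@measF_comp (fun x => Num.max (- x) 0)) => //.
    by apply: measurable_funrneg.
  have lp : L1 P (fun w => Num.max (h w) 0 * Y w).
    apply: L1_le (L1_norm lhY).
      by apply: measurable_funM => //; exact: measF_measurable mp.
    by move=> w; rewrite !normrM ler_wpM2r//; case: (leP (h w) 0) => h0; rewrite ?normr0.
  have ln : L1 P (fun w => Num.max (- h w) 0 * Y w).
    apply: L1_le (L1_norm lhY).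
      by apply: measurable_funM => //; exact: measF_measurable mn.
    by move=> w; rewrite !normrM ler_wpM2r// -(normrN (h w)); case: (leP (- h w) 0) => h0; rewrite ?normr0.
  transitivity (Ex P (fun w => Num.max (h w) 0 * Y w - Num.max (- h w) 0 * Y w)).
    apply: eq_Ex => w; rewrite -mulrBl; congr (_ * _).
    case: (leP (h w) 0) => h0.
      by rewrite (max_idPl _) ?oppr_ge0// sub0r opprK.
    by rewrite (max_idPr _) ?subr0// oppr_le0 ltW.
  by rewrite ExB// pos// ?pos// ?subrr// => w; rewrite le_max lexx orbT.
move=> mh h0 lhY.
have mhE : measurable_fun setT (EFin \o h' : g_sigma_algebraType F0 -> \bar R).
  exact/measurable_EFinP.
pose s := nnsfun_approx measurableT mhE.
have s_cvg w : (s n w)%:E @[n --> \oo] --> (h' w)%:E.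
  by apply: (cvg_nnsfun_approx measurableT mhE) => // x _; rewrite lee_fin.
have s_le n w : s n w <= h' w.
  rewrite -lee_fin /s nnsfun_approxE.
  by apply: (@le_approx _ _ _ setT (EFin \o h') n w) => // x _; rewrite lee_fin.
have ms n : measurable_fun setT (s n : Omega -> R).
  by apply: (@measF_measurable (s n)); exact: measurable_funPT.
have s0 n : Ex P (fun w => s n w * Y w) = 0.
  transitivity (Ex P (fun w => \sum_(r <- finmap.enum_fset (fset_set (range (s n))))
      (r * (\1_(s n @^-1` [set r]) w * Y w)))).
    apply: eq_Ex => w; rewrite [in LHS]fimfunE fsbig_finite//= mulr_suml.
    by apply: eq_bigr => r _; rewrite mulrA.
  have Fr r : F0 (s n @^-1` [set r]).
    by rewrite -measurable_sub; exact: measurable_sfunP.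
  rewrite Ex_sum; last by move=> r; apply/L1Z/L1_indic_mul.
  apply: big1_seq => r _; rewrite ExZ; last exact: L1_indic_mul.
  by rewrite Ex_indic_mul// Y0// mulr0.
have := @dominated_cvg _ _ _ P setT measurableT (fun n w => (s n w * Y w)%:E)
  (fun w => (h' w * Y w)%:E) (fun w => `|(h' w * Y w)%:E|%E).
move=> H; have {}H : ((\int[P]_w (s n w * Y w)%:E)%E @[n --> \oo]
    --> (\int[P]_w (h' w * Y w)%:E)%E).
  apply: H.
  - by move=> n; apply/measurable_EFinP; exact: measurable_funM.
  - move=> w _.
    have : ((s n w)%:E * (Y w)%:E)%E @[n --> \oo] --> ((h' w)%:E * (Y w)%:E)%E.
      by apply: cvgeZr => //; exact: s_cvg.
    by [].
  - by [].
  - exact: integrable_abse.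
  - move=> n w _; rewrite !abse_EFin lee_fin !normrM ler_wpM2r//.
    by rewrite !ger0_norm.
have E n : (\int[P]_w (s n w * Y w)%:E)%E = 0%E.
  rewrite -EFin_Ex ?s0//; apply: L1_le (L1_norm lhY).
    exact: measurable_funM.
  by move=> w; rewrite !normrM ler_wpM2r// !ger0_norm.
rewrite /Ex /Rintegral; have -> : (\int[P]_w (h' w * Y w)%:E)%E = 0%E => //.
move: H; under eq_fun do rewrite E; move=> H.
by rewrite -[LHS](cvg_lim _ H)// lim_cst.
Qed.

Lemma Ex_cond_exp Y h : L1 P Y -> measF h -> L1 P (fun w => h w * Y w) ->
  L1 P (fun w => h w * cond_exp P F0 Y w) ->
  Ex P (fun w => h w * Y w) = Ex P (fun w => h w * cond_exp P F0 Y w).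
Proof.
move=> lY mh lhY lhE.
have [mE lE EE] := cond_expP sF lY.
have lE' : L1 P (cond_exp P F0 Y) by exact: lE.
apply/eqP; rewrite -subr_eq0 -ExB//; apply/eqP.
rewrite -[RHS](@Ex_orthogonal (fun w => Y w - cond_exp P F0 Y w) h)//.
- by apply: eq_Ex => w; rewrite mulrBr.
- exact: L1B.
- move=> A FA; have mA : measurable A by exact: sF.2.
  under eq_integral do rewrite EFinB.
  rewrite integralB_EFin//; [|exact: integrableS lY|exact: integrableS lE'].
  rewrite EE// subee//; apply: integrable_fin_num => //.
  exact: integrableS lY.
- by apply: eq_L1 (L1B lhY lhE) => w; rewrite mulrBr.
Qed.

Lemma cond_exp_measF Y : L1 P Y -> measF (cond_exp P F0 Y).
Proof. by move=> lY; apply/measFP; have [] := cond_expP sF lY. Qed.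

Lemma cond_exp_L1 Y : L1 P Y -> L1 P (cond_exp P F0 Y).
Proof. by move=> lY; have [] := cond_expP sF lY. Qed.

End sub_sigma_algebra.

(** * The shift, adapted functions and stationary martingale differences *)

Section stationary_martingale.
Context d (Omega : measurableType d) (R : realType) (P : probability Omega R).
Variables (T Tinv : {mfun Omega >-> Omega}).
Hypotheses (TK : cancel T Tinv) (TinvK : cancel Tinv T).
Hypothesis Tpres : measure_preserving P T.
Variable F0 : set (set Omega).
Hypothesis sF : sigma_subalgebra F0.
Hypothesis F0T : F0 `<=` preimage_set_system setT T F0.
Implicit Types h f : Omega -> R.

Lemma iterK n : cancel (iter n T) (iter n Tinv).
Proof. by elim: n => [//|n IH] w; rewrite iterSr iterS TK IH. Qed.

Lemma iterKV n : cancel (iter n Tinv) (iter n T).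
Proof. by elim: n => [//|n IH] w; rewrite iterSr iterS TinvK IH. Qed.

Lemma iter_preserving n : measure_preserving P (iter n T).
Proof.
elim: n => [//|n IH] A mA; rewrite -(IH A mA).
have mB : measurable (iter n T @^-1` A).
  by rewrite -[X in measurable X]setTI; exact: measurable_iter.
by rewrite -(Tpres mB); congr (P _); apply/seteqP; split => w; rewrite /= -iterSr.
Qed.

Lemma inv_preserving n : measure_preserving P (iter n Tinv).
Proof.
move=> A mA.
have mB : measurable (iter n Tinv @^-1` A).
  by rewrite -[X in measurable X]setTI; exact: measurable_iter.
rewrite -(iter_preserving n mB); congr (P _).
by apply/seteqP; split => w; rewrite /= iterK.
Qed.

(** Composition with T^-1 moves into the past: A is the preimage under T of some B in F0, and B is
    then the preimage of A under T^-1. *)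
Lemma F0_inv A : F0 A -> F0 (Tinv @^-1` A).
Proof.
move=> /F0T[B FB <-]; rewrite setTI.
rewrite (_ : _ @^-1` _ = B)//; apply/seteqP; split => w /=; by rewrite TinvK.
Qed.

Lemma measF_inv h : measF F0 h -> measF F0 (h \o Tinv).
Proof.
move=> /(measFP sF) mh; apply/(measFP sF) => B mB.
exact: (F0_inv (mh _ mB)).
Qed.

Lemma measF_iter_inv n h : measF F0 h -> measF F0 (h \o iter n Tinv).
Proof.
move=> mh; elim: n => [//|n IH].
have -> : h \o iter n.+1 Tinv = (h \o iter n Tinv) \o Tinv.
  by apply/funext => w; rewrite /= -iterSr.
exact: measF_inv.
Qed.

(* h is measurable for T^-k(F0) iff h o T^-k is measurable for F0. *)
Definition adapted k h := measF F0 (h \o iter k Tinv).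

Lemma adapted_le k l h : (k <= l)%N -> adapted k h -> adapted l h.
Proof.
move=> kl; rewrite /adapted -(subnKC kl) => mh.
have -> : h \o iter (k + (l - k)) Tinv = (h \o iter k Tinv) \o iter (l - k) Tinv.
  by apply/funext => w; rewrite /= iterD.
exact: measF_iter_inv.
Qed.

Lemma adapted_comp k (g : R -> R) h : measurable_fun setT g -> adapted k h -> adapted k (g \o h).
Proof. by move=> mg mh; exact: (measF_comp mg mh). Qed.

Lemma adapted_shift k l h : adapted k h -> adapted (k + l) (h \o iter l T).
Proof.
rewrite /adapted => mh.
have -> // : (h \o iter l T) \o iter (k + l) Tinv = h \o iter k Tinv.
by apply/funext => w; rewrite /= addnC iterD iterKV.
Qed.

Lemma Ex_iter n f : measurable_fun setT f -> Ex P (fun w => f (iter n T w)) = Ex P f.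
Proof.
by move=> mf; apply: Ex_preserving => //; [exact: measurable_iter|exact: iter_preserving].
Qed.

Lemma L1_iter n f : L1 P f -> L1 P (fun w => f (iter n T w)).
Proof.
by move=> lf; apply: L1_preserving => //; [exact: measurable_iter|exact: iter_preserving].
Qed.

Lemma Ex_iter_inv n f : measurable_fun setT f -> Ex P (fun w => f (iter n Tinv w)) = Ex P f.
Proof.
by move=> mf; apply: Ex_preserving => //; [exact: measurable_iter|exact: inv_preserving].
Qed.

Lemma L1_iter_inv n f : L1 P f -> L1 P (fun w => f (iter n Tinv w)).
Proof.
by move=> lf; apply: L1_preserving => //; [exact: measurable_iter|exact: inv_preserving].
Qed.

Definition birkhoff f n w := \sum_(1 <= k < n.+1) f (iter k T w).

Lemma birkhoff0 f w : birkhoff f 0 w = 0.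
Proof. by rewrite /birkhoff big_geq. Qed.

Lemma birkhoffS f n w : birkhoff f n.+1 w = birkhoff f n w + f (iter n.+1 T w).
Proof. by rewrite /birkhoff big_nat_recr. Qed.

Lemma birkhoffD f m n w :
  birkhoff f (m + n) w = birkhoff f m w + birkhoff f n (iter m T w).
Proof.
elim: n => [|n IH]; first by rewrite addn0 birkhoff0 addr0.
by rewrite addnS !birkhoffS IH addrA -iterD addSn addnC.
Qed.

Section martingale_difference.
Variable D : Omega -> R.
Hypothesis mD : measF F0 D.
Hypothesis lD : L1 P D.
Hypothesis D0 : forall A, F0 A -> (\int[P]_(w in A) (D (T w))%:E = 0)%E.
Notation M := (birkhoff D).

Lemma adapted_birkhoff n : adapted n (M n).
Proof.
rewrite /adapted /measF /birkhoff.
have -> : (fun w => \sum_(1 <= k < n.+1) D (iter k T w)) \o iter n Tinv =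
  (fun w => \sum_(1 <= k < n.+1) D (iter (n - k) Tinv w)).
  apply/funext => w /=; rewrite !big_nat; apply: eq_bigr => k /andP[_ kn].
  by rewrite -{1}(subnKC (kn : (k <= n)%N)) iterD iterKV.
by apply: measurable_sum => k; exact: measF_iter_inv.
Qed.

(** By stationarity time k is moved to time 0, where h o T^-k is measurable for F0 and D o T is
    orthogonal to F0. *)
Lemma Ex_mul_increment k h : adapted k h ->
  L1 P (fun w => h w * D (iter k.+1 T w)) ->
  Ex P (fun w => h w * D (iter k.+1 T w)) = 0.
Proof.
move=> ah lh.
have E w : h w * D (iter k.+1 T w) = (fun v => h (iter k Tinv v) * D (T v)) (iter k T w).
  by rewrite /= iterK.
have l1 : L1 P (fun v => h (iter k Tinv v) * D (T v)).
  apply: eq_L1 (L1_iter_inv k lh) => v /=; by rewrite -iterS iterS iterKV.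
rewrite (eq_Ex _ E).
rewrite (Ex_iter k (f := fun v => h (iter k Tinv v) * D (T v)) (L1_measurable l1)).
apply: (Ex_orthogonal sF (Y := fun v => D (T v))) => //.
exact: (L1_iter 1 lD).
Qed.

End martingale_difference.

End stationary_martingale.

Lemma powR_mulD (R : realType) (x a b : R) : 0 < x -> x `^ a * x `^ b = x `^ (a + b).
Proof. by move=> x0; rewrite powRD// (gt_eqF x0) implybT. Qed.

(** * Random variables with a moment of order p *)

Section moments.
Context d (Omega : measurableType d) (R : realType) (P : probability Omega R).
Variable p : R.
Hypothesis p1 : 1 <= p.
Implicit Types f g U : Omega -> R.

Definition Lp f : Prop := measurable_fun setT f /\ L1 P (fun w => `|f w| `^ p).

Let p0 : 0 <= p. Proof. exact: le_trans ler01 p1. Qed.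

Lemma measurable_norm_powR f a : measurable_fun setT f ->
  measurable_fun setT (fun w => `|f w| `^ a).
Proof.
move=> mf; apply: (measurableT_comp (f := @powR R ^~ a)); first exact: measurable_powR.
exact: measurableT_comp.
Qed.

Lemma Lp_le f g : measurable_fun setT f -> Lp g -> (forall w, `|f w| <= `|g w|) -> Lp f.
Proof.
move=> mf [mg lg] fg; split => //; apply: L1_le lg; first exact: measurable_norm_powR.
by move=> w; rewrite ger0_norm ?powR_ge0// le_powR.
Qed.

Lemma LpD f g : Lp f -> Lp g -> Lp (fun w => f w + g w).
Proof.
move=> [mf lf] [mg lg]; split; first exact: measurable_funD.
apply: L1_le (L1Z (2 `^ p) (L1D lf lg)).
  by apply: measurable_norm_powR; exact: measurable_funD.
move=> w; rewrite ger0_norm ?powR_ge0//.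
rewrite (le_trans _ (powRD_le p0 (normr_ge0 (f w)) (normr_ge0 (g w))))//.
by apply: le_powR => //; exact: ler_normD.
Qed.

Lemma LpZ k f : Lp f -> Lp (fun w => k * f w).
Proof.
move=> [mf lf]; split; first exact: measurable_funM.
by apply: eq_L1 (L1Z (`|k| `^ p) lf) => w; rewrite normrM powRM.
Qed.

Lemma LpB f g : Lp f -> Lp g -> Lp (fun w => f w - g w).
Proof.
move=> lf lg; have := LpD lf (LpZ (-1) lg).
by congr (Lp _); apply/funext => w; rewrite mulN1r.
Qed.

Lemma Lp_cst k : Lp (fun=> k).
Proof. by split; [exact: measurable_cst|exact: L1_cst]. Qed.

Lemma Lp_norm f : Lp f -> Lp (fun w => `|f w|).
Proof.
by move=> lf; apply: Lp_le (lf) _; [exact: measurableT_comp lf.1|move=> w; rewrite normr_id].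
Qed.

Lemma Lp_sum (I : Type) (s : seq I) (F : I -> Omega -> R) :
  (forall i, Lp (F i)) -> Lp (fun w => \sum_(i <- s) F i w).
Proof.
move=> lF; elim: s => [|i s IH].
  have -> : (fun w => \sum_(i <- [::]) F i w) = (fun=> 0).
    by apply/funext => w; rewrite big_nil.
  exact: Lp_cst.
have -> : (fun w => \sum_(j <- i :: s) F j w) = (fun w => F i w + \sum_(j <- s) F j w).
  by apply/funext => w; rewrite big_cons.
exact: LpD.
Qed.

Lemma Lp_L1_powR f a : Lp f -> 0 <= a -> a <= p -> L1 P (fun w => `|f w| `^ a).
Proof.
move=> [mf lf] a0 ap; apply: L1_le (L1D (L1_cst P 1) lf).
  exact: measurable_norm_powR.
by move=> w; rewrite ger0_norm ?powR_ge0// powR_le1D.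
Qed.

Lemma Lp_L1 f : Lp f -> L1 P f.
Proof.
move=> lf; have := Lp_L1_powR lf ler01 p1; apply: L1_le lf.1 _.
by move=> w; rewrite powRr1.
Qed.

Lemma Lp_dominated C U f : Lp U -> measurable_fun setT f ->
  (forall w, `|f w| <= C * `|U w| `^ p) -> L1 P f.
Proof. by move=> [_ lU] mf fU; apply: L1_le (L1Z C lU). Qed.

End moments.

(** * Polynomial growth of a function with a second-order expansion *)

Section growth.
Context (R : realType) (p : R) (F F1 F2 w : R -> R) (A : R).
Hypotheses (p2 : 2 < p) (p3 : p < 3).
Hypothesis w_ge0 : forall u, 0 <= u -> 0 <= w u.
Hypothesis w_scale : forall c u, 0 <= c -> 0 <= u -> w (c * u) <= (1 + c) * w u.
Hypothesis w_powR : forall u, 0 <= u -> w u <= A * u `^ (p - 2).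
Hypothesis F_expand : forall x d,
  `|F (x + d) - F x - F1 x * d - F2 x * d ^+ 2 / 2| <= d ^+ 2 * w `|d|.

(** The expansion is taken at 0. The exponents p, p - 1, p - 2 leave room for the powers 0, 1, 2 of
    an increment that has p moments, which makes every term of a Lindeberg step integrable. *)
Lemma expansion_growth : exists2 C, 0 <= C & forall x,
  [/\ `|F x| <= C * (1 + `|x|) `^ p, `|F1 x| <= C * (1 + `|x|) `^ (p - 1)
    & `|F2 x| <= C * (1 + `|x|) `^ (p - 2)].
Proof.
have p2' := p2; have p3' := p3.
have A0 : 0 <= A by have := le_trans (w_ge0 ler01) (w_powR ler01); rewrite powR1 mulr1.
exists (`|F 0| + `|F1 0| + `|F2 0| + 16 * A).
  by rewrite !addr_ge0// mulr_ge0.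
move=> x; set V := 1 + `|x|.
have V1 : 1 <= V by rewrite lerDl.
have V0 : 0 <= V by exact: le_trans V1.
have xV : `|x| <= V by rewrite lerDr.
have Vn0 : V != 0 by rewrite gt_eqF// (lt_le_trans ltr01).
have Vq : 1 <= V `^ (p - 2).
  have q0 : 0 <= p - 2 by lra.
  by have := le_powR q0 ler01 V1; rewrite powR1.
have E1 : V `^ (p - 1) = V * V `^ (p - 2).
  have -> : p - 1 = 1 + (p - 2) by ring.
  by rewrite [LHS]powRD ?Vn0 ?implybT// powRr1.
have E0 : V `^ p = V ^+ 2 * V `^ (p - 2).
  rewrite -powR_mulrn// -powRD ?Vn0 ?implybT//; congr (_ `^ _); ring.
have wx : w `|x| <= A * V `^ (p - 2).
  rewrite (le_trans (w_powR (normr_ge0 x)))// ler_wpM2l//.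
  by apply: le_powR => //; lra.
have f0 := normr_ge0 (F 0); have f1 := normr_ge0 (F1 0); have f2 := normr_ge0 (F2 0).
have x0 := normr_ge0 x.
set v := V `^ (p - 2) in Vq E1 E0 wx *.
have v0 : 0 <= v by apply: le_trans Vq.
have VV : V <= V ^+ 2 by rewrite expr2 ler_peMl.
have Vv : V <= V * v by rewrite ler_peMr.
have V2v : V ^+ 2 <= V ^+ 2 * v by rewrite ler_peMr ?sqr_ge0.
split.
- have -> : F x = (F 0 + F1 0 * x + F2 0 * (x ^+ 2 / 2))
     + (F (0 + x) - F 0 - F1 0 * x - F2 0 * x ^+ 2 / 2) by rewrite add0r; ring.
  have x2 : x ^+ 2 <= V ^+ 2 by rewrite -(real_normK (num_real x)) lerXn2r.
  have h := F_expand 0 x.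
  apply: (@le_trans _ _ ((`|F 0| + `|F1 0| * `|x| + `|F2 0| * x ^+ 2) + x ^+ 2 * w `|x|)).
    rewrite (le_trans (ler_normD _ _))// lerD//.
    rewrite (le_trans (ler_normD _ _))// lerD//.
      by rewrite (le_trans (ler_normD _ _))// normrM.
    rewrite normrM ler_wpM2l// ger0_norm ?divr_ge0 ?sqr_ge0//.
    by have := sqr_ge0 x; lra.
  have t0 : `|F 0| <= `|F 0| * (V ^+ 2 * v) by rewrite ler_peMr//; lra.
  have t1 : `|F1 0| * `|x| <= `|F1 0| * (V ^+ 2 * v) by rewrite ler_wpM2l//; lra.
  have t2 : `|F2 0| * x ^+ 2 <= `|F2 0| * (V ^+ 2 * v) by rewrite ler_wpM2l//; lra.
  have t3 : x ^+ 2 * w `|x| <= V ^+ 2 * (A * v) by apply: ler_pM; rewrite ?sqr_ge0 ?w_ge0.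
  have t4 : 0 <= A * (V ^+ 2 * v) by rewrite mulr_ge0//; lra.
  rewrite E0; lra.
- have -> : F1 x = (F1 0 + F2 0 * x) + (F1 (0 + x) - F1 0 - F2 0 * x) by rewrite add0r; ring.
  have h := expansion_modulus1 w_scale F_expand 0 x.
  apply: (@le_trans _ _ ((`|F1 0| + `|F2 0| * `|x|) + 7 * (`|x| * w `|x|))).
    rewrite (le_trans (ler_normD _ _))// lerD//.
    by rewrite (le_trans (ler_normD _ _))// normrM.
  have t1 : `|F1 0| <= `|F1 0| * (V * v) by rewrite ler_peMr//; lra.
  have t2 : `|F2 0| * `|x| <= `|F2 0| * (V * v) by rewrite ler_wpM2l//; lra.
  have t3 : `|x| * w `|x| <= V * (A * v) by apply: ler_pM; rewrite ?w_ge0.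
  have t4 : 0 <= A * (V * v) by rewrite mulr_ge0//; lra.
  have t5 : 0 <= `|F 0| * (V * v) by rewrite mulr_ge0//; lra.
  rewrite E1; lra.
- have h := expansion_modulus2 w_ge0 w_scale F_expand 0 x; rewrite subr0 in h.
  apply: (@le_trans _ _ (`|F2 0| + 16 * w `|x|)).
    have := ler_normD (F2 x - F2 0) (F2 0); rewrite subrK; lra.
  have t2 : `|F2 0| <= `|F2 0| * v by rewrite ler_peMr.
  have t5 : 0 <= `|F 0| * v by rewrite mulr_ge0.
  have t6 : 0 <= `|F1 0| * v by rewrite mulr_ge0.
  lra.
Qed.

End growth.

(** * One replacement in Lindeberg's method *)

Section lindeberg_step.
Context d (Omega : measurableType d) (R : realType) (P : probability Omega R).
Variables (T Tinv : {mfun Omega >-> Omega}).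
Hypotheses (TK : cancel T Tinv) (TinvK : cancel Tinv T).
Hypothesis Tpres : measure_preserving P T.
Variable F0 : set (set Omega).
Hypothesis sF : sigma_subalgebra F0.
Hypothesis F0T : F0 `<=` preimage_set_system setT T F0.
Variables (p sigma : R).
Hypotheses (p2 : 2 < p) (p3 : p < 3) (sigma0 : 0 < sigma).
Variable D : Omega -> R.
Hypothesis mD : measF F0 D.
Hypothesis DLp : Lp P p D.
Hypothesis D0 : forall A, F0 A -> (\int[P]_(w in A) (D (T w))%:E = 0)%E.
Notation M := (birkhoff T D).
Notation G := (Ex (gauss R)).

Let p1 : 1 <= p. Proof. by have := p2; lra. Qed.

Lemma Lp_iter n f : Lp P p f -> Lp P p (fun w => f (iter n T w)).
Proof.
move=> [mf lf]; split; last exact: (L1_iter Tpres n lf).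
by apply: (measurableT_comp mf); exact: measurable_iter.
Qed.

Lemma Lp_birkhoff n f : Lp P p f -> Lp P p (birkhoff T f n).
Proof. by move=> lf; apply: Lp_sum => // k; exact: Lp_iter. Qed.

Variables (F F1 F2 H w : R -> R) (A : R).
Hypothesis w_ge0 : forall u, 0 <= u -> 0 <= w u.
Hypothesis w_scale : forall c u, 0 <= c -> 0 <= u -> w (c * u) <= (1 + c) * w u.
Hypothesis w_powR : forall u, 0 <= u -> w u <= A * u `^ (p - 2).
Hypothesis w_measurable : measurable_fun setT w.
Hypothesis F_expand : forall x d,
  `|F (x + d) - F x - F1 x * d - F2 x * d ^+ 2 / 2| <= d ^+ 2 * w `|d|.
Hypothesis H_tame : tame H.
Hypothesis H_average : forall x, H x = G (fun y => F (x + sigma * y)).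

Let q0 : 0 < p - 2. Proof. by rewrite subr_gt0. Qed.
Let tF : tame F. Proof. by apply: (expansion_tame q0 _ w_ge0 w_powR F_expand); have := p3; lra. Qed.
Let tF1 : tame F1.
Proof. by apply: (expansion_tame1 q0 _ w_ge0 w_scale w_powR F_expand); have := p3; lra. Qed.
Let tF2 : tame F2.
Proof. by apply: (expansion_tame2 q0 w_ge0 w_scale w_powR F_expand). Qed.

Definition step_error : R :=
  Ex P (fun v => D v ^+ 2 * w `|D v|) + G (fun z => (sigma * z) ^+ 2 * w `|sigma * z|).

Let A0 : 0 <= A.
Proof. by have := le_trans (w_ge0 ler01) (w_powR ler01); rewrite powR1 mulr1. Qed.

Let sqr_powR (x : R) : x ^+ 2 * `|x| `^ (p - 2) = `|x| `^ p.
Proof.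
have [->|x0] := eqVneq x 0; first by rewrite normr0 expr0n/= mul0r powR0// gt_eqF//; have := p2; lra.
rewrite -real_normK ?num_real// -powR_mulrn// -powRD ?normr_eq0 ?x0 ?implybT//.
by congr (_ `^ _); ring.
Qed.

Lemma step_error_integrable : L1 P (fun v => D v ^+ 2 * w `|D v|) /\
  L1 (gauss R) (fun z => (sigma * z) ^+ 2 * w `|sigma * z|).
Proof.
have b (x : R) : `|x ^+ 2 * w `|x| | <= A * `|x| `^ p.
  rewrite ger0_norm; last by rewrite mulr_ge0 ?sqr_ge0 ?w_ge0.
  by rewrite -sqr_powR mulrCA ler_wpM2l ?sqr_ge0 ?w_powR.
have mw (dd : measure_display) (X : measurableType dd) (f : X -> R) : measurable_fun setT f ->
    measurable_fun setT (fun v => f v ^+ 2 * w `|f v|).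
  move=> mf; apply: measurable_funM; first exact: measurable_funX.
  by apply: (measurableT_comp w_measurable); exact: measurableT_comp.
split.
- apply: (L1_le _ _ (L1Z A DLp.2)); first exact: (mw _ _ _ DLp.1).
  by move=> v; exact: b.
- have p0 : 0 < p by have := p2; lra.
  have tp : tame (fun z => A * `|sigma * z| `^ p).
    apply: tameZ; apply: eq_tame (tame_affine sigma 0 (tame_powR p0)) => z.
    by rewrite addr0.
  apply: (L1_le _ _ (tame_L1 tp)); last by move=> z; exact: b.
  apply: (mw _ _ (fun z : R => sigma * z)); exact: measurable_funM.
Qed.

Let average_error x : `|H x - F x - F2 x * sigma ^+ 2 / 2| <=
  G (fun z => (sigma * z) ^+ 2 * w `|sigma * z|).
Proof.
have ta : tame (fun z => F (x + sigma * z)).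
  by apply: eq_tame (tame_affine sigma x tF) => z; rewrite addrC.
have l1 := tame_L1 (@tame_id R); have l2 := tame_L1 (tameX 2 (@tame_id R)).
have tl := tame_L1 ta.
have -> : H x - F x - F2 x * sigma ^+ 2 / 2 =
   G (fun z => F (x + sigma * z) - F x - F1 x * sigma * z - F2 x * sigma ^+ 2 / 2 * z ^+ 2).
  rewrite ExB; [|apply: L1B; [apply: L1B => //; exact: L1_cst|exact: L1Z]|exact: L1Z l2].
  rewrite ExB; [|apply: L1B => //; exact: L1_cst|exact: L1Z].
  rewrite ExB//; last exact: L1_cst.
  by rewrite Ex_cst ExZ// ExZ// Ex_gauss_id Ex_gauss_sqr -H_average; ring.
apply: Ex_norm_le.
- apply: L1_measurable (gauss R) _ _.
  apply: L1B; last exact: L1Z l2.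
  by apply: L1B; [apply: L1B => //; exact: L1_cst|exact: L1Z].
- exact: step_error_integrable.2.
- move=> z; have := F_expand x (sigma * z).
  rewrite (_ : F2 x * (sigma * z) ^+ 2 / 2 = F2 x * sigma ^+ 2 / 2 * z ^+ 2).
    by rewrite mulrA.
  by field.
Qed.

Lemma expansion_L1 k (V : Omega -> R) : Lp P p V ->
  [/\ L1 P (fun v => F (V v)), L1 P (fun v => H (V v)),
      L1 P (fun v => F1 (V v) * D (iter k T v)),
      L1 P (fun v => F2 (V v)) & L1 P (fun v => F2 (V v) * D (iter k T v) ^+ 2)].
Proof.
move=> LV; have [C C0 gr] := expansion_growth p2 p3 w_ge0 w_scale w_powR F_expand.
have p2' := p2.
have Ld := Lp_iter k DLp; set dk := fun v => D (iter k T v).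
(* The terms in F, F1 and F2 are dominated by multiples of U^p, the growth exponent and the power of
   the increment adding up to at most p; H is compared with F by [average_error]. *)
pose U v := 1 + `|V v| + `|dk v|.
have LU : Lp P p U.
  by apply: (LpD p1); [apply: (LpD p1); [exact: Lp_cst|exact: Lp_norm]|exact: Lp_norm].
have U1 v : 1 <= U v by rewrite /U -addrA lerDl addr_ge0.
have U0 v : 0 <= U v by exact: le_trans (U1 v).
have VU v : 1 + `|V v| <= U v by rewrite lerDl.
have dU v : `|dk v| <= U v by rewrite /U lerDr addr_ge0.
have UU v : U v `^ p <= `|U v| `^ p by rewrite ger0_norm.
have pow a v : 0 <= a -> (1 + `|V v|) `^ a <= U v `^ a.
  by move=> a0; apply: le_powR => //; rewrite addr_ge0.
have split_pow a b v : a + b = p -> U v `^ a * U v `^ b = U v `^ p.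
  by move=> <-; rewrite powR_mulD// (lt_le_trans ltr01).
have powU a v : a <= p -> U v `^ a <= U v `^ p by move=> ap; exact: ler_powR.
have mF g : tame g -> measurable_fun setT (fun v => g (V v)).
  by move=> tg; apply: (measurableT_comp (tame_measurable tg)); exact: LV.1.
have lF : L1 P (fun v => F (V v)).
  apply: (Lp_dominated (C := C) LU (mF _ tF)) => v.
  have [h _ _] := gr (V v); apply: (le_trans h); rewrite ler_wpM2l//.
  by rewrite (le_trans (pow _ _ _))//; lra.
have lF2 : L1 P (fun v => F2 (V v)).
  apply: (Lp_dominated (C := C) LU (mF _ tF2)) => v.
  have [_ _ h] := gr (V v); apply: (le_trans h); rewrite ler_wpM2l//.
  rewrite (le_trans (pow _ _ _))//; first by lra.
  by rewrite (le_trans (powU _ _ _))//; lra.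
split => //.
- set c := G (fun z => (sigma * z) ^+ 2 * w `|sigma * z|).
  apply: L1_le (L1D (L1D (L1_norm lF) (L1Z (sigma ^+ 2 / 2) (L1_norm lF2))) (L1_cst P c)).
    exact: mF.
  move=> v; have := average_error (V v); rewrite -/c.
  set a := F2 (V v) * sigma ^+ 2 / 2.
  have -> : sigma ^+ 2 / 2 * `|F2 (V v)| = `|a|.
    have s2 : 0 <= sigma ^+ 2 / 2 by rewrite divr_ge0// sqr_ge0.
    have -> : a = sigma ^+ 2 / 2 * F2 (V v) by rewrite /a; ring.
    by rewrite normrM (ger0_norm s2).
  have := ler_normD (H (V v) - F (V v) - a) (F (V v) + a).
  rewrite (_ : H (V v) - F (V v) - a + (F (V v) + a) = H (V v)); last by ring.
  have := ler_normD (F (V v)) a; lra.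
- apply: (Lp_dominated LU (C := C)).
    by apply: measurable_funM; [exact: mF|exact: Ld.1].
  move=> v; have [_ h _] := gr (V v); rewrite normrM.
  rewrite (le_trans (ler_wpM2r _ h))// -mulrA ler_wpM2l//.
  rewrite (le_trans _ (UU v))// -(split_pow (p - 1) 1); last by ring.
  apply: ler_pM; rewrite ?powR_ge0 ?powRr1//; first by apply: pow; lra.
  exact: dU.
- apply: (Lp_dominated LU (C := C)).
    by apply: measurable_funM; [exact: mF|apply: measurable_funX; exact: Ld.1].
  move=> v; have [_ _ h] := gr (V v); rewrite normrM.
  rewrite (le_trans (ler_wpM2r _ h))// -mulrA ler_wpM2l//.
  rewrite (le_trans _ (UU v))// -(split_pow (p - 2) 2); last by ring.
  apply: ler_pM; rewrite ?powR_ge0//; first by apply: pow; lra.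
  by rewrite powR_mulrn// normrX lerXn2r ?nnegrE//; exact: dU.
Qed.

(** Both F (M (k+1)) and H (M k) are expanded around M k. The first-order term vanishes by the
    martingale property or by Gaussian symmetry; the second-order term is kept, because the
    conditional variance of an increment need not be constant. *)
Lemma lindeberg_step k :
  `|Ex P (fun v => F (M k.+1 v)) - Ex P (fun v => H (M k v))
    - 2^-1 * Ex P (fun v => F2 (M k v) * (D (iter k.+1 T v) ^+ 2 - sigma ^+ 2))|
  <= step_error.
Proof.
have LM m := Lp_birkhoff m DLp.
have [lF0 lH lF1 lF2 lF2d] := expansion_L1 k.+1 (LM k).
have [lFS _ _ _ _] := expansion_L1 k.+1 (LM k.+1).
set dk := fun v => D (iter k.+1 T v) in lF1 lF2d *.
have l2 : L1 P (fun v => F2 (M k v) * (dk v ^+ 2 - sigma ^+ 2)).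
  apply: eq_L1 (L1B lF2d (L1Z (sigma ^+ 2) lF2)) => v.
  by rewrite mulrBr; congr (_ - _); rewrite mulrC.
have z1 : Ex P (fun v => F1 (M k v) * dk v) = 0.
  apply: (Ex_mul_increment TK TinvK Tpres sF (Lp_L1 p1 DLp) D0) => //.
  apply: (adapted_comp (tame_measurable tF1)).
  exact: (adapted_birkhoff TinvK sF F0T mD).
have -> : Ex P (fun v => F (M k.+1 v)) - Ex P (fun v => H (M k v))
    - 2^-1 * Ex P (fun v => F2 (M k v) * (dk v ^+ 2 - sigma ^+ 2)) =
   Ex P (fun v => F (M k.+1 v) - H (M k v) - 2^-1 * (F2 (M k v) * (dk v ^+ 2 - sigma ^+ 2))
      - F1 (M k v) * dk v).
  rewrite ExB//; last by apply: L1B; [exact: L1B|exact: L1Z].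
  rewrite z1 subr0 ExB//; [|exact: L1B|exact: L1Z].
  by rewrite ExZ// ExB.
have [le1 _] := step_error_integrable.
have le1' : L1 P (fun v => dk v ^+ 2 * w `|dk v|) by exact: (L1_iter Tpres k.+1 le1).
set c := G (fun z => (sigma * z) ^+ 2 * w `|sigma * z|).
have -> : step_error = Ex P (fun v => dk v ^+ 2 * w `|dk v| + c).
  rewrite ExD//; last exact: L1_cst.
  rewrite Ex_cst /step_error; congr (_ + _).
  by rewrite -(Ex_iter Tpres k.+1 (L1_measurable le1)).
apply: Ex_norm_le.
- apply: (L1_measurable (P := P)).
  by apply: L1B => //; apply: L1B; [exact: L1B|exact: L1Z].
- by apply: L1D => //; exact: L1_cst.
- move=> v; have e1 := F_expand (M k v) (dk v); have e2 := average_error (M k v).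
  rewrite birkhoffS -/(dk v); rewrite -/c in e2.
  move: e1 e2; rewrite !ler_norml => /andP[? ?] /andP[? ?].
  by apply/andP; split; lra.
Qed.

End lindeberg_step.

Lemma ltn_half_double i j : (i < j./2)%N -> (i.*2.+2 <= j)%N.
Proof. by rewrite -doubleS; lia. Qed.

(** When [0, n] is cut into blocks of length m, the two halves of pair number i meet at time 2 i m +
    m, at least J - 2 i - 1 block lengths before n. This remaining time fixes the smoothing
    scale. *)
Lemma odd_block_index i J m n : (i.*2.+2 <= J)%N -> (J * m <= n)%N ->
  [/\ (0 < J - i.*2 - 1)%N, ((J - i.*2 - 1) * m <= n - i * (m + m) - m)%N
    & (i * (m + m) + m + m <= n)%N].
Proof.
move=> iJ Jn; split; first by lia.
  have -> : ((J - i.*2 - 1) * m = J * m - i * (m + m) - m)%N.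
    by rewrite !mulnBl mul1n addnn -doubleMr doubleMl.
  by lia.
have := leq_mul iJ (leqnn m); rewrite -doubleS -doubleMl mulSn addnn -doubleMr.
by move=> h; apply: leq_trans Jn; move: h; rewrite doubleD -addnn; lia.
Qed.

Lemma room_for_block b m n : (0 < m)%N -> (b + m <= n)%N ->
  [/\ (0 < n - b)%N, (0 < n)%N, (m <= n)%N & (m <= n - b)%N].
Proof. by move=> m0 bmn; split; lia. Qed.

Lemma room_for_two_blocks b m n : (0 < m)%N -> (b + m + m <= n)%N ->
  (0 < n - b)%N /\ (0 < n - b - m)%N.
Proof. by move=> m0 bmn; split; lia. Qed.

(** * Second-order Lindeberg terms in dyadic blocks *)

Section dyadic_blocks.
Context d (Omega : measurableType d) (R : realType) (P : probability Omega R).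
Variables (T Tinv : {mfun Omega >-> Omega}).
Hypotheses (TK : cancel T Tinv) (TinvK : cancel Tinv T).
Hypothesis Tpres : measure_preserving P T.
Variable F0 : set (set Omega).
Hypothesis sF : sigma_subalgebra F0.
Hypothesis F0T : F0 `<=` preimage_set_system setT T F0.
Variables (p sigma : R).
Hypotheses (p2 : 2 < p) (p3 : p < 3).
Variable D : Omega -> R.
Hypothesis mD : measF F0 D.
Hypothesis DLp : Lp P p D.
Hypothesis D0 : forall A, F0 A -> (\int[P]_(w in A) (D (T w))%:E = 0)%E.
Hypothesis Dvar : Ex P (fun v => D v ^+ 2) = sigma ^+ 2.
Notation M := (birkhoff T D).
Notation G := (Ex (gauss R)).

Let p1 : 1 <= p. Proof. by have := p2; lra. Qed.

(* The Hoelder conjugate exponent of p / 2. *)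
Let p' := p / (p - 2).

Let p'1 : 1 <= p'.
Proof. by have p2' := p2; rewrite /p' ler_pdivlMr; lra. Qed.

(** Pointwise Young inequality, by comparing |h| with |V|^(p-2): the product is at most |V|^p or
    |h|^p'. *)
Lemma L1_mul_sqr h V : Lp P p' h -> Lp P p V -> L1 P (fun v => h v * V v ^+ 2).
Proof.
move=> [mh lh] [mV lV]; have p2' := p2; apply: L1_le (L1D lh lV).
  by apply: measurable_funM => //; exact: measurable_funX.
move=> v; rewrite normrM normrX.
have [y0|y0] := eqVneq (V v) 0.
  by rewrite y0 normr0 expr0n/= mulr0 addr_ge0 ?powR_ge0.
have [x0|x0] := eqVneq (h v) 0.
  by rewrite x0 normr0 mul0r addr_ge0 ?powR_ge0.
move: x0 y0; rewrite -!normr_gt0; move: `|h v| `|V v| => x y x0 y0.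
have [xy|yx] := leP x (y `^ (p - 2)).
  rewrite (le_trans _ (_ : y `^ p <= _))//; last by rewrite lerDr powR_ge0.
  have -> : y `^ p = y `^ (p - 2) * y ^+ 2.
    by rewrite -powR_mulrn ?ltW// powR_mulD//; congr (_ `^ _); ring.
  by rewrite ler_wpM2r// sqr_ge0.
rewrite (le_trans _ (_ : x `^ p' <= _))//; last by rewrite lerDl powR_ge0.
have -> : x `^ p' = x * x `^ (2 / (p - 2)).
  rewrite -[X in _ = X * _](powRr1 (ltW x0)) powR_mulD//; congr (_ `^ _).
  by rewrite /p'; field; lra.
rewrite ler_wpM2l ?(ltW x0)//.
have -> : y ^+ 2 = (y `^ (p - 2)) `^ (2 / (p - 2)).
  rewrite -powRrM -powR_mulrn ?ltW//; congr (_ `^ _); field; lra.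
by apply: le_powR; rewrite ?powR_ge0 ?(ltW yx)//; apply: divr_ge0; lra.
Qed.

Lemma L1_mul_mul h a c : Lp P p' h -> Lp P p a -> Lp P p c ->
  L1 P (fun v => h v * (a v * c v)).
Proof.
move=> lh la lc.
apply: L1_le (L1D (L1_norm (L1_mul_sqr lh la)) (L1_norm (L1_mul_sqr lh lc))).
  by apply: measurable_funM; [exact: lh.1|apply: measurable_funM; [exact: la.1|exact: lc.1]].
move=> v; rewrite !normrM -mulrDr ler_wpM2l// -!expr2.
have := sqr_ge0 (`|a v| - `|c v|); rewrite sqrrB.
have := sqr_ge0 (`|a v|); have := sqr_ge0 (`|c v|); lra.
Qed.

Lemma Lp_conj_le (h V : Omega -> R) : measurable_fun setT h -> Lp P p V ->
  (forall v : Omega, `|h v| <= `|V v| `^ (p - 2)) -> Lp P p' h.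
Proof.
move=> mh [mV lV] hV; split => //; have p2' := p2.
apply: L1_le lV; first exact: measurable_norm_powR.
move=> v; rewrite ger0_norm ?powR_ge0//.
rewrite (_ : p = (p - 2) * p'); last by rewrite /p'; field; lra.
rewrite powRrM le_powR//; rewrite /p'; apply: divr_ge0; lra.
Qed.

Lemma Ex_block_orthogonal k m h : adapted Tinv F0 k h ->
  (forall i, L1 P (fun v => h v * D (iter i T v))) ->
  Ex P (fun v => h v * M m (iter k T v)) = 0.
Proof.
move=> ah lh.
transitivity (Ex P (fun v => \sum_(1 <= i < m.+1) h v * D (iter (i + k) T v))).
  by apply: eq_Ex => v; rewrite /birkhoff big_distrr/=; apply: eq_bigr => i _; rewrite iterD.
rewrite Ex_sum// big_nat_cond big1// => i; rewrite andbT => /andP[i1 _].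
rewrite -(prednK i1) addSn.
apply: (Ex_mul_increment TK TinvK Tpres sF (Lp_L1 p1 DLp) D0) => //.
by apply: (adapted_le TinvK sF F0T _ ah); rewrite leq_addl.
Qed.

Let LM m : Lp P p (M m). Proof. exact: (Lp_birkhoff Tpres p2). Qed.

Let LMT m k : Lp P p (fun v => M m (iter k T v)).
Proof. exact: (Lp_iter Tpres k (LM m)). Qed.

Let LDT k : Lp P p (fun v => D (iter k T v)).
Proof. exact: (Lp_iter Tpres k DLp). Qed.

Lemma Ex_birkhoff_sqr m : Ex P (fun v => M m v ^+ 2) = m%:R * sigma ^+ 2.
Proof.
elim: m => [|m IH].
  by rewrite mul0r -[RHS](Ex_cst P 0); apply: eq_Ex => v; rewrite birkhoff0 expr0n.
have one : Lp P p' (fun=> 1 : R) by exact: Lp_cst.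
have l1 := L1_mul_sqr one (LM m); have l3 := L1_mul_sqr one (LDT m.+1).
have l2 := L1_mul_mul one (LM m) (LDT m.+1).
transitivity (Ex P (fun v => (1 * M m v ^+ 2 + 2 * (1 * (M m v * D (iter m.+1 T v))))
    + 1 * D (iter m.+1 T v) ^+ 2)).
  by apply: eq_Ex => v; rewrite birkhoffS; ring.
rewrite ExD//; last by apply: L1D => //; exact: L1Z.
rewrite ExD//; last exact: L1Z.
rewrite (ExZ _ l2).
have -> : Ex P (fun v => 1 * (M m v * D (iter m.+1 T v))) = 0.
  transitivity (Ex P (fun v => M m v * D (iter m.+1 T v))).
    by apply: eq_Ex => v; rewrite mul1r.
  apply: (Ex_mul_increment TK TinvK Tpres sF (Lp_L1 p1 DLp) D0) => //.
    exact: (adapted_birkhoff TinvK sF F0T mD).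
  by apply: eq_L1 l2 => v; rewrite mul1r.
have -> : Ex P (fun v => 1 * D (iter m.+1 T v) ^+ 2) = sigma ^+ 2.
  rewrite -Dvar -(Ex_iter Tpres m.+1 (f := fun v => D v ^+ 2)).
    by apply: eq_Ex => v; rewrite mul1r.
  by apply: measurable_funX; exact: DLp.1.
have -> : Ex P (fun v => 1 * M m v ^+ 2) = m%:R * sigma ^+ 2.
  by rewrite -IH; apply: eq_Ex => v; rewrite mul1r.
by rewrite -[in RHS]natr1; ring.
Qed.

Notation Y m := (fun v => M m v ^+ 2 - m%:R * sigma ^+ 2).

Lemma L1_mul_Y h m k : Lp P p' h ->
  L1 P (fun v => h v * (M m (iter k T v) ^+ 2 - m%:R * sigma ^+ 2)).
Proof.
move=> lh; apply: eq_L1 (L1B (L1_mul_sqr lh (LMT m k)) (L1Z (m%:R * sigma ^+ 2) (Lp_L1 p'1 lh))) => v.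
by ring.
Qed.

Variables (eps : nat -> R) (B : R).
Hypothesis eps_ge0 : forall m, 0 <= eps m.
Hypothesis Hdual : forall m h V, (0 < m)%N -> measF F0 h -> Lp P p V ->
  (forall v, `|h v| <= `|V v| `^ (p - 2)) ->
  `|Ex P (fun v => h v * Y m v)| <= eps m * (1 + Ex P (fun v => `|V v| `^ p)).
Hypothesis Hmom : forall m, Ex P (fun v => `|M m v| `^ p) <= B * m%:R `^ (p / 2).
Let B0 : 0 <= B.
Proof.
have := Hmom 1; rewrite powR1 mulr1; apply: le_trans.
by apply: Ex_ge0 => v; rewrite powR_ge0.
Qed.

(** [Hdual] is not homogeneous in h. Applying it to h / c, dominated by (1 + |V|)^(p-2), makes the
    size c come out as a factor. *)
Lemma dual_scaled m h V c : (0 < m)%N -> 0 < c -> measF F0 h -> Lp P p V ->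
  (forall v, `|h v| <= c * (1 + `|V v|) `^ (p - 2)) ->
  Ex P (fun v => `|V v| `^ p) <= B ->
  `|Ex P (fun v => h v * Y m v)| <= c * (eps m * (1 + 2 `^ p * (1 + B))).
Proof.
move=> m0 c0 mh LV hV VB.
have p0 : 0 <= p by have := p1; lra.
have LU : Lp P p (fun v => 1 + `|V v|).
  by apply: (LpD p1); [exact: Lp_cst|exact: (Lp_norm p1)].
have mch : measF F0 (fun v => c^-1 * h v).
  by apply: (measF_comp (g := fun x => c^-1 * x)) => //; exact: measurable_funM.
have := Hdual m0 mch LU.
have E : Ex P (fun v => c^-1 * h v * Y m v) = c^-1 * Ex P (fun v => h v * Y m v).
  rewrite -ExZ; first by apply: eq_Ex => v; rewrite mulrA.
  have Lh : Lp P p' h.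
    have LU' := LpZ (c `^ (p - 2)^-1) LU; apply: Lp_conj_le LU' _.
      exact: (measF_measurable sF).
    move=> v; rewrite (le_trans (hV v))// normrM powRM//.
    rewrite (ger0_norm (powR_ge0 _ _)) -powRrM mulVf ?powRr1 ?(ltW c0)//.
      by rewrite (ger0_norm (x := 1 + _))// addr_ge0.
    by have := p2; lra.
  exact: (L1_mul_Y m 0 Lh).
rewrite E normrM ger0_norm ?invr_ge0 ?(ltW c0)// => H.
rewrite -ler_pdivrMl//; apply: (le_trans (H _)).
  move=> v; rewrite normrM gtr0_norm ?invr_gt0// ler_pdivrMl//.
  by rewrite (le_trans (hV v))// (ger0_norm (x := 1 + _))// addr_ge0.
rewrite ler_wpM2l// lerD2l.
have l1 := L1D (L1_cst P 1) LV.2.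
apply: (@le_trans _ _ (Ex P (fun v => 2 `^ p * (1 + `|V v| `^ p)))).
  apply: Ex_le; [exact: LU.2|exact: L1Z|].
  move=> v; rewrite ger0_norm ?addr_ge0//.
  by have := powRD_le p0 (ler01) (normr_ge0 (V v)); rewrite powR1.
by rewrite ExZ// ExD ?Ex_cst//; [rewrite ler_wpM2l ?powR_ge0// lerD2l|exact: L1_cst|exact: LV.2].
Qed.

Variables (n : nat) (F2 W : nat -> R -> R) (K : R).
Hypothesis K0 : 0 < K.
Hypothesis W_mono : forall i j u, (0 < i)%N -> (i <= j)%N -> 0 <= u -> W j u <= W i u.
Hypothesis F2_tame : forall j, (0 < j)%N -> tame (F2 j).
Hypothesis F2_growth : forall j, (0 < j)%N ->
  exists2 C, 0 <= C & forall x, `|F2 j x| <= C * (1 + `|x|) `^ (p - 2).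
Hypothesis F2_modulus : forall j x y, (0 < j)%N -> `|F2 j y - F2 j x| <= 16 * W j `|y - x|.
Hypothesis F2_step : forall j i x, (0 < j)%N ->
  `|F2 (j + i) x - F2 j x| <= 52 * W j (sigma * i%:R `^ 2^-1).
Hypothesis W_sum : forall m J u, (0 < m)%N -> (J * m <= n)%N -> 0 <= u ->
  \sum_(1 <= l < J.+1) W (l * m) u <= K * m%:R^-1 * u `^ (p - 2).
Hypothesis W_end : forall m u, (0 < m)%N -> (m <= n)%N -> 0 <= u ->
  W m u <= K * m%:R `^ ((p - 4) / 2) * (1 + (u / n%:R `^ 2^-1) `^ (p - 2)).
Hypothesis W_ge0 : forall j u, (0 < j)%N -> 0 <= u -> 0 <= W j u.
Hypothesis sigma0 : 0 <= sigma.

(* The second-order Lindeberg terms of the times in ]b, b + m], with the second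
   derivative frozen at time b. *)
Definition block b m :=
  Ex P (fun v => F2 (n - b) (M b v) * (M m (iter b T v) ^+ 2 - m%:R * sigma ^+ 2)).

Let LF2 j (V : Omega -> R) : (0 < j)%N -> Lp P p V -> Lp P p' (fun v => F2 j (V v)).
Proof.
move=> j0 LV; have [C C0 gr] := F2_growth j0.
have LU := LpZ (C `^ (p - 2)^-1) (LpD p1 (Lp_cst P p 1) (Lp_norm p1 LV)).
apply: Lp_conj_le LU _.
  by apply: (measurableT_comp (tame_measurable (F2_tame j0))); exact: LV.1.
move=> v; rewrite (le_trans (gr _))// normrM powRM//.
rewrite (ger0_norm (powR_ge0 _ _)) -powRrM mulVf ?powRr1//.
  by rewrite (ger0_norm (x := 1 + _))// addr_ge0.
by have := p2; lra.
Qed.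

Definition block_gap b m v :=
  F2 (n - b - m) (M (b + m) (iter (b + m) Tinv v)) - F2 (n - b) (M b (iter (b + m) Tinv v)).

(** The square of the block sum is that of each half plus a cross term, which vanishes by the
    martingale property. Freezing the second half at time b + m instead of b costs the gap. *)
Lemma block_split b m : (0 < m)%N -> (b + m + m <= n)%N ->
  block b (m + m) = block b m + block (b + m) m
    - Ex P (fun v => block_gap b m v * Y m v).
Proof.
move=> m0 bmn.
have [b0 bm0] := room_for_two_blocks m0 bmn.
have L1' := LF2 b0 (LM b); have L2' := LF2 bm0 (LM (b + m)).
have La := LMT m b; have Lc := LMT m (b + m).
have la := L1_mul_Y m b L1'; have lc := L1_mul_Y m (b + m) L1'.
have lc2 := L1_mul_Y m (b + m) L2'.
have lac := L1_mul_mul L1' La Lc.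
have -> : Ex P (fun v => block_gap b m v * Y m v) = block (b + m) m -
    Ex P (fun v => F2 (n - b) (M b v) * (M m (iter (b + m) T v) ^+ 2 - m%:R * sigma ^+ 2)).
  rewrite /block subnDA -ExB//.
  rewrite -(Ex_iter Tpres (b + m) (f := fun v => block_gap b m v * Y m v)).
    by apply: eq_Ex => v; rewrite /block_gap iterK// mulrBl.
  apply: measurable_funM; last first.
    by apply: measurable_funB => //; apply: measurable_funX; exact: (LM m).1.
  apply: measurable_funB.
    exact: (measurableT_comp L2'.1 (measurable_iter Tinv _)).
  exact: (measurableT_comp L1'.1 (measurable_iter Tinv _)).
have -> : block b (m + m) = block b m +
    Ex P (fun v => F2 (n - b) (M b v) * (M m (iter (b + m) T v) ^+ 2 - m%:R * sigma ^+ 2)) +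
    2 * Ex P (fun v => F2 (n - b) (M b v) * (M m (iter b T v) * M m (iter (b + m) T v))).
  rewrite /block -ExZ// -ExD// -ExD//; [|exact: L1D|exact: L1Z].
  apply: eq_Ex => v; rewrite birkhoffD -iterD [(m + b)%N]addnC natrD; ring.
have -> : Ex P (fun v => F2 (n - b) (M b v) * (M m (iter b T v) * M m (iter (b + m) T v))) = 0.
  transitivity (Ex P (fun v => F2 (n - b) (M b v) * M m (iter b T v) * M m (iter (b + m) T v))).
    by apply: eq_Ex => v; rewrite mulrA.
  apply: Ex_block_orthogonal.
    have a1 : adapted Tinv F0 (b + m) (fun v => F2 (n - b) (M b v)).
      apply: (adapted_comp (tame_measurable (F2_tame b0))).
      apply: (adapted_le TinvK sF F0T (leq_addr m b)).
      exact: (adapted_birkhoff TinvK sF F0T mD).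
    have a2 : adapted Tinv F0 (b + m) (fun v => M m (iter b T v)).
      by rewrite addnC; apply: (adapted_shift TinvK); exact: (adapted_birkhoff TinvK sF F0T mD).
    exact: (measurable_funM a1 a2).
  move=> i; apply: eq_L1 (L1_mul_mul L1' La (LDT i)) => v; by rewrite mulrA.
rewrite /block; ring.
Qed.

Lemma measF_birkhoff_inv b k : (b <= k)%N -> measF F0 (fun v => M b (iter k Tinv v)).
Proof.
move=> bk; apply: (adapted_le TinvK sF F0T bk).
exact: (adapted_birkhoff TinvK sF F0T mD).
Qed.

Lemma measF_block_gap b m : (0 < m)%N -> (b + m + m <= n)%N -> measF F0 (block_gap b m).
Proof.
move=> m0 bmn.
have [b0 bm0] := room_for_two_blocks m0 bmn.
apply: measurable_funB.
  apply: (measF_comp (tame_measurable (F2_tame bm0)) (h := fun v => M (b + m) (iter (b + m) Tinv v))).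
  exact: measF_birkhoff_inv.
apply: (measF_comp (tame_measurable (F2_tame b0)) (h := fun v => M b (iter (b + m) Tinv v))).
by apply: measF_birkhoff_inv; rewrite leq_addr.
Qed.

(** The position moves from M b to M (b + m) at fixed smoothing, which gives the modulus; then m
    Gaussian steps, of total standard deviation sigma m^(1/2), are added to the smoothing. *)
Lemma block_gap_le b m v : (0 < m)%N -> (b + m + m <= n)%N ->
  `|block_gap b m v| <= 16 * W (n - b - m) `|M m (iter m Tinv v)|
     + 52 * W (n - b - m) (sigma * m%:R `^ 2^-1).
Proof.
move=> m0 bmn; have [_ bm0] := room_for_two_blocks m0 bmn.
rewrite /block_gap; set a := M (b + m) _; set c := M b _.
have -> : F2 (n - b - m) a - F2 (n - b) c =
  (F2 (n - b - m) a - F2 (n - b - m) c) - (F2 (n - b) c - F2 (n - b - m) c) by ring.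
rewrite (le_trans (ler_normB _ _))// lerD//.
  rewrite (le_trans (F2_modulus _ _ bm0))//.
  rewrite (_ : a - c = M m (iter m Tinv v))// /a /c birkhoffD addrC addKr.
  by congr (M m _); rewrite iterD iterKV.
by have := F2_step m c bm0; rewrite subnK//; lia.
Qed.

(** The indices on the left are distinct and lie between 1 and J, so that a sum over pairs of blocks
    is covered by [W_sum]. *)
Lemma sum_odd_le (a : nat -> R) J : (forall i, (0 < i)%N -> 0 <= a i) ->
  \sum_(0 <= i < J./2) a (J - i.*2 - 1)%N <= \sum_(1 <= l < J.+1) a l.
Proof.
move=> a0; elim/ltn_ind: J => -[|[|J]] IH.
- by rewrite !big_geq.
- by rewrite [X in X <= _]big_geq// big_nat1 a0.
- rewrite /= big_nat_recl// big_nat_recr//= big_nat_recr//= subn0 subn1/=.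
  have := IH J (ltnW (leqnn _)).
  rewrite (eq_bigr (fun i => a (J.+2 - i.+1.*2 - 1)%N)); last first.
    by move=> i _; congr (a _); lia.
  have := a0 J.+2 isT; have := a0 J.+1 isT; lra.
Qed.

(** The paired blocks contribute 16 + 52 sigma^(p-2) and an unpaired one 32; together they are below
    twice the first factor. The second factor is that of [dual_scaled]. *)
Definition pass_constant := (32 + 52 * sigma `^ (p - 2)) * (1 + 2 `^ p * (1 + B)).

(* The blocks of length m are merged in pairs; the cost of a pair is an increment
   of F2 tested against M_m^2 - m sigma^2, and these increments are summed before
   the duality bound is applied. An unpaired last block is controlled by W_end. *)
Lemma dyadic_pass m : (0 < m)%N ->
  `|\sum_(0 <= i < (n %/ m)) block (i * m) m
    - \sum_(0 <= i < (n %/ m)./2) block (i * (m + m)) (m + m)|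
  <= K * (2 * pass_constant) * (m%:R `^ ((p - 4) / 2) * eps m).
Proof.
move=> m0; set J := (n %/ m)%N; have p2' := p2.
have Jn : (J * m <= n)%N by rewrite leq_trunc_div.
have s0 : 0 <= sigma `^ (p - 2) by exact: powR_ge0.
have m0R : 0 < m%:R :> R by rewrite ltr0n.
have mq : m%:R^-1 * (m%:R `^ 2^-1) `^ (p - 2) = m%:R `^ ((p - 4) / 2).
  rewrite -powRrM -{1}(powRr1 (ltW m0R)) -powRN powR_mulD//; congr (_ `^ _); by field.
have gap_n i : (i < J./2)%N -> (i * (m + m) + m + m <= n)%N.
  by move=> /ltn_half_double iJ; have [] := odd_block_index iJ Jn.
have pc m' : 0 <= eps m' * (1 + 2 `^ p * (1 + B)).
  by rewrite mulr_ge0// addr_ge0// mulr_ge0 ?powR_ge0// addr_ge0.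
pose h v := \sum_(0 <= i < J./2) block_gap (i * (m + m)) m v.
have mh : measF F0 h.
  rewrite /h /measF.
  rewrite (_ : (fun v => _) = (fun v => \sum_(i < J./2) block_gap (i * (m + m)) m v)).
    by apply: measurable_sum => i; apply: measF_block_gap => //; exact: gap_n.
  by apply/funext => v; rewrite big_mkord.
have hle : `|Ex P (fun v => h v * Y m v)| <=
    K * m%:R `^ ((p - 4) / 2) * (16 + 52 * sigma `^ (p - 2)) * (eps m * (1 + 2 `^ p * (1 + B))).
  (* Normalized by m^(1/2), so that its moment of order p is at most B whatever m is. *)
  pose V v := (m%:R `^ 2^-1)^-1 * M m (iter m Tinv v).
  have r0 : 0 < m%:R `^ 2^-1 :> R by rewrite powR_gt0.
  have LMinv : Lp P p (fun v => M m (iter m Tinv v)).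
    split.
      apply: (measurableT_comp (LM m).1); exact: measurable_iter.
    exact: (L1_iter_inv TK Tpres m (LM m).2).
  apply: (dual_scaled (V := V)) => //.
  - by rewrite mulr_gt0// ?mulr_gt0 ?powR_gt0//; lra.
  - exact: (LpZ _).
  - move=> v; rewrite /h (le_trans (ler_norm_sum _ _ _))//.
    set u := `|M m (iter m Tinv v)|; set t := sigma * m%:R `^ 2^-1.
    have t0 : 0 <= t by rewrite mulr_ge0 ?powR_ge0.
    (* The remaining time for pair number i is at least (J - 2 i - 1) m, and W decreases when the
       scale grows. *)
    have sumW x : 0 <= x -> \sum_(0 <= i < J./2) W (n - i * (m + m) - m) x <= K * m%:R^-1 * x `^ (p - 2).
      move=> x0; apply: le_trans (W_sum m0 Jn x0).
      apply: le_trans (sum_odd_le J (a := fun l => W (l * m) x) _); last first.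
        by move=> i i0; apply: W_ge0 => //; rewrite muln_gt0 i0.
      rewrite !big_nat; apply: ler_sum => i /andP[_ iJ].
      have [iJ1 iJ2 _] := odd_block_index (ltn_half_double iJ) Jn.
      by apply: W_mono => //; rewrite muln_gt0 iJ1.
    apply: (@le_trans _ _ (16 * \sum_(0 <= i < J./2) W (n - i * (m + m) - m) u +
        52 * \sum_(0 <= i < J./2) W (n - i * (m + m) - m) t)).
      rewrite !mulr_sumr -big_split/= !big_nat; apply: ler_sum => i /andP[_ iJ].
      by apply: block_gap_le => //; exact: gap_n.
    have su := sumW u (normr_ge0 _); have st := sumW t t0.
    apply: (@le_trans _ _ (16 * (K * m%:R^-1 * u `^ (p - 2)) + 52 * (K * m%:R^-1 * t `^ (p - 2)))).
      by lra.
    have Vu : u = m%:R `^ 2^-1 * `|V v|.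
      by rewrite /V normrM gtr0_norm ?invr_gt0// mulVKf ?gt_eqF.
    rewrite Vu /t !powRM ?powR_ge0//.
    have e1 : K * m%:R^-1 * ((m%:R `^ 2^-1) `^ (p - 2) * `|V v| `^ (p - 2)) =
        K * m%:R `^ ((p - 4) / 2) * `|V v| `^ (p - 2) by rewrite -mq; ring.
    have e2 : K * m%:R^-1 * (sigma `^ (p - 2) * (m%:R `^ 2^-1) `^ (p - 2)) =
        K * m%:R `^ ((p - 4) / 2) * sigma `^ (p - 2) by rewrite -mq; ring.
    rewrite e1 e2 -/(V v).
    have e3 : 16 * (K * m%:R `^ ((p - 4) / 2) * `|V v| `^ (p - 2)) +
       52 * (K * m%:R `^ ((p - 4) / 2) * sigma `^ (p - 2)) =
       K * m%:R `^ ((p - 4) / 2) * (16 * `|V v| `^ (p - 2) + 52 * sigma `^ (p - 2)) by ring.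
    rewrite e3 -[leRHS]mulrA ler_wpM2l ?mulr_ge0 ?powR_ge0 ?(ltW K0)//.
    have q0 : 0 <= p - 2 by lra.
    have v0 := normr_ge0 (V v).
    have o1 : 1 <= (1 + `|V v|) `^ (p - 2).
      have := @le_powR R (p - 2) 1 (1 + `|V v|) q0 ler01; rewrite powR1; apply; lra.
    have o2 : `|V v| `^ (p - 2) <= (1 + `|V v|) `^ (p - 2) by apply: le_powR => //; lra.
    have o3 : sigma `^ (p - 2) <= sigma `^ (p - 2) * (1 + `|V v|) `^ (p - 2) by rewrite ler_peMr.
    lra.
  - have -> : Ex P (fun v => `|V v| `^ p) = (m%:R `^ (p / 2))^-1 * Ex P (fun v => `|M m v| `^ p).
      rewrite -(Ex_iter_inv TK Tpres m (f := fun v => `|M m v| `^ p)); last first.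
        exact: (L1_measurable (LM m).2).
      rewrite -ExZ; last exact: LMinv.2.
      apply: eq_Ex => v; rewrite /V normrM powRM//; congr (_ * _).
      rewrite gtr0_norm ?invr_gt0// -powR_inv1 ?powR_ge0// -!powRrM -powRN.
      by congr (_ `^ _); field.
    rewrite mulrC ler_pdivrMr ?powR_gt0//; exact: Hmom.
have sumE k : (k <= J./2)%N -> \sum_(0 <= i < k.*2) block (i * m) m
    - \sum_(0 <= i < k) block (i * (m + m)) (m + m) =
    \sum_(0 <= i < k) Ex P (fun v => block_gap (i * (m + m)) m v * Y m v).
  elim: k => [|k IH] kJ; first by rewrite !big_geq// subrr.
  rewrite doubleS !big_nat_recr//= -IH ?(ltnW kJ)// block_split ?gap_n//.
  rewrite (_ : (k * (m + m) = k.*2 * m)%N); last by rewrite addnn -doubleMr doubleMl.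
  rewrite (_ : (k.*2.+1 * m = k.*2 * m + m)%N); last by rewrite mulSn addnC.
  ring.
have hE : Ex P (fun v => h v * Y m v) =
    \sum_(0 <= i < J./2) Ex P (fun v => block_gap (i * (m + m)) m v * Y m v).
  transitivity (Ex P (fun v => \sum_(i < J./2) block_gap (i * (m + m)) m v * Y m v)).
    by apply: eq_Ex => v; rewrite /h big_mkord mulr_suml.
  rewrite big_mkord Ex_sum// => i.
  have igap := gap_n i (ltn_ord i).
  have [b0 bm0] := room_for_two_blocks m0 igap.
  apply: (L1_mul_Y m 0 (h := block_gap (i * (m + m)) m)).
  apply: (LpB p'1).
    have L2' := LF2 bm0 (LM (i * (m + m) + m)).
    split; first by apply: (measurableT_comp L2'.1); exact: measurable_iter.
    exact: (L1_iter_inv TK Tpres _ L2'.2).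
  have L2' := LF2 b0 (LM (i * (m + m))).
  split; first by apply: (measurableT_comp L2'.1); exact: measurable_iter.
  exact: (L1_iter_inv TK Tpres _ L2'.2).
have last_le : (0 < J)%N -> `|block (J.-1 * m) m| <=
    K * m%:R `^ ((p - 4) / 2) * 32 * (eps m * (1 + 2 `^ p * (1 + B))).
  move=> J0; set b := (J.-1 * m)%N.
  have bm : (b + m <= n)%N by apply: leq_trans Jn; rewrite /b -{2}(prednK J0) mulSn addnC.
  have [b0 n0' mn mnb] := room_for_block m0 bm.
  have n0 : 0 < n%:R :> R by rewrite ltr0n.
  (* Since M_m^2 - m sigma^2 has mean 0, the constant F2 (n - b) 0 may be subtracted, which turns
     the second derivative into an increment. The position is of order n^(1/2), hence the
     normalization by n below. *)
  pose g v := F2 (n - b) (M b (iter b Tinv v)) - F2 (n - b) 0.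
  have LMinv : Lp P p (fun v => M b (iter b Tinv v)).
    split.
      apply: (measurableT_comp (LM b).1); exact: measurable_iter.
    exact: (L1_iter_inv TK Tpres b (LM b).2).
  have -> : block b m = Ex P (fun v => g v * Y m v).
    have LF := LF2 b0 (LM b).
    have lY : L1 P (Y m) by apply: eq_L1 (L1_mul_Y m 0 (Lp_cst P p' 1)) => v; rewrite mul1r.
    have lY' := L1_iter Tpres b lY.
    transitivity (block b m - F2 (n - b) 0 * Ex P (Y m)).
      have -> : Ex P (Y m) = 0.
        rewrite ExB ?Ex_birkhoff_sqr ?Ex_cst ?subrr//; last exact: L1_cst.
        by apply: eq_L1 (L1_mul_sqr (Lp_cst P p' 1) (LM m)) => v; rewrite mul1r.
      by rewrite mulr0 subr0.
    rewrite -(Ex_iter Tpres b (L1_measurable lY)) /block -ExZ//.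
    rewrite -ExB//; [|exact: L1_mul_Y|exact: L1Z].
    rewrite -(Ex_iter Tpres b (f := fun v => g v * Y m v)).
      by apply: eq_Ex => v; rewrite /g iterK// mulrBl.
    apply: measurable_funM; last exact: L1_measurable lY.
    by apply: measurable_funB => //; apply: (measurableT_comp LF.1); exact: measurable_iter.
  pose V v := (n%:R `^ 2^-1)^-1 * M b (iter b Tinv v).
  have r0 : 0 < n%:R `^ 2^-1 :> R by rewrite powR_gt0.
  apply: (dual_scaled (V := V)) => //.
  - by rewrite mulr_gt0// mulr_gt0// powR_gt0.
  - apply: measurable_funB => //.
    apply: (measF_comp (tame_measurable (F2_tame b0)) (h := fun v => M b (iter b Tinv v))).
    exact: measF_birkhoff_inv.
  - exact: (LpZ _).
  - move=> v; rewrite /g (le_trans (F2_modulus _ _ b0))// subr0.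
    set u := `|_|; have u0 : 0 <= u by exact: normr_ge0.
    have w1 : W (n - b) u <= W m u by exact: W_mono.
    have w2 := W_end m0 mn u0.
    have Vu : u / n%:R `^ 2^-1 = `|V v|.
      by rewrite /V normrM gtr0_norm ?invr_gt0// mulrC.
    rewrite Vu in w2.
    have q0 : 0 <= p - 2 by lra.
    have v0 := normr_ge0 (V v).
    have o1 : 1 <= (1 + `|V v|) `^ (p - 2).
      have := @le_powR R (p - 2) 1 (1 + `|V v|) q0 ler01; rewrite powR1; apply; lra.
    have o2 : `|V v| `^ (p - 2) <= (1 + `|V v|) `^ (p - 2) by apply: le_powR => //; lra.
    have o4 : 0 <= K * m%:R `^ ((p - 4) / 2) by rewrite mulr_ge0 ?powR_ge0 ?(ltW K0).
    have o3 : K * m%:R `^ ((p - 4) / 2) * (1 + `|V v| `^ (p - 2)) <=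
       K * m%:R `^ ((p - 4) / 2) * (2 * (1 + `|V v|) `^ (p - 2)).
      by rewrite ler_wpM2l//; lra.
    lra.
  - have -> : Ex P (fun v => `|V v| `^ p) = (n%:R `^ (p / 2))^-1 * Ex P (fun v => `|M b v| `^ p).
      rewrite -(Ex_iter_inv TK Tpres b (f := fun v => `|M b v| `^ p)); last first.
        exact: (L1_measurable (LM b).2).
      rewrite -ExZ; last exact: LMinv.2.
      apply: eq_Ex => v; rewrite /V normrM powRM//; congr (_ * _).
      rewrite gtr0_norm ?invr_gt0// -powR_inv1 ?powR_ge0// -!powRrM -powRN.
      by congr (_ `^ _); field.
    rewrite mulrC ler_pdivrMr ?powR_gt0// (le_trans (Hmom b))// ler_wpM2l//.
    apply: le_powR; rewrite ?ler0n ?ler_nat//; first by lra.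
    exact: leq_trans (leq_addr m b) bm.
have evenE := sumE _ (leqnn _).
set a := m%:R `^ ((p - 4) / 2) in hle last_le *.
have a0 : 0 <= a by exact: powR_ge0.
have e0 := pc m; set e := eps m * (1 + _) in e0 hle last_le *.
have -> : K * (2 * pass_constant) * (a * eps m) = K * a * (2 * (32 + 52 * sigma `^ (p - 2))) * e.
  by rewrite /pass_constant /e; ring.
have Kae : 0 <= K * a * e by rewrite mulr_ge0// mulr_ge0// ltW.
have Kaes : 0 <= K * a * sigma `^ (p - 2) * e by rewrite mulr_ge0// mulr_ge0// mulr_ge0// ltW.
rewrite -hE in evenE.
have [oJ|oJ] := boolP (odd J).
  have JE : J = J./2.*2.+1 by rewrite -[LHS](odd_double_half J) oJ.
  have J0 : (0 < J)%N by rewrite JE.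
  rewrite [in X in `|X - _|]JE big_nat_recr//= addrAC evenE.
  have := last_le J0; rewrite [in J.-1]JE /= => ll.
  rewrite (le_trans (ler_normD _ _))//; lra.
have JE : J = J./2.*2 by rewrite -[LHS](odd_double_half J) (negbTE oJ).
rewrite [in X in `|X - _|]JE evenE; lra.
Qed.

Lemma dyadic_sum : `|\sum_(0 <= i < n) block i 1| <=
  K * (2 * pass_constant) * \sum_(0 <= l < n) (2 ^ l)%:R `^ ((p - 4) / 2) * eps (2 ^ l).
Proof.
pose Q l := \sum_(0 <= i < n %/ 2 ^ l) block (i * 2 ^ l) (2 ^ l).
have Q0 : Q 0%N = \sum_(0 <= i < n) block i 1.
  by rewrite /Q expn0 divn1; apply: eq_bigr => i _; rewrite muln1.
(* As 2^n > n, level n contains no complete block and the telescoping sum has no terminal term. *)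
have Qn : Q n = 0.
  by rewrite /Q (divn_small (ltn_expl n (ltnSn 1))) (big_geq (leqnn 0)).
have -> : \sum_(0 <= i < n) block i 1 = - \sum_(0 <= l < n) (Q l.+1 - Q l).
  by rewrite telescope_sumr// Qn Q0 sub0r opprK.
rewrite normrN mulr_sumr (le_trans (ler_norm_sum _ _ _))//; apply: ler_sum => l _.
have l0 : (0 < 2 ^ l)%N by rewrite expn_gt0.
have := dyadic_pass l0; rewrite distrC /Q.
have <- : (n %/ 2 ^ l.+1 = (n %/ 2 ^ l)./2)%N by rewrite -divn2 -divnMA expnSr.
by have -> : (2 ^ l + 2 ^ l = 2 ^ l.+1)%N by rewrite addnn expnS mul2n.
Qed.

End dyadic_blocks.

Lemma sum_nat_subn (V : nmodType) (f : nat -> V) n :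
  \sum_(0 <= k < n) f (n - k)%N = \sum_(1 <= j < n.+1) f j.
Proof.
rewrite big_nat_rev/= add0n big_add1/= !big_nat.
by apply: eq_bigr => k /andP[_ kn]; rewrite subKn.
Qed.

(** * Standard deviations of Gaussian sums as smoothing scales *)

Section gaussian_scale.
Context (R : realType) (p r sigma : R).
Hypotheses (p2 : 2 < p) (p3 : p < 3) (r0 : p - 2 <= r) (rp : r <= p) (sigma0 : 0 < sigma).

(* The standard deviation of a sum of j independent N(0, sigma^2) variables. *)
Definition sd (j : nat) : R := sigma * j%:R `^ 2^-1.

Lemma sd_gt0 j : (0 < j)%N -> 0 < sd j.
Proof. by move=> j0; rewrite mulr_gt0// powR_gt0// ltr0n. Qed.

Lemma sd_ge0 j : 0 <= sd j.
Proof. by rewrite mulr_ge0 ?powR_ge0// ltW. Qed.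

Lemma sd_le i j : (i <= j)%N -> sd i <= sd j.
Proof.
by move=> ij; rewrite ler_wpM2l ?(ltW sigma0)// le_powR ?invr_ge0 ?ler0n// ler_nat.
Qed.

Lemma sd_sqr j : sd j ^+ 2 = j%:R * sigma ^+ 2.
Proof.
rewrite exprMn -[X in _ * X]powR_mulrn ?powR_ge0// -powRrM.
by rewrite mulVf// powRr1// mulrC.
Qed.

Lemma sd_powR j a : sd j `^ a = sigma `^ a * j%:R `^ (a / 2).
Proof. by rewrite powRM ?(ltW sigma0) ?powR_ge0// -powRrM [2^-1 * a]mulrC. Qed.

Lemma sd_mul i j : sd (i * j) = sd j * i%:R `^ 2^-1.
Proof. by rewrite /sd natrM powRM// mulrAC mulrA. Qed.

Lemma sum_omega_sd : exists2 C, 0 <= C & forall n m J u, (0 < m)%N -> (J * m <= n)%N ->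
  0 <= u -> \sum_(1 <= l < J.+1) omega p r (sd (l * m)) u
    <= C * n%:R `^ ((r - p + 2) / 2) * m%:R^-1 * u `^ (p - 2).
Proof.
have [C C0 HC] := sum_omega_le p2 p3 r0 rp.
exists (C * sigma `^ (r - p + 2) * sigma `^ (- 2)); first by rewrite !mulr_ge0 ?powR_ge0.
move=> n m J u m0 Jmn u0.
under eq_bigr do rewrite sd_mul.
have h := HC (sd m) (sd n) u J (sd_gt0 m0) u0.
apply: (le_trans (h _)); first by rewrite -sd_mul; exact: sd_le.
rewrite !sd_powR le_eqVlt; apply/orP; left; apply/eqP.
have -> : m%:R `^ (- 2 / 2) = m%:R^-1 :> R.
  by rewrite mulNr divff// powR_inv1 ?ler0n.
ring.
Qed.

Lemma omega_sd_end : exists2 C, 0 <= C & forall n m u, (0 < m)%N -> (m <= n)%N ->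
  0 <= u -> omega p r (sd m) u
    <= C * n%:R `^ ((r - p + 2) / 2) * m%:R `^ ((p - 4) / 2)
       * (1 + (u / n%:R `^ 2^-1) `^ (p - 2)).
Proof.
pose c := sigma^-1 `^ (p - 2).
have c0 : 0 <= c by exact: powR_ge0.
exists (sigma `^ (r - p + 2) * sigma `^ (p - 4) * (1 + c)).
  by rewrite !mulr_ge0 ?powR_ge0// addr_ge0.
move=> n m u m0 mn u0.
apply: (le_trans (omega_le_scale p2 p3 r0 rp (sd_gt0 m0) (sd_le mn) u0)).
rewrite !sd_powR.
have -> : u / sd n = sigma^-1 * (u / n%:R `^ 2^-1).
  by rewrite /sd invfM mulrA [u / sigma]mulrC mulrA.
rewrite powRM ?invr_ge0 ?(ltW sigma0)//; last by rewrite divr_ge0 ?powR_ge0.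
rewrite -/c; set v := (u / _) `^ (p - 2).
have v0 : 0 <= v by exact: powR_ge0.
set a := sigma `^ _; set b := n%:R `^ _; set e := sigma `^ _; set f := m%:R `^ _.
have -> : a * e * (1 + c) * b * f * (1 + v) = a * b * (e * f) * ((1 + c) * (1 + v)) by ring.
rewrite ler_wpM2l ?mulr_ge0 ?powR_ge0//.
have := mulr_ge0 c0 v0; lra.
Qed.

Lemma measurable_omega t : measurable_fun setT (omega p r t).
Proof.
rewrite /omega /base_modulus; apply: measurable_funM => //; case: (r <= 2).
  apply: measurable_minr => //.
  by apply: measurable_funM.
apply: (measurableT_comp (f := @powR R ^~ (p - 2)) (measurable_powR _)).
by apply: measurable_funM.
Qed.

End gaussian_scale.

(** * Rate for smoothed functions of the martingale *)

Section martingale_rate.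
Context d (Omega : measurableType d) (R : realType) (P : probability Omega R).
Variables (T Tinv : {mfun Omega >-> Omega}).
Hypotheses (TK : cancel T Tinv) (TinvK : cancel Tinv T).
Hypothesis Tpres : measure_preserving P T.
Variable F0 : set (set Omega).
Hypothesis sF : sigma_subalgebra F0.
Hypothesis F0T : F0 `<=` preimage_set_system setT T F0.
Variables (p sigma : R).
Hypotheses (p2 : 2 < p) (p3 : p < 3) (sigma0 : 0 < sigma).
Variable D : Omega -> R.
Hypothesis mD : measF F0 D.
Hypothesis DLp : Lp P p D.
Hypothesis D0 : forall A, F0 A -> (\int[P]_(w in A) (D (T w))%:E = 0)%E.
Hypothesis Dvar : Ex P (fun v => D v ^+ 2) = sigma ^+ 2.
Notation M := (birkhoff T D).
Notation G := (Ex (gauss R)).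
Notation Y m := (fun v => M m v ^+ 2 - m%:R * sigma ^+ 2).
Notation s := (sd sigma).
Variables (eps : nat -> R) (B E : R).
Hypothesis eps_ge0 : forall m, 0 <= eps m.
Hypothesis Hdual : forall m h V, (0 < m)%N -> measF F0 h -> Lp P p V ->
  (forall v, `|h v| <= `|V v| `^ (p - 2)) ->
  `|Ex P (fun v => h v * Y m v)| <= eps m * (1 + Ex P (fun v => `|V v| `^ p)).
Hypothesis Hmom : forall m, Ex P (fun v => `|M m v| `^ p) <= B * m%:R `^ (p / 2).
Hypothesis eps_sum : forall n,
  \sum_(0 <= l < n) (2 ^ l)%:R `^ ((p - 4) / 2) * eps (2 ^ l) <= E.
Variable r : R.
Hypotheses (r0 : p - 2 <= r) (rp : r <= p).

Let r_gt0 : 0 < r. Proof. have := p2; have := r0; lra. Qed.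

Lemma sqr_powR_subr (x : R) : x ^+ 2 * `|x| `^ (p - 2) = `|x| `^ p.
Proof.
have [->|x0] := eqVneq x 0; first by rewrite normr0 expr0n/= mul0r powR0// gt_eqF//; have := p2; lra.
rewrite -real_normK ?num_real// -powR_mulrn// powR_mulD ?normr_gt0//.
by congr (_ `^ _); ring.
Qed.

(** The interpolation is [a k], the mean of f smoothed by n - k + 1 Gaussian steps at M k. One step
    is left at k = n so that every function expanded has a second derivative; hence the scale
    [s n.+1] at the other end. *)
Lemma martingale_smooth_rate : exists2 C, 0 <= C & forall n K f c1 c2,
  (0 < n)%N -> 0 < K -> taylor2 r K f c1 c2 ->
  `|Ex P (fun v => smooth f (s 1) (M n v)) - smooth f (s n.+1) 0|
    <= C * K * n%:R `^ ((r - p + 2) / 2).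
Proof.
have [C1 C10 HC1] := smooth_expand p2 p3 r_gt0 rp.
have [C2 C20 HC2] := sum_omega_sd p2 p3 r0 rp sigma0.
have [C3 C30 HC3] := omega_sd_end p2 p3 r0 rp sigma0.
have p2' := p2; have p3' := p3; have q0 : 0 < p - 2 by lra.
have q1 : p - 2 <= 1 by lra.
pose mp := Ex P (fun v => `|D v| `^ p) + G (fun z => `|sigma * z| `^ p).
have mp0 : 0 <= mp by rewrite addr_ge0// Ex_ge0// => z; rewrite powR_ge0.
have B0 : 0 <= B.
  have := Hmom 1; rewrite powR1 mulr1; apply: le_trans.
  by apply: Ex_ge0 => v; rewrite powR_ge0.
have pc0 : 0 <= pass_constant p sigma B.
  by rewrite /pass_constant mulr_ge0 ?addr_ge0 ?mulr_ge0 ?powR_ge0 ?addr_ge0.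
have E0 : 0 <= E by have := eps_sum 0; rewrite big_geq.
(* The summand 1 makes the constant [K'] below strictly positive, as [dyadic_sum] requires. *)
pose C4 := C1 * (C2 + C3) + 1.
have C40 : 0 < C4 by rewrite ltr_wpDl// mulr_ge0// addr_ge0.
exists (C4 * (mp + 2 * pass_constant p sigma B * E)).
  by rewrite mulr_ge0 ?(ltW C40)// addr_ge0// mulr_ge0// mulr_ge0.
move=> n K f c1 c2 n0 K0 tf.
set N := n%:R `^ ((r - p + 2) / 2).
have N0 : 0 < N by rewrite powR_gt0// ltr0n.
pose F j := smooth f (s j); pose F1 j := smooth1 f (s j); pose F2 j := smooth2 f (s j).
pose W j u := C1 * K * omega p r (s j) u.
pose K' := C4 * K * N.
have K'0 : 0 < K' by rewrite !mulr_gt0.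
have CK0 : 0 <= C1 * K by rewrite mulr_ge0// ltW.
have sj j : (0 < j)%N -> 0 < s j by exact: sd_gt0.
have W_ge0 j u : (0 < j)%N -> 0 <= u -> 0 <= W j u.
  by move=> j0 u0; rewrite mulr_ge0// omega_ge0// sj.
have W_scale j : (0 < j)%N -> forall c u, 0 <= c -> 0 <= u -> W j (c * u) <= (1 + c) * W j u.
  move=> j0 c u c0 u0; rewrite /W [leRHS]mulrCA ler_wpM2l//.
  by apply: (omega_scale r p2 p3) => //; exact: sj.
have W_pow j : (0 < j)%N -> forall u, 0 <= u -> W j u <= C1 * K * s j `^ (r - p) * u `^ (p - 2).
  move=> j0 u u0; rewrite /W -[leRHS]mulrA ler_wpM2l//.
  by apply: (omega_powR r p2 p3) => //; exact: sj.
have W_mono i j u : (0 < i)%N -> (i <= j)%N -> 0 <= u -> W j u <= W i u.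
  move=> i0 ij u0; apply: (ler_wpM2l CK0).
  exact: (omega_nonincr rp (sj i i0) (sd_le sigma0 ij) u0).
have W_meas j : measurable_fun setT (W j).
  by apply: measurable_funM => //; exact: measurable_omega.
have F_expand j : (0 < j)%N -> forall x e,
    `|F j (x + e) - F j x - F1 j x * e - F2 j x * e ^+ 2 / 2| <= e ^+ 2 * W j `|e|.
  by move=> j0 x e; apply: HC1 tf _; exact: sj.
have F_tame j : (0 < j)%N -> tame (F j).
  move=> j0; exact: (expansion_tame q0 q1 (fun u => W_ge0 j u j0) (W_pow j j0) (F_expand j j0)).
have F_avg i j x : (0 < j)%N -> F (i + j)%N x = G (fun y => F j (x + s i * y)).
  move=> j0; rewrite /F -(smooth_semigroup _ r_gt0 tf (sd_ge0 sigma0 i) (sj j j0)).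
  congr (smooth f _ x); rewrite -[LHS]ger0_norm ?(sd_ge0 sigma0)// -sqrtr_sqr.
  by congr Num.sqrt; rewrite !sd_sqr natrD; ring.
have s1 : s 1 = sigma by rewrite /sd powR1 mulr1.
have F_avg1 j : (0 < j)%N -> forall x, F j.+1 x = G (fun y => F j (x + sigma * y)).
  by move=> j0 x; have := F_avg 1%N j x j0; rewrite s1 add1n.
have F2_step j i x : (0 < j)%N -> `|F2 (j + i)%N x - F2 j x| <= 52 * W j (sigma * i%:R `^ 2^-1).
  move=> j0; have [->|i0] := posnP i.
    by rewrite addn0 subrr normr0 mulr_ge0// W_ge0// mulr_ge0 ?powR_ge0// ltW.
  have ji0 : (0 < j + i)%N by rewrite addn_gt0 j0.
  apply: (expansion_gauss_average q0 q1 (sj i i0) (fun u => W_ge0 j u j0) (W_scale j j0)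
    (W_pow j j0) (F_expand j j0) _ (F_expand _ ji0)).
    by move=> u u0; apply: W_mono => //; exact: leq_addr.
  by move=> y; rewrite addnC F_avg.
have F2_modulus j x y : (0 < j)%N -> `|F2 j y - F2 j x| <= 16 * W j `|y - x|.
  move=> j0; exact: (expansion_modulus2 (fun u => W_ge0 j u j0) (W_scale j j0) (F_expand j j0)).
have F2_tame j : (0 < j)%N -> tame (F2 j).
  move=> j0; exact: (expansion_tame2 q0 (fun u => W_ge0 j u j0) (W_scale j j0) (W_pow j j0) (F_expand j j0)).
have F2_growth j : (0 < j)%N ->
    exists2 C, 0 <= C & forall x, `|F2 j x| <= C * (1 + `|x|) `^ (p - 2).
  move=> j0; have [C C0 gr] := expansion_growth p2 p3 (fun u => W_ge0 j u j0) (W_scale j j0)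
    (W_pow j j0) (F_expand j j0).
  by exists C => // x; have [] := gr x.
have W_sum m J u : (0 < m)%N -> (J * m <= n)%N -> 0 <= u ->
    \sum_(1 <= l < J.+1) W (l * m)%N u <= K' * m%:R^-1 * u `^ (p - 2).
  move=> m0 Jmn u0; rewrite -mulr_sumr.
  apply: (le_trans (ler_wpM2l CK0 (HC2 n m J u m0 Jmn u0))); rewrite -/N.
  have -> : K' * m%:R^-1 * u `^ (p - 2) = C4 * (K * N * (m%:R^-1 * u `^ (p - 2))).
    by rewrite /K'; ring.
  have -> : C1 * K * (C2 * N * m%:R^-1 * u `^ (p - 2)) =
     C1 * C2 * (K * N * (m%:R^-1 * u `^ (p - 2))) by ring.
  rewrite ler_wpM2r//; first by rewrite !mulr_ge0 ?powR_ge0 ?invr_ge0 ?ler0n// ltW.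
  by rewrite /C4; have := mulr_ge0 C10 C30; lra.
have W_end m u : (0 < m)%N -> (m <= n)%N -> 0 <= u ->
    W m u <= K' * m%:R `^ ((p - 4) / 2) * (1 + (u / n%:R `^ 2^-1) `^ (p - 2)).
  move=> m0 mn u0; apply: (le_trans (ler_wpM2l CK0 (HC3 n m u m0 mn u0))); rewrite -/N.
  set a := m%:R `^ _; set b := 1 + _.
  have b0 : 0 <= b by rewrite addr_ge0 ?powR_ge0.
  have -> : K' * a * b = C4 * (K * N * (a * b)) by rewrite /K'; ring.
  have -> : C1 * K * (C3 * N * a * b) = C1 * C3 * (K * N * (a * b)) by ring.
  rewrite ler_wpM2r//; first by rewrite !mulr_ge0 ?powR_ge0// ltW.
  by rewrite /C4; have := mulr_ge0 C10 C20; lra.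
have blocks := dyadic_sum TK TinvK Tpres sF F0T p2 p3 mD DLp D0 Dvar eps_ge0 Hdual Hmom K'0
  W_mono F2_tame F2_growth F2_modulus F2_step W_sum W_end W_ge0 (ltW sigma0).
pose a k := Ex P (fun v => F (n - k).+1 (M k v)).
have stepk k : (k < n)%N ->
    `|a k.+1 - a k - 2^-1 * block P T sigma D n F2 k 1| <= step_error P sigma D (W (n - k)%N).
  move=> kn; have nk : (0 < n - k)%N by rewrite subn_gt0.
  have := lindeberg_step TK TinvK Tpres sF F0T p2 p3 mD DLp D0
    (fun u => W_ge0 _ u nk) (W_scale _ nk) (W_pow _ nk) (W_meas _) (F_expand _ nk)
    (F_tame (n - k).+1 isT) (F_avg1 _ nk) k.
  rewrite /a subnSK// /block.
  rewrite (_ : (fun v => F2 (n - k)%N (M k v) * (M 1 (iter k T v) ^+ 2 - 1 * sigma ^+ 2)) =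
    (fun v => F2 (n - k)%N (M k v) * (D (iter k.+1 T v) ^+ 2 - sigma ^+ 2)))//.
  by apply/funext => v; rewrite mul1r /birkhoff big_nat1 -iterD add1n.
have tele : `|a n - a 0 - 2^-1 * \sum_(0 <= k < n) block P T sigma D n F2 k 1|
    <= \sum_(0 <= k < n) step_error P sigma D (W (n - k)%N).
  rewrite -telescope_sumr// mulr_sumr -sumrB.
  apply: (le_trans (ler_norm_sum _ _ _)); rewrite !big_nat; apply: ler_sum => k /andP[_ kn].
  exact: stepk.
have errs : \sum_(0 <= k < n) step_error P sigma D (W (n - k)%N) <= K' * mp.
  have eI j : (0 < j)%N -> L1 P (fun v => D v ^+ 2 * W j `|D v|) /\
      L1 (gauss R) (fun z => (sigma * z) ^+ 2 * W j `|sigma * z|).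
    move=> j0; exact: (step_error_integrable sigma p2 DLp (fun u => W_ge0 j u j0) (W_pow j j0) (W_meas j)).
  (* [W_sum] with m = 1 and J = n: the remainders of all the steps add up to a single moment of
     order p. *)
  have sumW x : \sum_(1 <= j < n.+1) x ^+ 2 * W j `|x| <= K' * `|x| `^ p.
    rewrite -mulr_sumr -sqr_powR_subr mulrCA ler_wpM2l ?sqr_ge0//.
    have := W_sum 1%N n `|x| isT; rewrite muln1 invr1 mulr1 => /(_ (leqnn _) (normr_ge0 _)).
    move=> h; apply: le_trans h; apply: ler_sum => l _; rewrite muln1; exact: lexx.
  rewrite (sum_nat_subn (fun j => step_error P sigma D (W j))).
  rewrite /step_error big_split /mp mulrDr.
  have sumL1 (dd : measure_display) (X : measurableType dd) (Q : probability X R) (f' : X -> R) :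
      (forall j, (0 < j)%N -> L1 Q (fun v => f' v ^+ 2 * W j `|f' v|)) ->
      L1 Q (fun v => `|f' v| `^ p) ->
      \sum_(1 <= j < n.+1) Ex Q (fun v => f' v ^+ 2 * W j `|f' v|) <= K' * Ex Q (fun v => `|f' v| `^ p).
    move=> lj lp; rewrite -ExZ// big_add1/= big_mkord -Ex_sum; last by move=> i; exact: lj.
    apply: Ex_le; [by apply: L1_sum => i; exact: lj|exact: L1Z|].
    move=> v; have := sumW (f' v); by rewrite big_add1/= big_mkord.
  apply: lerD.
    by apply: sumL1; [move=> j j0; have [] := eI j j0|exact: DLp.2].
  apply: sumL1; first by move=> j j0; have [] := eI j j0.
  have p0 : 0 < p by lra.
  have tp : tame (fun z => `|sigma * z| `^ p).
    by apply: eq_tame (tame_affine sigma 0 (tame_powR p0)) => z; rewrite addr0.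
  exact: tame_L1.
have aE : Ex P (fun v => smooth f (s 1) (M n v)) - smooth f (s n.+1) 0 = a n - a 0.
  rewrite /a subnn subn0; congr (_ - _).
  by rewrite -[LHS](Ex_cst P); apply: eq_Ex => v; rewrite birkhoff0.
rewrite aE.
have -> : C4 * (mp + 2 * pass_constant p sigma B * E) * K * N =
    K' * mp + K' * (2 * pass_constant p sigma B) * E by rewrite /K'; ring.
have bE := eps_sum n.
set S := \sum_(0 <= k < n) block _ _ _ _ _ _ _ _ in blocks tele.
have KE : K' * (2 * pass_constant p sigma B) *
     \sum_(0 <= l < n) (2 ^ l)%:R `^ ((p - 4) / 2) * eps (2 ^ l) <=
     K' * (2 * pass_constant p sigma B) * E.
  by rewrite ler_wpM2l// mulr_ge0 ?(ltW K'0)// mulr_ge0.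
have KS : `|S| <= K' * (2 * pass_constant p sigma B) * E := le_trans blocks KE.
have := ler_normD (a n - a 0 - 2^-1 * S) (2^-1 * S).
rewrite subrK normrM ger0_norm ?invr_ge0//.
move=> h; apply: (le_trans h); apply: lerD; first exact: (le_trans tele errs).
by apply: le_trans KS; rewrite ler_piMl// invf_le1// ler1n.
Qed.

End martingale_rate.

(** * Pointwise inequalities for moments of order p *)

Section moment_bound.
Context (R : realType) (p : R).
Hypotheses (p2 : 2 < p) (p3 : p < 3).

(** Near 0, (1+t)^p = (1+t)^2 (1+t)^(p-2), and Bernoulli's inequality with exponent p - 2 < 1 gives
    the exact linear term p t. For |t| > 1/2, |1 + t| <= 3 |t| and the last term absorbs everything,
    27 bounding 3^p. *)
Lemma norm_powR_add1_le (t : R) :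
  `|1 + t| `^ p <= 1 + p * t + 64 * (t ^+ 2 + `|t| `^ p).
Proof.
have p2' := p2; have p3' := p3; have p0 : 0 <= p by lra.
have tp0 : 0 <= `|t| `^ p by exact: powR_ge0.
have [th|th] := lerP `|t| (2^-1).
  have t1 : 0 < 1 + t by move: th; rewrite ler_norml => /andP[]; lra.
  rewrite gtr0_norm//.
  have -> : (1 + t) `^ p = (1 + t) ^+ 2 * (1 + t) `^ (p - 2).
    by rewrite -powR_mulrn ?(ltW t1)// powR_mulD//; congr (_ `^ _); ring.
  have q0 : 0 <= p - 2 by lra.
  have q1 : p - 2 <= 1 by lra.
  have b : (1 + t) `^ (p - 2) <= 1 + (p - 2) * t by apply: powR_bernoulli => //; lra.
  apply: (le_trans (ler_wpM2l (sqr_ge0 _) b)).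
  have -> : (1 + t) ^+ 2 * (1 + (p - 2) * t) =
     1 + p * t + t ^+ 2 * (1 + 2 * (p - 2) + (p - 2) * t) by ring.
  rewrite lerD2l.
  have tt : t ^+ 2 * (1 + 2 * (p - 2) + (p - 2) * t) <= t ^+ 2 * 64.
    rewrite ler_wpM2l ?sqr_ge0//; have := ler_norm t.
    have : (p - 2) * t <= 1 * 1.
      rewrite (le_trans (ler_norm _))// normrM ger0_norm//.
      by apply: ler_pM => //; lra.
    lra.
  lra.
set a := `|t| in th tp0 *.
have a0 : 0 <= a by lra.
have h1 : `|1 + t| `^ p <= 27 * a `^ p.
  apply: (@le_trans _ _ ((3 * a) `^ p)).
    apply: le_powR => //; rewrite (le_trans (ler_normD _ _))// normr1 -/a; lra.
  rewrite powRM// ler_wpM2r//.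
  apply: (@le_trans _ _ (3 `^ 3%:R)); last by rewrite powR_mulrn// -natrX.
  by apply: ler_powR; [rewrite ler1n|lra].
have h2 : t ^+ 2 = a ^+ 2 by rewrite real_normK// num_real.
have h3 : a <= 2 * a ^+ 2 by rewrite expr2 mulrA ler_peMl//; lra.
have h4 : - (3 * a) <= p * t.
  have : `|p * t| <= 3 * a by rewrite normrM ger0_norm// -/a ler_wpM2r//; lra.
  by rewrite ler_norml => /andP[].
rewrite h2; have := sqr_ge0 a; lra.
Qed.

Lemma norm_powR_add_le (x h : R) :
  `|x + h| `^ p <= `|x| `^ p + p * (x * `|x| `^ (p - 2)) * h
     + 64 * (`|x| `^ (p - 2) * h ^+ 2 + `|h| `^ p).
Proof.
have p2' := p2.
have [->|x0] := eqVneq x 0.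
  rewrite add0r normr0 powR0 ?mul0r ?mulr0 ?mul0r; last by rewrite gt_eqF//; lra.
  rewrite powR0 ?mul0r ?add0r; last by rewrite gt_eqF//; lra.
  by rewrite ler_peMl ?powR_ge0// ler1n.
have [t hE] : exists t, h = x * t by exists (h / x); rewrite mulrC divfK.
have E : x ^+ 2 * `|x| `^ (p - 2) = `|x| `^ p := sqr_powR_subr p2 x.
have -> : x + h = x * (1 + t) by rewrite hE; ring.
rewrite hE !normrM !powRM//.
have -> : `|x| `^ p + p * (x * `|x| `^ (p - 2)) * (x * t) +
  64 * (`|x| `^ (p - 2) * (x * t) ^+ 2 + `|x| `^ p * `|t| `^ p) =
  `|x| `^ p * (1 + p * t + 64 * (t ^+ 2 + `|t| `^ p)).
  by rewrite -E; ring.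
by rewrite ler_wpM2l ?powR_ge0// norm_powR_add1_le.
Qed.

Lemma powR_sub2_mul_sqr_le (x y : R) : 0 <= x -> 0 <= y ->
  x `^ (p - 2) * y ^+ 2 <= x `^ p + y `^ p.
Proof.
have p2' := p2; move=> x0 y0; have q0 : 0 <= p - 2 by lra.
have E : p - 2 + 2 = p by ring.
have p0 : 0 < p - 2 + 2 by rewrite E; lra.
by have := powR_mul_leD q0 (ler0n _ 2) p0 x0 y0; rewrite E powR_mulrn.
Qed.

End moment_bound.

(** * Growth of the moments of order p of a martingale *)

Section martingale_moment.
Context d (Omega : measurableType d) (R : realType) (P : probability Omega R).
Variables (T Tinv : {mfun Omega >-> Omega}).
Hypotheses (TK : cancel T Tinv) (TinvK : cancel Tinv T).
Hypothesis Tpres : measure_preserving P T.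
Variable F0 : set (set Omega).
Hypothesis sF : sigma_subalgebra F0.
Hypothesis F0T : F0 `<=` preimage_set_system setT T F0.
Variable p : R.
Hypotheses (p2 : 2 < p) (p3 : p < 3).
Variable D : Omega -> R.
Hypothesis mD : measF F0 D.
Hypothesis DLp : Lp P p D.
Hypothesis D0 : forall A, F0 A -> (\int[P]_(w in A) (D (T w))%:E = 0)%E.
Notation M := (birkhoff T D).

Let p1 : 1 <= p. Proof. by have := p2; lra. Qed.

(** Induction on m through the expansion of |x + h|^p, in which the first-order term is orthogonal
    to the next increment. Young's inequality separates the mixed term |M k|^(p-2) d^2, with d the
    increment, at the scale k^(1/2) of M k. *)
Lemma martingale_moment : exists B, forall m,
  Ex P (fun v => `|M m v| `^ p) <= B * m%:R `^ (p / 2).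
Proof.
have p2' := p2; have p3' := p3; have p0 : 0 <= p by lra.
have q0 : 0 <= p - 2 by lra.
have LM m : Lp P p (M m) := Lp_birkhoff Tpres p2 m DLp.
pose a m := Ex P (fun v => `|M m v| `^ p); pose mp := Ex P (fun v => `|D v| `^ p).
have mp0 : 0 <= mp by apply: Ex_ge0 => v; rewrite powR_ge0.
have lDk k : L1 P (fun v => `|D (iter k T v)| `^ p) := (Lp_iter Tpres k DLp).2.
have mpk k : Ex P (fun v => `|D (iter k T v)| `^ p) = mp.
  exact: (Ex_iter Tpres k (L1_measurable DLp.2)).
pose C := 64 * 16 `^ (p - 2) + 64.
have C0 : 0 <= C by rewrite addr_ge0// mulr_ge0// powR_ge0.
have step k : (0 < k)%N -> a k.+1 <= a k + a k / (4 * k%:R) + C * mp * k%:R `^ ((p - 2) / 2).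
  move=> k0; have k0R : 0 < k%:R :> R by rewrite ltr0n.
  (* As 16^2 = 256, the coefficient 64 of the mixed term becomes 1 / (4 k) in front of the moment of
     M k, a quarter of the relative growth 1 / k that the bound k^(p/2) allows. *)
  pose t : R := 16 * k%:R `^ 2^-1.
  have t0 : 0 < t by rewrite mulr_gt0// powR_gt0.
  set dk := fun v => D (iter k.+1 T v).
  have dkL : Lp P p dk := Lp_iter Tpres k.+1 DLp.
  pose g v := M k v * `|M k v| `^ (p - 2).
  have mg : measurable_fun setT g.
    by apply: measurable_funM; [exact: (LM k).1|apply: measurable_norm_powR; exact: (LM k).1].
  have lg : L1 P (fun v => g v * dk v).
    apply: (L1_le _ _ (L1D (LM k).2 dkL.2)).
      by apply: measurable_funM => //; exact: dkL.1.
    move=> v; rewrite /g !normrM (ger0_norm (powR_ge0 _ _)).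
    have p11 : 0 <= p - 1 by lra.
    have p12 : 0 < p - 1 + 1 by lra.
    have := powR_mul_leD p11 ler01 p12 (normr_ge0 (M k v)) (normr_ge0 (dk v)).
    rewrite subrK powRr1//; apply: le_trans; rewrite ler_wpM2r//.
    have [->|x0] := eqVneq (M k v) 0; first by rewrite normr0 mul0r powR_ge0.
    rewrite -[X in X * _](powRr1 (normr_ge0 _)) powR_mulD ?normr_gt0//.
    by rewrite le_eqVlt; apply/orP; left; apply/eqP; congr (_ `^ _); ring.
  have z0 : Ex P (fun v => g v * dk v) = 0.
    apply: (Ex_mul_increment TK TinvK Tpres sF (Lp_L1 p1 DLp) D0) => //.
    apply: (adapted_comp (g := fun x => x * `|x| `^ (p - 2)) (h := M k)).
      by apply: measurable_funM => //; exact: measurable_norm_powR.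
    exact: (adapted_birkhoff TinvK sF F0T mD).
  have pw v : `|M k.+1 v| `^ p <= `|M k v| `^ p + p * (g v * dk v)
      + (`|M k v| `^ p / (4 * k%:R) + C * k%:R `^ ((p - 2) / 2) * `|dk v| `^ p).
    rewrite birkhoffS -/(dk v).
    apply: (le_trans (norm_powR_add_le p2 p3 _ _)).
    rewrite -/(g v) -[p * g v * dk v]mulrA lerD2l mulrDr.
    set x := `|M k v|; set y := `|dk v|.
    have h := powR_sub2_mul_sqr_le p2 (divr_ge0 (normr_ge0 (M k v)) (ltW t0)) (normr_ge0 (dk v)).
    rewrite -/x -/y in h.
    have tq : 0 < t `^ (p - 2) by rewrite powR_gt0.
    have tqE : t `^ (p - 2) = 16 `^ (p - 2) * k%:R `^ ((p - 2) / 2).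
      by rewrite /t powRM ?powR_ge0// -powRrM [2^-1 * _]mulrC.
    have t2 : t ^+ 2 = 256 * k%:R.
      rewrite /t exprMn -[X in _ * X]powR_mulrn ?powR_ge0// -powRrM mulVf// powRr1//.
      by rewrite -natrX.
    have e1 : x `^ (p - 2) * dk v ^+ 2 = t `^ (p - 2) * ((x / t) `^ (p - 2) * y ^+ 2).
      have xt0 : 0 <= x / t by rewrite divr_ge0 ?(ltW t0)// normr_ge0.
      rewrite mulrA -(powRM _ (ltW t0) xt0) [t * _]mulrC divfK ?gt_eqF//.
      by rewrite /y real_normK// num_real.
    have e2 : t `^ (p - 2) * (x / t) `^ p = x `^ p / (256 * k%:R).
      have ti0 : 0 <= t^-1 by rewrite invr_ge0 ltW.
      rewrite (powRM _ (normr_ge0 _ : 0 <= x) ti0).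
      have -> : t^-1 `^ p = t `^ (- p) by rewrite -(powR_inv1 (ltW t0)) -powRrM mulN1r.
      rewrite mulrCA powR_mulD//; congr (_ * _).
      rewrite (_ : p - 2 - p = - 2); last by ring.
      by rewrite powRN powR_mulrn ?(ltW t0)// t2.
    have h2 := ler_wpM2l (ltW tq) h; rewrite -e1 mulrDr e2 tqE in h2.
    have y0 : 0 <= y `^ p by exact: powR_ge0.
    have k1 : 1 <= k%:R `^ ((p - 2) / 2) :> R.
      have qq : 0 <= (p - 2) / 2 by lra.
      by have := le_powR qq ler01 (_ : 1 <= k%:R); rewrite powR1 ler1n; apply.
    have yk : y `^ p <= k%:R `^ ((p - 2) / 2) * y `^ p by rewrite ler_peMl.
    have e3 : x `^ p / (4 * k%:R) = 64 * (x `^ p / (256 * k%:R)).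
      by field; rewrite gt_eqF.
    rewrite e3 /C.
    set u1 := 16 `^ _ in h2 *; set u2 := k%:R `^ _ in h2 yk *.
    have -> : (64 * u1 + 64) * u2 * y `^ p = 64 * (u1 * u2 * y `^ p) + 64 * (u2 * y `^ p) by ring.
    clearbody x y u1 u2; lra.
  have -> : a k + a k / (4 * k%:R) + C * mp * k%:R `^ ((p - 2) / 2) =
     Ex P (fun v => `|M k v| `^ p + p * (g v * dk v)
      + (`|M k v| `^ p / (4 * k%:R) + C * k%:R `^ ((p - 2) / 2) * `|dk v| `^ p)).
    have l1 := (LM k).2; have l2 := L1Z p lg; have l3 := L1Z (4 * k%:R)^-1 l1.
    have l4 := L1Z (C * k%:R `^ ((p - 2) / 2)) dkL.2.
    have l3' : L1 P (fun v => `|M k v| `^ p / (4 * k%:R)).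
      by apply: eq_L1 l3 => v; rewrite mulrC.
    rewrite ExD; [|exact: L1D|exact: L1D].
    rewrite ExD// ExD// ExZ// z0 mulr0 addr0 (ExZ _ dkL.2) mpk.
    have -> : Ex P (fun v => `|M k v| `^ p / (4 * k%:R)) = a k / (4 * k%:R).
      rewrite [RHS]mulrC /a -(ExZ _ l1); apply: eq_Ex => v; exact: mulrC.
    by rewrite /a; ring.
  apply: Ex_le => //; first exact: (LM k.+1).2.
  have l1 := (LM k).2; have l2 := L1Z p lg; have l3 := L1Z (4 * k%:R)^-1 l1.
  have l4 := L1Z (C * k%:R `^ ((p - 2) / 2)) dkL.2.
  apply: L1D; first exact: L1D.
  by apply: L1D => //; apply: eq_L1 l3 => v; rewrite mulrC.
(* The term mp settles m = 1. In the induction C mp is at most half of this constant, and the other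
   loss is a quarter of it. *)
exists (2 * (C * mp) + mp).
have Cm : 0 <= C * mp by rewrite mulr_ge0.
elim=> [|k IH].
  rewrite powR0 ?gt_eqF// ?mulr0; last by lra.
  rewrite -(Ex_cst P 0) le_eqVlt; apply/orP; left; apply/eqP; apply: eq_Ex => v.
  by rewrite birkhoff0 normr0 powR0// gt_eqF//; lra.
have [->|k0] := posnP k.
  rewrite powR1 mulr1.
  have -> : Ex P (fun v => `|M 1 v| `^ p) = mp.
    by rewrite -(mpk 1%N); apply: eq_Ex => v; rewrite /birkhoff big_nat1.
  lra.
have k0R : 0 < k%:R :> R by rewrite ltr0n.
have := step k k0; rewrite -/(a k.+1).
set u := k%:R `^ ((p - 2) / 2).
have u0 : 0 <= u by exact: powR_ge0.
have uE : k%:R `^ (p / 2) = k%:R * u.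
  rewrite /u -[X in _ = X * _](powRr1 (ltW k0R)) powR_mulD//; congr (_ `^ _); by field.
have uS : (k%:R + 1) * u <= k.+1%:R `^ (p / 2).
  have k1 : 0 < k.+1%:R :> R by rewrite ltr0n.
  have -> : p / 2 = 1 + (p - 2) / 2 by field.
  rewrite -powR_mulD// powRr1 ?(ltW k1)// natr1 ler_wpM2l ?(ltW k1)// le_powR ?(ltW k0R) ?ler_nat//.
  by lra.
have IH' : a k <= (2 * (C * mp) + mp) * (k%:R * u) by rewrite -uE.
have IH2 : a k / (4 * k%:R) <= (2 * (C * mp) + mp) * u / 4.
  rewrite ler_pdivrMr ?mulr_gt0//; apply: (le_trans IH').
  by rewrite le_eqVlt; apply/orP; left; apply/eqP; field.
move=> h; apply: (le_trans h).
have B0 : 0 <= 2 * (C * mp) + mp by rewrite addr_ge0 ?mulr_ge0.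
apply: (le_trans _ (ler_wpM2l B0 uS)).
have Cu : 0 <= C * mp * u by rewrite mulr_ge0.
have mu : 0 <= mp * u by rewrite mulr_ge0.
clearbody u mp C a; lra.
Qed.

End martingale_moment.

(** * Square-integrable variables and convergence in L^2 *)

Section square_integrable.
Context d (Omega : measurableType d) (R : realType) (P : probability Omega R).
Implicit Types f g : Omega -> R.

Lemma Lp2_sqr f : Lp P 2 f -> L1 P (fun w => f w ^+ 2).
Proof.
by move=> [_ lf]; apply: eq_L1 lf => w; rewrite powR_mulrn// real_normK// num_real.
Qed.

Lemma Lp2_mul f g : Lp P 2 f -> Lp P 2 g -> L1 P (fun w => f w * g w).
Proof.
move=> lf lg; apply: (L1_le _ _ (L1D (Lp2_sqr lf) (Lp2_sqr lg))).
  by apply: measurable_funM; [exact: lf.1|exact: lg.1].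
move=> w; rewrite ler_norml.
have := sqr_ge0 (f w - g w); have := sqr_ge0 (f w + g w); rewrite sqrrB sqrrD.
have := sqr_ge0 (f w); have := sqr_ge0 (g w) => ? ? ? ?; apply/andP; split; lra.
Qed.

Lemma Lp_Lp2 p f : 2 <= p -> Lp P p f -> Lp P 2 f.
Proof.
move=> p2 lf; split; first exact: lf.1.
by apply: (Lp_L1_powR lf).
Qed.

Lemma Ex_sqr_ge0 f : 0 <= Ex P (fun w => f w ^+ 2).
Proof. by apply: Ex_ge0 => w; exact: sqr_ge0. Qed.

(** Nonnegativity of E (s f - t g)^2 at (s, t) = (b, c), and at (c, a + 1) when b = 0. *)
Lemma Ex_mul_sqr_le f g : Lp P 2 f -> Lp P 2 g ->
  Ex P (fun w => f w * g w) ^+ 2 <= Ex P (fun w => f w ^+ 2) * Ex P (fun w => g w ^+ 2).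
Proof.
move=> lf lg; have lfg := Lp2_mul lf lg.
have lf2 := Lp2_sqr lf; have lg2 := Lp2_sqr lg.
set a := Ex P (fun w => f w ^+ 2); set b := Ex P (fun w => g w ^+ 2).
set c := Ex P (fun w => f w * g w).
have H (s t : R) : 0 <= s ^+ 2 * a + t ^+ 2 * b - 2 * s * t * c.
  have -> : s ^+ 2 * a + t ^+ 2 * b - 2 * s * t * c =
     Ex P (fun w => s ^+ 2 * f w ^+ 2 + t ^+ 2 * g w ^+ 2 - 2 * s * t * (f w * g w)).
    rewrite ExB; [|by apply: L1D; exact: L1Z|exact: L1Z].
    by rewrite ExD ?ExZ//; exact: L1Z.
  apply: Ex_ge0 => w.
  have -> : s ^+ 2 * f w ^+ 2 + t ^+ 2 * g w ^+ 2 - 2 * s * t * (f w * g w) =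
    (s * f w - t * g w) ^+ 2 by ring.
  exact: sqr_ge0.
have a0 : 0 <= a by exact: Ex_sqr_ge0.
have b0 : 0 <= b by exact: Ex_sqr_ge0.
have [b00|bn0] := eqVneq b 0.
  have := H c (a + 1); rewrite b00 mulr0 addr0 mulr0 => h.
  have : c ^+ 2 * (a + 2) <= 0 by move: h; rewrite !expr2; lra.
  rewrite pmulr_lle0//; lra.
have bp : 0 < b by rewrite lt_neqAle eq_sym bn0.
have := H b c; rewrite (_ : b ^+ 2 * a + c ^+ 2 * b - 2 * b * c * c = b * (a * b - c ^+ 2)); last by ring.
by rewrite pmulr_rge0// subr_ge0.
Qed.

(** Convergence to 0 in L^2, where orthogonality is available, expressed by second moments. *)
Definition null (F : nat -> Omega -> R) : Prop :=
  (Ex P (fun w => F n w ^+ 2) @[n --> \oo] --> (0 : R))%classic.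

Lemma squeeze_null (u v : nat -> R) : (forall n, `|u n| <= v n) ->
  (v n @[n --> \oo] --> (0 : R))%classic -> (u n @[n --> \oo] --> (0 : R))%classic.
Proof.
move=> uv v0; apply: norm_cvg0.
apply: (squeeze_cvgr _ (cvg_cst 0) v0).
by apply: nearW => n; rewrite normr_ge0 uv.
Qed.

Lemma cvg_mul0 (k : R) (u : nat -> R) : (u n @[n --> \oo] --> (0 : R))%classic ->
  (k * u n @[n --> \oo] --> (0 : R))%classic.
Proof.
move=> u0; have H : (k * u n @[n --> \oo] --> k * (0 : R))%classic.
  by apply: cvgM => //; exact: cvg_cst.
by rewrite mulr0 in H.
Qed.

Lemma nullD F G : (forall n, Lp P 2 (F n)) -> (forall n, Lp P 2 (G n)) ->
  null F -> null G -> null (fun n w => F n w + G n w).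
Proof.
move=> lF lG nF nG.
apply: (@squeeze_null _ (fun n => 2 * (Ex P (fun w => F n w ^+ 2) + Ex P (fun w => G n w ^+ 2)))).
  move=> n; rewrite ger0_norm ?Ex_sqr_ge0//.
  have l1 := Lp2_sqr (lF n); have l2 := Lp2_sqr (lG n).
  rewrite -ExD// -ExZ; last exact: L1D.
  have := Lp2_sqr (LpD (ler1n _ 2) (lF n) (lG n)) => l3.
  apply: Ex_le => //; first by apply: L1Z; exact: L1D.
  move=> w; have := sqr_ge0 (F n w - G n w); rewrite sqrrB sqrrD; lra.
apply: cvg_mul0.
have H : (Ex P (fun w => F n w ^+ 2) + Ex P (fun w => G n w ^+ 2) @[n --> \oo] --> (0 : R) + (0 : R))%classic.
  exact: cvgD.
by rewrite addr0 in H.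
Qed.

Lemma nullZ k F : (forall n, Lp P 2 (F n)) -> null F -> null (fun n w => k * F n w).
Proof.
move=> lF nF; rewrite /null.
have E n : Ex P (fun w => (k * F n w) ^+ 2) = k ^+ 2 * Ex P (fun w => F n w ^+ 2).
  by rewrite -ExZ; [apply: eq_Ex => w; rewrite exprMn|exact: Lp2_sqr].
by under eq_fun do rewrite E; exact: cvg_mul0.
Qed.

Lemma nullB F G : (forall n, Lp P 2 (F n)) -> (forall n, Lp P 2 (G n)) ->
  null F -> null G -> null (fun n w => F n w - G n w).
Proof.
move=> lF lG nF nG.
have := nullD lF (fun n => LpZ (-1) (lG n)) nF (nullZ (-1) lG nG).
by congr null; apply/funext => n; apply/funext => w; rewrite mulN1r.
Qed.

Lemma null_comp (tau : Omega -> Omega) F : measurable_fun setT tau ->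
  measure_preserving P tau -> (forall n, measurable_fun setT (F n)) ->
  null F -> null (fun n w => F n (tau w)).
Proof.
move=> mt tP mF nF; rewrite /null.
have E n : Ex P (fun w => F n (tau w) ^+ 2) = Ex P (fun w => F n w ^+ 2).
  exact: (Ex_preserving mt tP (measurable_funX 2 (mF n))).
by under eq_fun do rewrite E.
Qed.

Lemma null_mul F G K : (forall n, Lp P 2 (F n)) -> (forall n, Lp P 2 (G n)) ->
  null F -> (forall n, Ex P (fun w => G n w ^+ 2) <= K) ->
  (Ex P (fun w => F n w * G n w) @[n --> \oo] --> (0 : R))%classic.
Proof.
move=> lF lG nF GK.
have sq : (Ex P (fun w => F n w * G n w) ^+ 2 @[n --> \oo] --> (0 : R))%classic.
  apply: (@squeeze_null _ (fun n => Ex P (fun w => F n w ^+ 2) * K)).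
    move=> n; rewrite ger0_norm ?sqr_ge0// (le_trans (Ex_mul_sqr_le (lF n) (lG n)))//.
    by rewrite ler_wpM2l// Ex_sqr_ge0.
  by under eq_fun do rewrite mulrC; exact: cvg_mul0.
apply: norm_cvg0.
have := cvg_comp _ _ sq (@sqrt_continuous R 0); rewrite sqrtr0.
rewrite (_ : _ \o _ = (fun n => `|Ex P (fun w => F n w * G n w)|))//.
by apply/funext => n /=; rewrite sqrtr_sqr.
Qed.

(** Distinguishing x^2 <= del from x^2 > del gives x^2 <= del + c |x|^p pointwise, with c =
    del^((2-p)/2); this replaces a comparison of norms. *)
Lemma null_Lnorm p F : 2 < p -> (forall n, Lp P p (F n)) ->
  ('N[P]_(p%:E)[(fun w => (F n w)%:E)] @[n --> \oo] --> 0)%E -> null F.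
Proof.
move=> p2 lF nF; have p0 : 0 < p by lra.
apply/cvgrPdist_le => e e0.
pose del := e / 2; have d0 : 0 < del by rewrite divr_gt0.
pose c := del `^ ((2 - p) / 2); have c0 : 0 < c by rewrite powR_gt0.
have pw (x : R) : x ^+ 2 <= del + c * `|x| `^ p.
  have [xd|dx] := leP (x ^+ 2) del.
    by rewrite (le_trans xd)// lerDl mulr_ge0 ?powR_ge0// ltW.
  have x0 : 0 < `|x|.
    by rewrite normr_gt0; apply: contraTneq dx => ->; rewrite expr0n/= -leNgt ltW.
  rewrite (le_trans _ (_ : c * `|x| `^ p <= _))//; last by rewrite lerDr ltW.
  have -> : x ^+ 2 = `|x| `^ (2 - p) * `|x| `^ p.
    by rewrite powR_mulD// subrK powR_mulrn// real_normK// num_real.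
  rewrite ler_wpM2r ?powR_ge0//.
  have -> : `|x| `^ (2 - p) = (x ^+ 2) `^ ((2 - p) / 2).
    rewrite -(real_normK (num_real x)) -powR_mulrn// -powRrM; congr (_ `^ _); by field.
  have -> : (2 - p) / 2 = - ((p - 2) / 2) by field.
  rewrite /c; have -> : (2 - p) / 2 = - ((p - 2) / 2) by field.
  rewrite !powRN lef_pV2 ?posrE ?powR_gt0// ?(lt_trans d0)//.
  by apply: le_powR; rewrite ?(ltW d0) ?(ltW dx)//; lra.
pose eta := del / c; have eta0 : 0 < eta by rewrite divr_gt0.
have : \forall n \near \oo, ('N[P]_(p%:E)[(fun w => (F n w)%:E)] < (eta `^ p^-1)%:E)%E.
  have h0 : (0 < (eta `^ p^-1)%:E)%E by rewrite lte_fin powR_gt0.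
  apply: (nF (fun x => (x < (eta `^ p^-1)%:E)%E)); apply: open_nbhs_nbhs; split; first exact: open_ereal_lt_ereal.
  exact: h0.
apply: filterS => n nn.
rewrite sub0r normrN ger0_norm ?Ex_sqr_ge0//.
have lp := (lF n).2.
have Ep : Ex P (fun w => `|F n w| `^ p) <= eta.
  rewrite -lee_fin (EFin_Ex lp).
  have := powR_Lnorm P (fun w => (F n w)%:E) (lt0r_neq0 p0).
  under [X in _ = X -> _]eq_integral do rewrite abse_EFin poweR_EFin.
  move=> <-.
  have -> : eta%:E = ((eta `^ p^-1)%:E `^ p)%E.
    by rewrite poweR_EFin -powRrM mulVf ?gt_eqF// powRr1// ltW.
  by apply: gt0_ler_poweR; rewrite ?in_itv/= ?(ltW p0)// ?(ltW nn) ?Lnorm_ge0 ?leey ?lee_fin ?powR_ge0.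
have l2 := Lp2_sqr (Lp_Lp2 (ltW p2) (lF n)).
apply: (@le_trans _ _ (Ex P (fun w => del + c * `|F n w| `^ p))).
  by apply: Ex_le => //; apply: L1D; [exact: L1_cst|exact: L1Z].
rewrite ExD; [|exact: L1_cst|exact: L1Z].
rewrite Ex_cst ExZ//.
have := ler_wpM2l (ltW c0) Ep.
have -> : c * eta = del by rewrite /eta mulrC divfK ?gt_eqF.
by rewrite /del; lra.
Qed.

End square_integrable.

(** * Conditional expectation preserves moments of order p *)

Section conditional_moments.
Context d (Omega : measurableType d) (R : realType) (P : probability Omega R).
Variable F0 : set (set Omega).
Hypothesis sF : sigma_subalgebra F0.
Variable p : R.
Hypothesis p2 : 2 < p.

(* Test the conditional expectation Z of Y against |Z|^(p-1) sgn Z, truncated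
   where |Z| > n. *)
Lemma cond_exp_Lp Y : Lp P p Y -> Lp P p (cond_exp P F0 Y).
Proof.
move=> lY; have p2' := p2.
have p1 : 1 <= p by lra.
have lY1 := Lp_L1 p1 lY.
have mZ := cond_exp_measF sF lY1; have lZ := cond_exp_L1 sF lY1.
set Z := cond_exp P F0 Y in mZ lZ *.
have mZ' := L1_measurable lZ.
have mc n : measurable_fun setT (fun x : R => (\1_[set y : R | `|y| <= n%:R] x) : R).
  apply: measurable_indic.
  rewrite -[X in measurable X]setTI.
  have := @normr_measurable R setT measurableT [set` `]-oo, n%:R]] (measurable_itv _).
  by congr measurable; apply/seteqP; split => x; rewrite /= in_itv/=.
pose g n x : R := \1_[set y : R | `|y| <= n%:R] x * (x * `|x| `^ (p - 2)).
pose t n w : R := \1_[set y : R | `|y| <= n%:R] (Z w) * `|Z w| `^ p.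
have mg n : measurable_fun setT (g n).
  by apply: measurable_funM => //; apply: measurable_funM => //; exact: measurable_norm_powR.
have ind n x : (\1_[set y : R | `|y| <= n%:R] x : R) = if `|x| <= n%:R then 1 else 0.
  rewrite indicE; case: ifPn => h; first by rewrite mem_set.
  by rewrite memNset//=; exact/negP.
have g_le n x : `|g n x| <= n%:R * n%:R `^ (p - 2).
  rewrite /g ind; case: ifPn => h; last by rewrite mul0r normr0 mulr_ge0 ?powR_ge0.
  rewrite mul1r normrM (ger0_norm (powR_ge0 _ _)); apply: ler_pM; rewrite ?powR_ge0//.
  by apply: le_powR => //; lra.
have lgY n : L1 P (fun w => g n (Z w) * Y w).
  apply: (L1_le _ _ (L1Z (n%:R * n%:R `^ (p - 2)) (L1_norm lY1))).
    apply: measurable_funM; last exact: lY.1.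
    exact: (measurableT_comp (mg n) mZ').
  by move=> w; rewrite normrM ler_wpM2r.
have lgZ n : L1 P (fun w => g n (Z w) * Z w).
  apply: (L1_le _ _ (L1Z (n%:R * n%:R `^ (p - 2)) (L1_norm lZ))).
    apply: measurable_funM => //; exact: (measurableT_comp (mg n) mZ').
  by move=> w; rewrite normrM ler_wpM2r.
have tE n w : g n (Z w) * Z w = t n w.
  by rewrite /g /t -(sqr_powR_subr p2); ring.
have lt n : L1 P (t n) by apply: eq_L1 (lgZ n).
pose C := 2 `^ p * Ex P (fun w => `|Y w| `^ p).
have tC n : Ex P (t n) <= C.
  have E : Ex P (t n) = Ex P (fun w => g n (Z w) * Y w).
    rewrite (Ex_cond_exp sF lY1 (measF_comp (mg n) mZ) (lgY n) (lgZ n)).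
    by apply: eq_Ex => w; rewrite tE.
  have : Ex P (fun w => g n (Z w) * Y w) <= Ex P (fun w => 2^-1 * t n w + 2 `^ (p - 1) * `|Y w| `^ p).
    apply: Ex_le => //; first by apply: L1D; [exact: L1Z|exact: L1Z lY.2].
    move=> w; rewrite /g /t ind; case: ifPn => h; last first.
      by rewrite !mul0r mulr0 add0r mulr_ge0 ?powR_ge0.
    rewrite !mul1r (le_trans (ler_norm _))// !normrM (ger0_norm (powR_ge0 _ _)).
    set a := `|Z w|; set b := `|Y w|.
    have a0 : 0 <= a by exact: normr_ge0.
    have b0 : 0 <= b by exact: normr_ge0.
    (* If |Y| <= |Z| / 2, half of the truncated moment of Z absorbs the product and is moved to the
       left side; otherwise |Z| < 2 |Y| and the moment of Y suffices. *)
    have [ba|ab] := leP (2 * b) a.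
      rewrite (le_trans (ler_wpM2l _ (_ : b <= 2^-1 * a)))//; [by rewrite mulr_ge0 ?powR_ge0|lra|].
      have -> : a * a `^ (p - 2) * (2^-1 * a) = 2^-1 * (a ^+ 2 * `|a| `^ (p - 2)).
        by rewrite (ger0_norm a0); ring.
      by rewrite sqr_powR_subr// (ger0_norm a0) lerDl mulr_ge0 ?powR_ge0.
    rewrite (le_trans _ (_ : 2 `^ (p - 1) * b `^ p <= _))//; last by rewrite lerDr mulr_ge0 ?powR_ge0// invr_ge0.
    have -> : 2 `^ (p - 1) * b `^ p = (2 * b) * (2 * b) `^ (p - 2) * b.
      have [->|bn0] := eqVneq b 0; first by rewrite powR0 ?mulr0//; lra.
      have bp : 0 < b by rewrite lt_neqAle eq_sym bn0.
      have bE : b `^ p = b ^+ 2 * b `^ (p - 2).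
        by have := sqr_powR_subr p2 b; rewrite (ger0_norm b0) => ->.
      rewrite powRM// bE.
      have -> : 2 `^ (p - 1) = 2 * 2 `^ (p - 2) :> R.
        rewrite -[X in _ = X * _](powRr1 (ler0n R 2)) powR_mulD//; congr (_ `^ _); ring.
      ring.
    rewrite ler_wpM2r//; apply: ler_pM; rewrite ?powR_ge0//; first exact: ltW.
    by apply: le_powR => //; [lra|exact: ltW].
  rewrite -E ExD; [|exact: L1Z|exact: L1Z lY.2].
  rewrite (ExZ 2^-1 (lt n)) (ExZ (2 `^ (p - 1)) lY.2) /C.
  have -> : 2 `^ p = 2 * 2 `^ (p - 1) :> R.
    rewrite -[X in _ = X * _](powRr1 (ler0n R 2)) powR_mulD//; congr (_ `^ _); ring.
  lra.
split => //; apply: L1_ge0; first exact: measurable_norm_powR.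
  by move=> w; rewrite powR_ge0.
have t0 n w : 0 <= t n w by rewrite /t ind; case: ifP; rewrite ?mul1r ?mul0r ?powR_ge0.
have lim w : ((t n w)%:E @[n --> \oo] --> (`|Z w| `^ p)%:E)%classic.
  apply: cvg_near_cst; near=> n; rewrite /t ind.
  have -> : `|Z w| <= n%:R by near: n; exact: nbhs_infty_ger.
  by rewrite mul1r.
apply: le_lt_trans (ltry C).
have H := @cvg_monotone_convergence _ _ _ P setT measurableT (fun n w => (t n w)%:E).
have {}H : ((\int[P]_w (t n w)%:E)%E @[n --> \oo] -->
   (\int[P]_w limn (fun n => (t n w)%:E))%E)%classic.
  apply: H.
  - by move=> n; apply/measurable_EFinP; exact: L1_measurable (lt n).
  - by move=> n w _; rewrite lee_fin.
  - move=> w _ m n mn; rewrite lee_fin /t !ind.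
    case: ifPn => h1; last by rewrite mul0r; case: ifP; rewrite ?mul1r ?mul0r ?powR_ge0.
    by rewrite (le_trans h1) ?ler_nat.
have E : (\int[P]_w limn (fun n => (t n w)%:E) = \int[P]_w (`|Z w| `^ p)%:E)%E.
  by apply: eq_integral => w _; exact/cvg_lim.
rewrite E in H.
rewrite -(cvg_lim _ H)//; apply: lime_le; first exact: (cvgP _ H).
by apply: nearW => n /=; rewrite -(EFin_Ex (lt n)) lee_fin.
Unshelve. all: by end_near. Qed.

End conditional_moments.

Lemma telescope_sum_pos (V : zmodType) (a : int -> V) n :
  \sum_(1 <= k < n.+1) (a (k%:Z + 1) - a k%:Z) = a n.+1%:Z - a 1.
Proof.
elim: n => [|n IH]; first by rewrite big_geq// subrr.
by rewrite big_nat_recr//= IH -PoszD addn1 addrC addrA subrK.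
Qed.

Lemma telescope_sum_neg (V : zmodType) (a : int -> V) n :
  \sum_(1 <= k < n.+1) (a (- k%:Z + 1) - a (- k%:Z)) = a 0 - a (- n%:Z).
Proof.
elim: n => [|n IH]; first by rewrite big_geq// oppr0 subrr.
rewrite big_nat_recr//= IH; have -> : - n.+1%:Z + 1 = - n%:Z by rewrite intS; ring.
by rewrite addrA subrK.
Qed.

(** * Martingale and coboundary decomposition of the sequence *)

Section martingale_approximation.
Context d (Omega : measurableType d) (R : realType) (P : probability Omega R).
Variables (T Tinv : {mfun Omega >-> Omega}).
Hypotheses (TK : cancel T Tinv) (TinvK : cancel Tinv T).
Hypothesis Tpres : measure_preserving P T.
Variable F0 : set (set Omega).
Hypothesis sF : sigma_subalgebra F0.
Hypothesis F0T : F0 `<=` preimage_set_system setT T F0.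
Variable p : R.
Hypotheses (p2 : 2 < p).
Variable X0 : {mfun Omega >-> R}.
Hypothesis X0Lp : Lp P p X0.
Notation X := (Xseq T Tinv X0).

Let p1 : 1 <= p. Proof. by have := p2; lra. Qed.

Lemma Xseq_shift k w : X k (T w) = X (k + 1) w.
Proof.
rewrite /Xseq /=; congr (X0 _); case: k => [n|[|n]].
- by rewrite -PoszD addn1 /iterz -iterSr.
- by rewrite /= TK.
- rewrite (_ : Negz n.+1 + 1 = Negz n); last by rewrite !NegzE !intS; ring.
  by rewrite /iterz iterSr TK.
Qed.

Lemma Xseq_shift_inv k w : X k (Tinv w) = X (k - 1) w.
Proof. by rewrite -[w in RHS]TinvK Xseq_shift subrK. Qed.

Lemma Xseq_iter n k w : X k (iter n T w) = X (k + n%:Z) w.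
Proof.
elim: n k => [|n IH] k; first by rewrite addr0.
by rewrite iterS Xseq_shift IH intS addrA.
Qed.

Lemma Lp_Xseq k : Lp P p (X k).
Proof.
split; first exact: measurable_Xseq.
case: k => n; first exact: (L1_iter Tpres n X0Lp.2).
exact: (L1_iter_inv TK Tpres n.+1 X0Lp.2).
Qed.

Lemma Lp_inv f : Lp P p f -> Lp P p (fun w => f (Tinv w)).
Proof.
move=> [mf lf]; split; last exact: (L1_iter_inv TK Tpres 1 lf).
by apply: (measurableT_comp mf); exact: (measurable_iter Tinv 1).
Qed.

Definition condX k := cond_exp P F0 (X k).

Lemma Lp_condX k : Lp P p (condX k).
Proof. exact: (cond_exp_Lp sF p2 (Lp_Xseq k)). Qed.

Lemma measF_condX k : measF F0 (condX k).
Proof. exact: (cond_exp_measF sF (Lp_L1 p1 (Lp_Xseq k))). Qed.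

Let L2 f : Lp P p f -> Lp P 2 f. Proof. exact: (Lp_Lp2 (ltW p2)). Qed.

Lemma Ex_mul_cond_exp h Y : Lp P p Y -> Lp P 2 h -> measF F0 h ->
  Ex P (fun w => h w * cond_exp P F0 Y w) = Ex P (fun w => h w * Y w).
Proof.
move=> lY lh mh; rewrite (Ex_cond_exp sF (Lp_L1 p1 lY) mh)//.
  exact: (Lp2_mul lh (L2 lY)).
exact: (Lp2_mul lh (L2 (cond_exp_Lp sF p2 lY))).
Qed.

(** The composition of E(X_k|F0) with T is the conditional expectation of X_(k+1) given T^-1(F0),
    and F0 is contained in T^-1(F0). This tower property is tested against h by means of h o
    T^-1. *)
Lemma Ex_mul_condX_shift h k : Lp P 2 h -> measF F0 h ->
  Ex P (fun w => h w * condX k (T w)) = Ex P (fun w => h w * condX (k + 1) w).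
Proof.
move=> lh mh.
have lh' : Lp P 2 (fun w => h (Tinv w)).
  split; last exact: (L1_iter_inv TK Tpres 1 lh.2).
  by apply: (measurableT_comp lh.1); exact: (measurable_iter Tinv 1).
have mh' : measF F0 (fun w => h (Tinv w)) by exact: (measF_inv TinvK sF F0T mh).
rewrite (Ex_mul_cond_exp (Lp_Xseq _) lh mh).
have l1 := Lp2_mul lh' (L2 (Lp_condX k)); have l2 := Lp2_mul lh' (L2 (Lp_Xseq k)).
have := Ex_mul_cond_exp (Lp_Xseq k) lh' mh'.
rewrite -(Ex_iter Tpres 1 (L1_measurable l1)) -(Ex_iter Tpres 1 (L1_measurable l2)) /=.
move=> E; transitivity (Ex P (fun w => h (Tinv (T w)) * condX k (T w))).
  by apply: eq_Ex => w; rewrite TK.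
by rewrite E; apply: eq_Ex => w; rewrite TK Xseq_shift.
Qed.

Definition past_sum n w := \sum_(1 <= k < n.+1) condX k%:Z w.
Definition future_sum n w := \sum_(1 <= k < n.+1) (X (- k%:Z) w - condX (- k%:Z) w).

Variables (A B : Omega -> R).
Hypotheses (LA : Lp P p A) (LB : Lp P p B).
Hypothesis nA : null P (fun n w => past_sum n w - A w).
Hypothesis nB : null P (fun n w => future_sum n w - B w).

Lemma Lp_past_sum n : Lp P p (past_sum n).
Proof. by apply: (Lp_sum p1) => k; exact: Lp_condX. Qed.

Lemma Lp_future_sum n : Lp P p (future_sum n).
Proof. by apply: (Lp_sum p1) => k; apply: (LpB p1); [exact: Lp_Xseq|exact: Lp_condX]. Qed.

Lemma nullS F : null P F -> null P (fun n => F n.+1).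
Proof. by move=> nF; rewrite /null (cvg_shiftS (fun n => Ex P (fun w => F n w ^+ 2))). Qed.

Lemma null_condX : null P (fun n => condX n.+1%:Z).
Proof.
have := nullB (fun n => L2 (LpB p1 (Lp_past_sum n.+1) LA)) (fun n => L2 (LpB p1 (Lp_past_sum n) LA))
  (nullS nA) nA.
congr null; apply/funext => n; apply/funext => w.
by rewrite /past_sum big_nat_recr//=; ring.
Qed.

Lemma null_Xseq_condX : null P (fun n w => X (- n.+1%:Z) w - condX (- n.+1%:Z) w).
Proof.
have := nullB (fun n => L2 (LpB p1 (Lp_future_sum n.+1) LB)) (fun n => L2 (LpB p1 (Lp_future_sum n) LB))
  (nullS nB) nB.
congr null; apply/funext => n; apply/funext => w.
by rewrite /future_sum big_nat_recr//=; ring.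
Qed.

(* The coboundary part: X0 = D - V + V o T^-1 with D a martingale difference. *)
Definition cobound w := A w - B w - X 0 w + condX 0 w.
Definition cobound_sum n w := past_sum n w - future_sum n w - X 0 w + condX 0 w.
Definition mart0 w := X 0 w + cobound w - cobound (Tinv w).
(** Approximates [mart0]; the last term tends to 0 in L^2 and makes this function exactly measurable
    for F0. *)
Definition mart_sum n w := X 0 w + cobound_sum n w - cobound_sum n (Tinv w)
  - (X (- n.+1%:Z) w - condX (- n.+1%:Z) w).
(** As a limit in L^2, [mart0] is measurable for F0 only up to a null set; its conditional
    expectation is a version that is exactly measurable. *)
Definition mart := cond_exp P F0 mart0.

Lemma Lp_cobound : Lp P p cobound.
Proof.
by apply: (LpD p1); [apply: (LpB p1); [exact: (LpB p1)|exact: Lp_Xseq]|exact: Lp_condX].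
Qed.

Lemma Lp_cobound_sum n : Lp P p (cobound_sum n).
Proof.
apply: (LpD p1); last exact: Lp_condX.
apply: (LpB p1); last exact: Lp_Xseq.
by apply: (LpB p1); [exact: Lp_past_sum|exact: Lp_future_sum].
Qed.

Lemma Lp_mart0 : Lp P p mart0.
Proof.
apply: (LpB p1); last exact: (Lp_inv Lp_cobound).
by apply: (LpD p1); [exact: Lp_Xseq|exact: Lp_cobound].
Qed.

Lemma Lp_mart : Lp P p mart. Proof. exact: (cond_exp_Lp sF p2 Lp_mart0). Qed.

Lemma measF_mart : measF F0 mart.
Proof. exact: (cond_exp_measF sF (Lp_L1 p1 Lp_mart0)). Qed.

Lemma Lp_mart_sum n : Lp P p (mart_sum n).
Proof.
apply: (LpB p1); last by apply: (LpB p1); [exact: Lp_Xseq|exact: Lp_condX].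
apply: (LpB p1); last exact: (Lp_inv (Lp_cobound_sum n)).
by apply: (LpD p1); [exact: Lp_Xseq|exact: Lp_cobound_sum].
Qed.

Lemma null_cobound : null P (fun n w => cobound_sum n w - cobound w).
Proof.
have := nullB (fun n => L2 (LpB p1 (Lp_past_sum n) LA)) (fun n => L2 (LpB p1 (Lp_future_sum n) LB)) nA nB.
by congr null; apply/funext => n; apply/funext => w; rewrite /cobound_sum /cobound; ring.
Qed.

Let Linv2 f : Lp P p f -> Lp P 2 (fun w => f (Tinv w)).
Proof. by move=> lf; apply: L2; exact: Lp_inv. Qed.

Lemma null_mart : null P (fun n w => mart_sum n w - mart0 w).
Proof.
have lc n : Lp P p (fun w => cobound_sum n w - cobound w).
  exact: (LpB p1 (Lp_cobound_sum n) Lp_cobound).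
have n1 := null_comp (measurable_iter Tinv 1) (inv_preserving TK Tpres 1) (fun n => (lc n).1) null_cobound.
have lx n : Lp P p (fun w => X (- n.+1%:Z) w - condX (- n.+1%:Z) w).
  by apply: (LpB p1); [exact: Lp_Xseq|exact: Lp_condX].
have n2 := nullB (fun n => L2 (lc n)) (fun n => Linv2 (lc n)) null_cobound n1.
have l2 n := LpB (ler1n R 2) (L2 (lc n)) (Linv2 (lc n)).
have := nullB l2 (fun n => L2 (lx n)) n2 null_Xseq_condX.
by congr null; apply/funext => n; apply/funext => w; rewrite /mart_sum /mart0 /=; ring.
Qed.

Lemma future_sum_shift n w : future_sum n (Tinv w) =
  \sum_(1 <= k < n.+1) X (- k%:Z) w - X (-1) w + X (- n.+1%:Z) w
  - \sum_(1 <= k < n.+1) condX (- k%:Z) (Tinv w).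
Proof.
rewrite /future_sum sumrB; congr (_ - _).
elim: n => [|n IH]; first by rewrite !big_geq// add0r addrC subrr.
rewrite big_nat_recr//= IH [in RHS]big_nat_recr//= Xseq_shift_inv -addrA.
rewrite (_ : - n.+1%:Z - 1 = - n.+2%:Z); last by rewrite !intS; ring.
ring.
Qed.

(** The terms X (- k) telescope up to X (- (n + 1)), which the correction cancels; only conditional
    expectations and their compositions with T^-1 remain. *)
Lemma mart_sumE n w : mart_sum n w =
  (past_sum n w + condX 0 w + \sum_(1 <= k < n.+1) condX (- k%:Z) w)
  - (past_sum n (Tinv w) + condX 0 (Tinv w) + \sum_(1 <= k < n.+1) condX (- k%:Z) (Tinv w))
  + condX (- n.+1%:Z) w.
Proof.
rewrite /mart_sum /cobound_sum future_sum_shift Xseq_shift_inv sub0r.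
rewrite {1}/future_sum sumrB; ring.
Qed.

Lemma measF_mart_sum n : measF F0 (mart_sum n).
Proof.
have mS (F : nat -> Omega -> R) : (forall k, measF F0 (F k)) ->
    measF F0 (fun w => \sum_(1 <= k < n.+1) F k w).
  by move=> mF; apply: measurable_sum.
have mS' : measF F0 (fun w => past_sum n w + condX 0 w + \sum_(1 <= k < n.+1) condX (- k%:Z) w).
  apply: measurable_funD; last by apply: mS => k; exact: measF_condX.
  apply: measurable_funD; last exact: measF_condX.
  by apply: mS => k; exact: measF_condX.
set u := (fun w => _ + _) in mS'.
have -> : mart_sum n = (fun w => u w - u (Tinv w) + condX (- n.+1%:Z) w).
  by apply/funext => w; exact: mart_sumE.
apply: measurable_funD; last exact: measF_condX.
by apply: measurable_funB => //; exact: (measF_inv TinvK sF F0T mS').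
Qed.

(** By Pythagoras the conditional expectation is the best F0-measurable approximation of [mart0] in
    L^2, and the functions [mart_sum n] approximate it arbitrarily well. *)
Lemma mart_mart0_sqr : Ex P (fun w => (mart0 w - mart w) ^+ 2) = 0.
Proof.
have l0 := LpB p1 Lp_mart0 Lp_mart.
set c := Ex P _; have c0 : 0 <= c by exact: Ex_sqr_ge0.
have cle n : c <= Ex P (fun w => (mart_sum n w - mart0 w) ^+ 2).
  have lm := LpB p1 Lp_mart (Lp_mart_sum n).
  have i1 := Lp2_sqr (L2 l0); have i2 := Lp2_sqr (L2 lm).
  have i3 := Lp2_mul (L2 lm) (L2 l0).
  have -> : Ex P (fun w => (mart_sum n w - mart0 w) ^+ 2) =
    Ex P (fun w => ((mart0 w - mart w) ^+ 2 + (mart w - mart_sum n w) ^+ 2)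
       + 2 * ((mart w - mart_sum n w) * (mart0 w - mart w))).
    by apply: eq_Ex => w; ring.
  rewrite ExD; [|exact: L1D|exact: L1Z].
  rewrite ExD// ExZ//.
  have -> : Ex P (fun w => (mart w - mart_sum n w) * (mart0 w - mart w)) = 0.
    have j1 := Lp2_mul (L2 lm) (L2 Lp_mart0); have j2 := Lp2_mul (L2 lm) (L2 Lp_mart).
    transitivity (Ex P (fun w => (mart w - mart_sum n w) * mart0 w - (mart w - mart_sum n w) * mart w)).
      by apply: eq_Ex => w; ring.
    rewrite ExB// -(Ex_mul_cond_exp Lp_mart0 (L2 lm)) ?subrr//.
    by apply: measurable_funB; [exact: measF_mart|exact: measF_mart_sum].
  by rewrite mulr0 addr0 lerDl Ex_sqr_ge0.
apply/eqP; rewrite eq_le c0 andbT; apply/ler_addgt0Pr => e e0; rewrite add0r.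
have := null_mart; move=> /cvgr0Pnorm_lt /(_ e e0) [N _ /(_ N (leqnn N))] /= h.
by apply: ltW; apply: le_lt_trans h; rewrite ger0_norm ?Ex_sqr_ge0.
Qed.

Lemma mart_mart0_norm : Ex P (fun w => `|mart w - mart0 w|) = 0.
Proof.
have l0 := L2 (LpB p1 Lp_mart0 Lp_mart).
have := Ex_mul_sqr_le (Lp_norm (ler1n R 2) l0) (Lp_cst P 2 1).
rewrite expr1n Ex_cst mulr1.
have -> : Ex P (fun w => `|mart0 w - mart w| ^+ 2) = 0.
  by rewrite -mart_mart0_sqr; apply: eq_Ex => w; rewrite real_normK// num_real.
have -> : Ex P (fun w => `|mart0 w - mart w| * 1) = Ex P (fun w => `|mart w - mart0 w|).
  by apply: eq_Ex => w; rewrite mulr1 distrC.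
by move=> h; apply/eqP; rewrite -sqrf_eq0 eq_le h sqr_ge0.
Qed.

(** Against F0, composition with T raises the index of [condX] by one, so the differences telescope
    and only index n + 1 survives. Its limit 0 gives the martingale property. *)
Lemma Ex_mul_mart_sum h n : Lp P 2 h -> measF F0 h ->
  Ex P (fun w => h w * mart_sum n (T w)) = Ex P (fun w => h w * condX n.+1%:Z w).
Proof.
move=> lh mh; pose a k := Ex P (fun w => h w * condX k w).
have la k : L1 P (fun w => h w * condX k w) := Lp2_mul lh (L2 (Lp_condX k)).
have laT k : L1 P (fun w => h w * condX k (T w)).
  exact: (Lp2_mul lh (L2 (Lp_iter Tpres 1 (Lp_condX k)))).
have aT k : Ex P (fun w => h w * condX k (T w)) = a (k + 1) := Ex_mul_condX_shift k lh mh.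
pose D k w := h w * condX k (T w) - h w * condX k w.
have lD k : L1 P (D k) by exact: L1B.
have ED k : Ex P (D k) = a (k + 1) - a k by rewrite ExB// aT.
transitivity (Ex P (fun w => (\sum_(1 <= k < n.+1) D k%:Z w + \sum_(1 <= k < n.+1) D (- k%:Z) w)
     + (D 0 w + h w * condX (- n.+1%:Z) (T w)))).
  apply: eq_Ex => w; rewrite mart_sumE TK /past_sum /D !sumrB -!mulr_sumr; ring.
have lS (s : nat -> int) : L1 P (fun w => \sum_(1 <= k < n.+1) D (s k) w).
  by apply: L1_sum => k; exact: lD.
rewrite ExD; [|exact: L1D|exact: L1D].
have S1 : Ex P (fun w => \sum_(1 <= k < n.+1) D k%:Z w) = a n.+1%:Z - a 1.
  rewrite (Ex_sum _ (fun k => lD k%:Z)) -telescope_sum_pos.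
  by apply: eq_bigr => k _; exact: ED.
have S2 : Ex P (fun w => \sum_(1 <= k < n.+1) D (- k%:Z) w) = a 0 - a (- n%:Z).
  rewrite (Ex_sum _ (fun k => lD (- k%:Z))) -telescope_sum_neg.
  by apply: eq_bigr => k _; exact: ED.
rewrite (ExD (lS _) (lS _)) S1 S2 (ExD (lD 0) (laT _)) ED aT.
rewrite (_ : - n.+1%:Z + 1 = - n%:Z); last by rewrite intS; ring.
rewrite add0r -[RHS]/(a n.+1%:Z).
move: (a n.+1%:Z) (a 1) (a 0) (a (- n%:Z)) => u v x y; ring.
Qed.

Lemma mart_orthogonal S : F0 S -> (\int[P]_(w in S) (mart (T w))%:E = 0)%E.
Proof.
move=> FS; have mS : measurable S by exact: sF.2.
have lmT : L1 P (fun w => mart (T w)) := L1_iter Tpres 1 (Lp_L1 p1 Lp_mart).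
have lm0T := Lp_iter Tpres 1 Lp_mart0.
have mI : measF F0 (\1_S : Omega -> R).
  by apply: measurable_indic; rewrite measurable_sub.
have lI : Lp P 2 (\1_S : Omega -> R).
  apply: (Lp_le (ler1n R 2) _ (Lp_cst P 2 1)); first exact: measurable_indic.
  by move=> w; rewrite indicE; case: (_ \in _); rewrite ?normr0 ?normr1.
have IE : Ex P (fun w => \1_S w * mart (T w)) = Ex P (fun w => \1_S w * mart0 (T w)).
  apply/eqP; rewrite -subr_eq0 -ExB; last 2 first.
  - exact: (Lp2_mul lI (L2 (Lp_iter Tpres 1 Lp_mart))).
  - exact: (Lp2_mul lI (L2 lm0T)).
  rewrite -normr_le0.
  have ld := L1_norm (L1B (Lp_L1 p1 Lp_mart) (Lp_L1 p1 Lp_mart0)).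
  rewrite -[leRHS]mart_mart0_norm -(Ex_iter Tpres 1 (L1_measurable ld)).
  apply: Ex_norm_le; last 2 first.
  - exact: (L1_iter Tpres 1 ld).
  - move=> w; rewrite -mulrBr normrM indicE.
    by case: (_ \in _); rewrite ?normr0 ?normr1 ?mul1r ?mul0r.
  apply: (L1_measurable (P := P)); apply: L1B.
    exact: (Lp2_mul lI (L2 (Lp_iter Tpres 1 Lp_mart))).
  exact: (Lp2_mul lI (L2 lm0T)).
have I0 : Ex P (fun w => \1_S w * mart0 (T w)) = 0.
  have lmm n : Lp P p (fun w => mart_sum n w - mart0 w) := LpB p1 (Lp_mart_sum n) Lp_mart0.
  have n1 := null_comp (measurable_iter T 1) (iter_preserving Tpres 1) (fun n => (lmm n).1) null_mart.
  have c1 := null_mul (fun n => L2 (Lp_iter Tpres 1 (lmm n))) (fun=> lI) n1 (fun=> lexx _).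
  have c2 := null_mul (fun n => L2 (Lp_condX n.+1%:Z)) (fun=> lI) null_condX (fun=> lexx _).
  have E n : Ex P (fun w => condX n.+1%:Z w * \1_S w) - Ex P (fun w => (mart_sum n (T w) - mart0 (T w)) * \1_S w)
     = Ex P (fun w => \1_S w * mart0 (T w)).
    have -> : Ex P (fun w => condX n.+1%:Z w * \1_S w) = Ex P (fun w => \1_S w * mart_sum n (T w)).
      by rewrite (Ex_mul_mart_sum n lI mI); apply: eq_Ex => w; rewrite mulrC.
    rewrite -ExB; last 2 first.
    - exact: (Lp2_mul lI (L2 (Lp_iter Tpres 1 (Lp_mart_sum n)))).
    - exact: (Lp2_mul (L2 (Lp_iter Tpres 1 (lmm n))) lI).
    by apply: eq_Ex => w; ring.
  have c3 : (Ex P (fun w => condX n.+1%:Z w * \1_S w)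
      - Ex P (fun w => (mart_sum n (T w) - mart0 (T w)) * \1_S w) @[n --> \oo] --> (0 : R) - (0 : R))%classic.
    exact: cvgB.
  have c4 : (Ex P (fun w => \1_S w * mart0 (T w)) @[n --> \oo] --> (0 : R))%classic.
    by move: c3; rewrite subrr; under eq_fun do rewrite E.
  by have <- := cvg_lim (@Rhausdorff R) c4; exact/esym/lim_cst.
have := Ex_indic_mul FS lmT; rewrite IE I0 => h.
have fin : (\int[P]_(w in S) (mart (T w))%:E)%E \is a fin_num.
  by apply: integrable_fin_num => //; exact: integrableS lmT.
by rewrite -(fineK fin) -h.
Qed.

Lemma Ssum_mart0 n w :
  Ssum T Tinv X0 n w = birkhoff T mart0 n w - cobound (iter n T w) + cobound w.
Proof.
rewrite /Ssum; elim: n => [|n IH]; first by rewrite birkhoff0 big_geq// sub0r addrC subrr.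
rewrite big_nat_recr//= IH birkhoffS /mart0 iterS TK -iterS Xseq_iter add0r; ring.
Qed.

Lemma Ssum_mart n :
  Ssum T Tinv X0 n = (fun w => birkhoff T mart n w - cobound (iter n T w) + cobound w) %[ae P].
Proof.
have lk k : L1 P (fun w => `|mart (iter k T w) - mart0 (iter k T w)|).
  exact: (L1_iter Tpres k (L1_norm (L1B (Lp_L1 p1 Lp_mart) (Lp_L1 p1 Lp_mart0)))).
pose s w := \sum_(1 <= k < n.+1) `|mart (iter k T w) - mart0 (iter k T w)|.
have s0 : Ex P s = 0.
  rewrite /s Ex_sum// big1// => k _.
  rewrite -mart_mart0_norm -(Ex_iter Tpres k (f := fun w => `|mart w - mart0 w|))//.
  exact: (L1_measurable (L1_norm (L1B (Lp_L1 p1 Lp_mart) (Lp_L1 p1 Lp_mart0)))).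
have ls : L1 P s by apply: L1_sum.
have sge w : 0 <= s w by rewrite sumr_ge0.
have := Ex_ge0_eq0 ls sge s0; apply: filterS => w h _.
rewrite Ssum_mart0; congr (_ - _ + _).
have : `|birkhoff T mart n w - birkhoff T mart0 n w| <= s w.
  by rewrite /birkhoff -sumrB; exact: ler_norm_sum.
by rewrite h// normr_le0 subr_eq0 => /eqP.
Qed.

End martingale_approximation.

(** * Duality bound for M_m^2 - m sigma^2 *)

Section dual_bound.
Context d (Omega : measurableType d) (R : realType) (P : probability Omega R).
Variables (T Tinv : {mfun Omega >-> Omega}).
Hypotheses (TK : cancel T Tinv) (TinvK : cancel Tinv T).
Hypothesis Tpres : measure_preserving P T.
Variable F0 : set (set Omega).
Hypothesis sF : sigma_subalgebra F0.
Hypothesis F0T : F0 `<=` preimage_set_system setT T F0.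
Variables (p sigma : R).
Hypotheses (p2 : 2 < p) (p3 : p < 3).
Variable D : Omega -> R.
Hypothesis mD : measF F0 D.
Hypothesis DLp : Lp P p D.
Hypothesis D0 : forall A, F0 A -> (\int[P]_(w in A) (D (T w))%:E = 0)%E.
Hypothesis Dvar : Ex P (fun v => D v ^+ 2) = sigma ^+ 2.
Notation M := (birkhoff T D).
Notation Y m := (fun v => M m v ^+ 2 - m%:R * sigma ^+ 2).
Variable B : R.
Hypothesis Hmom : forall m, Ex P (fun v => `|M m v| `^ p) <= B * m%:R `^ (p / 2).
Variables (V : Omega -> R) (S : nat -> Omega -> R).
Hypothesis VLp : Lp P p V.
Hypothesis SLp : forall n, Lp P p (S n).
Hypothesis SE : forall n, S n = (fun w => M n w - V (iter n T w) + V w) %[ae P].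
Notation s2 n := (n%:R^-1 * Ex P (fun w => S n w ^+ 2)).
Notation W n := (fun w => n%:R^-1 * cond_exp P F0 (fun w' => S n w' ^+ 2) w - s2 n).
Variable c : nat -> R.
Hypothesis c_ge0 : forall n, 0 <= c n.
Hypothesis WLp : forall n, (0 < n)%N -> L1 P (fun w => `|W n w| `^ (p / 2)).
Hypothesis Wc : forall n, (0 < n)%N -> Ex P (fun w => `|W n w| `^ (p / 2)) <= c n `^ (p / 2).

Let p1 : 1 <= p. Proof. by have := p2; lra. Qed.
Let L2 f : Lp P p f -> Lp P 2 f. Proof. exact: (Lp_Lp2 (ltW p2)). Qed.
Let LM m : Lp P p (M m). Proof. exact: (Lp_birkhoff Tpres p2). Qed.

Let rho n w := V w - V (iter n T w).

Let Lrho n : Lp P p (rho n).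
Proof. by apply: (LpB p1) => //; exact: (Lp_iter Tpres n VLp). Qed.

Definition remainder_moment := 2 `^ p * (2 * Ex P (fun w => `|V w| `^ p)).

Lemma remainder_le n : Ex P (fun w => `|rho n w| `^ p) <= remainder_moment.
Proof.
have p0 : 0 <= p by have := p1; lra.
have l1 := VLp.2; have l2 := (Lp_iter Tpres n VLp).2.
have E : Ex P (fun w => `|V (iter n T w)| `^ p) = Ex P (fun w => `|V w| `^ p).
  exact: (Ex_iter Tpres n (L1_measurable l1)).
apply: (@le_trans _ _ (Ex P (fun w => 2 `^ p * (`|V w| `^ p + `|V (iter n T w)| `^ p)))).
  apply: Ex_le; [exact: (Lrho n).2|by apply: L1Z; exact: L1D|].
  move=> w; rewrite (le_trans _ (powRD_le p0 (normr_ge0 (V w)) (normr_ge0 (V (iter n T w)))))//.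
  by apply: le_powR => //; exact: ler_normB.
rewrite ExZ; last exact: L1D.
by rewrite (ExD l1 l2) E /remainder_moment ler_wpM2l ?powR_ge0// mulr_natl mulr2n.
Qed.

Lemma young_half (u w : R) : 0 <= u -> 0 <= w -> u `^ (p - 2) * w <= u `^ p + w `^ (p / 2).
Proof.
move=> u0 w0; have := powR_sub2_mul_sqr_le p2 u0 (powR_ge0 w 2^-1).
rewrite -powR_mulrn ?powR_ge0// -!powRrM mulVf// powRr1//.
by rewrite [2^-1 * p]mulrC.
Qed.

Lemma young_three (u x y : R) : 0 <= u -> 0 <= x -> 0 <= y ->
  u `^ (p - 2) * (x * y) <= u `^ p + x `^ p + y `^ p.
Proof.
move=> u0 x0 y0; have [xy|/ltW yx] := leP x y.
  rewrite (le_trans (ler_wpM2l (powR_ge0 _ _) (ler_wpM2r y0 xy)))// -expr2.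
  by rewrite (le_trans (powR_sub2_mul_sqr_le p2 u0 y0))// lerD2r lerDl powR_ge0.
rewrite (le_trans (ler_wpM2l (powR_ge0 _ _) (ler_wpM2l x0 yx)))// -expr2.
by rewrite (le_trans (powR_sub2_mul_sqr_le p2 u0 x0))// lerDl powR_ge0.
Qed.

Let p' := p / (p - 2).

Let Lconj (h U : Omega -> R) : measurable_fun setT h -> Lp P p U ->
  (forall v, `|h v| <= `|U v| `^ (p - 2)) -> Lp P p' h.
Proof. exact: (Lp_conj_le p2). Qed.

Let LS2 h n : Lp P p' h -> L1 P (fun w => h w * S n w ^+ 2).
Proof. by move=> lh; exact: (L1_mul_sqr p2 lh (SLp n)). Qed.

Let LM2 h n : Lp P p' h -> L1 P (fun w => h w * M n w ^+ 2).
Proof. by move=> lh; exact: (L1_mul_sqr p2 lh (LM n)). Qed.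

Let sqrt_ge1 n : (0 < n)%N -> 1 <= n%:R `^ 2^-1 :> R.
Proof.
move=> n0; have h : 0 <= 2^-1 :> R by rewrite invr_ge0.
by have := le_powR h ler01 (_ : 1 <= n%:R); rewrite powR1 ler1n; apply.
Qed.

Definition gap_constant := 3 + 2 * B + 3 * remainder_moment.

Let B0 : 0 <= B.
Proof.
have := Hmom 1; rewrite powR1 mulr1; apply: le_trans.
by apply: Ex_ge0 => v; rewrite powR_ge0.
Qed.

Let remainder_moment0 : 0 <= remainder_moment.
Proof. by rewrite !mulr_ge0 ?powR_ge0// Ex_ge0// => w; rewrite powR_ge0. Qed.

(** Almost everywhere S_n = M_n + rho with rho the coboundary, so the difference of squares is 2 M_n
    rho + rho^2. Young's inequality is applied with M_n / n^(1/2) and rho, both bounded in L^p, and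
    restores one factor n^(1/2). *)
Lemma sqr_gap n (h U : Omega -> R) : (0 < n)%N -> measurable_fun setT h -> Lp P p U ->
  (forall w, `|h w| <= `|U w| `^ (p - 2)) ->
  `|Ex P (fun w => h w * S n w ^+ 2) - Ex P (fun w => h w * M n w ^+ 2)|
    <= gap_constant * n%:R `^ 2^-1 * (1 + Ex P (fun w => `|U w| `^ p)).
Proof.
move=> n0 mh LU hU; have lh := Lconj mh LU hU.
set t := n%:R `^ 2^-1; have t1 : 1 <= t := sqrt_ge1 n0.
have t0 : 0 < t by rewrite (lt_le_trans ltr01).
have p0 : 0 <= p by have := p1; lra.
set u := Ex P (fun w => `|U w| `^ p).
have u0 : 0 <= u by apply: Ex_ge0 => w; rewrite powR_ge0.
pose S' w := M n w + rho n w.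
have LS' : Lp P p S' by exact: (LpD p1).
have lS' : L1 P (fun w => h w * S' w ^+ 2) := L1_mul_sqr p2 lh LS'.
have -> : Ex P (fun w => h w * S n w ^+ 2) = Ex P (fun w => h w * S' w ^+ 2).
  apply: Ex_ae; [exact: L1_measurable (LS2 n lh)|exact: L1_measurable lS'|].
  have := SE n; apply: filterS => w E wT.
  by rewrite (E wT) /S' /rho; congr (_ * _ ^+ 2); ring.
have lM := LM2 n lh.
rewrite -(ExB lS' lM).
pose g w := t * (3 * `|U w| `^ p + 2 * (`|M n w| `^ p / t `^ p) + 3 * `|rho n w| `^ p).
have lu := LU.2; have lm := (LM n).2; have lr := (Lrho n).2.
have l2 : L1 P (fun w => `|M n w| `^ p / t `^ p).
  by apply: eq_L1 (L1Z (t `^ p)^-1 lm) => w; rewrite mulrC.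
have l3 := L1Z 3 lu; have l4 := L1Z 2 l2; have l5 := L1Z 3 lr.
have lg : L1 P g by apply: L1Z; apply: L1D => //; exact: L1D.
apply: (@le_trans _ _ (Ex P g)).
  apply: Ex_norm_le => //; first exact: (L1_measurable (L1B lS' lM)).
  move=> w; rewrite -mulrBr normrM.
  have -> : S' w ^+ 2 - M n w ^+ 2 = 2 * (M n w * rho n w) + rho n w ^+ 2 by rewrite /S'; ring.
  apply: (@le_trans _ _ (`|U w| `^ (p - 2) * (2 * (`|M n w| * `|rho n w|) + `|rho n w| ^+ 2))).
    apply: ler_pM => //; rewrite (le_trans (ler_normD _ _))// !normrM normr_nat.
    by rewrite -expr2.
  set x := `|M n w|; set y := `|rho n w|; set z := `|U w|.
  have x0 : 0 <= x / t by rewrite divr_ge0 ?normr_ge0// ltW.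
  have y0 : 0 <= y by exact: normr_ge0.
  have z0 : 0 <= z by exact: normr_ge0.
  have e1 := young_three z0 x0 y0; have e2 := powR_sub2_mul_sqr_le p2 z0 y0.
  have xE : (x / t) `^ p = x `^ p / t `^ p.
    have ti0 : 0 <= t^-1 by rewrite invr_ge0 ltW.
    rewrite (powRM _ (normr_ge0 _ : 0 <= x) ti0) -(powR_inv1 (ltW t0)).
    by rewrite -powRrM mulN1r powRN.
  have -> : z `^ (p - 2) * (2 * (x * y) + y ^+ 2) =
    t * (2 * (z `^ (p - 2) * (x / t * y))) + z `^ (p - 2) * y ^+ 2.
    by field; rewrite gt_eqF.
  rewrite xE in e1.
  have e3 : z `^ p + y `^ p <= t * (z `^ p + y `^ p).
    by rewrite ler_peMl// addr_ge0 ?powR_ge0.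
  have := ler_wpM2l (ltW t0) e1.
  rewrite /g -/x -/y -/z.
  have -> : t * (3 * z `^ p + 2 * (x `^ p / t `^ p) + 3 * y `^ p) =
    2 * (t * (z `^ p + x `^ p / t `^ p + y `^ p)) + t * (z `^ p + y `^ p) by ring.
  lra.
rewrite /g ExZ; last by apply: L1D => //; exact: L1D.
rewrite (ExD (L1D l3 l4) l5) (ExD l3 l4) (ExZ 3 lu) (ExZ 2 l2) (ExZ 3 lr).
have -> : Ex P (fun w => `|M n w| `^ p / t `^ p) = Ex P (fun w => `|M n w| `^ p) / t `^ p.
  by rewrite mulrC -ExZ//; apply: eq_Ex => w; rewrite mulrC.
have h2 : Ex P (fun w => `|M n w| `^ p) / t `^ p <= B.
  rewrite (ler_pdivrMr _ _ (powR_gt0 p t0)); apply: (le_trans (Hmom n)).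
  rewrite /t -powRrM [2^-1 * p]mulrC; exact: lexx.
have h3 := remainder_le n; rewrite -/u.
rewrite [gap_constant * t]mulrC -[leRHS]mulrA; apply: (ler_wpM2l (ltW t0)).
have Bu : 0 <= B * u by rewrite mulr_ge0.
have Cu : 0 <= remainder_moment * u by rewrite mulr_ge0.
rewrite /gap_constant; lra.
Qed.

Lemma gap_constant_ge0 : 0 <= gap_constant.
Proof.
have := B0; have := remainder_moment0; rewrite /gap_constant; lra.
Qed.

Lemma variance_gap n : (0 < n)%N ->
  `|Ex P (fun w => S n w ^+ 2) - n%:R * sigma ^+ 2| <= 2 * gap_constant * n%:R `^ 2^-1.
Proof.
move=> n0.
have h1 (w : Omega) : `|1 : R| <= `|1| `^ (p - 2) by rewrite normr1 powR1.
have := sqr_gap n0 (@measurable_cst _ _ _ _ setT (1 : R)) (Lp_cst P p 1) h1.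
rewrite normr1 powR1 Ex_cst.
have -> : Ex P (fun w => 1 * S n w ^+ 2) = Ex P (fun w => S n w ^+ 2).
  by apply: eq_Ex => w; rewrite mul1r.
have -> : Ex P (fun w => 1 * M n w ^+ 2) = n%:R * sigma ^+ 2.
  rewrite -(Ex_birkhoff_sqr TK TinvK Tpres sF F0T p2 mD DLp D0 Dvar n).
  by apply: eq_Ex => w; rewrite mul1r.
move=> h; apply: (le_trans h); rewrite le_eqVlt; apply/orP; left; apply/eqP; ring.
Qed.

(** The first term comes from E(S_n^2|F0). Of the three gaps, one replaces S_n^2 by M_n^2 and two
    replace E(S_n^2) by n sigma^2. *)
Definition base_bound n := n%:R * c n + 3 * gap_constant * n%:R `^ 2^-1.

Lemma base_bound_ge0 n : 0 <= base_bound n.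
Proof.
by rewrite addr_ge0 ?mulr_ge0 ?ler0n ?powR_ge0 ?gap_constant_ge0.
Qed.

Lemma dual_base n (h U : Omega -> R) : (0 < n)%N -> measF F0 h -> Lp P p U ->
  (forall w, `|h w| <= `|U w| `^ (p - 2)) ->
  `|Ex P (fun w => h w * Y n w)| <= base_bound n * (1 + Ex P (fun w => `|U w| `^ p)).
Proof.
move=> n0 mh LU hU; have mh' := measF_measurable sF mh; have lh := Lconj mh' LU hU.
have n0R : 0 < n%:R :> R by rewrite ltr0n.
have p'1 : 1 <= p' by rewrite /p' ler_pdivlMr; have := p2; lra.
have lh1 := Lp_L1 p'1 lh.
set u := Ex P (fun w => `|U w| `^ p).
have u0 : 0 <= u by apply: Ex_ge0 => w; rewrite powR_ge0.
have gap := sqr_gap n0 mh' LU hU.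
have lhW : L1 P (fun w => h w * W n w).
  apply: (L1_le _ _ (L1D LU.2 (WLp n0))).
    apply: measurable_funM => //; apply: measurable_funB => //; apply: measurable_funM => //.
    exact: (L1_measurable (cond_exp_L1 sF (Lp2_sqr (L2 (SLp n))))).
  move=> w; rewrite normrM (le_trans (ler_wpM2r (normr_ge0 _) (hU w)))//.
  exact: young_half.
have hW : `|Ex P (fun w => h w * W n w)| <= c n * (1 + u).
  (* Young's inequality is applied to [W n] divided by c n, in place of a duality of norms; if c n =
     0, [W n] vanishes almost everywhere. *)
  have [cn0|cn0] := eqVneq (c n) 0.
    have := Wc n0; rewrite cn0 powR0; last by apply/eqP; have := p2; lra.
    move=> W0; have {}W0 : Ex P (fun w => `|W n w| `^ (p / 2)) = 0.
      by apply/eqP; rewrite eq_le W0 Ex_ge0// => w; rewrite powR_ge0.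
    have Wae := Ex_ge0_eq0 (WLp n0) (fun w => powR_ge0 _ _) W0.
    rewrite mul0r (_ : Ex P _ = 0) ?normr0//.
    rewrite -[RHS](Ex_cst P 0); apply: Ex_ae => //; first exact: L1_measurable lhW.
    move: Wae; apply: filterS => w /[apply] /eqP.
    by rewrite powR_eq0 normr_eq0 => /andP[/eqP -> _]; rewrite mulr0.
  have cp : 0 < c n by rewrite lt_neqAle eq_sym cn0 c_ge0.
  have lW' : L1 P (fun w => `|W n w| `^ (p / 2) / c n `^ (p / 2)).
    by apply: eq_L1 (L1Z (c n `^ (p / 2))^-1 (WLp n0)) => w; rewrite mulrC.
  apply: (@le_trans _ _ (Ex P (fun w => c n * (`|U w| `^ p + `|W n w| `^ (p / 2) / c n `^ (p / 2))))).
    apply: Ex_norm_le; first exact: L1_measurable lhW.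
      by apply: L1Z; apply: L1D => //; exact: LU.2.
    move=> w; rewrite normrM (le_trans (ler_wpM2r (normr_ge0 _) (hU w)))//.
    have wc0 : 0 <= `|W n w| / c n by rewrite divr_ge0.
    have := ler_wpM2l (ltW cp) (young_half (normr_ge0 (U w)) wc0).
    have -> : c n * (`|U w| `^ (p - 2) * (`|W n w| / c n)) = `|U w| `^ (p - 2) * `|W n w|.
      by field; rewrite gt_eqF.
    have ci0 : 0 <= (c n)^-1 by rewrite invr_ge0.
    rewrite (powRM _ (normr_ge0 _) ci0) -(powR_inv1 (ltW cp)) -powRrM mulN1r powRN.
    by [].
  rewrite ExZ; last by apply: L1D => //; exact: LU.2.
  rewrite (ExD LU.2 lW') ler_wpM2l// addrC lerD2r.
  have -> : Ex P (fun w => `|W n w| `^ (p / 2) / c n `^ (p / 2)) =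
     Ex P (fun w => `|W n w| `^ (p / 2)) / c n `^ (p / 2).
    by rewrite [RHS]mulrC -(ExZ _ (WLp n0)); apply: eq_Ex => w; rewrite mulrC.
  by rewrite ler_pdivrMr ?powR_gt0// mul1r Wc.
have hh : `|Ex P h| <= 1 + u.
  rewrite -(Ex_cst P 1) -ExD; [|exact: L1_cst|exact: LU.2].
  apply: Ex_norm_le => //; first by apply: L1D; [exact: L1_cst|exact: LU.2].
  move=> w; rewrite (le_trans (hU w))// powR_le1D//; have := p2; lra.
have lS2 := Lp2_sqr (L2 (SLp n)).
have lhE : L1 P (fun w => h w * cond_exp P F0 (fun w' => S n w' ^+ 2) w).
  apply: eq_L1 (L1D (L1Z n%:R lhW) (L1Z (n%:R * s2 n) lh1)) => w /=.
  by rewrite -/(s2 n); field; rewrite gt_eqF.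
have EhS : Ex P (fun w => h w * S n w ^+ 2) = n%:R * Ex P (fun w => h w * W n w)
    + Ex P (fun w => S n w ^+ 2) * Ex P h.
  rewrite (Ex_cond_exp sF lS2 mh (LS2 n lh) lhE).
  rewrite -ExZ// -ExZ// -ExD; [|exact: L1Z|exact: L1Z].
  by apply: eq_Ex => w; field; rewrite gt_eqF.
have -> : Ex P (fun w => h w * Y n w) =
   - (Ex P (fun w => h w * S n w ^+ 2) - Ex P (fun w => h w * M n w ^+ 2))
   + n%:R * Ex P (fun w => h w * W n w)
   + (Ex P (fun w => S n w ^+ 2) - n%:R * sigma ^+ 2) * Ex P h.
  have -> : Ex P (fun w => h w * Y n w) = Ex P (fun w => h w * M n w ^+ 2) - n%:R * sigma ^+ 2 * Ex P h.
    rewrite -ExZ// -ExB//; [|exact: LM2|exact: L1Z].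
    by apply: eq_Ex => w; ring.
  by rewrite EhS; ring.
have t0 : 0 <= n%:R `^ 2^-1 :> R by exact: powR_ge0.
have vg := variance_gap n0.
rewrite /base_bound [leRHS]mulrDl.
set g := gap_constant * n%:R `^ 2^-1 in gap.
have g0 : 0 <= g.
  by rewrite mulr_ge0// gap_constant_ge0.
have -> : 3 * gap_constant * n%:R `^ 2^-1 * (1 + u) = g * (1 + u) + 2 * g * (1 + u) by rewrite /g; ring.
have e3 : `|(Ex P (fun w => S n w ^+ 2) - n%:R * sigma ^+ 2) * Ex P h| <= 2 * g * (1 + u).
  by rewrite normrM; apply: ler_pM => //; rewrite /g mulrA.
have e2 : `|n%:R * Ex P (fun w => h w * W n w)| <= n%:R * c n * (1 + u).
  by rewrite normrM normr_nat -mulrA ler_wpM2l.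
rewrite addrA; apply: (le_trans (ler_normD _ _)); apply: lerD e3.
apply: (le_trans (ler_normD _ _)); rewrite [leRHS]addrC.
by apply: (lerD _ e2); rewrite normrN.
Qed.

(* Splitting M_m at time n bounds the dual norm of M_m^2 - m sigma^2 by
   base_bound n + base_bound (m - n); averaging over n makes the sum of these
   bounds along m = 2^j a sum over all n. *)
Definition dual_eps m :=
  if (m <= 1)%N then base_bound 1
  else 2 * m.-1%:R^-1 * \sum_(1 <= n < m) base_bound n.

Lemma dual_eps_ge0 m : 0 <= dual_eps m.
Proof.
rewrite /dual_eps; case: ifP => _; first exact: base_bound_ge0.
by rewrite !mulr_ge0 ?invr_ge0 ?ler0n// sumr_ge0// => n _; exact: base_bound_ge0.
Qed.

Lemma dual_split m n (h U : Omega -> R) : (0 < n)%N -> (n < m)%N -> measF F0 h -> Lp P p U ->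
  (forall w, `|h w| <= `|U w| `^ (p - 2)) ->
  `|Ex P (fun w => h w * Y m w)|
    <= (base_bound n + base_bound (m - n)) * (1 + Ex P (fun w => `|U w| `^ p)).
Proof.
move=> n0 nm mh LU hU; have mh' := measF_measurable sF mh; have lh := Lconj mh' LU hU.
have k0 : (0 < m - n)%N by rewrite subn_gt0.
set k := (m - n)%N in k0 *.
have mE : m = (n + k)%N by rewrite subnKC// ltnW.
have LMT := Lp_iter Tpres n (LM k).
have lY j i : L1 P (fun v => h v * (M j (iter i T v) ^+ 2 - j%:R * sigma ^+ 2)).
  exact: (L1_mul_Y Tpres sigma p2 DLp j i lh).
have lmm := L1_mul_mul p2 lh (LM n) LMT.
have -> : Ex P (fun w => h w * Y m w) = Ex P (fun w => h w * Y n w)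
   + Ex P (fun w => h w * (M k (iter n T w) ^+ 2 - k%:R * sigma ^+ 2))
   + 2 * Ex P (fun w => h w * (M n w * M k (iter n T w))).
  rewrite -ExZ// -ExD; [|exact: (lY n 0%N)|exact: lY].
  rewrite -ExD; [|by apply: L1D; [exact: (lY n 0%N)|exact: lY]|exact: L1Z].
  by apply: eq_Ex => w; rewrite mE birkhoffD natrD; ring.
have -> : Ex P (fun w => h w * (M n w * M k (iter n T w))) = 0.
  transitivity (Ex P (fun w => h w * M n w * M k (iter n T w))).
    by apply: eq_Ex => w; rewrite mulrA.
  apply: (Ex_block_orthogonal TK TinvK Tpres sF F0T p2 DLp D0).
    have a1 : adapted Tinv F0 n h by exact: (adapted_le TinvK sF F0T (leq0n n)).
    exact: (measurable_funM a1 (adapted_birkhoff TinvK sF F0T mD n)).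
  move=> i; apply: eq_L1 (L1_mul_mul p2 lh (LM n) (Lp_iter Tpres i DLp)) => v; by rewrite mulrA.
rewrite mulr0 addr0 mulrDl; apply: (le_trans (ler_normD _ _)); apply: lerD.
  exact: dual_base.
have -> : Ex P (fun w => h w * (M k (iter n T w) ^+ 2 - k%:R * sigma ^+ 2)) =
   Ex P (fun w => h (iter n Tinv w) * Y k w).
  rewrite -(Ex_iter Tpres n (f := fun w => h (iter n Tinv w) * Y k w)).
    by apply: eq_Ex => w; rewrite iterK.
  apply: measurable_funM.
    exact: (measurableT_comp mh' (measurable_iter Tinv n)).
  by apply: measurable_funB => //; apply: measurable_funX; exact: (LM k).1.
have -> : Ex P (fun w => `|U w| `^ p) = Ex P (fun w => `|U (iter n Tinv w)| `^ p).
  exact/esym/(Ex_iter_inv TK Tpres n (L1_measurable LU.2)).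
apply: dual_base => //.
  exact: (measF_iter_inv TinvK sF F0T n mh).
split; first exact: (measurableT_comp LU.1 (measurable_iter Tinv n)).
exact: (L1_iter_inv TK Tpres n LU.2).
Qed.

Lemma dual_eps_le m (h U : Omega -> R) : (0 < m)%N -> measF F0 h -> Lp P p U ->
  (forall w, `|h w| <= `|U w| `^ (p - 2)) ->
  `|Ex P (fun w => h w * Y m w)| <= dual_eps m * (1 + Ex P (fun w => `|U w| `^ p)).
Proof.
move=> m0 mh LU hU; rewrite /dual_eps; case: ifPn => [m1|].
  have -> : m = 1%N by apply/eqP; rewrite eqn_leq m1.
  exact: dual_base.
rewrite -ltnNge => m1; set e := Ex P _; set u := 1 + _.
have m1R : 0 < m.-1%:R :> R by rewrite ltr0n -ltnS prednK.
set s := \sum_(1 <= n < m) _.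
have -> : 2 * m.-1%:R^-1 * s * u = 2 * s * u / m.-1%:R by ring.
rewrite (ler_pdivlMr _ _ m1R).
have -> : `|e| * m.-1%:R = \sum_(1 <= n < m) `|e|.
  by rewrite sumr_const_nat subn1 mulr_natr.
apply: (@le_trans _ _ (\sum_(1 <= n < m) (base_bound n + base_bound (m - n)) * u)).
  rewrite !big_nat; apply: ler_sum => n /andP[n0 nm].
  exact: dual_split.
rewrite -mulr_suml big_split/=.
(* The reflection n -> m - n identifies the two halves of the split, whence the factor 2 in
   [dual_eps]. *)
have -> : \sum_(1 <= n < m) base_bound (m - n) = \sum_(1 <= n < m) base_bound n.
  rewrite [RHS]big_nat_rev/= !big_nat; apply: eq_bigr => n /andP[n0 nm].
  by rewrite ?add1n ?subSS.
by rewrite -/s le_eqVlt; apply/orP; left; apply/eqP; ring.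
Qed.

End dual_bound.

(** * Dyadic sums of averages *)

Section dyadic_averages.
Context (R : realType) (p g Cs : R) (c : nat -> R).
Hypotheses (p2 : 2 < p) (p3 : p < 3) (g0 : 0 <= g).
Hypothesis c_ge0 : forall n, 0 <= c n.
Hypothesis c_sum : forall m, \sum_(1 <= n < m) n%:R `^ (- 2 + p / 2) * c n <= Cs.

Let b n := n%:R * c n + g * n%:R `^ 2^-1.

Lemma geometric_sum_le (x : R) n : 0 <= x -> x < 1 ->
  \sum_(0 <= l < n) x ^+ l <= (1 - x)^-1.
Proof.
move=> x0 x1; have y0 : 0 < 1 - x by rewrite subr_gt0.
rewrite -[leRHS]mul1r (ler_pdivlMr _ _ y0).
have -> : (\sum_(0 <= l < n) x ^+ l) * (1 - x) = 1 - x ^+ n.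
  elim: n => [|n IH]; first by rewrite big_geq// mul0r expr0 subrr.
  by rewrite big_nat_recr//= mulrDl IH exprSr; ring.
by rewrite gerBl exprn_ge0.
Qed.

Lemma pow2_powR l (e : R) : (2 ^ l)%:R `^ e = (2 `^ e) ^+ l.
Proof.
rewrite natrX -powR_mulrn ?ler0n// -powRrM mulrC powRrM powR_mulrn ?powR_ge0//.
Qed.

Lemma pow2N_lt1 (a : R) : 0 < a -> 2 `^ (- a) < 1 :> R.
Proof.
move=> a0; rewrite powRN invf_lt1 ?powR_gt0//.
rewrite -[ltLHS](_ : 1 `^ a = 1); last by rewrite powR1.
by apply: gt0_ltr_powR; rewrite ?nnegrE// ltr1n.
Qed.

(** A geometric series that starts at the first power 2^l beyond n. In the strengthened induction
    the term with the minimum is the part of the series not yet spent. *)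
Lemma dyadic_tail_le (a : R) (n N : nat) : 0 < a -> (0 < n)%N ->
  \sum_(0 <= l < N) (if (n < 2 ^ l)%N then (2 `^ (- a)) ^+ l else 0)
    <= (1 - 2 `^ (- a))^-1 * n%:R `^ (- a).
Proof.
move=> a0 n0; set x := 2 `^ (- a).
have x0 : 0 < x by exact: powR_gt0.
have x1 : x < 1 by exact: pow2N_lt1.
have y0 : 0 < 1 - x by rewrite subr_gt0.
set K := (1 - x)^-1; have K0 : 0 <= K by rewrite invr_ge0 ltW.
set v := n%:R `^ (- a).
suff H : \sum_(0 <= l < N) (if (n < 2 ^ l)%N then x ^+ l else 0) + K * Num.min v (x ^+ N)
    <= K * Num.min v 1.
  apply: le_trans (_ : _ <= K * Num.min v 1) _.
    apply: le_trans H; rewrite lerDl mulr_ge0// le_min powR_ge0/=.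
    by rewrite exprn_ge0// ltW.
  by rewrite ler_wpM2l// ge_min lexx.
elim: N => [|N IH]; first by rewrite big_geq// add0r expr0.
apply: le_trans IH; rewrite big_nat_recr//= -addrA lerD2l.
have xS : x ^+ N.+1 <= x ^+ N by rewrite exprS ler_piMl ?exprn_ge0 ?(ltW x0) ?(ltW x1).
case: ifPn => [n2|_].
  have xv : x ^+ N <= v.
    rewrite /x -pow2_powR /v !powRN lef_pV2 ?posrE ?powR_gt0 ?ltr0n ?expn_gt0//.
    by apply: le_powR; rewrite ?ler0n ?(ltW a0)// ler_nat ltnW.
  rewrite !min_r//; last exact: le_trans xv.
  rewrite exprS; have KE : K * (1 - x) = 1 by rewrite mulVf// gt_eqF.
  have -> : x ^+ N + K * (x * x ^+ N) = K * x ^+ N + (1 - K * (1 - x)) * x ^+ N by ring.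
  by rewrite KE subrr mul0r addr0.
rewrite add0r ler_wpM2l// le_min ge_min lexx/= ge_min; apply/orP; right; exact: xS.
Qed.

(** Exchanging the sums, n c n receives the weights 2^(-l a) for 2^l > n, with a = (6-p)/2; they add
    up to a multiple of n^(-a), and n^(1-a) = n^(-2+p/2) is the weight in [c_sum]. The n^(1/2) part
    leaves powers of 2^((p-3)/2) < 1. *)
Lemma dyadic_average_sum : exists E, forall N,
  \sum_(0 <= l < N) (2 ^ l)%:R `^ ((p - 4) / 2) *
    (if (2 ^ l <= 1)%N then b 1
     else 2 * (2 ^ l).-1%:R^-1 * \sum_(1 <= n < 2 ^ l) b n) <= E.
Proof.
have p2' := p2; have p3' := p3.
pose a := (6 - p) / 2; have a0 : 0 < a by rewrite /a; lra.
pose x : R := 2 `^ (- a); pose y : R := 2 `^ ((p - 3) / 2).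
have x0 : 0 <= x by exact: powR_ge0.
have y0 : 0 <= y by exact: powR_ge0.
have y1 : y < 1.
  rewrite /y (_ : (p - 3) / 2 = - ((3 - p) / 2)); last by field.
  by apply: pow2N_lt1; lra.
have b0 n : 0 <= b n by rewrite /b addr_ge0 ?mulr_ge0 ?powR_ge0 ?ler0n.
pose K := (1 - x)^-1.
have K0 : 0 <= K.
  by rewrite invr_ge0 subr_ge0 ltW// pow2N_lt1.
exists (b 1 + 4 * (K * Cs) + 4 * g * (1 - y)^-1) => N.
pose A l := \sum_(1 <= n < 2 ^ l) n%:R * c n.
apply: (@le_trans _ _ (\sum_(0 <= l < N) ((if l == 0%N then b 1 else 0) + 4 * (x ^+ l * A l) + 4 * g * y ^+ l))).
  apply: ler_sum => l _; have [->|l0] := eqVneq l 0%N.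
    rewrite expn0/= powR1 mul1r -addrA lerDl addr_ge0 ?mulr_ge0 ?expr0 ?mulr1//.
    by rewrite /A expn0 big_geq.
  have m2 : (2 <= 2 ^ l)%N by rewrite -{1}(expn1 2) leq_exp2l// lt0n.
  rewrite leqNgt m2/= add0r.
  set m := (2 ^ l)%N in m2 *.
  have m0 : 0 < m%:R :> R by rewrite ltr0n; exact: ltn_trans m2.
  have m1 : 0 < m.-1%:R :> R by rewrite ltr0n -ltnS prednK//; exact: ltn_trans m2.
  have i1 : 2 * m.-1%:R^-1 <= 4 / m%:R :> R.
    rewrite (ler_pdivlMr _ _ m0) mulrAC (ler_pdivrMr _ _ m1).
    have : (m <= m.-1 * 2)%N by lia.
    by rewrite -(ler_nat R) natrM; lra.
  have i2 : \sum_(1 <= n < m) b n <= A l + g * (m%:R * m%:R `^ 2^-1).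
    rewrite /b big_split/= lerD2l -mulr_sumr ler_wpM2l//.
    apply: (@le_trans _ _ (\sum_(1 <= n < m) m%:R `^ 2^-1)).
      rewrite !big_nat; apply: ler_sum => n /andP[_ nm].
      by apply: le_powR; rewrite ?invr_ge0 ?ler0n// ler_nat ltnW.
    by rewrite sumr_const_nat -[leLHS]mulr_natl ler_wpM2r ?powR_ge0// ler_nat leq_subr.
  have A0 : 0 <= A l by apply: sumr_ge0 => n _; rewrite mulr_ge0.
  apply: (@le_trans _ _ (m%:R `^ ((p - 4) / 2) * (4 / m%:R * (A l + g * (m%:R * m%:R `^ 2^-1))))).
    rewrite ler_wpM2l ?powR_ge0//; apply: ler_pM => //; exact: sumr_ge0.
  have xE : x ^+ l = m%:R `^ ((p - 4) / 2) / m%:R.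
    rewrite /x -pow2_powR -/m -(powR_inv1 (ltW m0)) powR_mulD//; congr (_ `^ _).
    by rewrite /a; field.
  have yE : y ^+ l = m%:R `^ ((p - 4) / 2) * m%:R `^ 2^-1.
    rewrite /y -pow2_powR -/m powR_mulD//; congr (_ `^ _); by field.
  rewrite xE yE le_eqVlt; apply/orP; left; apply/eqP; field; by rewrite gt_eqF.
rewrite !big_split/= lerD//; last first.
  by rewrite -mulr_sumr ler_wpM2l ?mulr_ge0//; exact: geometric_sum_le.
rewrite lerD//.
  case: N => [|N]; first by rewrite big_geq.
  rewrite big_nat_recl//= big1 ?addr0// => i _.
rewrite -mulr_sumr ler_wpM2l//.
apply: (@le_trans _ _ (\sum_(1 <= n < 2 ^ N) n%:R * c n *
   \sum_(0 <= l < N) (if (n < 2 ^ l)%N then x ^+ l else 0))).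
  under [leRHS]eq_bigr do rewrite mulr_sumr.
  rewrite exchange_big/= !big_nat; apply: ler_sum => l /andP[_ lN].
  rewrite /A mulr_sumr.
  have l2 : (2 ^ l <= 2 ^ N)%N by rewrite leq_exp2l// ltnW.
  have l1 : (1 <= 2 ^ l)%N by rewrite expn_gt0.
  rewrite [leRHS](big_cat_nat l1 l2)/= -[leLHS]addr0 lerD//; last first.
    by apply: sumr_ge0 => n _; case: ifP => _; rewrite ?mulr0// mulr_ge0 ?exprn_ge0// mulr_ge0.
  rewrite !big_nat; apply: ler_sum => n /andP[_ ->].
  by rewrite mulrC.
apply: (@le_trans _ _ (\sum_(1 <= n < 2 ^ N) K * (n%:R `^ (- 2 + p / 2) * c n))).
  rewrite !big_nat; apply: ler_sum => n /andP[n0 _].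
  have n0R : 0 < n%:R :> R by rewrite ltr0n.
  apply: (le_trans (ler_wpM2l _ (dyadic_tail_le N a0 n0))); first by rewrite mulr_ge0.
  rewrite -/x -/K.
  have -> : n%:R `^ (- 2 + p / 2) = n%:R * n%:R `^ (- a).
    rewrite -[X in _ = X * _](powRr1 (ltW n0R)) powR_mulD//; congr (_ `^ _).
    by rewrite /a; field.
  by rewrite le_eqVlt; apply/orP; left; apply/eqP; ring.
by rewrite -mulr_sumr ler_wpM2l.
Qed.

End dyadic_averages.

Lemma eq_cvgn (R : realType) (u v : nat -> R) (l : R) : u =1 v ->
  (u n @[n --> \oo] --> l)%classic -> (v n @[n --> \oo] --> l)%classic.
Proof. by move=> /funext ->. Qed.

Lemma cvg_shiftz (R : realType) (u : int -> R) (l : R) z :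
  (u n%:Z @[n --> \oo] --> l)%classic -> (u (n%:Z + z) @[n --> \oo] --> l)%classic.
Proof.
case: z => a ul; first by have := ul; rewrite -(cvg_shiftn a).
rewrite -(cvg_shiftn a.+1); move: ul; by apply: eq_cvgn => n; congr u; rewrite NegzE PoszD addrK.
Qed.

(** * Convergence of the covariance series, and its sum *)

Section covariance_series.
Context d (Omega : measurableType d) (R : realType) (P : probability Omega R).
Variables (T Tinv : {mfun Omega >-> Omega}).
Hypotheses (TK : cancel T Tinv) (TinvK : cancel Tinv T).
Hypothesis Tpres : measure_preserving P T.
Variable F0 : set (set Omega).
Hypothesis sF : sigma_subalgebra F0.
Hypothesis F0T : F0 `<=` preimage_set_system setT T F0.
Variable p : R.
Hypotheses (p2 : 2 < p).
Variable X0 : {mfun Omega >-> R}.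
Hypothesis X0Lp : Lp P p X0.
Notation X := (Xseq T Tinv X0).
Notation eX := (condX P T Tinv F0 X0).
Variables (A B : Omega -> R).
Hypotheses (LA : Lp P p A) (LB : Lp P p B).
Hypothesis nA : null P (fun n w => past_sum P T Tinv F0 X0 n w - A w).
Hypothesis nB : null P (fun n w => future_sum P T Tinv F0 X0 n w - B w).
Notation V := (cobound P T Tinv F0 X0 A B).
Notation D0 := (mart0 P T Tinv F0 X0 A B).
Notation D := (mart P T Tinv F0 X0 A B).

Let p1 : 1 <= p. Proof. by have := p2; lra. Qed.
Let L2 f : Lp P p f -> Lp P 2 f. Proof. exact: (Lp_Lp2 (ltW p2)). Qed.
Let LX k : Lp P 2 (X k). Proof. exact: (L2 (Lp_Xseq TK Tpres X0Lp k)). Qed.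
Let LeX k : Lp P 2 (eX k). Proof. exact: (L2 (Lp_condX TK Tpres sF p2 X0Lp k)). Qed.
Let LV : Lp P 2 V. Proof. exact: (L2 (Lp_cobound TK Tpres sF p2 X0Lp LA LB)). Qed.
Let LD0 : Lp P 2 D0. Proof. exact: (L2 (Lp_mart0 TK Tpres sF p2 X0Lp LA LB)). Qed.
Let LD : Lp P 2 D. Proof. exact: (L2 (Lp_mart TK Tpres sF p2 X0Lp LA LB)). Qed.
Let LT f n : Lp P 2 f -> Lp P 2 (fun w => f (iter n T w)). Proof. exact: (Lp_iter Tpres n). Qed.

(** The coboundary is known only as a limit in L^2, so the decay of its correlations is proved for
    finite sums and extended by closure, without a rate. *)
Definition decorrelated (Y : nat -> Omega -> R) (U : Omega -> R) : Prop :=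
  (Ex P (fun w => U w * Y n w) @[n --> \oo] --> (0 : R))%classic.

Section decorrelation.
Variables (Y : nat -> Omega -> R) (K : R).
Hypothesis LY : forall n, Lp P 2 (Y n).
Hypothesis YK : forall n, Ex P (fun w => Y n w ^+ 2) <= K.

Lemma decorrelatedD U W : Lp P 2 U -> Lp P 2 W -> decorrelated Y U -> decorrelated Y W ->
  decorrelated Y (fun w => U w + W w).
Proof.
move=> lU lW dU dW.
have H : (Ex P (fun w => U w * Y n w) + Ex P (fun w => W w * Y n w) @[n --> \oo] --> (0 : R) + 0)%classic.
  exact: cvgD.
rewrite addr0 in H; move: H; apply: eq_cvgn => n; rewrite -ExD; [|exact: Lp2_mul|exact: Lp2_mul].
by apply: eq_Ex => w; rewrite mulrDl.
Qed.

Lemma decorrelatedN U : Lp P 2 U -> decorrelated Y U -> decorrelated Y (fun w => - U w).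
Proof.
move=> lU dU.
have := cvg_mul0 (-1) dU; apply: eq_cvgn => n; rewrite -ExZ; last exact: Lp2_mul.
by apply: eq_Ex => w; rewrite mulN1r mulNr.
Qed.

Let LpN U : Lp P 2 U -> Lp P 2 (fun w => - U w).
Proof.
by move=> lU; have := LpZ (-1) lU; congr (Lp _ _); apply/funext => w; rewrite mulN1r.
Qed.

Lemma decorrelatedB U W : Lp P 2 U -> Lp P 2 W -> decorrelated Y U -> decorrelated Y W ->
  decorrelated Y (fun w => U w - W w).
Proof.
move=> lU lW dU dW; apply: decorrelatedD => //; first exact: LpN.
exact: decorrelatedN.
Qed.

Lemma decorrelated_sum m n (F : nat -> Omega -> R) : (forall k, Lp P 2 (F k)) ->
  (forall k, decorrelated Y (F k)) -> decorrelated Y (fun w => \sum_(m <= k < n) F k w).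
Proof.
move=> lF dF; elim: (index_iota m n) => [|k s IH].
  rewrite /decorrelated (_ : (fun n0 => _) = fun=> 0); first exact: cvg_cst.
  by apply/funext => i; rewrite -[RHS](Ex_cst P 0); apply: eq_Ex => w; rewrite big_nil mul0r.
have := decorrelatedD (lF k) (Lp_sum (ler1n R 2) s lF) (dF k) IH.
by congr decorrelated; apply/funext => w; rewrite big_cons.
Qed.

Lemma decorrelated_closed U (W : nat -> Omega -> R) : Lp P 2 U -> (forall j, Lp P 2 (W j)) ->
  null P (fun j w => W j w - U w) -> (forall j, decorrelated Y (W j)) -> decorrelated Y U.
Proof.
move=> lU lW nW dW; apply/cvgr0Pnorm_lt => e e0.
have K0 : 0 <= K := le_trans (Ex_sqr_ge0 P (Y 0%N)) (YK 0%N).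
pose del := (e / 2) ^+ 2 / (K + 1).
have K1 : 0 < K + 1 by rewrite ltr_wpDl.
have d0 : 0 < del by rewrite divr_gt0// exprn_gt0// divr_gt0.
have /cvgr0Pnorm_lt /(_ del d0) [j _ /(_ j (leqnn j))] /= := nW.
rewrite ger0_norm ?Ex_sqr_ge0// => hj.
have e20 : 0 < e / 2 by rewrite divr_gt0.
have /cvgr0Pnorm_lt /(_ _ e20) := dW j; apply: filterS => n hn.
have lWU : Lp P 2 (fun w => W j w - U w) by apply: (LpB (ler1n R 2)).
have cs := Ex_mul_sqr_le lWU (LY n).
have gap : `|Ex P (fun w => (W j w - U w) * Y n w)| < e / 2.
  rewrite -(ltr_pXn2r (ltn0Sn 1)) ?nnegrE ?normr_ge0 ?(ltW e20)// -normrX ger0_norm ?sqr_ge0//.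
  apply: (le_lt_trans cs); apply: (@le_lt_trans _ _ (Ex P (fun w => (W j w - U w) ^+ 2) * (K + 1))).
    by rewrite ler_wpM2l ?Ex_sqr_ge0// (le_trans (YK n))// lerDl.
  by rewrite -(ltr_pdivlMr _ _ K1).
have -> : Ex P (fun w => U w * Y n w) = Ex P (fun w => W j w * Y n w) - Ex P (fun w => (W j w - U w) * Y n w).
  rewrite -ExB; [|exact: Lp2_mul|exact: Lp2_mul].
  by apply: eq_Ex => w; ring.
by rewrite (le_lt_trans (ler_normB _ _))// [ltRHS]splitr ltrD.
Qed.

Lemma decorrelated_cobound : (forall a : nat, decorrelated Y (X (- a%:Z))) ->
  (forall k, decorrelated Y (eX k)) -> decorrelated Y V.
Proof.
move=> dX deX.
have LVn n : Lp P 2 (cobound_sum P T Tinv F0 X0 n).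
  exact: (L2 (Lp_cobound_sum TK Tpres sF p2 X0Lp n)).
apply: (decorrelated_closed LV LVn).
  exact: (null_cobound TK Tpres sF p2 X0Lp LA LB nA nB).
move=> n; have lp : Lp P 2 (past_sum P T Tinv F0 X0 n).
  exact: (L2 (Lp_past_sum TK Tpres sF p2 X0Lp n)).
have lf : Lp P 2 (future_sum P T Tinv F0 X0 n).
  exact: (L2 (Lp_future_sum TK Tpres sF p2 X0Lp n)).
have lB1 := LpB (ler1n R 2) lp lf.
have d0 : decorrelated Y (X 0) by have := dX 0%N; rewrite oppr0.
have dp : decorrelated Y (past_sum P T Tinv F0 X0 n).
  exact: (decorrelated_sum 1 n.+1 (fun k => LeX k%:Z) (fun k => deX k%:Z)).
have df : decorrelated Y (future_sum P T Tinv F0 X0 n).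
  apply: (decorrelated_sum 1 n.+1 (F := fun k w => X (- k%:Z) w - eX (- k%:Z) w)) => k.
    exact: (LpB (ler1n R 2) (LX _) (LeX _)).
  exact: (decorrelatedB (LX _) (LeX _) (dX k) (deX _)).
exact: (decorrelatedD (LpB (ler1n R 2) lB1 (LX 0)) (LeX 0)
  (decorrelatedB lB1 (LX 0) (decorrelatedB lp lf dp df) d0) (deX 0)).
Qed.

End decorrelation.

(* X(-a) is approximated in L^2 by functions measurable with respect to T^{-m} F0. *)
Lemma null_approx (a : nat) :
  null P (fun j w => eX (- (a + j).+1%:Z) (iter j.+1 T w) - X (- a%:Z) w).
Proof.
have := null_Xseq_condX TK Tpres sF p2 X0Lp LB nB.
rewrite /null -(cvg_shiftn a); apply: eq_cvgn => j.
have lm := Lp2_sqr (LpB (ler1n R 2) (LX (- (j + a).+1%:Z)) (LeX (- (j + a).+1%:Z))).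
rewrite -(Ex_iter Tpres j.+1 (L1_measurable lm)); apply: eq_Ex => w.
rewrite Xseq_iter// [(a + j)%N]addnC (_ : - (j + a).+1%:Z + j.+1%:Z = - a%:Z).
  by ring.
by rewrite !intS PoszD; ring.
Qed.

Let Ex_XX_iter n k l : Ex P (fun w => X k w * X l w) = Ex P (fun w => X (k + n%:Z) w * X (l + n%:Z) w).
Proof.
rewrite -(Ex_iter Tpres n (L1_measurable (Lp2_mul (LX k) (LX l)))).
by apply: eq_Ex => w; rewrite !Xseq_iter.
Qed.

Let EX2 k : Ex P (fun w => X k w ^+ 2) = Ex P (fun w => X 0 w ^+ 2).
Proof.
case: k => n.
  rewrite -(Ex_iter Tpres n (L1_measurable (Lp2_sqr (LX 0)))).
  by apply: eq_Ex => w; rewrite Xseq_iter// add0r.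
rewrite -(Ex_iter Tpres n.+1 (L1_measurable (Lp2_sqr (LX (Negz n))))).
by apply: eq_Ex => w; rewrite Xseq_iter// NegzE addNr.
Qed.

(** X 0 is approximated in L^2 by functions of the past of some time j + 1. Against these, X (n + z)
    may be replaced by its conditional expectation given that past, which tends to 0 with the terms
    of the first series. *)
Lemma cov_null z : (Ex P (fun w => X 0 w * X (n%:Z + z) w) @[n --> \oo] --> (0 : R))%classic.
Proof.
apply: (@decorrelated_closed (fun n => X (n%:Z + z)) (Ex P (fun w => X 0 w ^+ 2)) _ _ (X 0)
   (fun j w => eX (- (0 + j).+1%:Z) (iter j.+1 T w))) => //.
- by move=> n; rewrite EX2.
- by move=> j; exact: (LT j.+1 (LeX _)).
- by have := null_approx 0; rewrite oppr0.
- move=> j; set i := - _.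
  have null_e : null P (fun n => eX (n%:Z + (z - j.+1%:Z))).
    apply: (cvg_shiftz (u := fun k => Ex P (fun w => eX k w ^+ 2))).
    rewrite -(cvg_shiftS (fun n => Ex P (fun w => eX n%:Z w ^+ 2))).
    exact: (null_condX TK Tpres sF p2 X0Lp LA nA).
  have := null_mul (fun n => LeX _) (fun=> LeX i) null_e (fun=> lexx _).
  apply: eq_cvgn => n.
  transitivity (Ex P (fun w => eX i w * X (n%:Z + (z - j.+1%:Z)) w)).
    rewrite -(Ex_mul_cond_exp sF p2 (Lp_Xseq TK Tpres X0Lp _) (LeX i) (measF_condX TK Tpres sF p2 X0Lp i)).
    by apply: eq_Ex => w; rewrite mulrC.
  rewrite -(Ex_iter Tpres j.+1 (L1_measurable (Lp2_mul (LeX i) (LX _)))).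
  apply: eq_Ex => w; rewrite Xseq_iter//; congr (_ * X _ w); ring.
Qed.

(** After a shift, V is tested against X (- n). Its terms X (- a) are covered by [cov_null]; for its
    terms E(X_k|F0), the conditioning is transferred to X (- n), which is asymptotically measurable
    for F0. *)
Lemma cobound_Xseq : (Ex P (fun w => X 0 w * V (iter n T w)) @[n --> \oo] --> (0 : R))%classic.
Proof.
have xx k : (Ex P (fun w => X k w * X (- n%:Z) w) @[n --> \oo] --> (0 : R))%classic.
  have := cov_null k; apply: eq_cvgn => n.
  rewrite (Ex_XX_iter n k) addNr [k + _]addrC; apply: eq_Ex => w; exact: mulrC.
have H : decorrelated (fun n => X (- n%:Z)) V.
  apply: (@decorrelated_cobound _ (Ex P (fun w => X 0 w ^+ 2))) => //.
  - by move=> n; rewrite EX2.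
  - by move=> a; exact: xx.
  move=> k.
  have n1 : null P (fun n w => X (- n%:Z) w - eX (- n%:Z) w).
    rewrite /null -(cvg_shiftS (fun n => Ex P (fun w => (X (- n%:Z) w - eX (- n%:Z) w) ^+ 2))).
    exact: (null_Xseq_condX TK Tpres sF p2 X0Lp LB nB).
  have lB n := LpB (ler1n R 2) (LX (- n%:Z)) (LeX (- n%:Z)).
  have c1 := null_mul lB (fun=> LX k) n1 (fun=> lexx _).
  have c2 : (Ex P (fun w => X k w * X (- n%:Z) w)
     - Ex P (fun w => (X (- n%:Z) w - eX (- n%:Z) w) * X k w) @[n --> \oo] --> (0 : R) - 0)%classic.
    exact: cvgB.
  rewrite subrr in c2; move: c2; apply: eq_cvgn => n.
  rewrite -ExB; [|exact: Lp2_mul|exact: Lp2_mul].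
  transitivity (Ex P (fun w => eX (- n%:Z) w * X k w)).
    by apply: eq_Ex => w; ring.
  rewrite -(Ex_mul_cond_exp sF p2 (Lp_Xseq TK Tpres X0Lp k) (LeX _) (measF_condX TK Tpres sF p2 X0Lp _)).
  rewrite -(Ex_mul_cond_exp sF p2 (Lp_Xseq TK Tpres X0Lp _) (LeX k) (measF_condX TK Tpres sF p2 X0Lp _)).
  by apply: eq_Ex => w; exact: mulrC.
move: H; apply: eq_cvgn => n.
have lm := Lp2_mul LV (LX (- n%:Z)).
rewrite -(Ex_iter Tpres n (L1_measurable lm)).
by apply: eq_Ex => w; rewrite Xseq_iter// addNr mulrC.
Qed.

Let D_orth n (h : Omega -> R) : adapted Tinv F0 n h -> Lp P 2 h ->
  Ex P (fun w => h w * D (iter n.+1 T w)) = 0.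
Proof.
move=> ah lh; have lD1 : L1 P D by exact: (Lp_L1 (ler1n R 2) LD).
apply: (Ex_mul_increment TK TinvK Tpres sF lD1 _ ah).
  exact: (mart_orthogonal TK TinvK Tpres sF F0T p2 X0Lp LA LB nA nB).
exact: (Lp2_mul lh (LT _ LD)).
Qed.

Lemma Ex_mul_mart0 h k : Lp P 2 h ->
  Ex P (fun w => h w * D0 (iter k T w)) = Ex P (fun w => h w * D (iter k T w)).
Proof.
move=> lh; apply/eqP; rewrite -subr_eq0 -ExB; [|exact: (Lp2_mul lh (LT k LD0))|exact: (Lp2_mul lh (LT k LD))].
have lB := LpB (ler1n R 2) LD0 LD.
have := Ex_mul_sqr_le lh (LT k lB).
have -> : Ex P (fun w => (D0 (iter k T w) - D (iter k T w)) ^+ 2) = 0.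
  rewrite (Ex_iter Tpres k (f := fun w => (D0 w - D w) ^+ 2)); last exact: L1_measurable (Lp2_sqr lB).
  exact: (mart_mart0_sqr TK TinvK Tpres sF F0T p2 X0Lp LA LB nA nB).
rewrite mulr0 => h0; rewrite -sqrf_eq0 eq_le sqr_ge0 andbT; apply: le_trans h0.
rewrite le_eqVlt; apply/orP; left; apply/eqP; congr (_ ^+ 2); apply: eq_Ex => w; ring.
Qed.

(** The approximants of V depend on the past of a fixed time, hence are exactly orthogonal to D o
    T^n for large n. *)
Lemma cobound_mart : (Ex P (fun w => V w * D0 (iter n T w)) @[n --> \oo] --> (0 : R))%classic.
Proof.
have E0 (u : nat -> R) N : (forall n, (N < n)%N -> u n = 0) -> (u n @[n --> \oo] --> (0 : R))%classic.
  by move=> u0; apply: cvg_near_cst; exists N.+1 => //= n; exact: u0.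
have H : decorrelated (fun n w => D (iter n T w)) V.
  apply: (@decorrelated_cobound _ (Ex P (fun w => D w ^+ 2))).
  - by move=> n; exact: (LT n LD).
  - move=> n; rewrite (Ex_iter Tpres n (f := fun w => D w ^+ 2))//.
    exact: L1_measurable (Lp2_sqr LD).
  - move=> a.
    apply: (@decorrelated_closed _ (Ex P (fun w => D w ^+ 2)) _ _ (X (- a%:Z))
       (fun j w => eX (- (a + j).+1%:Z) (iter j.+1 T w))) => //.
    + by move=> n; exact: (LT n LD).
    + move=> n; rewrite (Ex_iter Tpres n (f := fun w => D w ^+ 2))//.
      exact: L1_measurable (Lp2_sqr LD).
    + by move=> j; exact: (LT j.+1 (LeX _)).
    + exact: null_approx.
    + move=> j; apply: (E0 _ j.+1) => -[//|n] jn; apply: D_orth; last exact: (LT j.+1 (LeX _)).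
      apply: (adapted_le TinvK sF F0T (jn : (j.+1 <= n)%N)).
      have := adapted_shift TinvK (k := 0) j.+1 (measF_condX TK Tpres sF p2 X0Lp (- (a + j).+1%:Z)).
      by rewrite add0n.
  - move=> k; apply: (E0 _ 0%N) => -[//|n] _.
    apply: (D_orth _ (LeX k)); apply: (adapted_le TinvK sF F0T (leq0n n)).
    exact: (measF_condX TK Tpres sF p2 X0Lp k).
move: H; apply: eq_cvgn => n.
exact/esym/Ex_mul_mart0.
Qed.

Definition cov_limit := Ex P (fun w => X 0 w * V w) - Ex P (fun w => V w * D0 (T w)).

(** Summation by parts: with X 0 = D0 - V + V o T^-1, the correlation of V o T^-1 with D0 o T^k
    equals that of V with D0 o T^(k+1), so the correlations of X 0 with D0 o T^k telescope. *)
Lemma cov_sumE n : \sum_(1 <= k < n.+1) Ex P (fun w => X 0 w * X k%:Z w) =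
  Ex P (fun w => V w * D0 (iter n.+1 T w)) - Ex P (fun w => X 0 w * V (iter n T w)) + cov_limit.
Proof.
have X0E w : X 0 w = D0 w - V w + V (Tinv w) by rewrite /mart0; ring.
have LVi : Lp P 2 (fun w => V (Tinv w)).
  exact: (L2 (Lp_inv TK Tpres (Lp_cobound TK Tpres sF p2 X0Lp LA LB))).
have adD : adapted Tinv F0 0 D.
  exact: (measF_mart TK Tpres sF p2 X0Lp LA LB).
have DD k : Ex P (fun w => D0 w * D0 (iter k.+1 T w)) = 0.
  rewrite Ex_mul_mart0//.
  transitivity (Ex P (fun w => D (iter k.+1 T w) * D0 (iter 0 T w))).
    by apply: eq_Ex => w; rewrite mulrC.
  rewrite Ex_mul_mart0; last exact: (LT k.+1 LD).
  rewrite -[RHS](D_orth (adapted_le TinvK sF F0T (leq0n k) adD) LD).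
  by apply: eq_Ex => w; rewrite mulrC.
pose v k := Ex P (fun w => V w * D0 (iter k T w)).
have XD k : Ex P (fun w => X 0 w * D0 (iter k.+1 T w)) = v k.+2 - v k.+1.
  have l1 := Lp2_mul LD0 (LT k.+1 LD0); have l2 := Lp2_mul LV (LT k.+1 LD0).
  have l3 := Lp2_mul LVi (LT k.+1 LD0); have l4 := Lp2_mul LV (LT k.+2 LD0).
  transitivity (Ex P (fun w => D0 w * D0 (iter k.+1 T w) - V w * D0 (iter k.+1 T w) + V (Tinv w) * D0 (iter k.+1 T w))).
    by apply: eq_Ex => w; rewrite {1}X0E; ring.
  rewrite (ExD (L1B l1 l2) l3) (ExB l1 l2) DD sub0r addrC; congr (_ - _).
  rewrite -(Ex_iter Tpres 1 (L1_measurable l3)); apply: eq_Ex => w /=.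
  by rewrite TK -iterSr.
have LS k : L1 P (fun w => X 0 w * X k%:Z w) := Lp2_mul (LX 0) (LX k%:Z).
rewrite -Ex_sum//.
have LM : Lp P 2 (birkhoff T D0 n) by apply: (Lp_sum (ler1n R 2)) => k; exact: LT.
have l1 := Lp2_mul (LX 0) LM; have l2 := Lp2_mul (LX 0) (LT n LV); have l3 := Lp2_mul (LX 0) LV.
transitivity (Ex P (fun w => X 0 w * birkhoff T D0 n w - X 0 w * V (iter n T w) + X 0 w * V w)).
  apply: eq_Ex => w; rewrite -mulr_sumr -[\sum_(1 <= k < n.+1) _]/(Ssum T Tinv X0 n w).
  by rewrite (Ssum_mart0 P TK F0 X0 A B); ring.
rewrite (ExD (L1B l1 l2) l3) (ExB l1 l2).
have -> : Ex P (fun w => X 0 w * birkhoff T D0 n w) = v n.+1 - v 1%N.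
  transitivity (Ex P (fun w => \sum_(1 <= k < n.+1) X 0 w * D0 (iter k T w))).
    by apply: eq_Ex => w; rewrite /birkhoff mulr_sumr.
  rewrite Ex_sum; last by move=> k; exact: (Lp2_mul (LX 0) (LT k LD0)).
  rewrite big_add1/=; under eq_bigr do rewrite XD.
  by rewrite (telescope_sumr (fun k => v k.+1)).
rewrite /cov_limit /v; ring.
Qed.

Lemma cov_sum_cvg :
  (\sum_(1 <= k < n.+1) Ex P (fun w => X 0 w * X k%:Z w) @[n --> \oo] --> cov_limit)%classic.
Proof.
under eq_fun do rewrite cov_sumE.
have c1 : (Ex P (fun w => V w * D0 (iter n.+1 T w)) @[n --> \oo] --> (0 : R))%classic.
  by rewrite (cvg_shiftS (fun n => Ex P (fun w => V w * D0 (iter n T w)))); exact: cobound_mart.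
have H : (Ex P (fun w => V w * D0 (iter n.+1 T w)) - Ex P (fun w => X 0 w * V (iter n T w))
   + cov_limit @[n --> \oo] --> (0 : R) - 0 + cov_limit)%classic.
  by apply: cvgD; [apply: cvgB => //; exact: cobound_Xseq|exact: cvg_cst].
by rewrite subrr add0r in H.
Qed.

(** Expanding the square of D0 = X 0 + V - V o T^-1; E(V^2) cancels by invariance. This identifies
    the sum of the bilateral series with a second moment, hence its sign. *)
Lemma cov_limitE : Ex P (fun w => X 0 w ^+ 2) + 2 * cov_limit = Ex P (fun w => D w ^+ 2).
Proof.
have X0E w : X 0 w = D0 w - V w + V (Tinv w) by rewrite /mart0; ring.
have LVi : Lp P 2 (fun w => V (Tinv w)).
  exact: (L2 (Lp_inv TK Tpres (Lp_cobound TK Tpres sF p2 X0Lp LA LB))).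
have DE : Ex P (fun w => D w ^+ 2) = Ex P (fun w => D0 w ^+ 2).
  transitivity (Ex P (fun w => D w * D (iter 0 T w))); first by apply: eq_Ex => w; rewrite expr2.
  rewrite -Ex_mul_mart0//; transitivity (Ex P (fun w => D0 w * D (iter 0 T w))).
    by apply: eq_Ex => w; rewrite mulrC.
  by rewrite -Ex_mul_mart0//; apply: eq_Ex => w; rewrite expr2.
rewrite DE /cov_limit.
have E1 : Ex P (fun w => V w * D0 (T w)) = Ex P (fun w => V (Tinv w) * D0 w).
  rewrite -(Ex_iter Tpres 1 (L1_measurable (Lp2_mul LVi LD0))).
  by apply: eq_Ex => w /=; rewrite TK.
have E2 : Ex P (fun w => V (Tinv w) ^+ 2) = Ex P (fun w => V w ^+ 2).
  exact: (Ex_iter_inv TK Tpres 1 (L1_measurable (Lp2_sqr LV))).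
rewrite E1.
have l1 := Lp2_sqr (LX 0); have l2 := Lp2_mul (LX 0) LV; have l3 := Lp2_mul LVi LD0.
have l4 := Lp2_sqr LV; have l5 := Lp2_sqr LVi.
have -> : Ex P (fun w => D0 w ^+ 2) = Ex P (fun w => X 0 w ^+ 2 + 2 * (X 0 w * V w)
    - 2 * (V (Tinv w) * D0 w) + (V w ^+ 2 - V (Tinv w) ^+ 2)).
  by apply: eq_Ex => w; rewrite !X0E; ring.
rewrite (ExD _ (L1B l4 l5)); last by apply: L1B; [apply: L1D => //|]; exact: L1Z.
rewrite (ExB l4 l5) E2 subrr addr0 (ExB _ (L1Z 2 l3)); last by apply: L1D => //; exact: L1Z.
rewrite (ExD l1 (L1Z 2 l2)) (ExZ 2 l2) (ExZ 2 l3); ring.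
Qed.

End covariance_series.

(** * Test functions whose Taylor polynomial at 0 vanishes *)

Section centered_test_functions.
Context (R : realType) (p r : R).
Hypotheses (p2 : 2 < p) (p3 : p < 3) (r0 : p - 2 <= r) (rp : r <= p).

Let r_gt0 : 0 < r. Proof. have := p2; have := r0; lra. Qed.

Lemma taylor2_center K f c1 c2 : taylor2 r K f c1 c2 ->
  taylor2 r K (fun x => f x - f 0 - c1 0 * x - c2 0 * x ^+ 2)
    (fun x => c1 x - c1 0 - 2 * c2 0 * x) (fun x => c2 x - c2 0).
Proof.
move=> tf; have tmf := taylor2_tame r_gt0 tf; case: tf => K0 cf fe z1 z2; split => //.
- suff [] : tame (fun x => f x - f 0 - c1 0 * x - c2 0 * x ^+ 2) by [].
  apply: tameB; last by apply/tameZ/tameX; exact: tame_id.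
  apply: tameB; last by apply/tameZ; exact: tame_id.
  by apply: tameB => //; exact: tame_cst.
- move=> x h; rewrite (le_trans _ (fe x h))// le_eqVlt; apply/orP; left; apply/eqP.
  by congr `|_|; ring.
- by move=> r1 x; rewrite !(z1 r1) z2 ?subrr ?mulr0 ?mul0r ?subrr//; lra.
- by move=> r2 x; rewrite !(z2 r2) subrr.
Qed.

Variables (K : R) (g c1 c2 : R -> R).
Hypothesis tg : taylor2 r K g c1 c2.
Hypotheses (g0 : g 0 = 0) (c10 : c1 0 = 0) (c20 : c2 0 = 0).

Let K0 : 0 <= K. Proof. by case: tg. Qed.

Lemma centered_le x : `|g x| <= K * `|x| `^ r.
Proof.
case: tg => _ _ h _ _; have := h 0 x; rewrite add0r g0 c10 c20.
by rewrite !mul0r !subr0.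
Qed.

(** The expansions at x of steps x and -x determine both coefficients from g (2 x), g x and g 0 = 0;
    the constant 6 uses 2^r <= 8. *)
Lemma centered_coef_le x : `|c1 x * x| <= 6 * K * `|x| `^ r /\ `|c2 x * x ^+ 2| <= 6 * K * `|x| `^ r.
Proof.
case: tg => _ _ e _ _.
have e1 := e x x; have e2 := e x (- x).
have b0 := centered_le x; have b1 := centered_le (x + x).
rewrite subrr g0 sub0r normrN in e2.
have two : `|x + x| `^ r <= 8 * `|x| `^ r.
  have -> : x + x = 2 * x by ring.
  rewrite normrM normr_nat powRM// ler_wpM2r ?powR_ge0//.
  apply: (@le_trans _ _ (2 `^ 3%:R)); last by rewrite powR_mulrn// -natrX.
  by apply: ler_powR; [rewrite ler1n|have := p3; have := rp; lra].
have two' := ler_wpM2l K0 two.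
set a := `|x| `^ r in b0 e1 e2 two' *; set b := `|x + x| `^ r in b1 two'.
have Ka : 0 <= K * a by rewrite mulr_ge0 ?powR_ge0.
rewrite sqrrN mulrN in e2.
move: b0 b1 e1 e2; rewrite !ler_norml => /andP[? ?] /andP[? ?] /andP[? ?] /andP[? ?].
by split; apply/andP; split; lra.
Qed.

(** For x of order t and h of order 1 the main term c1 x * h has order t^(r-1), and r - 1 <= r - p +
    2 since p < 3. In its uses |x| / t + |h| has bounded moments. *)
Lemma centered_increment_le x h t : 1 <= t ->
  `|g (x + h) - g x| <= 13 * K * t `^ (r - p + 2) * (`|x| / t + `|h|) `^ r.
Proof.
have p2' := p2; have p3' := p3; have r0' := r0; have rp' := rp; have r_gt0' := r_gt0.
move=> t1; have t0 : 0 < t by rewrite (lt_le_trans ltr01).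
case: tg => _ _ e z1 z2.
have xt0 : 0 <= `|x| / t by rewrite divr_ge0 ?(ltW t0).
set w := `|x| / t + `|h|; have w0 : 0 <= w by rewrite addr_ge0.
have hw : `|h| <= w by rewrite lerDr.
have e0 : 0 <= r - p + 2 by lra.
have te : 1 <= t `^ (r - p + 2).
  by have := le_powR e0 ler01 t1; rewrite powR1.
have hr : `|h| `^ r <= w `^ r by apply: le_powR => //; exact: ltW.
have wr : 0 <= w `^ r by exact: powR_ge0.
have base : K * `|h| `^ r <= K * (t `^ (r - p + 2) * w `^ r).
  by rewrite ler_wpM2l// (le_trans hr)// ler_peMl.
have [r1|r1] := leP r 1.
  have := e x h; rewrite (z1 r1) z2; last by lra.
  rewrite !mul0r !subr0 => H; apply: (le_trans H); apply: (le_trans base).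
  rewrite -[leRHS]mulrA -[leRHS]mulrA ler_peMl ?mulr_ge0 ?powR_ge0//; lra.
have [->|xn0] := eqVneq x 0.
  rewrite add0r g0 subr0; apply: (le_trans (centered_le h)); apply: (le_trans base).
  rewrite -[leRHS]mulrA -[leRHS]mulrA ler_peMl ?mulr_ge0 ?powR_ge0//; lra.
have x0 : 0 < `|x| by rewrite normr_gt0.
have [b1 b2] := centered_coef_le x.
have xtw : `|x| <= t * w.
  by rewrite /w mulrDr mulrC divfK ?gt_eqF// lerDl mulr_ge0// ltW.
have tr1 : t `^ (r - 1) <= t `^ (r - p + 2) by apply: ler_powR => //; lra.
have hx1 : `|x| `^ (r - 1) * `|h| <= t `^ (r - p + 2) * w `^ r.
  apply: (@le_trans _ _ ((t * w) `^ (r - 1) * w)).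
    by apply: ler_pM; rewrite ?powR_ge0//; apply: le_powR => //; lra.
  have [wz|wn0] := eqVneq w 0; first by rewrite wz mulr0 mulr_ge0 ?powR_ge0.
  have wp : 0 < w by rewrite lt_neqAle eq_sym wn0.
  rewrite powRM ?(ltW t0)// -mulrA -{2}(powRr1 w0) powR_mulD// subrK ler_wpM2r//.
have c1b : `|c1 x * h| <= 6 * K * (t `^ (r - p + 2) * w `^ r).
  have : `|c1 x| <= 6 * K * `|x| `^ (r - 1).
    rewrite -(ler_pM2r x0) -normrM (le_trans b1)// -[leRHS]mulrA.
    by rewrite -[X in _ * (_ * X)](powRr1 (ltW x0)) powR_mulD// subrK.
  move=> b; rewrite normrM (le_trans (ler_wpM2r (normr_ge0 _) b))//.
  by rewrite -[leLHS]mulrA ler_wpM2l// mulr_ge0.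
have c2b : `|c2 x * h ^+ 2| <= 6 * K * (t `^ (r - p + 2) * w `^ r).
  have [r2|r2] := leP r 2.
    by rewrite (z2 r2) mul0r normr0 mulr_ge0 ?mulr_ge0 ?powR_ge0.
  have : `|c2 x| <= 6 * K * `|x| `^ (r - 2).
    have x2 : 0 < x ^+ 2 by rewrite exprn_even_gt0.
    rewrite -(ler_pM2r x2) -{1}(ger0_norm (sqr_ge0 x)) -normrM (le_trans b2)// -[leRHS]mulrA.
    rewrite -(real_normK (num_real x)) -[X in _ * (_ * X)]powR_mulrn// powR_mulD//.
    by rewrite subrK.
  move=> b; rewrite normrM (le_trans (ler_wpM2r (normr_ge0 _) b))//.
  rewrite -[leLHS]mulrA ler_wpM2l ?mulr_ge0// normrX.
  apply: (@le_trans _ _ ((t * w) `^ (r - 2) * w ^+ 2)).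
    apply: ler_pM; rewrite ?powR_ge0 ?sqr_ge0//; first by apply: le_powR => //; lra.
    by rewrite lerXn2r ?nnegrE.
  have [wz|wn0] := eqVneq w 0; first by rewrite wz expr0n/= mulr0 mulr_ge0 ?powR_ge0.
  have wp : 0 < w by rewrite lt_neqAle eq_sym wn0.
  rewrite powRM ?(ltW t0)// -mulrA -[X in _ * (_ * X)]powR_mulrn// powR_mulD// subrK ler_wpM2r//.
  by apply: ler_powR => //; lra.
have := e x h.
set u := g (x + h) - g x; set v := t `^ _ * _ in base c1b c2b.
have -> : 13 * K * t `^ (r - p + 2) * w `^ r = 13 * (K * v) by rewrite /v; ring.
move=> H; have H' := le_trans H base.
have -> : u = (u - c1 x * h - c2 x * h ^+ 2) + c1 x * h + c2 x * h ^+ 2 by ring.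
apply: (le_trans (ler_normD _ _)).
have := ler_normD (u - c1 x * h - c2 x * h ^+ 2) (c1 x * h).
clearbody u v w; lra.
Qed.

End centered_test_functions.

(** * Rate for the sums, against a Gaussian law of nearby variance *)

Section convergence_rate.
Context d (Omega : measurableType d) (R : realType) (P : probability Omega R).
Variables (T Tinv : {mfun Omega >-> Omega}).
Hypotheses (TK : cancel T Tinv) (TinvK : cancel Tinv T).
Hypothesis Tpres : measure_preserving P T.
Variable F0 : set (set Omega).
Hypothesis sF : sigma_subalgebra F0.
Hypothesis F0T : F0 `<=` preimage_set_system setT T F0.
Variables (p sigma : R).
Hypotheses (p2 : 2 < p) (p3 : p < 3) (sigma_ge0 : 0 <= sigma).
Variable D : Omega -> R.
Hypothesis mD : measF F0 D.
Hypothesis DLp : Lp P p D.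
Hypothesis D0 : forall A, F0 A -> (\int[P]_(w in A) (D (T w))%:E = 0)%E.
Hypothesis Dvar : Ex P (fun v => D v ^+ 2) = sigma ^+ 2.
Notation M := (birkhoff T D).
Notation G := (Ex (gauss R)).
Variables (V : Omega -> R) (S : nat -> Omega -> R).
Hypothesis VLp : Lp P p V.
Hypothesis SLp : forall n, Lp P p (S n).
Hypothesis SE : forall n, S n = (fun w => M n w - V (iter n T w) + V w) %[ae P].
Hypothesis SC : forall n, Ex P (S n) = 0.
Notation W n := (fun w => n%:R^-1 * cond_exp P F0 (fun w' => S n w' ^+ 2) w
  - n%:R^-1 * Ex P (fun w => S n w ^+ 2)).
Variables (c : nat -> R) (Cs : R).
Hypothesis c_ge0 : forall n, 0 <= c n.
Hypothesis WLp : forall n, (0 < n)%N -> L1 P (fun w => `|W n w| `^ (p / 2)).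
Hypothesis Wc : forall n, (0 < n)%N -> Ex P (fun w => `|W n w| `^ (p / 2)) <= c n `^ (p / 2).
Hypothesis c_sum : forall m, \sum_(1 <= n < m) n%:R `^ (- 2 + p / 2) * c n <= Cs.
Variable r : R.
Hypotheses (r0 : p - 2 <= r) (rp : r <= p).

Let p1 : 1 <= p. Proof. by have := p2; lra. Qed.
Let p0 : 0 <= p. Proof. by have := p1; lra. Qed.
Let r_gt0 : 0 < r. Proof. have := p2; have := r0; lra. Qed.
Let e0 : 0 <= r - p + 2. Proof. have := p3; have := r0; lra. Qed.
Let LM m : Lp P p (M m). Proof. exact: (Lp_birkhoff Tpres p2). Qed.

Lemma smooth_tame K f c1 c2 t : taylor2 r K f c1 c2 -> 0 < t -> tame (smooth f t).
Proof.
move=> tf t0; have [C C0 HC] := smooth_expand p2 p3 r_gt0 rp.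
have p2' := p2; have p3' := p3; have q0 : 0 < p - 2 by lra.
have q1 : p - 2 <= 1 by lra.
have K0 : 0 <= K by case: tf.
have CK : 0 <= C * K by rewrite mulr_ge0.
apply: (@expansion_tame _ _ _ (smooth1 f t) (smooth2 f t) (fun u => C * K * omega p r t u)
  (C * K * t `^ (r - p)) q0 q1).
- by move=> u u0; rewrite mulr_ge0// omega_ge0.
- move=> u u0; rewrite -[leRHS]mulrA ler_wpM2l//; exact: (omega_powR r p2 p3 t0 u0).
- by move=> x h; exact: HC tf t0.
Qed.

Let mr := G (fun z => `|z| `^ r).
Let mr_ge0 : 0 <= mr. Proof. by apply: Ex_ge0 => z; rewrite powR_ge0. Qed.

Section one_function.
Variables (n : nat) (K : R) (g c1 c2 : R -> R).
Hypotheses (n0 : (0 < n)%N) (K_gt0 : 0 < K) (tg : taylor2 r K g c1 c2).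
Hypotheses (g0 : g 0 = 0) (c10 : c1 0 = 0) (c20 : c2 0 = 0).
Variable B : R.
Hypothesis Hmom : forall m, Ex P (fun v => `|M m v| `^ p) <= B * m%:R `^ (p / 2).

Let t := n%:R `^ 2^-1 : R.
Let t1 : 1 <= t.
Proof.
have h : 0 <= 2^-1 :> R by rewrite invr_ge0.
by have := le_powR h ler01 (_ : 1 <= n%:R); rewrite powR1 ler1n; apply.
Qed.
Let t0 : 0 < t. Proof. exact: lt_le_trans ltr01 t1. Qed.
Let N := t `^ (r - p + 2).
Let N0 : 0 <= N. Proof. exact: powR_ge0. Qed.
Let KN0 : 0 <= 13 * K * N. Proof. by rewrite mulr_ge0// mulr_ge0// ltW. Qed.
Let B0 : 0 <= B.
Proof.
have := Hmom 1; rewrite powR1 mulr1; apply: le_trans.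
by apply: Ex_ge0 => v; rewrite powR_ge0.
Qed.

Let incr x h : `|g (x + h) - g x| <= 13 * K * N * (`|x| / t + `|h|) `^ r.
Proof. exact: (centered_increment_le p2 p3 r0 rp tg g0 c10 c20). Qed.

Let tmg : tame g. Proof. exact: (taylor2_tame r_gt0 tg). Qed.

Lemma centered_L1 U : Lp P p U -> L1 P (fun w => g (U w)).
Proof.
move=> lU; apply: (L1_le _ _ (L1Z K (Lp_L1_powR lU (ltW r_gt0) rp))).
  by apply: (measurableT_comp (tame_measurable tmg)); exact: lU.1.
by move=> w; exact: (centered_le tg g0 c10 c20).
Qed.

Let LMt : L1 P (fun w => (`|M n w| / t) `^ p) /\ Ex P (fun w => (`|M n w| / t) `^ p) <= B.
Proof.
have ti0 : 0 <= t^-1 by rewrite invr_ge0 ltW.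
have E w : (`|M n w| / t) `^ p = (t `^ p)^-1 * `|M n w| `^ p.
  by rewrite (powRM _ (normr_ge0 _) ti0) mulrC -(powR_inv1 (ltW t0)) -powRrM mulN1r powRN.
split; first by apply: eq_L1 (L1Z (t `^ p)^-1 (LM n).2) => w; rewrite E.
rewrite (eq_Ex _ E) ExZ; last exact: (LM n).2.
rewrite mulrC (ler_pdivrMr _ _ (powR_gt0 p t0)); apply: (le_trans (Hmom n)).
by rewrite /t -powRrM [2^-1 * p]mulrC; exact: lexx.
Qed.

Lemma rate_sum_martingale : `|Ex P (fun w => g (S n w)) - Ex P (fun w => g (M n w))|
  <= 13 * K * N * (1 + 2 `^ p * (B + remainder_moment P p V)).
Proof.
pose rho w := V w - V (iter n T w).
have lV' : Lp P p (fun w => V (iter n T w)) := Lp_iter Tpres n VLp.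
have lrho : Lp P p rho := LpB p1 VLp lV'.
have lS' : Lp P p (fun w => M n w + rho w) := LpD p1 (LM n) lrho.
have l1 := centered_L1 lS'; have l2 := centered_L1 (LM n).
have -> : Ex P (fun w => g (S n w)) = Ex P (fun w => g (M n w + rho w)).
  apply: Ex_ae; [exact: L1_measurable (centered_L1 (SLp n))|exact: L1_measurable l1|].
  have := SE n; apply: filterS => w E wT.
  by rewrite (E wT) /rho; congr g; ring.
rewrite -(ExB l1 l2).
have [lm mB] := LMt.
have l3 : L1 P (fun w => 1 + 2 `^ p * ((`|M n w| / t) `^ p + `|rho w| `^ p)).
  by apply: L1D; [exact: L1_cst|apply: L1Z; apply: L1D => //; exact: lrho.2].
apply: (@le_trans _ _ (Ex P (fun w => 13 * K * N * (1 + 2 `^ p * ((`|M n w| / t) `^ p + `|rho w| `^ p))))).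
  apply: Ex_norm_le; [exact: L1_measurable (L1B l1 l2)|exact: L1Z|].
  move=> w; apply: (le_trans (incr _ _)); apply: (ler_wpM2l KN0).
  have x0 : 0 <= `|M n w| / t by rewrite divr_ge0// ltW.
  apply: (le_trans (powR_le1D (ltW r_gt0) rp (addr_ge0 x0 (normr_ge0 (rho w))))).
  by rewrite lerD2l; exact: (powRD_le p0 x0 (normr_ge0 (rho w))).
rewrite (ExZ _ l3); apply: (ler_wpM2l KN0).
have l4 := L1D lm lrho.2.
rewrite (ExD (L1_cst P 1) (L1Z _ l4)) Ex_cst (ExZ _ l4) lerD2l ler_wpM2l ?powR_ge0//.
rewrite (ExD lm lrho.2); apply: lerD => //.
exact: (remainder_le Tpres p2 VLp n).
Qed.

Lemma rate_smoothing : 0 < sigma ->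
  `|Ex P (fun w => g (M n w)) - Ex P (fun w => smooth g sigma (M n w))|
  <= 13 * K * N * (2 `^ r * (1 + B + sigma `^ r * mr)).
Proof.
move=> sigma0; have ts := smooth_tame tg sigma0.
have [lm mB] := LMt.
have tz : tame (fun z => `|sigma * z| `^ r).
  by apply: eq_tame (tame_affine sigma 0 (tame_powR r_gt0)) => z; rewrite addr0.
have mz : G (fun z => `|sigma * z| `^ r) = sigma `^ r * mr.
  rewrite /mr -ExZ; last exact: (tame_L1 (tame_powR r_gt0)).
  by apply: eq_Ex => z; rewrite normrM powRM// gtr0_norm.
have pw x : `|g x - smooth g sigma x| <= 13 * K * N * (2 `^ r * ((`|x| / t) `^ r + sigma `^ r * mr)).
  have tx := tame_add_scale x sigma tmg.
  have x0 : 0 <= `|x| / t by rewrite divr_ge0// ltW.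
  have lx : L1 (gauss R) (fun z => g (x + sigma * z) - g x).
    by apply: L1B; [exact: tame_L1|exact: L1_cst].
  have -> : g x - smooth g sigma x = - G (fun z => g (x + sigma * z) - g x).
    by rewrite ExB ?Ex_cst ?opprB//; [exact: tame_L1|exact: L1_cst].
  rewrite normrN -mz.
  have lz := L1D (L1_cst (gauss R) ((`|x| / t) `^ r)) (tame_L1 tz).
  have -> : (`|x| / t) `^ r + G (fun z => `|sigma * z| `^ r) = G (fun z => (`|x| / t) `^ r + `|sigma * z| `^ r).
    by rewrite ExD ?Ex_cst//; [exact: L1_cst|exact: tame_L1].
  rewrite -(ExZ _ lz) -(ExZ _ (L1Z (2 `^ r) lz)).
  apply: Ex_norm_le; [exact: L1_measurable lx|exact: L1Z (L1Z _ lz)|].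
  move=> z; apply: (le_trans (incr _ _)); apply: (ler_wpM2l KN0).
  exact: (powRD_le (ltW r_gt0) x0 (normr_ge0 _)).
have l1 := centered_L1 (LM n).
have l3 : L1 P (fun w => 2 `^ r * (1 + (`|M n w| / t) `^ p + sigma `^ r * mr)).
  by apply: L1Z; apply: L1D; [apply: L1D => //; exact: L1_cst|exact: L1_cst].
have pw' w : `|g (M n w) - smooth g sigma (M n w)|
    <= 13 * K * N * (2 `^ r * (1 + (`|M n w| / t) `^ p + sigma `^ r * mr)).
  apply: (le_trans (pw _)); apply: (ler_wpM2l KN0); rewrite ler_wpM2l ?powR_ge0// lerD2r.
  have x0 : 0 <= `|M n w| / t by rewrite divr_ge0// ltW.
  exact: (powR_le1D (ltW r_gt0) rp x0).
have l2 : L1 P (fun w => smooth g sigma (M n w)).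
  apply: (L1_le _ _ (L1D (L1_norm l1) (L1Z (13 * K * N) l3))).
    by apply: (measurableT_comp (tame_measurable ts)); exact: (LM n).1.
  move=> w; have := pw' w; have := ler_normB (g (M n w)) (g (M n w) - smooth g sigma (M n w)).
  have -> : g (M n w) - (g (M n w) - smooth g sigma (M n w)) = smooth g sigma (M n w) by ring.
  by move=> h1 h2; apply: (le_trans h1); rewrite lerD2l.
rewrite -(ExB l1 l2).
apply: (@le_trans _ _ (Ex P (fun w => 13 * K * N * (2 `^ r * (1 + (`|M n w| / t) `^ p + sigma `^ r * mr))))).
  by apply: Ex_norm_le; [exact: L1_measurable (L1B l1 l2)|exact: L1Z|].
have l4 := L1D (L1_cst P 1) lm; have l5 := L1D l4 (L1_cst P (sigma `^ r * mr)).
rewrite (ExZ _ l3) (ExZ _ l5) (ExD l4 (L1_cst P _)) (ExD (L1_cst P 1) lm) !Ex_cst.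
apply: (ler_wpM2l KN0); rewrite ler_wpM2l ?powR_ge0//.
by rewrite lerD2r lerD2l.
Qed.

(** The two Gaussian laws are coupled through the same z, which makes (b - a) z a bounded
    perturbation of a z in the sense of [incr]. *)
Lemma rate_gauss a b Ca Cd : 0 <= a -> a <= Ca * t -> `|b - a| <= Cd ->
  `|smooth g b 0 - G (fun z => g (a * z))| <= 13 * K * N * ((Ca + Cd) `^ r * mr).
Proof.
move=> a0 aC dC.
have at0 : 0 <= a / t by rewrite divr_ge0// ltW.
have aCt : a / t <= Ca by rewrite ler_pdivrMr.
have Ca0 : 0 <= Ca by apply: le_trans aCt.
have Cd0 : 0 <= Cd by apply: le_trans dC.
have tz := tame_powR r_gt0.
have ga : L1 (gauss R) (fun z => g (a * z)).
  apply: tame_L1; apply: eq_tame (tame_add_scale 0 a tmg) => z; by rewrite add0r.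
have gb : L1 (gauss R) (fun z => g (0 + b * z)) := tame_L1 (tame_add_scale 0 b tmg).
rewrite /smooth -(ExB gb ga) /mr -(ExZ _ (tame_L1 tz)).
have lz := L1Z ((Ca + Cd) `^ r) (tame_L1 tz).
rewrite -(ExZ _ lz).
apply: Ex_norm_le; [exact: L1_measurable (L1B gb ga)|exact: L1Z|].
move=> z; rewrite add0r (_ : b * z = a * z + (b - a) * z); last by ring.
apply: (le_trans (incr _ _)); apply: (ler_wpM2l KN0).
rewrite -powRM ?addr_ge0//; apply: le_powR => //; first exact: ltW.
  by rewrite addr_ge0// divr_ge0// ltW.
rewrite !normrM (ger0_norm a0) mulrAC mulrDl lerD//.
  by rewrite ler_wpM2r.
by rewrite ler_wpM2r.
Qed.

End one_function.

(** The chain runs through S_n, M_n, M_n smoothed by one Gaussian step, the Gaussian sum of n + 1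
    steps, and N(0, a^2). For sigma > 0, a variance a^2 within Cg n^(1/2) of n sigma^2 keeps a at
    bounded distance from sigma n^(1/2). *)
Lemma rate_centered (Cg : R) : 0 <= Cg -> exists2 C, 0 <= C & forall n K g c1 c2 a,
  (0 < n)%N -> 0 < K -> taylor2 r K g c1 c2 -> g 0 = 0 -> c1 0 = 0 -> c2 0 = 0 ->
  0 <= a -> `|a ^+ 2 - n%:R * sigma ^+ 2| <= Cg * n%:R `^ 2^-1 ->
  (r <= 2 -> a = sd sigma n) ->
  `|Ex P (fun w => g (S n w)) - G (fun z => g (a * z))|
    <= C * K * n%:R `^ ((r - p + 2) / 2).
Proof.
move=> Cg0; have p2' := p2; have p3' := p3.
have [B Hmom] := martingale_moment TK TinvK Tpres sF F0T p2 p3 mD DLp D0.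
have B0 : 0 <= B.
  have := Hmom 1; rewrite powR1 mulr1; apply: le_trans.
  by apply: Ex_ge0 => v; rewrite powR_ge0.
have Cr0 : 0 <= remainder_moment P p V.
  by rewrite /remainder_moment !mulr_ge0 ?powR_ge0// Ex_ge0// => w; rewrite powR_ge0.
pose C1 := 13 * (1 + 2 `^ p * (B + remainder_moment P p V)).
have C10 : 0 <= C1 by rewrite mulr_ge0// addr_ge0// mulr_ge0 ?powR_ge0// addr_ge0.
have tE n : (n%:R `^ 2^-1) `^ (r - p + 2) = n%:R `^ ((r - p + 2) / 2) :> R.
  by rewrite -powRrM [2^-1 * _]mulrC.
(* Without variance there is nothing to smooth with, but M_n vanishes almost everywhere and only the
   coboundary and the law N(0, a^2) remain, both small. *)
have [s0|sn0] := eqVneq sigma 0.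
  exists (C1 + (1 + Cg) `^ r * mr); first by rewrite addr_ge0// mulr_ge0 ?powR_ge0.
  move=> n K g c1 c2 a n0 K0 tg g0 c10 c20 a0 aC a2.
  have n0R : 0 < n%:R :> R by rewrite ltr0n.
  have n1 : 1 <= n%:R :> R by rewrite ler1n.
  have sm := rate_sum_martingale n0 K0 tg g0 c10 c20 Hmom.
  have M0 : Ex P (fun w => g (M n w)) = 0.
    have l2 := Lp2_sqr (Lp_Lp2 (ltW p2) (LM n)).
    have e2 := Ex_birkhoff_sqr TK TinvK Tpres sF F0T p2 mD DLp D0 Dvar n.
    rewrite s0 expr0n/= mulr0 in e2.
    have ae := Ex_ge0_eq0 l2 (fun w => sqr_ge0 _) e2.
    rewrite -[RHS](Ex_cst P 0); apply: Ex_ae => //.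
      exact: (L1_measurable (centered_L1 tg g0 c10 c20 (LM n))).
    move: ae; apply: filterS => w /[apply] /eqP.
    by rewrite sqrf_eq0 => /eqP ->.
  rewrite M0 subr0 tE in sm.
  have ga : `|G (fun z => g (a * z))| <= (1 + Cg) `^ r * mr * K * n%:R `^ ((r - p + 2) / 2).
    have tga : L1 (gauss R) (fun z => g (a * z)).
      apply: tame_L1; apply: eq_tame (tame_add_scale 0 a (taylor2_tame r_gt0 tg)) => z.
      by rewrite add0r.
    have lz := tame_L1 (tame_powR r_gt0 : tame (fun z : R => `|z| `^ r)).
    have ar : a `^ r <= (1 + Cg) `^ r * n%:R `^ ((r - p + 2) / 2).
      have [r2|r2] := leP r 2.
        rewrite (a2 r2) /sd s0 mul0r powR0 ?mulr_ge0 ?powR_ge0// gt_eqF//; exact: r_gt0.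
      (* This gives a^r of order n^(r/4), which is admissible: r / 4 <= (r - p + 2) / 2 because r >
         2 and p < 3. *)
      have a2' : a ^+ 2 <= Cg * n%:R `^ 2^-1.
        have := aC; rewrite s0 expr0n/= mulr0 subr0; exact: le_trans (ler_norm _).
      have -> : a `^ r = (a ^+ 2) `^ (r / 2).
        by rewrite -powR_mulrn// -powRrM mulrC divfK.
      have r20 : 0 <= r / 2 by lra.
      apply: (le_trans (le_powR r20 (sqr_ge0 a) a2')).
      rewrite (powRM _ Cg0 (powR_ge0 _ _)) -powRrM.
      apply: ler_pM; rewrite ?powR_ge0//.
        apply: (@le_trans _ _ ((1 + Cg) `^ (r / 2))); first by apply: le_powR => //; lra.
        by apply: ler_powR; lra.
      by apply: ler_powR => //; lra.
    apply: (@le_trans _ _ (G (fun z => K * a `^ r * `|z| `^ r))).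
      apply: Ex_norm_le; [exact: L1_measurable tga|exact: L1Z|].
      move=> z; apply: (le_trans (centered_le tg g0 c10 c20 _)).
      by rewrite normrM powRM// (ger0_norm a0) mulrA.
    rewrite (ExZ _ lz) -/mr.
    have -> : (1 + Cg) `^ r * mr * K * n%:R `^ ((r - p + 2) / 2) =
       K * ((1 + Cg) `^ r * n%:R `^ ((r - p + 2) / 2)) * mr by ring.
    by rewrite ler_wpM2r// ler_wpM2l// ltW.
  apply: (le_trans (ler_normB _ _)); rewrite mulrDl mulrDl; apply: lerD ga.
  apply: (le_trans sm); rewrite le_eqVlt; apply/orP; left; apply/eqP; rewrite /C1; ring.
have sigma0 : 0 < sigma by rewrite lt_neqAle eq_sym sn0.
pose gc := gap_constant P p B V.
have gc0 : 0 <= gc := gap_constant_ge0 Hmom V.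
have [E epsE] := dyadic_average_sum p2 p3 (mulr_ge0 (ler0n R 3) gc0) c_ge0 c_sum.
have Hdual := dual_eps_le TK TinvK Tpres sF F0T p2 mD DLp D0 Dvar Hmom VLp SLp SE c_ge0 WLp Wc.
have [C2 C20 HC2] := martingale_smooth_rate TK TinvK Tpres sF F0T p2 p3 sigma0 mD DLp D0 Dvar
  (dual_eps_ge0 Hmom V c_ge0) Hdual Hmom epsE r0 rp.
pose C3 := 13 * (2 `^ r * (1 + B + sigma `^ r * mr)).
have C30 : 0 <= C3.
  by rewrite mulr_ge0// mulr_ge0 ?powR_ge0// !addr_ge0// mulr_ge0 ?powR_ge0.
pose Ca := 1 + sigma ^+ 2 + Cg; pose Cd := sigma + Cg / sigma.
have Ca1 : 1 <= Ca by rewrite /Ca; have := sqr_ge0 sigma; lra.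
have Cd0 : 0 <= Cd by rewrite addr_ge0// divr_ge0.
pose C4 := 13 * ((Ca + Cd) `^ r * mr).
have C40 : 0 <= C4 by rewrite mulr_ge0// mulr_ge0 ?powR_ge0.
exists (C1 + C3 + C2 + C4); first by rewrite !addr_ge0.
move=> n K g c1 c2 a n0 K0 tg g0 c10 c20 a0 aC a2.
have n0R : 0 < n%:R :> R by rewrite ltr0n.
set t := n%:R `^ 2^-1 in aC.
have t0 : 0 < t by exact: powR_gt0.
have t2 : t ^+ 2 = n%:R.
  by rewrite /t -[LHS]powR_mulrn ?powR_ge0// -powRrM mulVf// powRr1.
have t1 : 1 <= t.
  have h : 0 <= 2^-1 :> R by rewrite invr_ge0.
  by have := le_powR h ler01 (_ : 1 <= n%:R); rewrite powR1 ler1n; apply.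
have sm := rate_sum_martingale n0 K0 tg g0 c10 c20 Hmom.
have sg := rate_smoothing n0 K0 tg g0 c10 c20 Hmom sigma0.
have mg := HC2 n K g c1 c2 n0 K0 tg.
have sd1 : sd sigma 1 = sigma by rewrite /sd powR1 mulr1.
rewrite sd1 in mg.
have aCa : a <= Ca * t.
  have Cat : 0 <= Ca * t by rewrite mulr_ge0 ?(ltW t0)// (le_trans ler01).
  rewrite -(ler_pXn2r (ltn0Sn 1)) ?nnegrE//.
  have tt : t <= t ^+ 2 by rewrite expr2 ler_peMl// ltW.
  have aa : a ^+ 2 <= t ^+ 2 * sigma ^+ 2 + Cg * t ^+ 2.
    have := ler_wpM2l Cg0 tt; move: aC; rewrite -t2 ler_norml => /andP[_]; lra.
  apply: (le_trans aa); rewrite exprMn.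
  have Cpow : Ca <= Ca ^+ 2 by rewrite expr2 ler_peMl// (le_trans ler01).
  have := ler_wpM2r (sqr_ge0 t) Cpow; rewrite {1}/Ca; have := sqr_ge0 t; lra.
have sdE : sd sigma n = sigma * t by [].
have dl : `|sd sigma n.+1 - a| <= Cd.
  have h1 : `|sd sigma n.+1 - sd sigma n| <= sigma.
    have le1 : sd sigma n <= sd sigma n.+1 by exact: sd_le.
    rewrite ger0_norm ?subr_ge0// lerBlDr.
    have sn : 0 <= sd sigma n := sd_ge0 sigma0 n.
    rewrite -(ler_pXn2r (ltn0Sn 1)) ?nnegrE ?sd_ge0 ?addr_ge0 ?(ltW sigma0)//.
    rewrite sd_sqr sqrrD sd_sqr -natr1.
    have := mulr_ge0 (ltW sigma0) sn; lra.
  have h2 : `|sd sigma n - a| <= Cg / sigma.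
    have st : 0 < sigma * t by rewrite mulr_gt0.
    rewrite sdE ler_pdivlMr//.
    have := aC; rewrite -t2 distrC (_ : t ^+ 2 * sigma ^+ 2 - a ^+ 2 = (sigma * t - a) * (sigma * t + a)); last by ring.
    rewrite normrM [`|sigma * t + a|]ger0_norm ?addr_ge0 ?(ltW st)// => h.
    rewrite -(ler_pM2r t0) -mulrA; apply: le_trans h.
    by rewrite ler_wpM2l// lerDl.
  rewrite (_ : sd sigma n.+1 - a = (sd sigma n.+1 - sd sigma n) + (sd sigma n - a)); last by ring.
  by rewrite (le_trans (ler_normD _ _))// lerD.
have gs := rate_gauss n0 K0 tg g0 c10 c20 a0 aCa dl.
rewrite tE in sm sg gs.
set N := n%:R `^ ((r - p + 2) / 2) in sm sg mg gs *.
set x1 := Ex P (fun w => g (S n w)) in sm *.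
set x2 := Ex P (fun w => g (M n w)) in sm sg.
set x3 := Ex P (fun w => smooth g sigma (M n w)) in sg mg.
set x4 := smooth g (sd sigma n.+1) 0 in mg gs.
set x5 := G _ in gs *.
rewrite (_ : x1 - x5 = (x1 - x2) + (x2 - x3) + (x3 - x4) + (x4 - x5)); last by ring.
rewrite (_ : (C1 + C3 + C2 + C4) * K * N = 13 * K * N * (1 + 2 `^ p * (B + remainder_moment P p V))
  + 13 * K * N * (2 `^ r * (1 + B + sigma `^ r * mr)) + C2 * K * N
  + 13 * K * N * ((Ca + Cd) `^ r * mr)); last by rewrite /C1 /C3 /C4; ring.
apply: (le_trans (ler_normD _ _)); apply: lerD gs.
apply: (le_trans (ler_normD _ _)); apply: lerD mg.
by apply: (le_trans (ler_normD _ _)); apply: lerD sg.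
Qed.

Lemma convergence_rate (Cg : R) : 0 <= Cg -> exists2 C, 0 <= C & forall n K f c1 c2 a,
  (0 < n)%N -> 0 < K -> taylor2 r K f c1 c2 ->
  0 <= a -> `|a ^+ 2 - n%:R * sigma ^+ 2| <= Cg * n%:R `^ 2^-1 ->
  (r <= 2 -> a = sd sigma n) -> (2 < r -> a ^+ 2 = Ex P (fun w => S n w ^+ 2)) ->
  L1 P (fun w => f (S n w)) /\
  `|Ex P (fun w => f (S n w)) - G (fun z => f (a * z))|
    <= C * K * n%:R `^ ((r - p + 2) / 2).
Proof.
move=> Cg0; have [C C0 HC] := rate_centered Cg0; exists C => // n K f c1 c2 a n0 K0 tf a0 aC a2 a3.
have tg := taylor2_center p2 r0 tf.
set g := fun x => _ in tg.
have g0 : g 0 = 0 by rewrite /g; ring.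
have c10 : c1 0 - c1 0 - 2 * c2 0 * 0 = 0 by ring.
have c20 : c2 0 - c2 0 = 0 by ring.
have := HC n K g _ _ a n0 K0 tg g0 c10 c20 a0 aC a2.
have lgS := centered_L1 tg g0 c10 c20 (SLp n).
have lS := Lp_L1 p1 (SLp n); have lS2 := Lp2_sqr (Lp_Lp2 (ltW p2) (SLp n)).
have fE x : f x = g x + (f 0 + c1 0 * x + c2 0 * x ^+ 2) by rewrite /g; ring.
have lq := L1D (L1D (L1_cst P (f 0)) (L1Z (c1 0) lS)) (L1Z (c2 0) lS2).
have lf : L1 P (fun w => f (S n w)) by apply: eq_L1 (L1D lgS lq) => w; rewrite -fE.
split => //; move: HC => _.
have -> : Ex P (fun w => f (S n w)) = Ex P (fun w => g (S n w)) + (f 0 + c2 0 * Ex P (fun w => S n w ^+ 2)).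
  rewrite (eq_Ex _ (fun w => fE (S n w))) (ExD lgS lq).
  rewrite (ExD (L1D (L1_cst P (f 0)) (L1Z (c1 0) lS)) (L1Z (c2 0) lS2)).
  by rewrite (ExD (L1_cst P (f 0)) (L1Z (c1 0) lS)) Ex_cst (ExZ _ lS) (ExZ _ lS2) SC mulr0 addr0.
have lz := tame_L1 (@tame_id R); have lz2 := tame_L1 (tameX 2 (@tame_id R)).
have lga : L1 (gauss R) (fun z => g (a * z)).
  apply: tame_L1; apply: eq_tame (tame_add_scale 0 a (taylor2_tame r_gt0 tg)) => z.
  by rewrite add0r.
have -> : G (fun z => f (a * z)) = G (fun z => g (a * z)) + (f 0 + c2 0 * a ^+ 2).
  transitivity (G (fun z => g (a * z) + (f 0 + c1 0 * a * z + c2 0 * a ^+ 2 * z ^+ 2))).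
    by apply: eq_Ex => z; rewrite fE; ring.
  have l1 := L1D (L1_cst (gauss R) (f 0)) (L1Z (c1 0 * a) lz).
  rewrite (ExD lga (L1D l1 (L1Z (c2 0 * a ^+ 2) lz2))) (ExD l1 (L1Z _ lz2)).
  by rewrite (ExD (L1_cst _ _) (L1Z _ lz)) Ex_cst (ExZ _ lz) (ExZ _ lz2) Ex_gauss_id Ex_gauss_sqr mulr0 addr0 mulr1.
have -> : c2 0 * Ex P (fun w => S n w ^+ 2) = c2 0 * a ^+ 2.
  have [r2|r2] := leP r 2; last by rewrite (a3 r2).
  by case: tf => _ _ _ _ /(_ r2) ->; rewrite !mul0r.
set x := Ex P _; set y := G _; set q := f 0 + _.
by rewrite (_ : x + q - (y + q) = x - y); last by ring.
Qed.

End convergence_rate.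

(** * The class Lambda_r and the Zolotarev distance *)

Section Zolotarev_test_functions.
Context (R : realType).
Implicit Types (f : R -> R) (r : R).

Lemma derivable_continuous_at f : (forall x : R, derivable f x 1) -> continuous f.
Proof.
by move=> df x; apply: differentiable_continuous; apply/derivable1_diffP; exact: df.
Qed.

(** The mean value inequality for f minus the quadratic polynomial integrates an expansion of f1.
    One use with b = 0 covers 1 < r <= 2; a second use covers 2 < r <= 3. *)
Lemma primitive_expansion f (f1 : R -> R) (q x a b : R) : 0 <= q ->
  (forall y : R, is_derive y 1 f (f1 y)) ->
  (forall h, `|f1 (x + h) - a - b * h| <= `|h| `^ q) ->
  forall h, `|f (x + h) - f x - a * h - b / 2 * h ^+ 2| <= `|h| `^ (q + 1).
Proof.
move=> q0 df f1e h; have [->|h0] := eqVneq h 0.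
  by rewrite addr0 subrr expr0n/= !mulr0 !subr0 normr0 powR_ge0.
pose g (s : R) := f (x + s) - a * s - b / 2 * s ^+ 2.
pose g1 (s : R) := f1 (x + s) - a - b * s.
have dg (s : R) : is_derive s 1 g (g1 s).
  have d0 : is_derive s 1 (fun s : R => x + s) 1.
    by rewrite -[X in is_derive _ _ _ X]add0r; exact: (is_deriveD (is_derive_cst x s 1) (is_derive_id s 1)).
  have d1 : is_derive s 1 (fun s => f (x + s)) (f1 (x + s)).
    by rewrite -[X in is_derive _ _ _ X]mulr1; exact: (is_derive1_comp (df (x + s)) d0).
  by rewrite /g; apply: is_derive_eq; rewrite /g1 /GRing.scale/=; field.
have gb s : `|s| <= `|h| -> `|g1 s| <= `|h| `^ q.
  by move=> sh; rewrite (le_trans (f1e s))// le_powR.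
have := mean_value_bound dg gb.
have -> : g h - g 0 = f (x + h) - f x - a * h - b / 2 * h ^+ 2.
  by rewrite /g addr0; ring.
have h0' : 0 < `|h| by rewrite normr_gt0.
by rewrite -(powR_mulD _ _ h0') (powRr1 (ltW h0')).
Qed.

Lemma Lambda_taylor2 r f : 0 < r -> r <= 3 -> Lambda r f ->
  exists c1 c2, taylor2 r 1 f c1 c2.
Proof.
move=> r0 r3 [l [lr rl dl cl hl]].
have l3 : (l < 3)%N by rewrite -(ltr_nat R) (lt_le_trans lr).
have der (g : R -> R) : (forall x : R, derivable g x 1) -> forall x : R, is_derive x 1 g (derive1n 1 g x).
  by move=> dg x; rewrite /derive1n/= derive1E; exact: derivableP.
case: l l3 lr rl dl cl hl => [|[|[|//]]] _ lr rl dl cl hl.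
- exists (fun=> 0), (fun=> 0); split => // x h.
  by rewrite !mul0r !subr0 mul1r; have := hl (x + h) x; rewrite subr0 [x + h]addrC addrK.
- have df : forall x, derivable f x 1 by exact: (dl 0%N).
  exists (derive1n 1 f), (fun=> 0); split => //; last by move=> r1; have := lr; rewrite ltNge r1.
    exact: derivable_continuous_at.
  move=> x h; rewrite mul1r.
  have q0 : 0 <= r - 1 by rewrite subr_ge0 ltW.
  have := primitive_expansion (a := derive1n 1 f x) (b := 0) q0 (der f df) (x := x).
  rewrite subrK => H; have := H _ h; rewrite !mul0r; apply.
  by move=> k; have := hl (x + k) x; rewrite mul0r subr0 [x + k]addrC addrK.
- have df : forall x, derivable f x 1 by exact: (dl 0%N).
  have df1 : forall x, derivable (derive1n 1 f) x 1 by exact: (dl 1%N).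
  exists (derive1n 1 f), (fun x => derive1n 2 f x / 2); split => //.
  + exact: derivable_continuous_at.
  + move=> x h; rewrite mul1r.
    have q0 : 0 <= r - 2 by rewrite subr_ge0 ltW.
    have q1 : 0 <= r - 1 by lra.
    have e1 k : `|derive1n 1 f (x + k) - derive1n 1 f x - derive1n 2 f x * k| <= `|k| `^ (r - 1).
      have := primitive_expansion (a := derive1n 2 f x) (b := 0) q0 (der _ df1) (x := x).
      rewrite (_ : r - 2 + 1 = r - 1); last by ring.
      move=> H; have := H _ k; rewrite !mul0r subr0; apply => j.
      by have := hl (x + j) x; rewrite mul0r subr0 [x + j]addrC addrK.
    have := primitive_expansion q1 (der f df) e1 h.
    by rewrite subrK.
  + by move=> r1; have := lr; rewrite ltNge (le_trans r1)// ler1n.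
  + by move=> r2; have := lr; rewrite ltNge r2.
Qed.

Lemma Lambda0 r : 0 < r -> r <= 3 -> Lambda r (fun=> 0).
Proof.
move=> r0 r3.
have [l [lr rl]] : exists l : nat, l%:R < r /\ r <= l.+1%:R.
  have [r1|r1] := leP r 1; first by exists 0%N.
  have [r2|r2] := leP r 2; first by exists 1%N.
  by exists 2.
have d0 k : derive1n k (fun=> 0 : R) = (fun=> 0 : R).
  elim: k => [//|k IH]; rewrite derive1nS IH; apply/funext => x.
  by rewrite derive1E (derive_cst (0 : R)).
exists l; split => //.
- by move=> k _ x; rewrite d0; exact: derivable_cst.
- by rewrite d0; exact: cst_continuous.
- by move=> x y; rewrite d0 subrr normr0 powR_ge0.
Qed.

Lemma taylor2_scale r K f c1 c2 a : 0 < a -> 0 <= r -> taylor2 r K f c1 c2 ->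
  taylor2 r (K * a `^ r) (fun x => f (a * x)) (fun x => a * c1 (a * x))
    (fun x => a ^+ 2 * c2 (a * x)).
Proof.
move=> a0 r0 [K0 cf fe z1 z2]; split.
- by rewrite mulr_ge0 ?powR_ge0.
- move=> x; apply: (continuous_comp (f := fun x => a * x)); last exact: cf.
  exact: mulrl_continuous.
- move=> x h; have := fe (a * x) (a * h); rewrite -mulrDr normrM powRM// gtr0_norm// mulrA.
  by congr (`|_| <= _); ring.
- by move=> r1 x; rewrite z1// mulr0.
- by move=> r2 x; rewrite z2// mulr0.
Qed.

Lemma Ex_normal_law v f : 0 <= v -> tame f ->
  (\int[normal_law v]_x (f x)%:E = (Ex (gauss R) (fun x => f (Num.sqrt v * x)))%:E)%E.
Proof.
move=> v0 tf; have cf := tame_continuous tf.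
have tz : tame (fun x => f (Num.sqrt v * x)).
  by apply: eq_tame (tame_add_scale 0 (Num.sqrt v) tf) => z; rewrite add0r.
rewrite (EFin_Ex (tame_L1 tz)) integralE [RHS]integralE; congr (_ - _)%E.
- have := @ge0_integral_normal_law_scale R v (fun x => Num.max (f x) 0) v0.
  move=> H; transitivity (\int[normal_law v]_x (Num.max (f x) 0)%:E)%E.
    by apply: eq_integral => x _; rewrite funeposE -EFin_max.
  rewrite H; first by apply: eq_integral => x _; rewrite funeposE -EFin_max.
    by move=> x; apply: continuous_max; [exact: cf|exact: cst_continuous].
  by move=> x; rewrite le_max lexx orbT.
- have := @ge0_integral_normal_law_scale R v (fun x => Num.max (- f x) 0) v0.
  move=> H; transitivity (\int[normal_law v]_x (Num.max (- f x) 0)%:E)%E.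
    by apply: eq_integral => x _; rewrite funenegE -EFin_max.
  rewrite H; first by apply: eq_integral => x _; rewrite funenegE -EFin_max.
    have cN : continuous (fun x => - f x) by move=> x; apply: continuousN; exact: cf.
    by move=> x; apply: (continuous_max (f := fun x => - f x)); [exact: cN|exact: cst_continuous].
  by move=> x; rewrite le_max lexx orbT.
Qed.

(** The zero function belongs to the class, so the supremum is nonnegative and a one-sided bound
    controls its absolute value. *)
Lemma zolotarev_le r (mu nu : probability R R) (C : R) : 0 < r -> r <= 3 ->
  (forall f, Lambda r f ->
    (\int[mu]_x (f x)%:E - \int[nu]_x (f x)%:E <= C%:E)%E) ->
  (`|zolotarev r mu nu| <= C%:E)%E.
Proof.
move=> r0 r3 H; rewrite gee0_abs; first by apply: ge_ereal_sup => _ [f Lf <-]; exact: H.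
apply: ereal_sup_ubound; exists (fun=> 0); first exact: Lambda0.
by rewrite !integral0 sube0.
Qed.

End Zolotarev_test_functions.

(** * Translation between expectations, norms, covariances and laws; rescaling of test functions *)

Section theorem_ingredients.
Context d (Omega : measurableType d) (R : realType) (P : probability Omega R).

Lemma fine_expectation (f : Omega -> R) : fine 'E_P[f]%E = Ex P f.
Proof. by rewrite unlock. Qed.

Lemma expectation_Ex (f : Omega -> R) : L1 P f -> 'E_P[f]%E = (Ex P f)%:E.
Proof. by move=> lf; rewrite (EFin_Ex lf) unlock. Qed.

Lemma Lfun_Lp (q : R) (f : Omega -> R) : 1 <= q -> f \in Lfun P q%:E -> Lp P q f.
Proof.
move=> q1 lf; split; last exact: Lfun_integrable.
by move: lf; rewrite inE => /andP[/[!inE]].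
Qed.

Lemma Lnorm_moment (q : R) (f : Omega -> R) : 0 < q -> measurable_fun setT f ->
  ('N[P]_(q%:E)[(fun w => (f w)%:E)] < +oo)%E ->
  L1 P (fun w => `|f w| `^ q) /\
  Ex P (fun w => `|f w| `^ q) = fine 'N[P]_(q%:E)[(fun w => (f w)%:E)] `^ q.
Proof.
move=> q0 mf nf; have := powR_Lnorm P (fun w => (f w)%:E) (lt0r_neq0 q0).
under [X in _ = X -> _]eq_integral do rewrite abse_EFin poweR_EFin.
have fN : 'N[P]_(q%:E)[(fun w => (f w)%:E)]%E \is a fin_num.
  by rewrite ge0_fin_numE// Lnorm_ge0.
rewrite -(fineK fN) poweR_EFin => E.
have lf : L1 P (fun w => `|f w| `^ q).
  apply/integrableP; split.
    apply/measurable_EFinP; apply: (measurableT_comp (f := fun x : R => x `^ q)) => //.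
    exact: measurableT_comp.
  under eq_integral do rewrite /= ger0_norm ?powR_ge0//.
  by rewrite -E ltry.
by split => //; apply: EFin_inj; rewrite (EFin_Ex lf).
Qed.

Lemma bilateral_series_cvgD (u : int -> R) (a b : R) :
  (\sum_(1 <= k < n.+1) u (- k%:Z) @[n --> \oo] --> a)%classic ->
  (\sum_(0 <= k < n.+1) u k%:Z @[n --> \oo] --> b)%classic ->
  bilateral_series_cvg (fun k => (u k)%:E) (a + b)%:E.
Proof.
move=> ca cb; rewrite /bilateral_series_cvg.
under eq_fun do rewrite !sumEFin.
apply: cvg_EFin; first exact: nearW.
rewrite /comp/=; apply: (cvgD (f := fun mn : nat * nat => \sum_(1 <= k < mn.1.+1) u (- k%:Z))).
- exact: (cvg_comp _ _ cvg_fst ca).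
- exact: (cvg_comp _ _ cvg_snd cb).
Qed.

Variables (T Tinv : {mfun Omega >-> Omega}).
Hypotheses (TK : cancel T Tinv) (TinvK : cancel Tinv T).
Hypothesis Tpres : measure_preserving P T.
Variable X0 : {mfun Omega >-> R}.
Notation X := (Xseq T Tinv X0).

Lemma Ex_Xseq k : Ex P (X k) = Ex P X0.
Proof.
by case: k => n; [apply: (Ex_iter Tpres n)|apply: (Ex_iter_inv TK Tpres n.+1)].
Qed.

Lemma covariance_Xseq k : Lp P 2 X0 -> Ex P X0 = 0 ->
  covariance P X0 (X k) = (Ex P (fun w => X 0 w * X k w))%:E.
Proof.
move=> lX eX; rewrite covariance.unlock !fine_expectation Ex_Xseq eX.
rewrite -expectation_Ex; last exact: (Lp2_mul lX (Lp_Xseq TK Tpres lX k)).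
by congr ('E_P[_])%E; apply/funext => w /=; rewrite /GRing.mul/= !subr0.
Qed.

Lemma Ex_Xseq_opp (k : nat) : Lp P 2 X0 ->
  Ex P (fun w => X 0 w * X (- k%:Z) w) = Ex P (fun w => X 0 w * X k%:Z w).
Proof.
move=> lX; have l := Lp2_mul (Lp_Xseq TK Tpres lX 0) (Lp_Xseq TK Tpres lX (- k%:Z)).
rewrite -(Ex_iter Tpres k (L1_measurable l)); apply: eq_Ex => w.
by rewrite !(Xseq_iter TK)// add0r addNr mulrC.
Qed.

(** The function f (n^(-1/2) x) satisfies the expansion with constant n^(-r/2), and n^(-r/2)
    n^((r-p+2)/2) = n^(1-p/2), whatever r is. *)
Lemma zolotarev_normSsum_le (p r C v a : R) n : 0 < r -> r <= 3 -> (0 < n)%N ->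
  0 <= v -> Num.sqrt v = n%:R `^ (- 2^-1) * a ->
  (forall K f c1 c2, 0 < K -> taylor2 r K f c1 c2 ->
    L1 P (fun w => f (Ssum T Tinv X0 n w)) /\
    `|Ex P (fun w => f (Ssum T Tinv X0 n w)) - Ex (gauss R) (fun z => f (a * z))|
      <= C * K * n%:R `^ ((r - p + 2) / 2)) ->
  (`|zolotarev r (distribution P (normSsum T Tinv X0 n)) (normal_law v)|
    <= (C * n%:R `^ (1 - p / 2))%:E)%E.
Proof.
move=> r0 r3 n0 v0 va H; apply: zolotarev_le => // f Lf.
have [c1 [c2 tf]] := Lambda_taylor2 r0 r3 Lf.
have nR : 0 < n%:R :> R by rewrite ltr0n.
have s0 : 0 < n%:R `^ (- 2^-1) :> R by rewrite powR_gt0.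
have tg := taylor2_scale s0 (ltW r0) tf.
have K0 : 0 < 1 * (n%:R `^ (- 2^-1)) `^ r :> R by rewrite mul1r powR_gt0.
have [lS hS] := H _ _ _ _ K0 tg.
have cf : continuous f by case: tf.
rewrite (Ex_normal_law v0 (taylor2_tame r0 tf)) integral_distribution; last 2 first.
- by apply/measurable_EFinP; exact: continuous_measurable_fun.
- exact: lS.
rewrite -(EFin_Ex lS) -EFinB lee_fin.
have -> : Ex (gauss R) (fun z => f (Num.sqrt v * z)) = Ex (gauss R) (fun z => f (n%:R `^ (- 2^-1) * (a * z))).
  by apply: eq_Ex => z; rewrite va mulrA.
apply: (le_trans (ler_norm _)); apply: (le_trans hS).
rewrite mul1r -powRrM -mulrA powR_mulD// le_eqVlt; apply/orP; left; apply/eqP.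
by congr (_ * _ `^ _); field.
Qed.

End theorem_ingredients.

Theorem theorem3p1 (R : realType) (d : measure_display)
  (Omega : measurableType d) (P : probability Omega R)
  (T Tinv : {mfun Omega >-> Omega})
  (TK : cancel T Tinv) (TinvK : cancel Tinv T)
  (Tpres : measure_preserving P T)
  (F0 : set (set Omega)) (F0sub : sigma_subalgebra F0)
  (F0T : F0 `<=` preimage_set_system setT T F0)
  (p : R) (p2 : 2 < p) (p3 : p < 3)
  (X0 : {RV P >-> R})
  (X0Lp : (X0 : Omega -> R) \in Lfun P p%:E)
  (X0centered : ('E_P[X0] = 0)%E)
  (X := Xseq T Tinv X0) (S := Ssum T Tinv X0)
  (sigma2_ := fun n : nat => n%:R^-1 * fine ('E_P[(fun w => (S n w ^+ 2)%R)])%E)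
  (cvg_past : series_cvg_in_Lp P p (fun n => cond_exp P F0 (X n%:Z)))
  (cvg_future : series_cvg_in_Lp P p
    (fun n w => X (- n%:Z) w - cond_exp P F0 (X (- n%:Z)) w))
  (cvg_var : (\sum_(1 <= n <oo) (n%:R `^ (- 2 + p / 2))%:E *
    'N[P]_((p / 2)%:E)[(fun w =>
       (n%:R^-1 * cond_exp P F0 (fun w' => S n w' ^+ 2) w - sigma2_ n)%:E)]
    < +oo)%E) :
  exists sigma2 : R,
    [/\ 0 <= sigma2,
        bilateral_series_cvg (fun k => covariance P X0 (X k)) sigma2%:E,
        (forall r : R, p - 2 <= r <= 2 ->
           ebigO (fun n => zolotarev r
                    (distribution P (normSsum T Tinv X0 n))
                    (normal_law sigma2))
                 (fun n => n%:R `^ (1 - p / 2))) &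
        (forall r : R, 2 < r <= p ->
           ebigO (fun n => zolotarev r
                    (distribution P (normSsum T Tinv X0 n))
                    (normal_law (sigma2_ n)))
                 (fun n => n%:R `^ (1 - p / 2)))].
Proof.
have p1 : 1 <= p by exact: le_trans (ler1n R 2) (ltW p2).
have lX0 : Lp P p X0 := Lfun_Lp p1 X0Lp.
have lX0_2 : Lp P 2 X0 := Lp_Lp2 (ltW p2) lX0.
have eX0 : Ex P X0 = 0 by rewrite -fine_expectation X0centered.
have lX := Lp_Xseq TK Tpres lX0.
case: cvg_past => A /(Lfun_Lp p1) lA cA; case: cvg_future => B /(Lfun_Lp p1) lB cB.
have nA : null P (fun n w => past_sum P T Tinv F0 X0 n w - A w).
  apply: (null_Lnorm p2) => // n; apply: (LpB p1 _ lA).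
  exact: (Lp_past_sum TK Tpres F0sub p2 lX0).
have nB : null P (fun n w => future_sum P T Tinv F0 X0 n w - B w).
  apply: (null_Lnorm p2) => // n; apply: (LpB p1 _ lB).
  exact: (Lp_future_sum TK Tpres F0sub p2 lX0).
pose D := mart P T Tinv F0 X0 A B; pose V := cobound P T Tinv F0 X0 A B.
have lD : Lp P p D := Lp_mart TK Tpres F0sub p2 lX0 lA lB.
have lV : Lp P p V := Lp_cobound TK Tpres F0sub p2 lX0 lA lB.
have mD : measF F0 D := measF_mart TK Tpres F0sub p2 lX0 lA lB.
have oD := mart_orthogonal TK TinvK Tpres F0sub F0T p2 lX0 lA lB nA nB.
have SE := Ssum_mart TK TinvK Tpres F0sub F0T p2 lX0 lA lB nA nB.
have lS n : Lp P p (S n) by apply: (Lp_sum p1) => k; exact: lX.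
have eS n : Ex P (S n) = 0.
  rewrite Ex_sum; last by move=> k; exact: (Lp_L1 p1 (lX k)).
  by apply: big1 => k _; rewrite (Ex_Xseq TK Tpres).
pose sigma2 := Ex P (fun w => D w ^+ 2); pose sigma := Num.sqrt sigma2.
have sigma2_ge0 : 0 <= sigma2 := Ex_sqr_ge0 P D.
have sigma_ge0 : 0 <= sigma := sqrtr_ge0 _.
have Dvar : Ex P (fun w => D w ^+ 2) = sigma ^+ 2 by rewrite sqr_sqrtr.
have s2E n : sigma2_ n = n%:R^-1 * Ex P (fun w => S n w ^+ 2) by rewrite /sigma2_ fine_expectation.
pose W n w := n%:R^-1 * cond_exp P F0 (fun w' => S n w' ^+ 2) w - n%:R^-1 * Ex P (fun w' => S n w' ^+ 2).
pose N n := 'N[P]_((p / 2)%:E)[(fun w => (W n w)%:E)]%E.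
have {}cvg_var : (\sum_(1 <= n <oo) (n%:R `^ (- 2 + p / 2))%:E * N n < +oo)%E.
  by move: cvg_var; under eq_eseriesr do rewrite s2E.
have t_ge0 n : (0 <= (n%:R `^ (- 2 + p / 2))%:E * N n)%E.
  by rewrite mule_ge0 ?lee_fin ?powR_ge0 ?Lnorm_ge0.
have partial m : (\sum_(1 <= n < m) (n%:R `^ (- 2 + p / 2))%:E * N n <=
    \sum_(1 <= n <oo) (n%:R `^ (- 2 + p / 2))%:E * N n)%E.
  exact: nneseries_lim_ge.
set total := (\sum_(1 <= n <oo) _)%E in cvg_var partial.
(* A convergent series of nonnegative terms with positive weights has finite norms, so that
   [fine (N n)] is a faithful bound. *)
have Nfin n : (0 < n)%N -> (N n < +oo)%E.
  move=> n0; have nR : 0 < n%:R `^ (- 2 + p / 2) :> R by rewrite powR_gt0 ?ltr0n.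
  have : ((n%:R `^ (- 2 + p / 2))%:E * N n < +oo)%E.
    apply: (le_lt_trans _ cvg_var); apply: (le_trans _ (partial n.+1)).
    by rewrite big_nat_recr//= leeDr// sume_ge0.
  have : (0 <= N n)%E := Lnorm_ge0 _ _ _.
  by case: (N n) => [x _ _|_|//]; [exact: ltry|rewrite gt0_muley ?lte_fin].
have q0 : 0 < p / 2 by rewrite divr_gt0// (lt_trans _ p2).
have mW n : measurable_fun setT (W n).
  have lS2 := Lp2_sqr (Lp_Lp2 (ltW p2) (lS n)).
  apply: measurable_funB => //; apply: measurable_funM => //.
  exact: (L1_measurable (cond_exp_L1 F0sub lS2)).
have mom n n0 := Lnorm_moment q0 (mW n) (Nfin n n0).
have c_ge0 n : 0 <= fine (N n) by rewrite fine_ge0// Lnorm_ge0.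
have total_fin : total \is a fin_num.
  by rewrite ge0_fin_numE// nneseries_ge0.
have c_sum m : \sum_(1 <= n < m) n%:R `^ (- 2 + p / 2) * fine (N n) <= fine total.
  rewrite -lee_fin fineK// -sumEFin; apply: (le_trans _ (partial m)).
  rewrite le_eqVlt; apply/orP; left; apply/eqP; apply: eq_big_nat => n /andP[n0 _].
  by rewrite EFinM fineK// ge0_fin_numE ?Nfin ?Lnorm_ge0.
have WLp n n0 := (mom n n0).1.
have Wc n (n0 : (0 < n)%N) : Ex P (fun w => `|W n w| `^ (p / 2)) <= fine (N n) `^ (p / 2).
  by rewrite (mom n n0).2.
have [B0 hB0] := martingale_moment TK TinvK Tpres F0sub F0T p2 p3 mD lD oD.
pose Cg := 2 * gap_constant P p B0 V.
have Cg0 : 0 <= Cg by rewrite mulr_ge0// (gap_constant_ge0 hB0).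
have gap := variance_gap TK TinvK Tpres F0sub F0T p2 mD lD oD Dvar hB0 lV lS SE.
have rate r (r0 : p - 2 <= r) (rp : r <= p) := convergence_rate TK TinvK Tpres F0sub F0T
  p2 p3 sigma_ge0 mD lD oD Dvar lV lS SE eS c_ge0 WLp Wc c_sum r0 rp Cg0.
exists sigma2; split => //.
- have -> : (fun k => covariance P X0 (X k)) = (fun k => (Ex P (fun w => X 0 w * X k w))%:E).
    by apply/funext => k; rewrite (covariance_Xseq TK Tpres).
  have cc := cov_sum_cvg TK TinvK Tpres F0sub F0T p2 lX0 lA lB nA nB.
  rewrite /sigma2 -(cov_limitE TK TinvK Tpres F0sub F0T p2 lX0 lA lB nA nB).
  set e0 := Ex P _; set l := cov_limit _ _ _ _ _ _ _ in cc *.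
  (* By symmetry of the covariances l is the sum over negative indices, and e0 + l the sum over the
     others, index 0 included. *)
  have -> : e0 + 2 * l = l + (e0 + l) by ring.
  apply: (bilateral_series_cvgD (u := fun k => Ex P (fun w => X 0 w * X k w))).
    move: cc; apply: eq_cvgn => n; apply: eq_bigr => k _.
    by rewrite (Ex_Xseq_opp TK Tpres).
  have : (e0 + \sum_(1 <= k < n.+1) Ex P (fun w => X 0 w * X k%:Z w) @[n --> \oo] --> e0 + l)%classic.
    by apply: cvgD => //; exact: cvg_cst.
  apply: eq_cvgn => n; by rewrite [RHS]big_ltn//.
- move=> r /andP[r0 r2]; have rp : r <= p := le_trans r2 (ltW p2).
  have [C C0 HC] := rate r r0 rp.
  exists C; exists 1%N => // n n0; rewrite ger0_norm ?powR_ge0//.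
  apply: (zolotarev_normSsum_le _ _ n0 (a := sd sigma n)) => //.
  + by apply: lt_le_trans r0; rewrite subr_gt0.
  + by rewrite (le_trans rp) ?ltW.
  + by rewrite /sd mulrCA powR_mulD ?ltr0n// addNr powRr0 mulr1.
  + move=> K f c1 c2 K0 tf; apply: (HC n K f c1 c2 (sd sigma n) n0 K0 tf).
    * by rewrite mulr_ge0 ?powR_ge0.
    * by rewrite sd_sqr subrr normr0 mulr_ge0 ?powR_ge0.
    * by [].
    * by rewrite ltNge r2.
- move=> r /andP[r2 rp].
  have r0 : p - 2 <= r by rewrite (le_trans _ (ltW r2))// lerBlDr (le_trans (ltW p3))// -natrD ler_nat.
  have [C C0 HC] := rate r r0 rp.
  exists C; exists 1%N => // n n0; rewrite ger0_norm ?powR_ge0//.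
  have vS : 0 <= Ex P (fun w => S n w ^+ 2) := Ex_sqr_ge0 P (S n).
  have nR : 0 < n%:R :> R by rewrite ltr0n.
  apply: (zolotarev_normSsum_le _ _ n0 (a := Num.sqrt (Ex P (fun w => S n w ^+ 2)))) => //.
  + by rewrite (lt_trans _ r2).
  + by rewrite (le_trans rp) ?ltW.
  + by rewrite s2E mulr_ge0// invr_ge0 ltW.
  + rewrite s2E sqrtrM ?invr_ge0 ?(ltW nR)//; congr (_ * _).
    by rewrite sqrtrV ?(ltW nR)// -powR12_sqrt ?(ltW nR)// powRN.
  + move=> K f c1 c2 K0 tf; apply: (HC n K f c1 c2 _ n0 K0 tf (sqrtr_ge0 _)).
    * by rewrite sqr_sqrtr//; exact: gap.
    * by rewrite leNgt r2.
    * by rewrite sqr_sqrtr.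
Qed.
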